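(* Suppose that $W$ is a model of $\mathsf{ZFC}+\mathsf{GCH}+\square^*_\lambda$ for every singular cardinal $\lambda$, and let $M$ be a Bristol extension of $W$ (that is, a Bristol model constructed from some Bristol sequence of $W$ and some Cohen real $c$ over $W$, so that $W\subseteq M\subseteq W[c]$). Then $W$ is definable in $M$.
   Context: Ground model. $W$ is a transitive model of $\mathsf{ZFC}+\mathsf{GCH}$ in which $\square^*_\lambda$ holds for all singular $\lambda$. The Cohen real is viewed as a function $c:\omega\to2$. All cardinals $\omega_\alpha$, successor cardinals and combinatorial objects below are computed in $W$. Permutable families. For $\kappa$ regular and $X,Y\subseteq\kappa$, $X=^*Y$ means that $X\triangle Y$ is bounded in $\kappa$. A family $\{A_\alpha\mid\alpha<\kappa^+\}$ of subsets of $\kappa$ of size $\kappa$ is permutable if $\sup(A_\alpha\cap A_\beta)<\kappa$ for $\alpha\ne\beta$, and for every $I\subseteq\kappa^+$ with $|I|<\kappa^+$ there is a pairwise disjoint family $\mathcal B=\{B_\xi\mid\xi\in I\}$ with $B_\xi=^*A_\xi$ and, for all $\alpha$, $\alpha\in I$ iff $A_\alpha\cap\bigcup\mathcal B$ is unbounded in $\kappa$. Such $\mathcal B$ is called a disjoint approximation. A permutation $\pi$ of $\kappa$ implements a permutation $\Pi$ of $\kappa^+$, written $\iota(\pi)=\Pi$, if $\pi[A_\alpha]=^*A_{\Pi(\alpha)}$ for all $\alpha$. A permutation of a cardinal is bounded if it is the identity on a tail. The derived group is the group of all permutations of $\kappa$ implementing a bounded permutation of $\kappa^+$; the derived filter (of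 subgroups) is generated by the groups $\mathrm{fix}(\mathcal B)=\{\pi\mid\pi\restriction\bigcup\mathcal B=\mathrm{id}\}$, $\mathcal B$ a disjoint approximation. Permutable scales. For a limit cardinal $\lambda$, $\mathrm{SC}(\lambda)=\{\mu^+\mid\mu<\lambda\}$ ($\mu$ an infinite cardinal). A scale $\{f_\alpha\mid\alpha<\lambda^+\}$ in $\prod\mathrm{SC}(\lambda)$ is a sequence that is increasing and bounding (cofinal) in the eventual domination order. A sequence $\vec\pi=\langle\pi_\theta\mid\theta\in\mathrm{SC}(\lambda)\rangle$, $\pi_\theta$ a permutation of $\theta$, implements $\Pi:\lambda^+\to\lambda^+$, written $\iota(\vec\pi)=\Pi$, if for every $\alpha<\lambda^+$, $f_{\Pi(\alpha)}(\theta)=\pi_\theta(f_\alpha(\theta))$ for all large enough $\theta$. The scale is permutable if every bounded permutation of $\lambda^+$ is implemented. Given groups $\mathscr G_\theta$ of permutations of $\theta$ (rich enough that implementing sequences for bounded permutations can be taken from them), the derived group consists of the $\vec\pi\in\prod_\theta\mathscr G_\theta$ implementing a bounded permutation of $\lambda^+$; the derived filter is generated by the groups $K_{\eta,f}=\{\vec\pi\mid\iota(\vec\pi)\restriction\eta=\mathrm{id},\ \pi_\theta\restriction f(\theta)=\mathrm{id}\text{ for all }\theta\}$, for $\eta<\lambda^+$, $f\in\prod\mathrm{SC}(\lambda)$. Bristol sequence. A sequence indexed by the ordinals giving, for $\alpha=0$ or successor, a permutable family $\mathcal A_\alpha=\{A^\alpha_\xi\mid\xi<\omega_{\alpha+1}\}$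 on $\omega_\alpha$, and for limit $\alpha$ a permutable scale $F_\alpha=\{f^\alpha_\xi\mid\xi<\omega_{\alpha+1}\}$ in $\prod\mathrm{SC}(\omega_\alpha)$. Symmetric iterations. For a collection of names, $\{\dot x_i\mid i\in I\}^\bullet=\{\langle 1,\dot x_i\rangle\mid i\in I\}$, and similarly for sequences. A symmetric system is a forcing, a group of its automorphisms, and a normal filter of subgroups. Given names $\langle\dot{\mathbb Q}_\beta,\dot{\mathscr G}_\beta,\dot{\mathscr F}_\beta\rangle$ of symmetric systems, $\mathbb P_\alpha$ is the finite support iteration of the $\dot{\mathbb Q}_\beta$, $\beta<\alpha$. $\mathcal G_\alpha$ is the group of automorphisms $\int_{\vec\pi}$ of $\mathbb P_\alpha$, where $\vec\pi=\langle\dot\pi_\beta\mid\beta<\alpha\rangle$ with $1\Vdash\dot\pi_\beta\in\dot{\mathscr G}_\beta$ and all but finitely many $\dot\pi_\beta$ forced to be the identity; if $\beta$ is the only non-trivial coordinate, $\int_{\vec\pi}p=p\restriction\beta{}^\frown\dot\pi_\beta(p(\beta)){}^\frown\dot\pi_\beta(p\restriction(\beta,\alpha))$, and in general $\int_{\vec\pi}$ is the composition $\int_{\dot\pi_{\beta_0}}\cdots\int_{\dot\pi_{\beta_n}}$ over the non-trivial coordinates $\beta_0<\dots<\beta_n$. An excellent support is a sequence $\vec H=\langle\dot H_\beta\mid\beta<\alpha\rangle$, with $\dot H_\beta$ a name appearing in $\dot{\mathscr F}_\beta$ and $\dot H_\beta=\dot{\mathscr G}_\beta$ for all but finitely many $\beta$.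 A $\mathbb P_\alpha$-name $\dot x$ is respected if there is an excellent support $\vec H$ such that whenever $p\Vdash\vec\pi\in\vec H$ (coordinatewise), $p\Vdash\int_{\vec\pi}\dot x=\dot x$. $\mathsf{IS}_\alpha$ is the class of hereditarily respected names. The construction. By recursion define the iteration together with objects $\varrho_\alpha\in W[c]$ with canonical names $\dot\varrho_\alpha$. $M_\alpha$ is the class of interpretations of names in $\mathsf{IS}_\alpha$ by the filter on $\mathbb P_\alpha$ given by $\langle\varrho_\beta\mid\beta<\alpha\rangle$ (conditions all of whose coordinates are approximations, i.e. restrictions, of the $\varrho_\beta$); $M_0=W$, and $M_{\alpha+1}$ is the symmetric extension of $M_\alpha$ by $\langle\mathbb Q_\alpha,\mathscr G_\alpha,\mathscr F_\alpha\rangle$ using $\varrho_\alpha$, which is $M_\alpha$-generic for $\mathbb Q_\alpha$. Always $\mathscr G_\alpha,\mathscr F_\alpha$ are the derived group and filter of $\mathcal A_\alpha$ (or of $F_\alpha$ for limit $\alpha$, where the group is a subgroup of the full support product $\prod_{\beta<\alpha}\mathscr G_{\beta+1}$). (i) $\mathbb Q_0=\mathrm{Add}(\omega,1)$ (finite partial functions $\omega\to2$) and $\varrho_0=c$. (ii) $\varrho_{\beta+1}=\langle R^{\beta+1}_\xi\mid\xi<\omega_{\beta+1}\rangle$, where $R^{\beta+1}_\xi=V_{\omega+\beta+1}$ as computed in $M_\beta[\varrho_\beta\restriction A^\beta_\xi]$ if $\beta$ is $0$ or a successor, and in $M_\beta[\varrho_{\beta,f^\beta_\xi}]$ if $\beta$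 is a limit. $\dot{\mathbb Q}_{\beta+1}=\{\int_{\vec\pi}(\dot\varrho_{\beta+1}\restriction I)\mid\int_{\vec\pi}\in\mathcal G_{\beta+1},\ I\in[\omega_{\beta+1}]^{<\omega_{\beta+1}}\cap W\}^\bullet$, ordered by reverse inclusion. For $\alpha=0$ or successor, $\pi\in\mathscr G_\alpha$ acts on $\mathbb Q_\alpha$ by $(\pi q)(\pi\xi)=q(\xi)$. (iii) For limit $\alpha$ and $f\in\prod\mathrm{SC}(\omega_\alpha)^W$, $\varrho_{\alpha,f}=\langle\varrho_{\beta+1}(f(\omega_{\beta+1}))\mid\beta<\alpha\rangle$ and $\varrho_\alpha=\langle\varrho_{\alpha,f}\mid f\in\prod\mathrm{SC}(\omega_\alpha)^W\rangle$. For $A\subseteq\alpha$ bounded and $E\subseteq\prod\mathrm{SC}(\omega_\alpha)^W$ bounded (some $f$ in the product satisfies $g(\theta)<f(\theta)$ for all $g\in E$ and all $\theta$), $\varrho_\alpha\restriction(E,A)=\langle\varrho_{\alpha,f}\restriction A\mid f\in E\rangle$, and $\dot{\mathbb Q}_\alpha=\{\int_{\vec\pi}\dot\varrho_\alpha\restriction(E,A)\mid E,A\in W\text{ bounded},\ \int_{\vec\pi}\in\mathcal G_\alpha\}^\bullet$, ordered by (coordinatewise) reverse inclusion. $\mathscr G_\alpha$ acts coordinatewise by permuting indices: $(\vec\pi q)(\vec\pi f)=q(f)$, where $(\vec\pi f)(\theta)=\pi_\theta(f(\theta))$. The Bristol model is $M=\bigcup_{\alpha\in\mathrm{Ord}}M_\alpha$.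 ''Definable in $M$'' means: a class of $M$ first-order definable over $M$, parameters from $M$ being allowed. *)

(* Defs.v *)
From Stdlib Require Import List Sorted Relation_Operators Transitive_Closure.
From Stdlib Require Import ClassicalEpsilon.

Set Implicit Arguments.

(** The metatheoretic universe of sets is an arbitrary well-founded model of
    second-order ZF (choice follows from [epsilon]).  Transitive models [W], [M]
    are arbitrary classes [set -> Prop] of it, so they may be sets or proper
    classes. *)

Record universe := Universe {
  set :> Type;
  mem : set -> set -> Prop;
  mem_ext : forall x y, (forall z, mem z x <-> mem z y) -> x = y;
  mem_wf : well_founded mem;
  pairing : forall x y, exists z, forall u, mem u z <-> u = x \/ u = y;
  union : forall x, exists y, forall z, mem z y <-> exists u, mem u x /\ mem z u;
  power : forall x, exists y, forall z,
    mem z y <-> forall u, mem u z -> mem u x;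
  separation : forall (P : set -> Prop) x, exists y, forall z,
    mem z y <-> mem z x /\ P z;
  replacement : forall (F : set -> set) x, exists y, forall z,
    mem z y <-> exists u, mem u x /\ z = F u;
  infinity : exists x, (exists e, mem e x /\ forall z, ~ mem z e) /\
    forall y, mem y x -> exists s, mem s x /\ forall z, mem z s <-> mem z y \/ z = y
}.

Arguments mem {u} _ _ : rename.
Infix "∈" := mem (at level 70, no associativity).
Notation "x ∉ y" := (~ mem x y) (at level 70, no associativity).

Lemma universe_inhabited (V : universe) : inhabited V.
Proof. destruct (infinity V) as [x _]. exact (inhabits x). Qed.

Section Sets.
Context {V : universe}.
Implicit Types x y z : V.

(** The set with extension [P]; meaningful only when there is one. *)
Definition setof (P : V -> Prop) : V :=
  epsilon (universe_inhabited V) (fun s => forall x, x ∈ s <-> P x).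

(** Recursion on the transitive closure of membership: [F x rec] may use [rec y]
    for [y] in the transitive closure of [x]; elsewhere [rec] returns [d]. *)
Definition mem_rec {T : Type} (d : T) (F : V -> (V -> T) -> T) : V -> T :=
  Fix (wf_clos_trans V (@mem V) (@mem_wf V)) (fun _ => T)
    (fun x rec => F x (fun y =>
       match excluded_middle_informative (clos_trans V (@mem V) y x) with
       | left h => rec y h
       | right _ => d
       end)).

Definition subset x y := forall z, z ∈ x -> z ∈ y.
Definition empty : V := setof (fun _ => False).
Definition upair x y : V := setof (fun z => z = x \/ z = y).
Definition opair x y : V := upair (upair x x) (upair x y).
Definition suc x : V := setof (fun z => z ∈ x \/ z = x).

Definition is_transitive x := forall y, y ∈ x -> subset y x.
Definition ord x := is_transitive x /\ forall y, y ∈ x -> is_transitive y.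
Definition is_limit x :=
  ord x /\ x <> empty /\ forall y, y ∈ x -> suc y ∈ x.
Definition finite x := exists l : list V, forall y, y ∈ x <-> In y l.
Definition omega : V := setof (fun n => ord n /\ finite n).

Definition oadd (a : V) : V -> V :=
  mem_rec empty (fun b rec => setof (fun x =>
    x ∈ a \/ exists y, y ∈ b /\ (x ∈ rec y \/ x = rec y))).

Definition limit_case {T : Type} (a : V) (t e : T) : T :=
  if excluded_middle_informative (is_limit a) then t else e.

Definition app (f x : V) : V :=
  epsilon (universe_inhabited V) (fun y => opair x y ∈ f).
Definition function_on (f a : V) :=
  (forall z, z ∈ f -> exists x y, z = opair x y /\ x ∈ a) /\
  (forall x, x ∈ a -> exists! y, opair x y ∈ f).
Definition maps (f a b : V) :=
  function_on f a /\ forall x, x ∈ a -> app f x ∈ b.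
Definition injection (f a b : V) :=
  maps f a b /\
  forall x y, x ∈ a -> y ∈ a -> app f x = app f y -> x = y.
Definition bijection (f a b : V) :=
  injection f a b /\ forall y, y ∈ b -> exists x, x ∈ a /\ app f x = y.

(** For sets of ordinals below a limit ordinal [k]. *)
Definition bounded (k X : V) := exists d, d ∈ k /\ subset X d.
Definition eqstar (k X Y : V) :=
  exists d, d ∈ k /\ forall x, x ∈ k -> x ∉ d -> (x ∈ X <-> x ∈ Y).
Definition image (f X : V) : V := setof (fun y => exists x, x ∈ X /\ y = app f x).
Definition inter (X Y : V) : V := setof (fun z => z ∈ X /\ z ∈ Y).

End Sets.

(** Formulas of the language of set theory with extra unary predicate symbols [S];
    variables are de Bruijn indices. *)
Inductive formula (S : Type) : Type :=
| FMem (i j : nat)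
| FEq (i j : nat)
| FPred (s : S) (i : nat)
| FBot
| FImp (f g : formula S)
| FAll (f : formula S).

Section Logic.
Context {V : universe}.

Definition scons (x : V) (e : nat -> V) (n : nat) : V :=
  match n with O => x | Datatypes.S k => e k end.

Fixpoint sat {S : Type} (I : S -> V -> Prop) (D : V -> Prop) (e : nat -> V)
    (f : formula S) : Prop :=
  match f with
  | FMem _ i j => e i ∈ e j
  | FEq _ i j => e i = e j
  | FPred s i => I s (e i)
  | FBot _ => False
  | FImp f g => sat I D e f -> sat I D e g
  | FAll f => forall x, D x -> sat I D (scons x e) f
  end.

Definition no_pred (s : Empty_set) (x : V) : Prop := match s with end.

(** [D] satisfies ZFC, with the separation and replacement schemes for formulas
    that may use the predicates [I]. *)
Record models_ZFC {S : Type} (D : V -> Prop) (I : S -> V -> Prop) : Prop := {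
  zfc_ext : forall x y, D x -> D y ->
    (forall z, D z -> (z ∈ x <-> z ∈ y)) -> x = y;
  zfc_found : forall x, D x -> (exists y, D y /\ y ∈ x) ->
    exists y, D y /\ y ∈ x /\ forall z, D z -> z ∈ y -> z ∉ x;
  zfc_pair : forall x y, D x -> D y ->
    exists z, D z /\ forall u, D u -> (u ∈ z <-> u = x \/ u = y);
  zfc_union : forall x, D x ->
    exists y, D y /\ forall z, D z -> (z ∈ y <-> exists u, D u /\ u ∈ x /\ z ∈ u);
  zfc_power : forall x, D x ->
    exists y, D y /\ forall z, D z ->
      (z ∈ y <-> forall u, D u -> u ∈ z -> u ∈ x);
  zfc_inf : exists x, D x /\
    (exists e, D e /\ e ∈ x /\ forall z, D z -> z ∉ e) /\
    (forall y, D y -> y ∈ x -> exists s, D s /\ s ∈ x /\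
       forall z, D z -> (z ∈ s <-> z ∈ y \/ z = y));
  zfc_sep : forall (f : formula S) e x, (forall n, D (e n)) -> D x ->
    exists y, D y /\ forall z, D z -> (z ∈ y <-> z ∈ x /\ sat I D (scons z e) f);
  zfc_repl : forall (f : formula S) e x, (forall n, D (e n)) -> D x ->
    (forall u, D u -> u ∈ x ->
       exists! v, D v /\ sat I D (scons u (scons v e)) f) ->
    exists y, D y /\ forall v, D v ->
      (v ∈ y <-> exists u, D u /\ u ∈ x /\ sat I D (scons u (scons v e)) f);
  zfc_choice : forall x, D x ->
    (forall y, D y -> y ∈ x -> exists z, D z /\ z ∈ y) ->
    (forall y y' z, D y -> D y' -> D z -> y ∈ x -> y' ∈ x ->
       z ∈ y -> z ∈ y' -> y = y') ->
    exists s, D s /\ forall y, D y -> y ∈ x ->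
      exists! z, D z /\ z ∈ y /\ z ∈ s
}.

Definition definable_in (M X : V -> Prop) : Prop :=
  exists (f : formula Empty_set) (e : nat -> V), (forall n, M (e n)) /\
    forall x, X x <-> M x /\ sat no_pred M (scons x e) f.

Definition transitive_class (D : V -> Prop) : Prop :=
  forall x y, D x -> y ∈ x -> D y.

End Logic.

(** Everything in this section is computed in [W]. *)

Section Combinatorics.
Context {V : universe}.
Variable W : V -> Prop.

Definition same_size (a b : V) := exists f, W f /\ bijection f a b.
Definition size_le (a b : V) := exists f, W f /\ injection f a b.
(** Meant for a cardinal [k]. *)
Definition size_lt (a k : V) := exists m, m ∈ k /\ same_size a m.

Definition inf_card (k : V) :=
  W k /\ ord k /\ subset omega k /\ forall m, m ∈ k -> ~ same_size m k.

Definition cardsucc (k : V) : V :=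
  setof (fun x => forall m, inf_card m -> k ∈ m -> x ∈ m).

(** [aleph a] is the least infinite cardinal above all [aleph b], [b < a]. *)
Definition aleph : V -> V :=
  mem_rec empty (fun a rec => setof (fun x =>
    forall k, inf_card k -> (forall b, b ∈ a -> rec b ∈ k) -> x ∈ k)).

Definition GCH := forall k, inf_card k ->
  same_size (setof (fun x => W x /\ subset x k)) (cardsucc k).

Definition singular (l : V) :=
  inf_card l /\ exists m f, m ∈ l /\ W f /\ maps f m l /\
    forall x, x ∈ l -> exists n, n ∈ m /\ x ∈ app f n.

Definition limit_point (C g : V) :=
  is_limit g /\ forall x, x ∈ g -> exists y, y ∈ C /\ y ∈ g /\ x ∈ y.

Definition club (C d : V) :=
  subset C d /\ (forall x, x ∈ d -> exists y, y ∈ C /\ x ∈ y) /\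
  (forall g, g ∈ d -> limit_point C g -> g ∈ C).

Definition otp_le (C l : V) :=
  exists h, W h /\ maps h C l /\
    forall x y, x ∈ C -> y ∈ C -> x ∈ y -> app h x ∈ app h y.

(** Jensen's weak square at [l]. *)
Definition weak_square (l : V) :=
  exists CC, W CC /\
    function_on CC (setof (fun d => d ∈ cardsucc l /\ is_limit d)) /\
    forall d, d ∈ cardsucc l -> is_limit d ->
      (exists C, C ∈ app CC d) /\ size_le (app CC d) l /\
      forall C, C ∈ app CC d ->
        club C d /\ otp_le C l /\
        forall g, g ∈ d -> limit_point C g -> inter C g ∈ app CC g.

Definition bounded_perm (P k : V) :=
  W P /\ bijection P k k /\
  exists d, d ∈ k /\ forall x, x ∈ k -> x ∉ d -> app P x = x.

Definition disjoint_approx (k A I B : V) :=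
  W B /\ function_on B I /\
  (forall x, x ∈ I -> subset (app B x) k /\ eqstar k (app B x) (app A x)) /\
  (forall x y z, x ∈ I -> y ∈ I -> z ∈ app B x -> z ∈ app B y -> x = y) /\
  (forall a, a ∈ cardsucc k -> (a ∈ I <->
     ~ bounded k (setof (fun z => z ∈ app A a /\ exists x, x ∈ I /\ z ∈ app B x)))).

Definition permutable_index (k I : V) :=
  W I /\ subset I (cardsucc k) /\ size_lt I (cardsucc k).

Definition permutable_family (k A : V) :=
  W A /\ function_on A (cardsucc k) /\
  (forall a, a ∈ cardsucc k -> subset (app A a) k /\ same_size (app A a) k) /\
  (forall a b, a ∈ cardsucc k -> b ∈ cardsucc k -> a <> b ->
     bounded k (inter (app A a) (app A b))) /\
  (forall I, permutable_index k I -> exists B, disjoint_approx k A I B).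

Definition family_implements (k A p P : V) :=
  forall a, a ∈ cardsucc k -> eqstar k (image p (app A a)) (app A (app P a)).

Definition family_group (k A : V) : V :=
  setof (fun p => W p /\ bijection p k k /\
    exists P, bounded_perm P (cardsucc k) /\ family_implements k A p P).

Definition family_generator (k A K : V) :=
  exists I B, permutable_index k I /\ disjoint_approx k A I B /\
    K = setof (fun p => p ∈ family_group k A /\
          forall x z, x ∈ I -> z ∈ app B x -> app p z = z).

Definition SC (l : V) : V :=
  setof (fun t => exists m, m ∈ l /\ inf_card m /\ t = cardsucc m).

Definition prodSC (l : V) : V :=
  setof (fun f => W f /\ function_on f (SC l) /\
    forall t, t ∈ SC l -> app f t ∈ t).

Definition eventually (l : V) (P : V -> Prop) :=
  exists d, d ∈ l /\ forall t, t ∈ SC l -> t ∉ d -> P t.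

Definition dominated (l f g : V) := eventually l (fun t => app f t ∈ app g t).

Definition scale (l F : V) :=
  W F /\ maps F (cardsucc l) (prodSC l) /\
  (forall a b, b ∈ cardsucc l -> a ∈ b -> dominated l (app F a) (app F b)) /\
  (forall g, g ∈ prodSC l -> exists a, a ∈ cardsucc l /\ dominated l g (app F a)).

Definition perm_sequence (l p : V) :=
  W p /\ function_on p (SC l) /\ forall t, t ∈ SC l -> bijection (app p t) t t.

Definition scale_implements (l F p P : V) :=
  forall a, a ∈ cardsucc l -> eventually l (fun t =>
    app (app F (app P a)) t = app (app p t) (app (app F a) t)).

Definition permutable_scale (l F : V) :=
  scale l F /\
  forall P, bounded_perm P (cardsucc l) ->
    exists p, perm_sequence l p /\ scale_implements l F p P.

(** [GG t] is the given group of permutations of [t]. *)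
Definition scale_group (GG : V -> V) (l F : V) : V :=
  setof (fun p => perm_sequence l p /\
    (forall t, t ∈ SC l -> app p t ∈ GG t) /\
    exists P, bounded_perm P (cardsucc l) /\ scale_implements l F p P).

Definition scale_generator (GG : V -> V) (l F K : V) :=
  exists h f, h ∈ cardsucc l /\ f ∈ prodSC l /\
    K = setof (fun p => p ∈ scale_group GG l F /\
          (exists P, bounded_perm P (cardsucc l) /\ scale_implements l F p P /\
             forall a, a ∈ h -> app P a = a) /\
          forall t z, t ∈ SC l -> z ∈ app f t -> app (app p t) z = z).

(** A class function on the ordinals of [W]; being a class of [W] means that it
    may be used as a predicate in the axiom schemes. *)
Definition bristol_sequence (S : V -> V) :=
  models_ZFC W (fun (_ : unit) z =>
    exists a, W a /\ ord a /\ z = opair a (S a)) /\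
  forall a, W a -> ord a ->
    (is_limit a -> permutable_scale (aleph a) (S a)) /\
    (~ is_limit a -> permutable_family (aleph a) (S a)).

Definition Add (s : V) :=
  finite s /\
  (forall z, z ∈ s -> exists n i, n ∈ omega /\ (i = empty \/ i = suc empty) /\
     z = opair n i) /\
  (forall n i j, opair n i ∈ s -> opair n j ∈ s -> i = j).

Definition cohen_real (c : V) :=
  maps c omega (suc (suc empty)) /\
  forall D, W D -> (forall s, s ∈ D -> Add s) ->
    (forall s, Add s -> exists t, t ∈ D /\ subset s t) ->
    exists s, s ∈ D /\ subset s c.

End Combinatorics.

Record poset (V : universe) := Poset {
  cond : V -> Prop;
  le : V -> V -> Prop
}.
Arguments Poset {V} _ _.
Arguments cond {V} _ _.
Arguments le {V} _ _ _.

Section Names.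
Context {V : universe}.

(** A name is a set of pairs (condition, name).  The weakest condition of every
    forcing considered here is [empty]. *)

(** [{x | X x}^bullet]. *)
Definition bullet (X : V -> Prop) : V :=
  setof (fun z => exists x, X x /\ z = opair empty x).

(** The canonical name for the ordered pair of two named objects. *)
Definition dpair (x y : V) : V :=
  bullet (fun u => u = bullet (fun w => w = x) \/
                   u = bullet (fun w => w = x \/ w = y)).

Definition check : V -> V :=
  mem_rec empty (fun x rec => bullet (fun u => exists y, y ∈ x /\ u = rec y)).

Inductive is_name (P : V -> Prop) : V -> Prop :=
| is_name_intro x :
    (forall z, z ∈ x -> exists p y, z = opair p y /\ P p /\ is_name P y) ->
    is_name P x.

(** The usual recursive definition of the forcing relation for atomic formulas. *)
Inductive forces_eq (P : poset V) : V -> V -> V -> Prop :=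
| forces_eq_intro p x y :
    (forall s z q, opair s z ∈ x -> cond P q -> le P q p -> le P q s ->
       exists r t w, cond P r /\ le P r q /\ opair t w ∈ y /\ le P r t /\
         forces_eq P r z w) ->
    (forall t w q, opair t w ∈ y -> cond P q -> le P q p -> le P q t ->
       exists r s z, cond P r /\ le P r q /\ opair s z ∈ x /\ le P r s /\
         forces_eq P r z w) ->
    forces_eq P p x y.

Definition forces_mem (P : poset V) (p x y : V) : Prop :=
  forall q, cond P q -> le P q p ->
    exists r t w, cond P r /\ le P r q /\ opair t w ∈ y /\ le P r t /\
      forces_eq P r x w.

Definition forces_sub (P : poset V) (p x y : V) : Prop :=
  forall s z q, opair s z ∈ x -> cond P q -> le P q p -> le P q s ->
    forces_mem P q z y.

(** A bound for the rank of the interpretations of [x]. *)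
Definition name_rank : V -> V :=
  mem_rec empty (fun x rec => setof (fun a =>
    exists p y, opair p y ∈ x /\ (a ∈ rec y \/ a = rec y))).

Definition interp (G : V -> Prop) : V -> V :=
  mem_rec empty (fun x rec => setof (fun v =>
    exists p y, opair p y ∈ x /\ G p /\ v = rec y)).

(** Conditions of a finite support iteration are finite functions on ordinals;
    coordinates outside the domain are trivial. *)
Definition coord (p b : V) : V := setof (fun z => exists u, opair b u ∈ p /\ z ∈ u).
Definition restrict (p b : V) : V :=
  setof (fun z => z ∈ p /\ exists g u, z = opair g u /\ g ∈ b).

(** Stage [b] of the construction: the poset [P_b] and the elements of the
    bullet-name for [Q_b]. *)
Record stage := Stage {
  stage_poset :> poset V;
  stage_Q : V -> Prop
}.

End Names.
Arguments stage V : clear implicits.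

Section Construction.
Context {V : universe}.
Variable W : V -> Prop.
Variable S : V -> V.

Notation om := (aleph W).

Definition fam_group_at (t : V) : V :=
  setof (fun p => exists b, W b /\ ord b /\ t = om b /\
    p ∈ family_group W t (S b)).

(** The group at [a]; at limits [theta = om (suc b)] gets the group at [suc b]. *)
Definition group (a : V) : V :=
  limit_case a (scale_group W fam_group_at (om a) (S a))
               (family_group W (om a) (S a)).

Definition generator (a K : V) : Prop :=
  limit_case a (scale_generator W fam_group_at (om a) (S a) K)
               (family_generator W (om a) (S a) K).

(** The generic object at [a] is a function on [index a], permuted by the group. *)
Definition index (a : V) : V := limit_case a (prodSC W (om a)) (om a).

Definition move (a p i : V) : V :=
  limit_case a
    (setof (fun z => exists t, t ∈ SC W (om a) /\
       z = opair t (app (app p t) (app i t))))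
    (app p i).

(** Nonempty and closed under [p, q |-> p q^-1]. *)
Definition subgroup (a H : V) : Prop :=
  subset H (group a) /\ (exists p, p ∈ H) /\
  forall p q r, p ∈ H -> q ∈ H -> r ∈ group a ->
    (forall i, i ∈ index a -> move a r (move a q i) = move a p i) -> r ∈ H.

Definition in_filter (a H : V) : Prop :=
  W H /\ subgroup a H /\
  exists l : list V, (forall K, In K l -> generator a K) /\
    forall p, p ∈ group a -> (forall K, In K l -> p ∈ K) -> p ∈ H.

(** In this part [st b] is the stage [b] of the construction, for [b] below the
    ordinal under consideration. *)

Section Iteration.
Variable st : V -> stage V.

(** [x] is a value of some element of [Q_b] (at name level). *)
Definition is_value (b x : V) : Prop :=
  exists y i, stage_Q (st b) y /\ i ∈ index b /\ opair empty (dpair (check i) x) ∈ y.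

(** Canonical representative, up to forced equality, of a [P_b]-name [y] for an
    element of [Q_b]: all pairs (r, "i-th value is x") that are forced.  Names
    in this form make [P_a] a set on which the automorphisms below act. *)
Definition full (b y : V) : V :=
  setof (fun z => exists r i x, z = opair r (dpair (check i) x) /\
    cond (st b) r /\ i ∈ index b /\ is_value b x /\
    forces_mem (st b) r (dpair (check i) x) y).

(** [r] forces that [u] is at least as strong as [v] in [Q_b]: reverse inclusion,
    and coordinatewise reverse inclusion at limits. *)
Definition forces_le (b r u v : V) : Prop :=
  limit_case b
    (forall s i y q, opair s (dpair (check i) y) ∈ v ->
       cond (st b) q -> le (st b) q r -> le (st b) q s ->
       exists q' s' y', cond (st b) q' /\ le (st b) q' q /\
         opair s' (dpair (check i) y') ∈ u /\ le (st b) q' s' /\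
         forces_sub (st b) q' y y')
    (forces_sub (st b) r v u).

Definition iter_cond (a p : V) : Prop :=
  W p /\ finite p /\
  (forall z, z ∈ p -> exists b u, z = opair b u /\ b ∈ a) /\
  (forall b u v, opair b u ∈ p -> opair b v ∈ p -> u = v) /\
  (forall b u, opair b u ∈ p ->
     full b u = u /\ forces_mem (st b) empty u (bullet (stage_Q (st b)))).

Definition iter_le (p q : V) : Prop :=
  forall b v, opair b v ∈ q -> forces_le b (restrict p b) (coord p b) v.

Definition iter (a : V) : poset V := Poset (iter_cond a) iter_le.

(** The full name for the result of applying (the permutation named by) [t] to
    the condition named by [u]: [(pi q)(pi i) = q(i)]. *)
Definition act (b t u : V) : V :=
  setof (fun z => exists r j x, z = opair r (dpair (check j) x) /\
    cond (st b) r /\ j ∈ index b /\ is_value b x /\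
    forall q, cond (st b) q -> le (st b) q r ->
      exists q' p i, cond (st b) q' /\ le (st b) q' q /\
        p ∈ group b /\ i ∈ index b /\ forces_eq (st b) q' t (check p) /\
        move b p i = j /\ opair q' (dpair (check i) x) ∈ u).

(** The automorphism with single non-trivial coordinate [b]; the first component
    is its action on conditions, the second its action on names. *)
Definition aut1 (b t : V) : V -> V * V :=
  mem_rec (empty, empty) (fun x rec =>
    (setof (fun z => exists g u, opair g u ∈ x /\
       ((g ∈ b /\ z = opair g u) \/
        (g = b /\ z = opair g (act b t u)) \/
        (b ∈ g /\ z = opair g (snd (rec u))))),
     setof (fun z => exists p y, opair p y ∈ x /\
       z = opair (fst (rec p)) (snd (rec y))))).

(** A sequence of names of permutations is given by the list of its non-trivial
    coordinates, in increasing order. *)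
Definition aut_seq (a : V) (pi : list (V * V)) : Prop :=
  StronglySorted (fun x y => fst x ∈ fst y) pi /\
  forall b t, In (b, t) pi -> b ∈ a /\ W t /\ is_name (cond (st b)) t /\
    forces_mem (st b) empty t (check (group b)).

(** Action on names.  The product is read from left to right, i.e. the lowest
    coordinate acts first.  Both orders give the same group of automorphisms;
    with this one, if [p] forces the entries of [pi] to have certain values,
    then [p] forces [aut pi x] to be computed from these values. *)
Definition aut (pi : list (V * V)) (x : V) : V :=
  fold_left (fun y bt => snd (aut1 (fst bt) (snd bt) y)) pi x.

(** Excellent supports; the groups are in [W], so a name appearing in the name
    of the filter is (the check name of) a member of the filter. *)
Definition support (a : V) (H : V -> V) : Prop :=
  (forall b, b ∈ a -> in_filter b (H b)) /\
  exists l : list V, forall b, b ∈ a -> ~ In b l -> H b = group b.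

Definition forces_in_support (p : V) (pi : list (V * V)) (H : V -> V) : Prop :=
  forall b t, In (b, t) pi -> forces_mem (st b) (restrict p b) t (check (H b)).

(** [x] is respected by the automorphisms with coordinates below [a], as a
    [P]-name. *)
Definition respected (P : poset V) (a x : V) : Prop :=
  exists H, support a H /\
    forall p pi, cond P p -> aut_seq a pi -> forces_in_support p pi H ->
      forces_eq P p (aut pi x) x.

Inductive IS (a : V) : V -> Prop :=
| IS_intro x : W x ->
    (forall z, z ∈ x -> exists p y, z = opair p y /\ cond (iter a) p /\ IS a y) ->
    respected (iter a) a x -> IS a x.

(** [P_(b+1)]-names for the members of [M_b[rho_b | A]], for [A] included in
    [index b]: these are the names in [IS_b] for names of the forcing
    [{q in Q_b | dom q included in A}]. *)
Inductive IS_gen (b A : V) : V -> Prop :=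
| IS_gen_intro x : W x ->
    (forall z, z ∈ x -> exists p y, z = opair p y /\ IS_gen b A y /\
       cond (iter (suc b)) p /\
       forall r i v, opair r (dpair (check i) v) ∈ coord p b -> i ∈ A) ->
    respected (iter (suc b)) b x -> IS_gen b A x.

Definition gen_part (b xi : V) : V :=
  limit_case b (upair (app (S b) xi) (app (S b) xi)) (app (S b) xi).

(** The [P_(b+1)]-name of [R^(b+1)_xi], that is of [V_(omega+b+1)] as computed
    in [M_b[rho_b | gen_part b xi]]: its members are the sets in that model
    which have a name of rank below [omega+b+1]. *)
Definition Rname (b xi : V) : V :=
  bullet (fun x => IS_gen b (gen_part b xi) x /\ name_rank x ∈ oadd omega (suc b)).

(** [rho_(b+1) | I]. *)
Definition rho_succ (b I : V) : V :=
  bullet (fun u => exists xi, xi ∈ I /\ u = dpair (check xi) (Rname b xi)).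

(** [rho_a | (E, A)] for limit [a]. *)
Definition rho_limit (E A : V) : V :=
  bullet (fun u => exists f, f ∈ E /\ u = dpair (check f)
    (bullet (fun w => exists b, b ∈ A /\
       w = dpair (check b) (Rname b (app f (om (suc b))))))).

Definition bounded_family (a E : V) : Prop :=
  W E /\ subset E (prodSC W (om a)) /\
  exists g, g ∈ prodSC W (om a) /\
    forall f t, f ∈ E -> t ∈ SC W (om a) -> app f t ∈ app g t.

(** [y] is the canonical name of a restriction of [rho_a], [a > 0]. *)
Definition rho_restriction (a y : V) : Prop :=
  (exists b I, a = suc b /\ W I /\ subset I (om a) /\ size_lt W I (om a) /\
     y = rho_succ b I) \/
  (is_limit a /\ exists E A, bounded_family a E /\
     W A /\ subset A a /\ bounded a A /\ y = rho_limit E A).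

Definition Q_names (a y : V) : Prop :=
  (a = empty /\ exists s, Add s /\ y = check s) \/
  (a <> empty /\ exists pi x, aut_seq a pi /\ rho_restriction a x /\ y = aut pi x).

End Iteration.

Definition stages : V -> stage V :=
  mem_rec (Stage (Poset (fun _ => False) (fun _ _ => False)) (fun _ => False))
    (fun a st => Stage (iter st a) (Q_names st a)).

Variable c : V.

Definition approximation (b y : V) : Prop :=
  (b = empty /\ exists s, Add s /\ subset s c /\ y = check s) \/
  (b <> empty /\ rho_restriction stages b y).

(** The filter on [P_a] generated by the conditions all of whose coordinates are
    (names of) restrictions of the [rho_b].  Only [rho_0 = c] has to be given:
    for [b > 0], [rho_b] is the interpretation of its canonical name. *)
Definition generic_filter (a p : V) : Prop :=
  cond (stages a) p /\
  exists q, cond (stages a) q /\ le (stages a) q p /\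
    forall b u, opair b u ∈ q ->
      exists y, approximation b y /\ u = full stages b y.

Definition M_at (a v : V) : Prop :=
  exists x, IS stages a x /\ v = interp (generic_filter a) x.

Definition bristol_model (v : V) : Prop :=
  exists a, W a /\ ord a /\ M_at a v.

End Construction.

(* Main.v *)
From Stdlib Require Import List Arith Lia Sorted Relation_Operators Transitive_Closure Operators_Properties.
From Stdlib Require Import Classical ClassicalEpsilon FunctionalExtensionality PropExtensionality.
Require Import Defs.
Import ListNotations.

Set Implicit Arguments.
Unset Strict Implicit.

(** The construction of [M] is definable in [W] from [S], and among the generic
    objects only [rho_0 = c] is not named in [W].  Hence every element of [M] is
    the value of a name of [W] by a filter which is computed, by a relation in
    [W], from the finite parts of [c]: in short [W] is included in [M], and [M]
    in [W[c]].

    The ground model is then recognised as in the theorem of Laver, Woodin and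
    Hamkins.  Cohen forcing is small.  So, for a large enough set [Z] of [W], a
    set of [M] which is an image of [Z] is covered by such a set of [W], and a set
    of [M] whose intersections with such sets of [W] are in [W] is itself in [W].
    Since [M] is not a model of choice, the argument is carried out one ordinal [T]
    at a time, for sets [K] in [M] of functions from [Z] to [T * T] whose ranges are
    the subsets of [T * T] that are images of [Z] in [W].  Such a [K] is
    characterised in [M] by a covering property, closure under intersections, and
    the demand that on a set [U] of bounded order type, approximated by [K], the
    ranges are the copies of the elements of a fixed set of relations of [W].
    If [K] has these properties, then any small set lies in such a [U], the union
    of a long chain which alternates sets of [W] with ranges of elements of [K];
    the chain is built in [W], by means of Cohen names.  Finally [x] is in [W] if
    and only if it is coded by a relation on some [T] whose intersections with the
    ranges of a characterised [K] are again such ranges. *)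

(** * Sets and ordinals *)

(** The classical proof pins down a ground model by its power set of one cardinal. Here that role
    falls to [r], the set of small relations on [w], fixed before [T]. A relation on an arbitrary
    [T] must be moved below [w] before it can be compared with [r], along the collapse of a set [U]
    containing its field. Hence the bound on the order type of [U]; [w] leaves room for a union of
    [hartogs W Z] many small sets, the length that regularity needs to catch a small set in one link
    of a chain.

    The index set [Z] contains the Cohen conditions, because covering guesses one value for each
    condition and approximation picks one undecided element for each; [Z] maps onto its square to
    absorb a condition together with an argument.

    Most of the length has another source. The construction lives in the universe, with [epsilon],
    recursion on membership and class-sized orders, whereas a name of the filter has to be a set of
    [W]. So each notion is shown definable over [W], with guards where [epsilon] might return junk,
    and stages, supports and automorphisms are replaced by sets that code them. *)

Ltac splits := repeat match goal with |- _ /\ _ => split end.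

Lemma pred_ext {A : Type} (P Q : A -> Prop) : (forall x, P x <-> Q x) -> P = Q.
Proof. intros H; extensionality x; apply propositional_extensionality; apply H. Qed.

Lemma ex_iff {A : Type} (P Q : A -> Prop) : (forall x, P x <-> Q x) -> (exists x, P x) <-> (exists x, Q x).
Proof. intros H; split; intros [x Hx]; exists x; apply H, Hx. Qed.

Lemma all_iff {A : Type} (P Q : A -> Prop) : (forall x, P x <-> Q x) -> (forall x, P x) <-> (forall x, Q x).
Proof. intros H; split; intros K x; apply H, K. Qed.

Section Basics.
Context {V : universe}.
Implicit Types x y z u v : V.

Lemma setof_spec (P : V -> Prop) :
  (exists y, forall z, z ∈ y <-> P z) -> forall x, x ∈ setof P <-> P x.
Proof. intros H; unfold setof; exact (epsilon_spec _ _ H). Qed.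

Lemma setof_bounded (P : V -> Prop) y :
  (forall z, P z -> z ∈ y) -> forall x, x ∈ setof P <-> P x.
Proof.
intros H; apply setof_spec; destruct (separation V P y) as [s Hs]; exists s.
intros z; rewrite Hs; split; [tauto | auto].
Qed.

Arguments setof_bounded P y _ x : clear implicits.

Lemma setof_mem y : setof (fun x => x ∈ y) = y.
Proof. apply mem_ext; apply (setof_bounded _ y); auto. Qed.

Lemma setof_ext (P Q : V -> Prop) : (forall x, P x <-> Q x) -> setof P = setof Q.
Proof. intros H; rewrite (pred_ext H); reflexivity. Qed.

Lemma in_image (P : V -> Prop) (F : V -> V) y : (forall z, P z -> z ∈ y) ->
  forall z, z ∈ setof (fun z => exists x, P x /\ z = F x) <->
    exists x, P x /\ z = F x.
Proof.
intros H; destruct (replacement V F y) as [t Ht].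
apply setof_bounded with t; intros z (x & Hx & ->); apply Ht; eauto.
Qed.

Arguments in_image P F y _ z : clear implicits.

Lemma in_empty x : x ∈ empty <-> False.
Proof.
destruct (infinity V) as (i & (e & _ & He) & _).
apply (@setof_spec (fun _ => False)); exists e; firstorder.
Qed.

Lemma in_upair x y z : z ∈ upair x y <-> z = x \/ z = y.
Proof. apply (@setof_spec (fun z => z = x \/ z = y)), pairing. Qed.

Lemma upair_inj x y x' y' : upair x y = upair x' y' ->
  (x = x' /\ y = y') \/ (x = y' /\ y = x').
Proof.
intros H.
assert (forall z, (z = x \/ z = y) <-> (z = x' \/ z = y')) as E.
{ intros z; rewrite <- !in_upair, H; tauto. }
destruct (proj1 (E x)), (proj1 (E y)), (proj2 (E x')), (proj2 (E y'));
  subst; auto.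
Qed.

Lemma opair_inj x y x' y' : opair x y = opair x' y' -> x = x' /\ y = y'.
Proof.
intros H; apply upair_inj in H as [[H1 H2] | [H1 H2]].
- apply upair_inj in H1 as [[-> _] | [-> _]];
  apply upair_inj in H2 as [[? ?] | [? ?]]; subst; auto.
- apply upair_inj in H1 as [[? ?] | [? ?]];
  apply upair_inj in H2 as [[? ?] | [? ?]]; subst; auto.
Qed.

Definition cup x := setof (fun z => exists u, u ∈ x /\ z ∈ u).

Lemma in_cup x z : z ∈ cup x <-> exists u, u ∈ x /\ z ∈ u.
Proof. apply (@setof_spec (fun z => exists u, u ∈ x /\ z ∈ u)), union. Qed.

Definition join x y := cup (upair x y).

Lemma in_join x y z : z ∈ join x y <-> z ∈ x \/ z ∈ y.
Proof.
unfold join; rewrite in_cup; split.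
- intros (u & Hu & Hz); apply in_upair in Hu as [-> | ->]; auto.
- intros [H | H]; [exists x | exists y]; rewrite in_upair; auto.
Qed.

Definition single x := upair x x.

Lemma in_single x z : z ∈ single x <-> z = x.
Proof. unfold single; rewrite in_upair; tauto. Qed.

Lemma in_suc x z : z ∈ suc x <-> z ∈ x \/ z = x.
Proof.
apply (setof_bounded (fun z => z ∈ x \/ z = x) (join x (single x))); intros w H.
apply in_join; rewrite in_single; exact H.
Qed.

Lemma in_opair_snd x y z : opair x y ∈ z -> y ∈ cup (cup z).
Proof.
intros H; apply in_cup; exists (upair x y); split.
- apply in_cup; exists (opair x y); split; [exact H | apply in_upair; auto].
- apply in_upair; auto.
Qed.

Lemma mem_irrefl x : x ∉ x.
Proof.
induction (mem_wf V x) as [x _ IH]; intros H; exact (IH x H H).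
Qed.

Lemma mem_asym x y : x ∈ y -> y ∉ x.
Proof.
revert y; induction (mem_wf V x) as [x _ IH]; intros y H1 H2; exact (IH y H2 x H2 H1).
Qed.

Definition below := clos_trans V (@mem V).

Lemma below_step x y : below x y <-> x ∈ y \/ exists u, u ∈ y /\ below x u.
Proof.
split.
- intros H; apply clos_trans_tn1 in H; inversion H as [H1 | u y' H1 H2]; subst.
  + auto.
  + right; exists u; split; [exact H1 | apply clos_tn1_trans; exact H2].
- intros [H | (u & H1 & H2)]; [apply t_step; exact H |].
  apply t_trans with u; [exact H2 | apply t_step; exact H1].
Qed.

Lemma below_mem x y : x ∈ y -> below x y.
Proof. apply t_step. Qed.

Lemma below_trans x y z : below x y -> below y z -> below x z.
Proof. apply t_trans. Qed.

Lemma below_wf : well_founded below.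
Proof. exact (wf_clos_trans V _ (mem_wf V)). Qed.

Lemma below_transitive x y : is_transitive y -> (below x y <-> x ∈ y).
Proof.
intros T; split; [| apply below_mem].
intros H; apply below_step in H as [H | (u & Hu & H)]; [exact H |].
revert Hu; induction H as [v w H | v w w' _ IH1 _ IH2]; intros Hw; [| auto].
exact (T w Hw v H).
Qed.

Definition tc x := setof (fun y => below y x).

Lemma in_tc x y : y ∈ tc x <-> below y x.
Proof.
apply (@setof_spec (fun y => below y x)).
induction (mem_wf V x) as [x _ IH].
exists (join x (cup (setof (fun t => exists u, u ∈ x /\ t = tc u)))); intros z.
rewrite in_join, in_cup, below_step; apply or_iff_compat_l; split.
- intros (t & Ht & Hz).
  apply (in_image (fun u => u ∈ x) tc x) in Ht; [| auto].
  destruct Ht as (u & Hu & ->); exists u; split; [exact Hu |].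
  apply (@setof_spec (fun y => below y u)); [apply IH; exact Hu | exact Hz].
- intros (u & Hu & Hz); exists (tc u); split.
  + apply (in_image (fun u => u ∈ x) tc x); eauto.
  + apply (@setof_spec (fun y => below y u)); [apply IH; exact Hu | exact Hz].
Qed.

Lemma tc_transitive x : is_transitive (tc x).
Proof.
intros y Hy z Hz; rewrite in_tc in *; apply below_trans with y; [apply below_mem |]; auto.
Qed.

Lemma mem_rec_eq {T : Type} (d : T) (F : V -> (V -> T) -> T) x :
  mem_rec d F x =
  F x (fun y => if excluded_middle_informative (below y x) then mem_rec d F y else d).
Proof.
unfold mem_rec at 1; rewrite Fix_eq.
- reflexivity.
- intros y f g H; f_equal; extensionality z.
  destruct excluded_middle_informative; auto.
Qed.

(** [mem_rec] answers [d] off the transitive closure, so the expected recursion equation is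
    available only for a step that consults its second argument below [x]. *)
Lemma mem_rec_below {T : Type} (d : T) (F : V -> (V -> T) -> T) x :
  (forall r r', (forall y, below y x -> r y = r' y) -> F x r = F x r') ->
  mem_rec d F x = F x (mem_rec d F).
Proof.
intros H; rewrite mem_rec_eq; apply H; intros y Hy.
destruct excluded_middle_informative; [reflexivity | contradiction].
Qed.

Lemma below_ind (P : V -> Prop) :
  (forall x, (forall y, below y x -> P y) -> P x) -> forall x, P x.
Proof. intros H x; induction (below_wf x) as [x _ IH]; auto. Qed.

Lemma below_fst x y z : opair x y ∈ z -> below x z.
Proof.
intros H; apply below_trans with (opair x y); [| apply below_mem; exact H].
apply below_trans with (upair x x); apply below_mem; apply in_upair; auto.
Qed.

Lemma below_snd x y z : opair x y ∈ z -> below y z.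
Proof.
intros H; apply below_trans with (opair x y); [| apply below_mem; exact H].
apply below_trans with (upair x y); apply below_mem; apply in_upair; auto.
Qed.

Lemma below_fst' x y : below x (opair x y).
Proof. apply below_trans with (upair x x); apply below_mem; apply in_upair; auto. Qed.

Lemma below_snd' x y : below y (opair x y).
Proof. apply below_trans with (upair x y); apply below_mem; apply in_upair; auto. Qed.

Definition prod x y := setof (fun z => exists a b, a ∈ x /\ b ∈ y /\ z = opair a b).

Lemma in_prod x y z : z ∈ prod x y <-> exists a b, a ∈ x /\ b ∈ y /\ z = opair a b.
Proof.
apply setof_spec.
exists (cup (setof (fun t => exists a, a ∈ x /\ t =
  setof (fun z => exists b, b ∈ y /\ z = opair a b)))); intros w.
rewrite in_cup; split.
- intros (t & Ht & Hw).
  apply (in_image (fun a => a ∈ x) (fun a => setof (fun z => exists b, b ∈ y /\ z = opair a b)) x)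
    in Ht as (a & Ha & ->); [| auto].
  apply (in_image (fun b => b ∈ y) (fun b => opair a b) y) in Hw as (b & Hb & ->); eauto 6.
- intros (a & b & Ha & Hb & ->).
  exists (setof (fun z => exists b, b ∈ y /\ z = opair a b)); split.
  + apply (in_image (fun a => a ∈ x)
      (fun a => setof (fun z => exists b, b ∈ y /\ z = opair a b)) x); eauto.
  + apply (in_image (fun b => b ∈ y) (fun b => opair a b) y); eauto.
Qed.

Lemma opair_in_prod x y a b : opair a b ∈ prod x y <-> a ∈ x /\ b ∈ y.
Proof.
rewrite in_prod; split.
- intros (a' & b' & Ha & Hb & E); apply opair_inj in E as [-> ->]; auto.
- intros [Ha Hb]; eauto 6.
Qed.

Definition graph (f : V -> V) x := setof (fun z => exists y, y ∈ x /\ z = opair y (f y)).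

Lemma in_graph f x z : z ∈ graph f x <-> exists y, y ∈ x /\ z = opair y (f y).
Proof. apply (in_image (fun y => y ∈ x) (fun y => opair y (f y)) x); auto. Qed.

Lemma opair_in_graph f x y v : opair y v ∈ graph f x <-> y ∈ x /\ v = f y.
Proof.
rewrite in_graph; split.
- intros (y' & Hy & E); apply opair_inj in E as [-> ->]; auto.
- intros [Hy ->]; eauto.
Qed.

Lemma graph_ext f g x : (forall y, y ∈ x -> f y = g y) -> graph f x = graph g x.
Proof.
intros H; apply mem_ext; intros z; rewrite !in_graph.
split; intros (y & Hy & ->); exists y; rewrite (H y Hy); auto.
Qed.

(** A total variant of [app]: it does not depend on [epsilon], and agrees with
    [app] where [f] is single-valued. *)
Definition app1 (f x : V) := setof (fun z => exists y, opair x y ∈ f /\ z ∈ y).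

Lemma in_app1 f x z : z ∈ app1 f x <-> exists y, opair x y ∈ f /\ z ∈ y.
Proof.
apply (setof_bounded (fun z => exists y, opair x y ∈ f /\ z ∈ y) (cup (cup (cup f)))).
intros w (y & H & Hw); apply in_cup; exists y; split; [| exact Hw].
exact (in_opair_snd H).
Qed.

Definition functional_at (f x : V) := exists! y, opair x y ∈ f.

Lemma app1_eq f x y : functional_at f x -> opair x y ∈ f -> app1 f x = y.
Proof.
intros (y' & _ & U) H; apply mem_ext; intros z; rewrite in_app1; split.
- intros (y'' & H' & Hz); rewrite <- (U y H), (U y'' H'); exact Hz.
- eauto.
Qed.

Lemma app_spec f x : functional_at f x -> opair x (app f x) ∈ f.
Proof.
intros (y & H & _); unfold app; apply epsilon_spec; exists y; exact H.
Qed.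

Lemma app_eq f x y : functional_at f x -> opair x y ∈ f -> app f x = y.
Proof.
intros F H; pose proof (app_spec F) as H'; destruct F as (y' & _ & U).
rewrite <- (U _ H), <- (U _ H'); reflexivity.
Qed.

Lemma app_app1 f x : functional_at f x -> app f x = app1 f x.
Proof. intros F; symmetry; apply app1_eq; [| apply app_spec]; exact F. Qed.

Lemma functional_graph f x y : y ∈ x -> functional_at (graph f x) y.
Proof.
intros H; exists (f y); split.
- apply opair_in_graph; auto.
- intros v Hv; apply opair_in_graph in Hv; symmetry; tauto.
Qed.

Lemma app_graph f x y : y ∈ x -> app (graph f x) y = f y.
Proof.
intros H; apply app_eq; [apply functional_graph; exact H | apply opair_in_graph; auto].
Qed.

Lemma app1_graph f x y : y ∈ x -> app1 (graph f x) y = f y.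
Proof. intros H; rewrite <- app_app1, app_graph; auto using functional_graph. Qed.

Lemma function_on_functional f a x : function_on f a -> x ∈ a -> functional_at f x.
Proof. intros [_ H] Hx; exact (H x Hx). Qed.

Lemma function_on_graph f x : function_on (graph f x) x.
Proof.
split.
- intros z Hz; apply in_graph in Hz as (y & Hy & ->); eauto.
- intros y Hy; exact (functional_graph f Hy).
Qed.

Lemma function_on_in f a z : function_on f a ->
  (z ∈ f <-> exists x, x ∈ a /\ z = opair x (app f x)).
Proof.
intros F; split.
- intros Hz; destruct (proj1 F z Hz) as (x & y & -> & Hx); exists x; split; [exact Hx |].
  rewrite (app_eq (function_on_functional F Hx) Hz); reflexivity.
- intros (x & Hx & ->); apply app_spec, (function_on_functional F Hx).
Qed.

Lemma ord_transitive x : ord x -> is_transitive x.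
Proof. intros [H _]; exact H. Qed.

Arguments ord_transitive {x} _ _ _ _ _.

Lemma ord_mem x y : ord x -> y ∈ x -> ord y.
Proof.
intros [T H] Hy; split; [exact (H y Hy) |].
intros z Hz; apply H; exact (T y Hy z Hz).
Qed.

Lemma ord_below x y : ord x -> (below y x <-> y ∈ x).
Proof. intros O; apply below_transitive, ord_transitive, O. Qed.

Lemma ord_tc x : ord x -> tc x = x.
Proof. intros O; apply mem_ext; intros z; rewrite in_tc; apply ord_below, O. Qed.

Lemma ord_trichotomy x y : ord x -> ord y -> x ∈ y \/ x = y \/ y ∈ x.
Proof.
revert y; induction (mem_wf V x) as [x _ IHx]; intros y Ox Oy.
induction (mem_wf V y) as [y _ IHy].
destruct (classic (x ∈ y)) as [| N1]; [auto |].
destruct (classic (y ∈ x)) as [| N2]; [auto |].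
right; left; apply mem_ext; intros z; split; intros Hz.
- destruct (IHx z Hz y (ord_mem Ox Hz) Oy) as [H | [-> | H]]; [exact H | contradiction |].
  destruct N2; exact (ord_transitive Ox z Hz y H).
- destruct (IHy z Hz (ord_mem Oy Hz)) as [H | [<- | H]]; [| contradiction | exact H].
  destruct N1; exact (ord_transitive Oy z Hz x H).
Qed.

Lemma ord_subset x y : ord x -> ord y -> (subset x y <-> x = y \/ x ∈ y).
Proof.
intros Ox Oy; split.
- intros H; destruct (ord_trichotomy Ox Oy) as [| [|]]; [auto | auto |].
  destruct (@mem_irrefl y); apply H; assumption.
- intros [-> | H]; [intros z Hz; exact Hz | exact (ord_transitive Oy x H)].
Qed.

Lemma ord_not_mem x y : ord x -> ord y -> (x ∉ y <-> subset y x).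
Proof.
intros Ox Oy; split.
- intros N; destruct (ord_trichotomy Ox Oy) as [| [->|]]; [contradiction | intros z Hz; exact Hz |].
  apply ord_subset; auto.
- intros H1 H2; exact (mem_irrefl (H1 _ H2)).
Qed.

Lemma ord_suc x : ord x -> ord (suc x).
Proof.
intros O; split.
- intros y Hy z Hz; apply in_suc; apply in_suc in Hy as [Hy | ->]; left; [| exact Hz].
  exact (ord_transitive O y Hy z Hz).
- intros y Hy; apply in_suc in Hy as [Hy | ->]; [exact (proj2 O y Hy) | exact (proj1 O)].
Qed.

Lemma ord_of_subset x : (forall y, y ∈ x -> ord y) -> is_transitive x -> ord x.
Proof. intros H T; split; [exact T | intros y Hy; exact (proj1 (H y Hy))]. Qed.

Lemma mem_min (P : V -> Prop) : (exists x, P x) ->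
  exists x, P x /\ forall y, y ∈ x -> ~ P y.
Proof.
intros [x Hx]; revert Hx; induction (mem_wf V x) as [x _ IH]; intros Hx.
destruct (classic (exists w, w ∈ x /\ P w)) as [(w & Hw & Hw') | N].
- exact (IH w Hw Hw').
- exists x; split; [exact Hx |]; intros w Hw Hw'; apply N; eauto.
Qed.

Lemma list_set (l : list V) : exists x, forall y, y ∈ x <-> In y l.
Proof.
induction l as [| a l (x & IH)].
- exists empty; intros y; rewrite in_empty; simpl; tauto.
- exists (join (single a) x); intros y; rewrite in_join, in_single, IH; simpl.
  split; intros [-> | H]; auto.
Qed.

End Basics.

Arguments ord_transitive {V x} _ _ _ _ _.
Arguments setof_bounded {V} P y _ x.
Arguments in_image {V} P F y _ z.

(** * Definability in a class *)

Fixpoint rename {A : Type} (r : nat -> nat) (f : formula A) : formula A :=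
  match f with
  | FMem _ i j => FMem _ (r i) (r j)
  | FEq _ i j => FEq _ (r i) (r j)
  | FPred s i => FPred s (r i)
  | FBot _ => FBot _
  | FImp f g => FImp (rename r f) (rename r g)
  | FAll f => FAll (rename (fun n => match n with O => O | Datatypes.S k => Datatypes.S (r k) end) f)
  end.

Section Calculus.
Context {V : universe} {A : Type} (I : A -> V -> Prop) (D : V -> Prop).
Notation env := (nat -> V).
Notation tl e := (fun n => e (Datatypes.S n)).

Definition over_D (e : env) := forall n, D (e n).

Lemma sat_rename f : forall r e, sat I D e (rename r f) <-> sat I D (fun n => e (r n)) f.
Proof.
induction f as [i j|i j|s i| |f IHf g IHg|f IHf]; intros r e; simpl; try tauto.
- rewrite IHf, IHg; tauto.
- assert (forall x, (fun n => scons x e (match n with O => O | Datatypes.S k => Datatypes.S (r k) end))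
      = scons x (fun n => e (r n))) as E.
  { intros x; extensionality n; destruct n; reflexivity. }
  split; intros H x Hx; specialize (H x Hx).
  + rewrite IHf, E in H; exact H.
  + rewrite IHf, E; exact H.
Qed.

(** Uniform definability, over [(D, I)], in the environments that satisfy the guard [G]. *)
Definition Dp (G P : env -> Prop) :=
  exists f, forall e, over_D e -> G e -> (sat I D e f <-> P e).

(** The language has no function symbols, so an operation is definable through its graph: the value
    occupies variable 0 and pushes the parameters, with their guard, up by one. The guard confines
    the claim to arguments where an operation built with [epsilon], such as [app], has a meaningful
    value. *)
Definition Df (G : env -> Prop) (t : env -> V) :=
  (forall e, over_D e -> G e -> D (t e)) /\
  Dp (fun e => G (tl e)) (fun e => e 0 = t (tl e)).

Lemma over_scons x e : D x -> over_D e -> over_D (scons x e).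
Proof. intros Hx He [|n]; simpl; auto. Qed.

Lemma over_tl e : over_D e -> over_D (tl e).
Proof. intros H n; apply H. Qed.

Lemma dp_ext G P Q : (forall e, over_D e -> G e -> (P e <-> Q e)) -> Dp G P -> Dp G Q.
Proof.
intros H (f & Hf); exists f; intros e He HG; rewrite Hf; auto.
Qed.

Lemma dp_weaken G G' P : (forall e, over_D e -> G e -> G' e) -> Dp G' P -> Dp G P.
Proof. intros H (f & Hf); exists f; auto. Qed.

Lemma dp_rename r G P : Dp G P -> Dp (fun e => G (fun n => e (r n))) (fun e => P (fun n => e (r n))).
Proof.
intros (f & Hf); exists (rename r f); intros e He HG; rewrite sat_rename; apply Hf; auto.
intros n; apply He.
Qed.

Lemma dp_true G : Dp G (fun _ => True).
Proof. exists (FImp (FBot _) (FBot _)); simpl; tauto. Qed.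

Lemma dp_false G : Dp G (fun _ => False).
Proof. exists (FBot _); simpl; tauto. Qed.

(** The premise [P] joins the guard for [Q], so a term inside [Q] need only be meaningful where [P]
    holds. This is how bounded quantifiers supply the guards of the terms in their scope. *)
Lemma dp_imp G P Q : Dp G P -> Dp (fun e => G e /\ P e) Q -> Dp G (fun e => P e -> Q e).
Proof.
intros (f & Hf) (g & Hg); exists (FImp f g); intros e He HG; simpl.
rewrite (Hf e He HG); split; intros H HP; apply (Hg e He (conj HG HP)); auto.
Qed.

Lemma dp_not G P : Dp G P -> Dp G (fun e => ~ P e).
Proof. intros H; apply (@dp_imp G P (fun _ => False)); [exact H | apply dp_false]. Qed.

Lemma dp_and G P Q : Dp G P -> Dp (fun e => G e /\ P e) Q -> Dp G (fun e => P e /\ Q e).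
Proof.
intros HP HQ; apply dp_ext with (fun e => ~ (P e -> ~ Q e)); [intros e _ _; tauto |].
apply dp_not, dp_imp; [exact HP | apply dp_not, HQ].
Qed.

Lemma dp_or G P Q : Dp G P -> Dp G Q -> Dp G (fun e => P e \/ Q e).
Proof.
intros HP HQ; apply dp_ext with (fun e => ~ P e -> Q e); [intros e _ _; tauto |].
apply dp_imp; [apply dp_not, HP |]; apply dp_weaken with G; [tauto | exact HQ].
Qed.

Lemma dp_iff G P Q : Dp G P -> Dp G Q -> Dp G (fun e => P e <-> Q e).
Proof.
intros HP HQ; unfold iff; apply dp_and; apply dp_imp;
  (exact HP || (apply dp_weaken with G; [tauto | assumption])).
Qed.

(** A quantifier over the universe agrees with the one over [D] as soon as no counterexample lies
    outside [D]. For bounded quantifiers this is transitivity of [D], so absoluteness of a notion is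
    proved along with its definability. *)
Lemma dp_all G P :
  (forall e x, over_D e -> G e -> ~ P x e -> D x) ->
  Dp (fun e => G (tl e)) (fun e => P (e 0) (tl e)) -> Dp G (fun e => forall x, P x e).
Proof.
intros HD (f & Hf); exists (FAll f); intros e He HG; simpl; split.
- intros H x; apply NNPP; intros N.
  pose proof (HD e x He HG N) as Hx; apply N.
  apply (Hf (scons x e)); [apply over_scons | |]; auto.
- intros H x Hx; apply (Hf (scons x e)); [apply over_scons | |]; auto.
  exact (H x).
Qed.

Lemma dp_ex G P :
  (forall e x, over_D e -> G e -> P x e -> D x) ->
  Dp (fun e => G (tl e)) (fun e => P (e 0) (tl e)) -> Dp G (fun e => exists x, P x e).
Proof.
intros HD HP; apply dp_ext with (fun e => ~ forall x, ~ P x e).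
{ intros e _ _; split; [apply not_all_not_ex | firstorder]. }
apply dp_not, (@dp_all G (fun x e => ~ P x e)); [| apply dp_not, HP].
intros e x He HG N; apply HD with e; auto; tauto.
Qed.

Lemma df_weaken G G' t : (forall e, over_D e -> G e -> G' e) -> Df G' t -> Df G t.
Proof.
intros H [H1 H2]; split; [auto |].
apply dp_weaken with (fun e => G' (tl e)); [| exact H2].
intros e He; apply H; apply over_tl, He.
Qed.

Lemma df_var G i : Df G (fun e => e i).
Proof.
split; [auto |]; exists (FEq _ 0 (Datatypes.S i)); simpl; tauto.
Qed.

Lemma df_rename r G t : Df G t -> Df (fun e => G (fun n => e (r n))) (fun e => t (fun n => e (r n))).
Proof.
intros [H1 H2]; split.
- intros e He; apply H1; intros n; apply He.
- exact (dp_rename (fun n => match n with O => O | Datatypes.S k => Datatypes.S (r k) end) H2).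
Qed.

Lemma df_char G t Q : (forall e, over_D e -> G e -> D (t e)) ->
  (forall e y, over_D e -> D y -> G e -> (Q y e <-> y = t e)) ->
  Dp (fun e => G (tl e)) (fun e => Q (e 0) (tl e)) -> Df G t.
Proof.
intros H1 H2 H3; split; [exact H1 |].
apply (dp_ext (P := fun e => Q (e 0) (tl e))); [| exact H3].
intros e He HG; apply H2; auto; apply over_tl, He.
Qed.

Lemma df_ext G t u : (forall e, over_D e -> G e -> t e = u e) -> Df G t -> Df G u.
Proof.
intros H [H1 H2]; apply (@df_char G u (fun y e => y = t e)); [| | exact H2].
- intros e He HG; rewrite <- H; auto.
- intros e y He _ HG; rewrite H; tauto.
Qed.

(** Substituting a term amounts to the existence of an element that equals the term and satisfies
    [P]; the existential is spelled with [FAll], [FImp] and [FBot]. *)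
Lemma dp_subst G G' P t : Df G t -> Dp G' P -> (forall e, over_D e -> G e -> G' (scons (t e) e)) ->
  Dp G (fun e => P (scons (t e) e)).
Proof.
intros [Ht1 (f & Hf)] (g & Hg) HG.
exists (FImp (FAll (FImp f (FImp g (FBot _)))) (FBot _)); intros e He Ge; simpl.
pose proof (Ht1 e He Ge) as Dt.
pose proof (Hg _ (over_scons Dt He) (HG e He Ge)) as E.
split.
- intros H; apply NNPP; intros N; apply H; intros x Hx Hx1 Hx2.
  apply (Hf (scons x e)) in Hx1; [| apply over_scons; auto | exact Ge].
  simpl in Hx1; rewrite Hx1 in Hx2; tauto.
- intros HP H; apply (H (t e) Dt); [| apply E, HP].
  apply (Hf (scons (t e) e)); [apply over_scons; auto | exact Ge | reflexivity].
Qed.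

Lemma dp_eq G t u : Df G t -> Df G u -> Dp G (fun e => t e = u e).
Proof.
intros Ht [Hu1 Hu2].
exact (dp_subst Ht Hu2 (fun e _ H => H)).
Qed.

Lemma dp_mem0 G : Dp G (fun e => e 0 ∈ e 1).
Proof. exists (FMem _ 0 1); simpl; tauto. Qed.

Lemma dp_pred G s t : Df G t -> Dp G (fun e => I s (t e)).
Proof.
intros Ht; apply (dp_subst (G' := fun _ => True) (P := fun e => I s (e 0)) Ht); [| auto].
exists (FPred s 0); simpl; tauto.
Qed.

Fixpoint pre (ts : list (env -> V)) (e : env) : env :=
  match ts with nil => e | cons t ts => scons (t e) (pre ts e) end.

Lemma df_tl G t : Df G t -> Df (fun e => G (tl e)) (fun e => t (tl e)).
Proof. exact (df_rename Datatypes.S (G := G) (t := t)). Qed.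

Let shift (t : env -> V) : env -> V := fun e => t (tl e).

Lemma pre_shift_lt ts x e n : n < length ts -> pre (map shift ts) (scons x e) n = pre ts e n.
Proof.
revert n; induction ts as [|t ts IH]; simpl; intros n Hn; [lia |].
destruct n; simpl; [reflexivity | apply IH; lia].
Qed.

Lemma pre_ge ts e n : pre ts e (length ts + n) = e n.
Proof. induction ts as [|t ts IH]; simpl; auto. Qed.

(** Simultaneous substitution is reduced to single ones: the value of the first term is pushed on
    the environment, the other terms are shifted past it, and a renaming restores the order of the
    variables. *)
Lemma dp_substs ts : forall G G' P, (forall t, In t ts -> Df G t) -> Dp G' P ->
  (forall e, over_D e -> G e -> G' (pre ts e)) -> Dp G (fun e => P (pre ts e)).
Proof.
remember (length ts) as l eqn:El; revert ts El.
induction l as [|l IH]; intros [|t ts] El; simpl in *; try discriminate; intros G G' P Ht HP HG.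
{ exact (dp_weaken HG HP). }
injection El as El; set (k := length ts).
(* Position [k], just after the values of the [k] other terms, holds the value of [t]; [rot] brings
   it to the front and skips it afterwards. *)
set (rot := fun n => match n with O => k | Datatypes.S m => if Nat.ltb m k then m else Datatypes.S m end).
assert (forall e, (fun n => pre (map shift ts) (scons (t e) e) (rot n)) = scons (t e) (pre ts e)) as E.
{ intros e; extensionality n; unfold rot; destruct n as [|m]; simpl.
  - replace k with (length (map shift ts) + 0) by (rewrite length_map; unfold k; lia).
    rewrite pre_ge; reflexivity.
  - destruct (Nat.ltb_spec m k) as [L | L]; [apply pre_shift_lt; exact L |].
    replace (Datatypes.S m) with (length (map shift ts) + Datatypes.S (m - k))
      by (rewrite length_map; unfold k in *; lia).
    rewrite pre_ge; simpl; replace m with (length ts + (m - k)) at 2 by (unfold k in *; lia).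
    rewrite pre_ge; reflexivity. }
pose (G1 := fun e => G (tl e) /\ G' (fun n => pre (map shift ts) e (rot n))).
assert (Dp G1 (fun e => P (fun n => pre (map shift ts) e (rot n)))) as H1.
{ apply (IH (map shift ts) ltac:(rewrite length_map; exact El) G1 (fun e => G' (fun n => e (rot n))) (fun e => P (fun n => e (rot n)))).
  - intros u Hu; apply in_map_iff in Hu as (u' & <- & Hu').
    apply (df_weaken (G' := fun e => G (tl e))); [intros e _ H; exact (proj1 H) |].
    apply df_tl, Ht; auto.
  - apply dp_rename, HP.
  - intros e _ H; exact (proj2 H). }
apply dp_ext with (fun e => P (fun n => pre (map shift ts) (scons (t e) e) (rot n))).
{ intros e _ _; rewrite E; tauto. }
apply (dp_subst (Ht t (or_introl eq_refl)) H1).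
intros e He Ge; split; [exact Ge |]; rewrite E; auto.
Qed.

Lemma over_pre ts G e : (forall t, In t ts -> Df G t) -> over_D e -> G e -> over_D (pre ts e).
Proof.
intros Ht He Ge; induction ts as [|t ts IH]; simpl; [exact He |].
apply over_scons; [apply (Ht t); simpl; auto | apply IH; simpl in *; auto].
Qed.

Lemma df_substs ts G G' t : (forall t, In t ts -> Df G t) -> Df G' t ->
  (forall e, over_D e -> G e -> G' (pre ts e)) -> Df G (fun e => t (pre ts e)).
Proof.
intros Ht [H1 H2] HG; split.
{ intros e He Ge; apply H1; auto; apply over_pre with G; auto. }
set (k := length ts).
set (rot := fun n => match n with O => k | Datatypes.S m => if Nat.ltb m k then m else Datatypes.S m end).
assert (forall e, (fun n => pre (map shift ts) e (rot n)) = scons (e 0) (pre ts (tl e))) as E.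
{ intros e; assert (e = scons (e 0) (tl e)) as Ee by (extensionality n; destruct n; reflexivity).
  rewrite Ee; generalize (e 0) (tl e); clear e Ee; intros x e; simpl.
  extensionality n; unfold rot; destruct n as [|m]; simpl.
  - replace k with (length (map shift ts) + 0) by (rewrite length_map; unfold k; lia).
    rewrite pre_ge; reflexivity.
  - destruct (Nat.ltb_spec m k) as [L | L]; [apply pre_shift_lt; exact L |].
    replace (Datatypes.S m) with (length (map shift ts) + Datatypes.S (m - k))
      by (rewrite length_map; unfold k in *; lia).
    rewrite pre_ge; simpl; replace m with (length ts + (m - k)) at 2 by (unfold k in *; lia).
    rewrite pre_ge; reflexivity. }
apply dp_ext with (fun e => (fun e' => e' 0 = t (tl e')) (fun n => pre (map shift ts) e (rot n))).
{ intros e _ _.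
  pose proof (f_equal (fun e' : env => e' 0 = t (tl e')) (E e)) as E'; simpl in E'; simpl.
  rewrite E'; tauto. }
apply (dp_substs (G' := fun e => G' (tl (fun n => e (rot n))))
   (P := fun e => (fun e' => e' 0 = t (tl e')) (fun n => e (rot n)))).
- intros u Hu; apply in_map_iff in Hu as (u' & <- & Hu'); apply df_tl, Ht, Hu'.
- exact (dp_rename rot H2).
- intros e He Ge.
  pose proof (f_equal (fun e' : env => G' (tl e')) (E e)) as E'; simpl in E'.
  eapply eq_ind_r with (P := fun Q : Prop => Q); [| exact E'].
  apply HG; [apply over_tl, He | exact Ge].
Qed.

(** [Dn G R] and [Fn G f] are the closed instances, for predicates and operations of
    arity [n].  Lemmas of this form are named [d_R] and [f_f], or [m_R] when they are
    about the class [M]. *)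
Definition D1 G R := Dp (fun e => G (e 0)) (fun e => R (e 0)).
Definition D2 G R := Dp (fun e => G (e 0) (e 1)) (fun e => R (e 0) (e 1)).
Definition D3 G R := Dp (fun e => G (e 0) (e 1) (e 2)) (fun e => R (e 0) (e 1) (e 2)).
Definition D4 G R := Dp (fun e => G (e 0) (e 1) (e 2) (e 3)) (fun e => R (e 0) (e 1) (e 2) (e 3)).
Definition D5 G R := Dp (fun e => G (e 0) (e 1) (e 2) (e 3) (e 4))
  (fun e => R (e 0) (e 1) (e 2) (e 3) (e 4)).
Definition D6 G R := Dp (fun e => G (e 0) (e 1) (e 2) (e 3) (e 4) (e 5))
  (fun e => R (e 0) (e 1) (e 2) (e 3) (e 4) (e 5)).
Definition F0 t := Df (fun _ => True) (fun _ => t).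
Definition F1 G f := Df (fun e => G (e 0)) (fun e => f (e 0)).
Definition F2 G f := Df (fun e => G (e 0) (e 1)) (fun e => f (e 0) (e 1)).
Definition F3 G f := Df (fun e => G (e 0) (e 1) (e 2)) (fun e => f (e 0) (e 1) (e 2)).
Definition F4 G f := Df (fun e => G (e 0) (e 1) (e 2) (e 3)) (fun e => f (e 0) (e 1) (e 2) (e 3)).
Definition F5 G f := Df (fun e => G (e 0) (e 1) (e 2) (e 3) (e 4))
  (fun e => f (e 0) (e 1) (e 2) (e 3) (e 4)).

Lemma dp_use1 G G0 R t1 : D1 G0 R -> Df G t1 ->
  (forall e, over_D e -> G e -> G0 (t1 e)) -> Dp G (fun e => R (t1 e)).
Proof.
intros H H1 HG; refine (dp_substs (ts := [t1]) _ H HG).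
simpl; intros t Ht; decompose [or] Ht; subst; tauto.
Qed.

Lemma df_use1 G G0 f t1 : F1 G0 f -> Df G t1 ->
  (forall e, over_D e -> G e -> G0 (t1 e)) -> Df G (fun e => f (t1 e)).
Proof.
intros H H1 HG; refine (df_substs (ts := [t1]) _ H HG).
simpl; intros t Ht; decompose [or] Ht; subst; tauto.
Qed.

Lemma dp_use2 G G0 R t1 t2 : D2 G0 R -> Df G t1 -> Df G t2 ->
  (forall e, over_D e -> G e -> G0 (t1 e) (t2 e)) -> Dp G (fun e => R (t1 e) (t2 e)).
Proof.
intros H H1 H2 HG; refine (dp_substs (ts := [t1; t2]) _ H HG).
simpl; intros t Ht; decompose [or] Ht; subst; tauto.
Qed.

Lemma df_use2 G G0 f t1 t2 : F2 G0 f -> Df G t1 -> Df G t2 ->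
  (forall e, over_D e -> G e -> G0 (t1 e) (t2 e)) -> Df G (fun e => f (t1 e) (t2 e)).
Proof.
intros H H1 H2 HG; refine (df_substs (ts := [t1; t2]) _ H HG).
simpl; intros t Ht; decompose [or] Ht; subst; tauto.
Qed.

Lemma dp_use3 G G0 R t1 t2 t3 : D3 G0 R -> Df G t1 -> Df G t2 -> Df G t3 ->
  (forall e, over_D e -> G e -> G0 (t1 e) (t2 e) (t3 e)) -> Dp G (fun e => R (t1 e) (t2 e) (t3 e)).
Proof.
intros H H1 H2 H3 HG; refine (dp_substs (ts := [t1; t2; t3]) _ H HG).
simpl; intros t Ht; decompose [or] Ht; subst; tauto.
Qed.

Lemma df_use3 G G0 f t1 t2 t3 : F3 G0 f -> Df G t1 -> Df G t2 -> Df G t3 ->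
  (forall e, over_D e -> G e -> G0 (t1 e) (t2 e) (t3 e)) -> Df G (fun e => f (t1 e) (t2 e) (t3 e)).
Proof.
intros H H1 H2 H3 HG; refine (df_substs (ts := [t1; t2; t3]) _ H HG).
simpl; intros t Ht; decompose [or] Ht; subst; tauto.
Qed.

Lemma dp_use4 G G0 R t1 t2 t3 t4 : D4 G0 R -> Df G t1 -> Df G t2 -> Df G t3 -> Df G t4 ->
  (forall e, over_D e -> G e -> G0 (t1 e) (t2 e) (t3 e) (t4 e)) -> Dp G (fun e => R (t1 e) (t2 e) (t3 e) (t4 e)).
Proof.
intros H H1 H2 H3 H4 HG; refine (dp_substs (ts := [t1; t2; t3; t4]) _ H HG).
simpl; intros t Ht; decompose [or] Ht; subst; tauto.
Qed.

Lemma df_use4 G G0 f t1 t2 t3 t4 : F4 G0 f -> Df G t1 -> Df G t2 -> Df G t3 -> Df G t4 ->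
  (forall e, over_D e -> G e -> G0 (t1 e) (t2 e) (t3 e) (t4 e)) -> Df G (fun e => f (t1 e) (t2 e) (t3 e) (t4 e)).
Proof.
intros H H1 H2 H3 H4 HG; refine (df_substs (ts := [t1; t2; t3; t4]) _ H HG).
simpl; intros t Ht; decompose [or] Ht; subst; tauto.
Qed.

Lemma dp_use5 G G0 R t1 t2 t3 t4 t5 : D5 G0 R -> Df G t1 -> Df G t2 -> Df G t3 -> Df G t4 -> Df G t5 ->
  (forall e, over_D e -> G e -> G0 (t1 e) (t2 e) (t3 e) (t4 e) (t5 e)) -> Dp G (fun e => R (t1 e) (t2 e) (t3 e) (t4 e) (t5 e)).
Proof.
intros H H1 H2 H3 H4 H5 HG; refine (dp_substs (ts := [t1; t2; t3; t4; t5]) _ H HG).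
simpl; intros t Ht; decompose [or] Ht; subst; tauto.
Qed.

Lemma df_use5 G G0 f t1 t2 t3 t4 t5 : F5 G0 f -> Df G t1 -> Df G t2 -> Df G t3 -> Df G t4 -> Df G t5 ->
  (forall e, over_D e -> G e -> G0 (t1 e) (t2 e) (t3 e) (t4 e) (t5 e)) -> Df G (fun e => f (t1 e) (t2 e) (t3 e) (t4 e) (t5 e)).
Proof.
intros H H1 H2 H3 H4 H5 HG; refine (df_substs (ts := [t1; t2; t3; t4; t5]) _ H HG).
simpl; intros t Ht; decompose [or] Ht; subst; tauto.
Qed.

Lemma dp_use6 G G0 R t1 t2 t3 t4 t5 t6 : D6 G0 R -> Df G t1 -> Df G t2 -> Df G t3 -> Df G t4 -> Df G t5 -> Df G t6 ->
  (forall e, over_D e -> G e -> G0 (t1 e) (t2 e) (t3 e) (t4 e) (t5 e) (t6 e)) -> Dp G (fun e => R (t1 e) (t2 e) (t3 e) (t4 e) (t5 e) (t6 e)).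
Proof.
intros H H1 H2 H3 H4 H5 H6 HG; refine (dp_substs (ts := [t1; t2; t3; t4; t5; t6]) _ H HG).
simpl; intros t Ht; decompose [or] Ht; subst; tauto.
Qed.

Lemma dp_inD G t : Df G t -> Dp G (fun e => D (t e)).
Proof.
intros Ht; apply dp_ext with (fun _ => True); [| apply dp_true].
intros e He HG; split; [| tauto]; intros _; apply Ht; auto.
Qed.

Lemma dp_limit_case G a P Q : D1 (fun _ => True) (@is_limit V) -> Df G a ->
  Dp (fun e => G e /\ is_limit (a e)) P -> Dp (fun e => G e /\ ~ is_limit (a e)) Q ->
  Dp G (fun e => limit_case (a e) (P e) (Q e)).
Proof.
intros HL Ha HP HQ.
assert (Dp G (fun e => is_limit (a e))) as HLa by exact (dp_use1 HL Ha (fun _ _ _ => Logic.I)).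
apply dp_ext with (fun e => (is_limit (a e) -> P e) /\ (~ is_limit (a e) -> Q e)).
- intros e _ _; unfold limit_case; destruct excluded_middle_informative; tauto.
- apply dp_and; [apply dp_imp; assumption |].
  apply dp_weaken with G; [tauto |]; apply dp_imp; [apply dp_not |]; assumption.
Qed.

Lemma df_limit_case G a t u : D1 (fun _ => True) (@is_limit V) -> Df G a ->
  Df (fun e => G e /\ is_limit (a e)) t -> Df (fun e => G e /\ ~ is_limit (a e)) u ->
  Df G (fun e => limit_case (a e) (t e) (u e)).
Proof.
intros HL Ha [T1 T2] [U1 U2]; split.
- intros e He Ge; unfold limit_case; destruct excluded_middle_informative; [apply T1 | apply U1]; auto.
- apply dp_ext with (fun e => limit_case (a (tl e)) (e 0 = t (tl e)) (e 0 = u (tl e))).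
  + intros e _ _; unfold limit_case; destruct excluded_middle_informative; tauto.
  + exact (dp_limit_case HL (df_tl Ha) T2 U2).
Qed.

End Calculus.

(* Automation of definability and of membership in the class *)
Create HintDb dfn discriminated.
Create HintDb guard.

Section Closure.
Context {V : universe} {A : Type} (I : A -> V -> Prop) (D : V -> Prop).

Let env0 (x : V) : nat -> V := fun _ => x.

Lemma F0_D t : models_ZFC D I -> F0 I D t -> D t.
Proof. intros HZ [H _]; destruct (zfc_inf HZ) as (x & Hx & _); apply (H (env0 x)); auto; intros n; exact Hx. Qed.

Lemma F1_D G f x : F1 I D G f -> D x -> G x -> D (f x).
Proof. intros [H _] Hx HG; apply (H (env0 x)); [intros n; exact Hx | exact HG]. Qed.

Lemma F2_D G f x1 x2 : F2 I D G f -> D x1 -> D x2 -> G x1 x2 -> D (f x1 x2).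
Proof.
intros [H _] H1 H2 HG; apply (H (scons x1 (env0 x2))); [| exact HG].
repeat apply over_scons; auto; intros n; auto.
Qed.

Lemma F3_D G f x1 x2 x3 : F3 I D G f -> D x1 -> D x2 -> D x3 -> G x1 x2 x3 -> D (f x1 x2 x3).
Proof.
intros [H _] H1 H2 H3 HG; apply (H (scons x1 (scons x2 (env0 x3)))); [| exact HG].
repeat apply over_scons; auto; intros n; auto.
Qed.

Lemma F4_D G f x1 x2 x3 x4 : F4 I D G f -> D x1 -> D x2 -> D x3 -> D x4 ->
  G x1 x2 x3 x4 -> D (f x1 x2 x3 x4).
Proof.
intros [H _] H1 H2 H3 H4 HG.
apply (H (scons x1 (scons x2 (scons x3 (env0 x4))))); [| exact HG].
repeat apply over_scons; auto; intros n; auto.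
Qed.

Lemma F5_D G f x1 x2 x3 x4 x5 : F5 I D G f -> D x1 -> D x2 -> D x3 -> D x4 -> D x5 ->
  G x1 x2 x3 x4 x5 -> D (f x1 x2 x3 x4 x5).
Proof.
intros [H _] H1 H2 H3 H4 H5 HG.
apply (H (scons x1 (scons x2 (scons x3 (scons x4 (env0 x5)))))); [| exact HG].
repeat apply over_scons; auto; intros n; auto.
Qed.

Lemma df_const G t : F0 I D t -> Df I D G (fun _ => t).
Proof. apply df_weaken; auto. Qed.

Lemma d_mem : D2 I D (fun _ _ => True) (@mem V).
Proof. apply dp_mem0. Qed.

Context (Dtrans : transitive_class D).

Lemma D_mem x y : x ∈ y -> D y -> D x.
Proof. intros H Hy; exact (Dtrans Hy H). Qed.

Lemma D_below x y : below x y -> D y -> D x.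
Proof. intros H; induction H; eauto using D_mem. Qed.

Lemma D_opair1 x y z : opair x y ∈ z -> D z -> D x.
Proof. intros H; apply D_below, (below_fst H). Qed.

Lemma D_opair2 x y z : opair x y ∈ z -> D z -> D y.
Proof. intros H; apply D_below, (below_snd H). Qed.

Lemma D_opairl x y : D (opair x y) -> D x.
Proof. apply D_below, below_fst'. Qed.

Lemma D_opairr x y : D (opair x y) -> D y.
Proof. apply D_below, below_snd'. Qed.

End Closure.

Definition tru1 {X : Type} (_ : X) := True.
Definition tru2 {X : Type} (_ _ : X) := True.
Definition tru3 {X : Type} (_ _ _ : X) := True.
Definition tru4 {X : Type} (_ _ _ _ : X) := True.
Definition tru5 {X : Type} (_ _ _ _ _ : X) := True.
Definition tru6 {X : Type} (_ _ _ _ _ _ : X) := True.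

#[export] Hint Resolve d_mem : dfn.

Ltac trivial_guard := first [exact Logic.I | solve [eauto 6 with guard]].

Ltac dm_hook := fail.

(** A set is placed in the class by descending through transitivity, or by peeling off an operation
    whose definability lemma, a hint in [dfn], also gives closure of the class under it. *)
Ltac dm :=
  match goal with
  | H : ?D ?x |- ?D ?x => exact H
  | H : forall n, ?D (?e n) |- ?D (?e ?i) => exact (H i)
  | T : transitive_class ?D, H : ?x ∈ ?y |- ?D ?x => apply (T y x); [solve [dm] | exact H]
  | T : transitive_class ?D, H : opair ?x ?z ∈ ?y |- ?D ?x => apply (D_opair1 T H); solve [dm]
  | T : transitive_class ?D, H : opair ?z ?x ∈ ?y |- ?D ?x => apply (D_opair2 T H); solve [dm]
  | T : transitive_class ?D, H : ?z = opair ?x ?y |- ?D ?x =>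
      apply (D_opairl T (x := x) (y := y)); rewrite <- H; solve [dm]
  | T : transitive_class ?D, H : ?z = opair ?y ?x |- ?D ?x =>
      apply (D_opairr T (x := y) (y := x)); rewrite <- H; solve [dm]
  | |- _ => dm_hook
  | |- ?D ?t => first
    [ eapply F0_D; [eassumption | solve [eauto 3 with dfn]]
    | eapply F1_D; [solve [eauto 3 with dfn] | solve [dm] | trivial_guard]
    | eapply F2_D; [solve [eauto 3 with dfn] | solve [dm] .. | trivial_guard]
    | eapply F3_D; [solve [eauto 3 with dfn] | solve [dm] .. | trivial_guard]
    | eapply F4_D; [solve [eauto 3 with dfn] | solve [dm] .. | trivial_guard]
    | eapply F5_D; [solve [eauto 3 with dfn] | solve [dm] .. | trivial_guard] ]
  end.

Ltac destruct_all :=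
  repeat match goal with
  | H : _ /\ _ |- _ => destruct H
  | H : exists _, _ |- _ => destruct H
  end.

Ltac wside :=
  cbv beta; intros; unfold over_D in *; destruct_all; subst;
  first
  [ exact Logic.I
  | solve [dm]
  | solve [eauto 6 with guard]
  | let N := fresh in apply NNPP; intros N;
    match goal with H : ~ _ |- False => apply H; intros; exfalso; apply N;
      destruct_all; subst; first [solve [dm] | solve [eauto 6 with guard]] end ].

(** The search follows the shape of the predicate: connectives and quantifiers are split, and any
    other head symbol is looked up among the relations and operations already known to be
    definable. *)
Ltac dstep :=
  cbv beta;
  lazymatch goal with
  | |- Dp _ _ _ (fun _ => True) => apply dp_true
  | |- Dp _ _ _ (fun _ => False) => apply dp_false
  | |- Dp _ ?D _ (fun e => ?D (@?t e)) => apply dp_inD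
  | |- Dp _ _ _ (fun e => limit_case _ _ _) => apply dp_limit_case; [solve [eauto 3 with dfn] | | |]
  | |- Df _ _ _ (fun e => limit_case _ _ _) => apply df_limit_case; [solve [eauto 3 with dfn] | | |]
  | |- Dp _ _ _ (fun e => _ /\ _) => apply dp_and
  | |- Dp _ _ _ (fun e => _ \/ _) => apply dp_or
  | |- Dp _ _ _ (fun e => _ <-> _) => apply dp_iff
  | |- Dp _ _ _ (fun e => ~ _) => apply dp_not
  | |- Dp _ _ _ (fun e => @ex _ _) => apply dp_ex; [try solve [wside] |]
  | |- Dp _ _ _ (fun e => _ = _) => apply dp_eq
  | |- Dp _ _ _ (fun e => forall x : set ?V, _) => apply dp_all; [try solve [wside] |]
  | |- Dp _ _ _ (fun e => _ -> _) => apply dp_imp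
  | |- Df _ _ _ (fun e => e ?i) => apply df_var
  | |- Df _ _ _ _ =>
    match goal with
    | |- Df _ _ _ (fun e => ?t) => apply df_const; solve [eauto 3 with dfn]
    | |- Df _ _ _ (fun e => ?f (@?a e)) =>
      eapply (df_use1 (f := f) (t1 := a)); [solve [eauto 3 with dfn] |  | try solve [wside]]
    | |- Df _ _ _ (fun e => ?f (@?a e) (@?b e)) =>
      eapply (df_use2 (f := f) (t1 := a) (t2 := b)); [solve [eauto 3 with dfn] |  |  | try solve [wside]]
    | |- Df _ _ _ (fun e => ?f (@?a e) (@?b e) (@?c e)) =>
      eapply (df_use3 (f := f) (t1 := a) (t2 := b) (t3 := c)); [solve [eauto 3 with dfn] |  |  |  | try solve [wside]]
    | |- Df _ _ _ (fun e => ?f (@?a e) (@?b e) (@?c e) (@?d e)) =>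
      eapply (df_use4 (f := f) (t1 := a) (t2 := b) (t3 := c) (t4 := d)); [solve [eauto 3 with dfn] |  |  |  |  | try solve [wside]]
    | |- Df _ _ _ (fun e => ?f (@?a e) (@?b e) (@?c e) (@?d e) (@?g e)) =>
      eapply (df_use5 (f := f) (t1 := a) (t2 := b) (t3 := c) (t4 := d) (t5 := g)); [solve [eauto 3 with dfn] |  |  |  |  |  | try solve [wside]]
    end
  | |- Dp _ _ _ _ =>
    match goal with
    | |- Dp _ _ _ (fun e => ?f (@?a e)) =>
      eapply (dp_use1 (R := f) (t1 := a)); [solve [eauto 3 with dfn] |  | try solve [wside]]
    | |- Dp _ _ _ (fun e => ?f (@?a e) (@?b e)) =>
      eapply (dp_use2 (R := f) (t1 := a) (t2 := b)); [solve [eauto 3 with dfn] |  |  | try solve [wside]]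
    | |- Dp _ _ _ (fun e => ?f (@?a e) (@?b e) (@?c e)) =>
      eapply (dp_use3 (R := f) (t1 := a) (t2 := b) (t3 := c)); [solve [eauto 3 with dfn] |  |  |  | try solve [wside]]
    | |- Dp _ _ _ (fun e => ?f (@?a e) (@?b e) (@?c e) (@?d e)) =>
      eapply (dp_use4 (R := f) (t1 := a) (t2 := b) (t3 := c) (t4 := d)); [solve [eauto 3 with dfn] |  |  |  |  | try solve [wside]]
    | |- Dp _ _ _ (fun e => ?f (@?a e) (@?b e) (@?c e) (@?d e) (@?g e)) =>
      eapply (dp_use5 (R := f) (t1 := a) (t2 := b) (t3 := c) (t4 := d) (t5 := g)); [solve [eauto 3 with dfn] |  |  |  |  |  | try solve [wside]]
    | |- Dp _ _ _ (fun e => ?f (@?a e) (@?b e) (@?c e) (@?d e) (@?g e) (@?h e)) =>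
      eapply (dp_use6 (R := f) (t1 := a) (t2 := b) (t3 := c) (t4 := d) (t5 := g) (t6 := h)); [solve [eauto 3 with dfn] |  |  |  |  |  |  | try solve [wside]]
    end
  end.
Ltac dauto := repeat dstep.
Ltac dgoal :=
  cbv delta [D1 D2 D3 D4 D5 D6 F0 F1 F2 F3 F4 F5]; cbv beta.

Section Transitive.
Context {V : universe} {A : Type} (I : A -> V -> Prop) (D : V -> Prop).
Context (Dtrans : transitive_class D).

Lemma d_subset : D2 I D tru2 (@subset V).
Proof. dgoal; unfold subset; dauto. Qed.

Lemma d_is_transitive : D1 I D tru1 (@is_transitive V).
Proof. dgoal; unfold is_transitive, subset; dauto. Qed.
End Transitive.

(** * Models of ZFC *)

#[export] Hint Resolve d_subset d_is_transitive : dfn.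

Section ZFC.
Context {V : universe} {A : Type} (I : A -> V -> Prop) (D : V -> Prop).
Context (Dtrans : transitive_class D) (HZ : models_ZFC D I).
Notation tl e := (fun n => e (Datatypes.S n)).
Notation Dp := (Dp I D).
Notation Df := (Df I D).
Notation ok := (over_D D).

Lemma D_sep G P e x : Dp G P -> ok e -> D x -> (forall z, z ∈ x -> G (scons z e)) ->
  exists y, D y /\ forall z, z ∈ y <-> z ∈ x /\ P (scons z e).
Proof.
intros (f & Hf) He Hx HG.
destruct (zfc_sep HZ f e x He Hx) as (y & Hy & H); exists y; split; [exact Hy |].
assert (forall z, z ∈ x -> (sat I D (scons z e) f <-> P (scons z e))) as E.
{ intros z Hz; apply Hf; [apply over_scons; [exact (Dtrans Hx Hz) | exact He] | auto]. }
intros z; split.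
- intros Hz; apply H in Hz as [Hz1 Hz2]; [| exact (Dtrans Hy Hz)].
  split; [exact Hz1 | apply E; assumption].
- intros [Hz1 Hz2]; apply H; [exact (Dtrans Hx Hz1) |].
  split; [exact Hz1 | apply E; assumption].
Qed.

(** The bound lets Separation produce the set, and extensionality forces the [epsilon]-chosen
    [setof] to be that set. Its graph is the equivalence of membership with [P], where neither side
    can hold outside [D]. *)
Lemma df_setof G P : (forall e, ok e -> G e -> exists y, D y /\ forall x, P x e -> x ∈ y) ->
  Dp (fun e => G (tl e)) (fun e => P (e 0) (tl e)) -> Df G (fun e => setof (fun x => P x e)).
Proof.
intros HB HP.
assert (forall e, ok e -> G e -> D (setof (fun x => P x e)) /\
  forall x, x ∈ setof (fun x => P x e) <-> P x e) as H.
{ intros e He HG; destruct (HB e He HG) as (y & Hy & Hb).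
  destruct (D_sep HP He Hy) as (s & Hs & Es); [intros; exact HG |].
  pose proof (setof_bounded (fun x => P x e) y Hb) as E; split; [| exact E].
  replace (setof (fun x => P x e)) with s; [exact Hs |].
  apply mem_ext; intros z; rewrite Es, E; simpl; split; [tauto | auto]. }
apply (@df_char V A I D G _ (fun y e => forall x, x ∈ y <-> P x e)).
- intros e He HG; apply H; assumption.
- intros e y He Hy HG; destruct (H e He HG) as [H1 H2]; split.
  + intros E; apply mem_ext; intros z; rewrite E, H2; tauto.
  + intros ->; exact H2.
- apply dp_all.
  + intros e x He HG N; apply NNPP; intros C; apply N; split.
    * intros Hx; destruct C; exact (Dtrans (He 0) Hx).
    * intros Hx; destruct (HB _ (over_tl He) HG) as (y & Hy & Hb).
      destruct C; exact (Dtrans Hy (Hb x Hx)).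
  + apply dp_iff; [apply dp_weaken with (fun _ => True); [auto |]; apply (dp_subst (G := fun _ => True)
      (t := fun e => e 0) (G' := fun _ => True) (P := fun e => e 0 ∈ e 2)); auto using df_var |].
    * apply dp_use2 with (fun _ _ => True); auto using df_var, d_mem.
    * exact (dp_rename (fun n => match n with O => O | Datatypes.S k => Datatypes.S (Datatypes.S k) end) HP).
Qed.

Lemma df_image G P F : (forall e, ok e -> G e -> exists y, D y /\ forall x, P x e -> x ∈ y) ->
  Dp (fun e => G (tl e)) (fun e => P (e 0) (tl e)) ->
  Df (fun e => G (tl e) /\ P (e 0) (tl e)) (fun e => F (e 0) (tl e)) ->
  Df G (fun e => setof (fun z => exists x, P x e /\ z = F x e)).
Proof.
intros HB HP HF; apply df_setof.
- intros e He HG; destruct (HB e He HG) as (y & Hy & Hb).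
  destruct (D_sep HP He Hy) as (s & Hs & Es); [intros; exact HG |]; simpl in Es.
  destruct HF as [HF1 (f & Hf)].
  (* Replacement has the argument at variable 0 and the value at variable 1, a definable operation
     the other way round; hence the exchange. *)
  assert (forall u, D u -> u ∈ s -> forall v, D v ->
    (sat I D (scons u (scons v e)) (rename (fun n => match n with 0 => 1 | 1 => 0 | _ => n end) f)
      <-> v = F u e)) as E.
  { intros u Hu Hus v Hv; rewrite sat_rename.
    replace (fun n => scons u (scons v e) match n with 0 => 1 | 1 => 0 | _ => n end)
      with (scons v (scons u e)) by (extensionality n; destruct n as [|[|n]]; reflexivity).
    rewrite Hf; [simpl; tauto | | ].
    - repeat apply over_scons; auto.
    - simpl; split; [exact HG | apply Es; exact Hus]. }
  assert (forall u, u ∈ s -> D (F u e)) as DF.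
  { intros u Hu; apply (HF1 (scons u e)); [apply over_scons; [exact (Dtrans Hs Hu) | exact He] |].
    simpl; split; [exact HG | apply Es; exact Hu]. }
  destruct (zfc_repl HZ (rename (fun n => match n with 0 => 1 | 1 => 0 | _ => n end) f) e s He Hs)
    as (t & Ht & Et).
  + intros u Hu Hus; exists (F u e); split.
    * split; [auto | apply E; auto].
    * intros v [Hv Hv']; symmetry; apply (E u Hu Hus v Hv); exact Hv'.
  + exists t; split; [exact Ht |]; intros x (u & Hu & ->).
    assert (u ∈ s) as Hus by (apply Es; split; [apply Hb |]; exact Hu).
    apply Et; [auto |]; exists u; pose proof (Dtrans Hs Hus); repeat split; auto.
    apply E; auto.
- apply dp_ex.
  + intros e x He HG [Hx _]; destruct (HB _ (over_tl He) HG) as (y & Hy & Hb).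
    exact (Dtrans Hy (Hb x Hx)).
  + apply dp_and.
    * exact (dp_rename (fun n => match n with O => O | Datatypes.S k => Datatypes.S (Datatypes.S k) end) HP).
    * apply dp_eq; [apply df_var |].
      exact (df_rename (fun n => match n with O => O | Datatypes.S k => Datatypes.S (Datatypes.S k) end) HF).
Qed.

Lemma f_empty : F0 I D (@empty V).
Proof.
dgoal; apply df_setof; [| dstep].
intros e He _; exists (e 0); split; [apply He | tauto].
Qed.

Lemma f_upair : F2 I D tru2 (@upair V).
Proof.
dgoal; unfold upair; apply df_setof; [| dauto].
intros e He _; destruct (zfc_pair HZ _ _ (He 0) (He 1)) as (z & Hz & E); exists z; split; [exact Hz |].
intros x [-> | ->]; apply E; auto.
Qed.

Lemma f_opair : F2 I D tru2 (@opair V).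
Proof. pose proof f_upair; dgoal; unfold opair; dauto. Qed.

Lemma f_single : F1 I D tru1 (@single V).
Proof. pose proof f_upair; dgoal; unfold single; dauto. Qed.

Lemma f_cup : F1 I D tru1 (@cup V).
Proof.
dgoal; unfold cup; apply df_setof; [| dauto].
intros e He _; destruct (zfc_union HZ _ (He 0)) as (z & Hz & E); exists z; split; [exact Hz |].
intros x (u & Hu & Hx); pose proof (Dtrans (He 0) Hu) as Du.
apply E; [exact (Dtrans Du Hx) | eauto].
Qed.

Lemma f_join : F2 I D tru2 (@join V).
Proof. pose proof f_upair; pose proof f_cup; dgoal; unfold join; dauto. Qed.

Lemma f_suc : F1 I D tru1 (@suc V).
Proof.
pose proof f_join; pose proof f_single; dgoal; apply df_ext with (fun e => join (e 0) (single (e 0))).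
- intros e _ _; apply mem_ext; intros z; rewrite in_join, in_single, in_suc; tauto.
- dauto.
Qed.

Definition powD x := setof (fun z => D z /\ subset z x).

Lemma in_powD x z : z ∈ powD x <-> D z /\ subset z x.
Proof.
destruct (power V x) as [p Hp]; apply (setof_bounded (fun z => D z /\ subset z x) p).
intros w [_ Hw]; apply Hp; exact Hw.
Qed.

Lemma f_powD : F1 I D tru1 powD.
Proof.
dgoal; unfold powD; apply df_setof.
- intros e He _; destruct (zfc_power HZ _ (He 0)) as (z & Hz & E); exists z; split; [exact Hz |].
  intros x [Hx Hs]; apply E; [exact Hx |]; intros u _; apply Hs.
- apply dp_and; [apply dp_inD |]; dauto.
Qed.

Lemma f_prod : F2 I D tru2 (@prod V).
Proof.
pose proof f_opair; pose proof f_powD; pose proof f_join; dgoal; unfold prod; apply df_setof; [| dauto].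
intros e He _; exists (powD (powD (join (e 0) (e 1)))); split; [wside |].
intros x (a & b & Ha & Hb & ->).
pose proof (Dtrans (He 0) Ha); pose proof (Dtrans (He 1) Hb).
apply in_powD; split; [wside |].
assert (forall u, u = a \/ u = b -> u ∈ join (e 0) (e 1)) as K.
{ intros u [-> | ->]; apply in_join; auto. }
intros z Hz; unfold opair in Hz; apply in_upair in Hz.
apply in_powD; split.
- pose proof f_upair; destruct Hz as [-> | ->]; wside.
- destruct Hz as [-> | ->]; intros u Hu; apply in_upair in Hu; apply K; tauto.
Qed.

Lemma f_inter : F2 I D tru2 (@inter V).
Proof.
dgoal; unfold inter; apply df_setof; [| dauto].
intros e He _; exists (e 0); split; [apply He | tauto].
Qed.

Lemma f_app1 : F2 I D tru2 (@app1 V).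
Proof.
pose proof f_opair; pose proof f_cup; dgoal; unfold app1; apply df_setof; [| dauto].
intros e He _; exists (cup (cup (cup (e 0)))); split; [wside |].
intros x (y & Hy & Hx); apply in_cup; exists y; split; [exact (in_opair_snd Hy) | exact Hx].
Qed.

Lemma f_app : F2 I D (@functional_at V) (@app V).
Proof.
pose proof f_app1; dgoal; apply df_ext with (fun e => app1 (e 0) (e 1)); [| dauto].
intros e _ HF; symmetry; apply app_app1, HF.
Qed.

Lemma d_function_on : D2 I D tru2 (@function_on V).
Proof. pose proof f_opair; dgoal; unfold function_on, unique; dauto. Qed.

(** The formula for [tc] describes the least transitive superset among the members of [D], which is
    the right set only once the transitive closure lies in [D]. So definability and closure are
    proved together by induction: Replacement collects the closures of the members of [x], and their
    union is adjoined to [x]. *)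
Lemma D_tc x : D x -> D (tc x).
Proof.
pose proof f_cup; pose proof f_join.
induction (mem_wf V x) as [x _ IH]; intros Hx.
assert (forall y t, D y -> D t -> D (tc y) ->
  ((is_transitive t /\ subset y t /\ forall t', D t' -> is_transitive t' -> subset y t' -> subset t t')
   <-> t = tc y)) as E.
{ intros y t Hy Ht Hty; split.
  - intros (H1 & H2 & H3); apply mem_ext; intros z; split.
    + apply (H3 (tc y) Hty); [apply tc_transitive |].
      intros w Hw; apply in_tc, below_mem, Hw.
    + intros Hz; apply in_tc in Hz; apply (below_transitive _ H1).
      apply below_step in Hz as [Hz | (u & Hu & Hz)]; [apply below_mem, H2, Hz |].
      apply below_trans with u; [exact Hz | apply below_mem, H2, Hu].
  - intros ->; split; [apply tc_transitive | split].
    + intros w Hw; apply in_tc, below_mem, Hw.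
    + intros t' _ H1 H2 z Hz; apply in_tc in Hz; apply (below_transitive _ H1).
      apply below_step in Hz as [Hz | (u & Hu & Hz)]; [apply below_mem, H2, Hz |].
      apply below_trans with u; [exact Hz | apply below_mem, H2, Hu]. }
assert (Df (fun e => D (tc (e 0))) (fun e => tc (e 0))) as F.
{ apply (@df_char V A I D _ _ (fun t e => is_transitive t /\ subset (e 0) t /\
    forall t', D t' -> is_transitive t' -> subset (e 0) t' -> subset t t')).
  - auto.
  - intros e t He Ht HG; apply E; auto.
  - dstep; [dauto |]; dstep; [dauto |]; apply dp_all; [|apply dp_imp; [apply dp_inD|]; dauto].
    intros e t He _ N; apply NNPP; intros C; apply N; intros Dt; contradiction. }
assert (Df (fun e => forall y, y ∈ e 0 -> D (tc y)) (fun e => setof (fun z => exists y, y ∈ e 0 /\ z = tc y))) as F'.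
{ apply (df_image (G := fun e => forall y, y ∈ e 0 -> D (tc y)) (P := fun y e => y ∈ e 0) (F := fun y _ => tc y)).
  - intros e He _; exists (e 0); split; [apply He | auto].
  - dauto.
  - apply df_weaken with (fun e => D (tc (e 0))); [| exact F].
    intros e _ [H1 H2]; auto. }
assert (D (setof (fun z => exists y, y ∈ x /\ z = tc y))) as DF.
{ apply ((proj1 F') (fun _ => x)); [intros _; exact Hx |].
  intros y Hy; apply IH; [exact Hy | exact (Dtrans Hx Hy)]. }
replace (tc x) with (join x (cup (setof (fun z => exists y, y ∈ x /\ z = tc y)))); [wside |].
apply mem_ext; intros z; rewrite in_join, in_cup, in_tc, below_step; apply or_iff_compat_l; split.
- intros (t & Ht & Hz); apply (in_image (fun y => y ∈ x) (@tc V) x) in Ht as (y & Hy & ->); [| auto].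
  exists y; rewrite <- in_tc; auto.
- intros (u & Hu & Hz); exists (tc u); rewrite in_tc; split; [| exact Hz].
  apply (in_image (fun y => y ∈ x) (@tc V) x); eauto.
Qed.

Lemma d_below : D2 I D tru2 (@below V).
Proof.
apply dp_ext with (fun e => forall t, D t -> is_transitive t -> subset (e 1) t -> e 0 ∈ t).
- intros e He _; split.
  + intros H; apply in_tc, H; [apply D_tc, He | apply tc_transitive |].
    intros w Hw; apply in_tc, below_mem, Hw.
  + intros Hz t _ H1 H2; apply (below_transitive _ H1).
    apply below_step in Hz as [Hz | (u & Hu & Hz)]; [apply below_mem, H2, Hz |].
    apply below_trans with u; [exact Hz | apply below_mem, H2, Hu].
- apply dp_all; [|apply dp_imp; [apply dp_inD|]; dauto].
  intros e t He _ N; apply NNPP; intros C; apply N; intros Dt; contradiction.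
Qed.

Lemma f_tc : F1 I D tru1 (@tc V).
Proof.
pose proof d_below; dgoal; unfold tc; apply df_setof; [| dauto].
intros e He _; exists (tc (e 0)); split; [apply D_tc, He | intros x Hx; apply in_tc, Hx].
Qed.

End ZFC.

#[export] Hint Resolve f_empty f_upair f_opair f_single f_cup f_join f_suc f_powD f_prod f_inter
  f_app1 f_app d_function_on d_below f_tc : dfn.

(** * Transfinite recursion inside a model of ZFC *)

Section Recursion.
Context {V : universe} {A : Type} (I : A -> V -> Prop) (D : V -> Prop).
Context (Dtrans : transitive_class D) (HZ : models_ZFC D I).
Notation tl e := (fun n => e (Datatypes.S n)).
Notation tl2 e := (fun n => e (Datatypes.S (Datatypes.S n))).
Notation Dp := (Dp I D).
Notation Df := (Df I D).
Notation ok := (over_D D).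

Definition restr_below (f u : V) := setof (fun z => z ∈ f /\ exists w v, z = opair w v /\ below w u).

Lemma in_restr_below f u z : z ∈ restr_below f u <-> z ∈ f /\ exists w v, z = opair w v /\ below w u.
Proof.
apply (setof_bounded (fun z => z ∈ f /\ exists w v, z = opair w v /\ below w u) f); tauto.
Qed.

Lemma f_restr_below : F2 I D tru2 restr_below.
Proof.
dgoal; unfold restr_below; apply (df_setof Dtrans HZ).
- intros e He _; exists (e 0); split; [apply He | tauto].
- dauto.
Qed.

Lemma restr_below_graph R f X u : is_transitive X -> function_on f X -> u ∈ X ->
  (forall w, below w u -> app1 f w = R w) -> restr_below f u = graph R (tc u).
Proof.
intros T F Hu H; apply mem_ext; intros z; rewrite in_restr_below, in_graph.
assert (forall w, below w u -> w ∈ X) as K.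
{ intros w Hw; apply (below_transitive _ T); apply below_trans with u; [exact Hw | apply below_mem, Hu]. }
split.
- intros (Hz & w & v & -> & Hw); exists w; split; [apply in_tc, Hw |].
  rewrite <- (H w Hw), (app1_eq (function_on_functional F (K w Hw)) Hz); reflexivity.
- intros (w & Hw & ->); apply in_tc in Hw; split; [| eauto].
  rewrite <- (H w Hw), <- app_app1 by exact (function_on_functional F (K w Hw)).
  apply app_spec, (function_on_functional F (K w Hw)).
Qed.

(** [R] is defined by the existence of an attempt, a function on a transitive set that obeys the
    recursion. The step [H] is definable only at the true graph of [R], so attempts are tested with
    its raw formula [h] and recognised as correct afterwards. *)
Theorem df_rec G (R : (nat -> V) -> V -> V) H :
  (forall e x, ok e -> G e -> D x -> R e x = H x (graph (R e) (tc x)) e) ->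
  Df (fun e => G (tl2 e) /\ e 1 = graph (R (tl2 e)) (tc (e 0))) (fun e => H (e 0) (e 1) (tl2 e)) ->
  Df (fun e => G (tl e)) (fun e => R (tl e) (e 0)).
Proof.
intros HR [HH1 (h & Hh)].
pose proof f_restr_below as Kr.
pose (S v x g e := sat I D (scons v (scons x (scons g e))) h).
assert (forall x g v e, D x -> D g -> D v -> ok e -> G e -> g = graph (R e) (tc x) ->
  (S v x g e <-> v = H x g e)) as HS.
{ intros x g v e Hx Hg Hv He Ge E; apply Hh; [repeat apply over_scons; auto |]; simpl; auto. }
pose (att f X e := is_transitive X /\ function_on f X /\
  forall u, u ∈ X -> S (app1 f u) u (restr_below f u) e).
(* An attempt computes [R], by induction: once it is correct below [u], its restriction is the true
   graph, and there the formula can be trusted. *)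
assert (forall f X e, ok e -> G e -> D f -> D X -> att f X e -> forall u, u ∈ X -> app1 f u = R e u) as C1.
{ intros f X e He Ge Hf HX (T & F & Hatt) u; induction u as [u IH] using below_ind; intros Hu.
  assert (restr_below f u = graph (R e) (tc u)) as E.
  { apply (restr_below_graph T F Hu); intros w Hw; apply IH; [exact Hw |].
    apply (below_transitive _ T); apply below_trans with u; [exact Hw | apply below_mem, Hu]. }
  pose proof (Dtrans HX Hu) as Du.
  assert (D (restr_below f u)) as Dr by dm.
  assert (D (app1 f u)) as Da by dm.
  apply (HS u _ _ e Du Dr Da He Ge E) in Hatt; [| exact Hu].
  rewrite Hatt, (HR e u He Ge Du), E; reflexivity. }
pose (Att v y e := exists f X, D f /\ D X /\ att f X e /\ y ∈ X /\ v = app1 f y).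
pose (good y e := D (R e y) /\ D (graph (R e) (tc y))).
assert (forall y e v, ok e -> G e -> D y -> good y e -> (Att v y e <-> v = R e y)) as C2.
{ intros y e v He Ge Hy [g1 g2]; split.
  - intros (f & X & Hf & HX & Ha & HyX & ->); exact (C1 f X e He Ge Hf HX Ha y HyX).
  - intros ->.
    pose (X := join (tc y) (single y)).
    assert (forall u, u ∈ X <-> below u y \/ u = y) as EX.
    { intros u; unfold X; rewrite in_join, in_tc, in_single; tauto. }
    assert (D X) as DX by (unfold X; dm).
    assert (graph (R e) X = join (graph (R e) (tc y)) (single (opair y (R e y)))) as EG.
    { apply mem_ext; intros z; rewrite in_join, in_single, !in_graph; split.
      - intros (u & Hu & ->); apply EX in Hu as [Hu | ->]; [left; exists u; rewrite in_tc; auto | auto].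
      - intros [(u & Hu & ->) | ->]; [exists u; rewrite EX, <- in_tc; auto | exists y; rewrite EX; auto]. }
    assert (D (graph (R e) X)) as DG by (rewrite EG; dm).
    assert (is_transitive X) as T.
    { intros u Hu w Hw; apply EX in Hu as [Hu | ->]; apply EX; left; [| apply below_mem, Hw].
      apply below_trans with u; [apply below_mem, Hw | exact Hu]. }
    exists (graph (R e) X), X; repeat split; auto.
    + apply function_on_graph.
    + apply function_on_graph.
    + intros u Hu; pose proof (Dtrans DX Hu) as Du.
      assert (restr_below (graph (R e) X) u = graph (R e) (tc u)) as E.
      { apply (restr_below_graph T (function_on_graph _ _) Hu); intros w Hw; apply app1_graph.
        apply (below_transitive _ T); apply below_trans with u; [exact Hw | apply below_mem, Hu]. }
      rewrite app1_graph by exact Hu; apply HS; auto.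
      * dm.
      * rewrite <- (app1_graph (R e) Hu); dm.
      * rewrite E; auto.
    + apply EX; auto.
    + rewrite app1_graph; [reflexivity | apply EX; auto]. }
assert (Df (fun e => G (tl e) /\ good (e 0) (tl e)) (fun e => R (tl e) (e 0))) as F.
{ apply (@df_char V A I D _ _ (fun v e => Att v (e 0) (tl e))).
  - intros e He [_ [g1 _]]; exact g1.
  - intros e v He Hv [Ge Hg]; apply C2; auto; apply over_tl, He.
  - unfold Att, att; do 2 dstep.
    apply dp_and; [apply dp_inD; dauto |]; apply dp_and; [apply dp_inD; dauto |].
    apply dp_and; [| dauto].
    dstep; [dauto |]; dstep; [dauto |]; dstep.
    dstep; [dauto |].
    apply dp_weaken with (fun _ => True); [auto |].
    apply dp_ext with (fun e => (fun e' => sat I D e' h)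
      (fun n => pre [fun e => app1 (e 2) (e 0); fun e => e 0; fun e => restr_below (e 2) (e 0)] e
        (match n with 0 => 0 | 1 => 1 | 2 => 2 | Datatypes.S (Datatypes.S (Datatypes.S n)) =>
           3 + (5 + n) end))).
    { intros e _ _; unfold S.
      match goal with |- sat _ _ ?a _ <-> sat _ _ ?b _ => replace a with b; [tauto |] end.
      extensionality n; destruct n as [|[|[|n]]]; reflexivity. }
    apply (dp_substs (G' := fun _ => True) (P := fun e => (fun e' => sat I D e' h)
      (fun n => e (match n with 0 => 0 | 1 => 1 | 2 => 2 | Datatypes.S (Datatypes.S (Datatypes.S n)) =>
           3 + (5 + n) end)))); [| | auto].
    + simpl; intros t Ht; decompose [or] Ht; subst; try tauto; dauto.
    + exists (rename (fun n => match n with 0 => 0 | 1 => 1 | 2 => 2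
        | Datatypes.S (Datatypes.S (Datatypes.S n)) => 3 + (5 + n) end) h).
      intros e _ _; rewrite sat_rename; tauto. }
(* All values of [R] lie in [D]: if the earlier ones do, the definition just obtained applies to
   them, and Replacement puts their graph in [D]. *)
assert (forall e x, ok e -> G e -> D x -> good x e) as C3.
{ intros e x He Ge; induction x as [x IH] using below_ind; intros Hx.
  assert (forall y, y ∈ tc x -> good y e) as IH'.
  { intros y Hy; apply IH; [apply in_tc, Hy | apply (Dtrans (x := tc x)); [dm | exact Hy]]. }
  assert (D (graph (R e) (tc x))) as DG.
  { assert (Df (fun e => G (tl e) /\ forall y, y ∈ tc (e 0) -> good y (tl e))
      (fun e => setof (fun z => exists y, y ∈ tc (e 0) /\ z = opair y (R (tl e) y)))) as F'.
    { apply (df_image Dtrans HZ (G := fun e => G (tl e) /\ forall y, y ∈ tc (e 0) -> good y (tl e))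
        (P := fun y e => y ∈ tc (e 0)) (F := fun y e => opair y (R (tl e) y))).
      - intros e' He' _; exists (tc (e' 0)); split; [pose proof He' 0; dm | auto].
      - dauto.
      - dstep; [dauto |].
        apply (df_weaken (G' := fun e => G (tl2 e) /\ good (e 0) (tl2 e))).
        + intros e' He' [[G1 G2] G3]; auto.
        + exact (df_rename (fun n => match n with O => O | Datatypes.S k => Datatypes.S (Datatypes.S k) end) F). }
    exact (proj1 F' (scons x e) (over_scons Hx He) (conj Ge IH')). }
  split; [| exact DG].
  rewrite (HR e x He Ge Hx).
  apply (HH1 (scons x (scons (graph (R e) (tc x)) e))); [repeat apply over_scons; auto |].
  simpl; auto. }
apply (df_weaken (G' := fun e => G (tl e) /\ good (e 0) (tl e))); [| exact F].
intros e He Ge; split; [exact Ge | apply C3; auto; apply over_tl, He].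
Qed.

End Recursion.

(** * Coding of finite lists by sets *)

Section Lists.
Context {V : universe}.

(** Lists of the metatheory become sets of the class, so that the quantifiers over lists in
    finiteness and in sequences of automorphisms turn into quantifiers over sets. *)
Fixpoint code (l : list V) : V :=
  match l with [] => empty | x :: l => opair x (code l) end.

Lemma opair_not_empty (x y : V) : opair x y <> empty.
Proof.
intros H; apply (proj1 (in_empty (upair x x))); rewrite <- H; apply in_upair; auto.
Qed.

Lemma code_inj l l' : code l = code l' -> l = l'.
Proof.
revert l'; induction l as [|x l IH]; intros [|y l'] H; simpl in H; auto.
- symmetry in H; destruct (opair_not_empty H).
- destruct (opair_not_empty H).
- apply opair_inj in H as [-> H]; rewrite (IH l' H); reflexivity.
Qed.

Definition is_code (z : V) := exists l, z = code l.
Definition in_code (y z : V) := exists l, z = code l /\ In y l.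

Lemma in_code_code y l : in_code y (code l) <-> In y l.
Proof.
split; [intros (l' & E & H); rewrite (code_inj E); exact H | intros H; exists l; auto].
Qed.

Lemma is_code_eq z : is_code z <-> z = empty \/ exists a b, z = opair a b /\ is_code b.
Proof.
split.
- intros ([|a l] & ->); [auto | right; exists a, (code l); split; [reflexivity | exists l; auto]].
- intros [-> | (a & b & -> & l & ->)]; [exists []; auto | exists (a :: l); auto].
Qed.

Lemma in_code_eq y z : in_code y z <-> exists a b, z = opair a b /\ is_code b /\ (y = a \/ in_code y b).
Proof.
split.
- intros ([|a l] & -> & H); [destruct H |].
  exists a, (code l); split; [reflexivity | split; [exists l; auto |]].
  rewrite in_code_code; destruct H; auto.
- intros (a & b & -> & (l & ->) & [-> | H]); exists (a :: l); simpl; auto.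
  rewrite in_code_code in H; auto.
Qed.

Lemma below_code y l : In y l -> below y (code l).
Proof.
induction l as [|a l IH]; simpl; [tauto |].
intros [-> | H]; [apply below_fst' |].
apply below_trans with (code l); [auto | apply below_snd'].
Qed.

Definition elements (z : V) := setof (fun y => in_code y z).

Lemma in_elements y l : y ∈ elements (code l) <-> In y l.
Proof.
rewrite <- in_code_code; apply (setof_bounded (fun y => in_code y (code l)) (tc (code l))).
intros w H; apply in_tc, below_code, in_code_code, H.
Qed.

Lemma finite_code (x : V) : finite x <-> exists l, x = elements (code l).
Proof.
split.
- intros (l & H); exists l; apply mem_ext; intros y; rewrite in_elements; apply H.
- intros (l & ->); exists l; intros y; apply in_elements.
Qed.

Lemma finite_subset (x y : V) : finite y -> subset x y -> finite x.
Proof.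
intros (l & H) Hs.
exists (filter (fun z => if excluded_middle_informative (z ∈ x) then true else false) l).
intros z; rewrite filter_In, <- H.
destruct excluded_middle_informative as [h | h]; split; intros; auto; try tauto.
destruct H0; discriminate.
Qed.

End Lists.

(** * Recursive predicates, finiteness, omega and closures *)

Section Omega.
Context {V : universe} {A : Type} (I : A -> V -> Prop) (D : V -> Prop).
Context (Dtrans : transitive_class D) (HZ : models_ZFC D I).
Notation tl e := (fun n => e (Datatypes.S n)).
Notation tl2 e := (fun n => e (Datatypes.S (Datatypes.S n))).
Notation tl3 e := (fun n => e (Datatypes.S (Datatypes.S (Datatypes.S n)))).
Notation Dp := (Dp I D).
Notation Df := (Df I D).
Notation ok := (over_D D).

(** A recursion for a predicate becomes one for an operation when truth values are encoded as the
    subsets of [single empty]. *)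
Lemma dp_rec G (P : (nat -> V) -> V -> Prop) Phi :
  (forall e x, ok e -> G e -> D x -> (P e x <-> Phi x (setof (fun y => below y x /\ P e y)) e)) ->
  Dp (fun e => G (tl2 e) /\ forall y, y ∈ e 1 <-> below y (e 0) /\ P (tl2 e) y)
    (fun e => Phi (e 0) (e 1) (tl2 e)) ->
  Dp (fun e => G (tl e)) (fun e => P (tl e) (e 0)).
Proof.
intros HP HPhi.
pose (R := fun e x => setof (fun u : V => u = empty /\ P e x)).
pose (T := fun x g : V => setof (fun y : V => below y x /\ empty ∈ app1 g y)).
pose (H := fun (x g : V) e => setof (fun u : V => u = empty /\ Phi x (T x g) e)).
assert (forall e x, empty ∈ R e x <-> P e x) as ER.
{ intros e x; unfold R.
  rewrite (setof_bounded (fun u => u = empty /\ P e x) (single empty)); [tauto |].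
  intros z [-> _]; apply in_single; auto. }
assert (forall e x, T x (graph (R e) (tc x)) = setof (fun y => below y x /\ P e y)) as ET.
{ intros e x; apply setof_ext; intros y; split; intros [H1 H2]; split; auto;
    rewrite app1_graph in * by (apply in_tc; auto); apply ER; auto. }
assert (F2 I D tru2 T) as FT.
{ dgoal; unfold T; apply (df_setof Dtrans HZ); [| dauto].
  intros e He _; exists (tc (e 0)); split; [pose proof He 0; dm |].
  intros x [Hx _]; apply in_tc, Hx. }
apply dp_ext with (fun e => empty ∈ R (tl e) (e 0)); [intros e _ _; apply ER |].
apply dp_use2 with (fun _ _ => True); [apply dp_mem0 | dstep | | auto].
apply (@df_rec V A I D Dtrans HZ G R H).
- intros e x He Ge Hx; unfold R at 1, H; apply setof_ext; intros u.
  rewrite ET, (HP e x He Ge Hx); tauto.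
- unfold H; apply (df_setof Dtrans HZ).
  + intros e He _; exists (single empty); split; [wside |].
    intros x [-> _]; apply in_single; auto.
  + dstep; [dauto |].
    pose (r := fun n => match n with 0 => 2 | 1 => 0 | Datatypes.S (Datatypes.S n) => 4 + n end).
    apply (dp_subst (t := fun e => T (e 1) (e 2))
      (G' := fun e => G (tl2 (fun n => e (r n))) /\ forall y, y ∈ e 0 <-> below y (e 2) /\ P (tl2 (fun n => e (r n))) y)
      (P := fun e => Phi (e 2) (e 0) (tl2 (fun n => e (r n))))); [dauto | exact (dp_rename r HPhi) |].
    intros e He [[Ge E] _]; split; [exact Ge |]; simpl; rewrite E.
    intros y; rewrite ET; apply (setof_bounded (fun y => below y (e 1) /\ P (tl3 e) y) (tc (e 1))).
    intros z [Hz _]; apply in_tc, Hz.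
Qed.

Lemma D_code l : (forall x, In x l -> D x) -> D (code l).
Proof.
induction l as [|x l IH]; simpl; intros H; [dm |].
assert (D x) by auto; assert (D (code l)) by auto; dm.
Qed.

Lemma d_is_code : D1 I D tru1 (@is_code V).
Proof.
apply (@dp_rec (fun _ => True) (fun _ z => is_code z)
  (fun x t e => x = empty \/ exists a b, x = opair a b /\ b ∈ t)).
- intros e x He _ Hx; rewrite is_code_eq; apply or_iff_compat_l.
  apply ex_iff; intros a; apply ex_iff; intros b.
  split; intros (-> & H); split; auto.
  + apply (setof_bounded (fun y => below y (opair a b) /\ is_code y) (tc (opair a b)));
      [intros z [Hz _]; apply in_tc, Hz | split; [apply below_snd' | exact H]].
  + apply (setof_bounded (fun y => below y (opair a b) /\ is_code y) (tc (opair a b))) in H;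
      [tauto | intros z [Hz _]; apply in_tc, Hz].
- dauto.
Qed.

Lemma d_in_code : D2 I D tru2 (@in_code V).
Proof.
pose proof d_is_code.
cut (D2 I D tru2 (fun z y => @in_code V y z)); [intros K; exact (dp_use2 K (df_var _ _ _ 1) (df_var _ _ _ 0) (fun _ _ _ => Logic.I)) |].
apply (@dp_rec (fun _ => True) (fun e z => in_code (e 0) z)
  (fun x t e => exists a b, x = opair a b /\ is_code b /\ (e 0 = a \/ b ∈ t))).
- intros e x He _ Hx; rewrite in_code_eq.
  apply ex_iff; intros a; apply ex_iff; intros b.
  split; intros (-> & Hb & [H' | H']); split; auto; split; auto; right.
  + apply (setof_bounded (fun y => below y (opair a b) /\ in_code (e 0) y) (tc (opair a b)));
      [intros z [Hz _]; apply in_tc, Hz | split; [apply below_snd' | exact H']].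
  + apply (setof_bounded (fun y => below y (opair a b) /\ in_code (e 0) y) (tc (opair a b))) in H';
      [tauto | intros z [Hz _]; apply in_tc, Hz].
- dauto.
Qed.

Lemma f_elements : F1 I D tru1 (@elements V).
Proof.
pose proof d_in_code; dgoal; unfold elements; apply (df_setof Dtrans HZ); [| dauto].
intros e He _; exists (tc (e 0)); split; [pose proof He 0; dm |].
intros x (l & E & Hx); apply in_tc; rewrite E; apply below_code, Hx.
Qed.

Lemma D_list_set l (x : V) : (forall y, In y l -> D y) -> (forall y, y ∈ x <-> In y l) -> D x.
Proof.
pose proof f_elements; intros Hl Hx; replace x with (elements (code l)).
- assert (D (code l)) by (apply D_code, Hl); dm.
- apply mem_ext; intros y; rewrite in_elements, Hx; tauto.
Qed.

Lemma d_finite : D1 I D tru1 (@finite V).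
Proof.
pose proof f_elements; pose proof d_is_code.
dgoal; apply dp_ext with (fun e => exists z, D z /\ is_code z /\ e 0 = elements z).
- intros e He _; split.
  + intros (z & Hz & (l & ->) & E); apply finite_code; eauto.
  + intros (l & Hl); exists (code l); split; [| split; [exists l; auto |]].
    * apply D_code; intros y Hy; apply (Dtrans (He 0)); apply Hl, Hy.
    * apply mem_ext; intros y; rewrite in_elements; apply Hl.
- dstep; apply dp_and; [apply dp_inD; dauto | dauto].
Qed.

Lemma d_ord : D1 I D tru1 (@ord V).
Proof. dgoal; unfold ord; dauto. Qed.

Lemma d_is_limit : D1 I D tru1 (@is_limit V).
Proof. pose proof d_ord; dgoal; unfold is_limit; dauto. Qed.

(** Induction on [n]: a nonempty finite ordinal has a greatest element, found along the list of its
    elements, and is the successor of that element. So any inductive set of [D] bounds the class of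
    finite ordinals, and [omega], formed in the universe, lies in [D]. *)
Lemma finite_ord_D n : ord n -> finite n -> forall x, D x ->
  (exists e, D e /\ e ∈ x /\ forall z, D z -> z ∉ e) ->
  (forall y, D y -> y ∈ x -> exists s, D s /\ s ∈ x /\ forall z, D z -> (z ∈ s <-> z ∈ y \/ z = y)) ->
  n ∈ x.
Proof.
induction n as [n IH] using below_ind; intros On Fn x Hx (e & He & Hex & Hee) Hs.
assert (forall m, m ∈ n -> m ∈ x) as K.
{ intros m Hm; apply IH; eauto using below_mem, ord_mem.
  apply finite_subset with n; [exact Fn | exact (ord_transitive On m Hm)]. }
destruct (classic (exists m, m ∈ n)) as [(m0 & Hm0) | N].
- assert (exists m, m ∈ n /\ forall k, k ∈ n -> m ∉ k) as (m & Hm & Hmax).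
  { destruct Fn as (l & Hl); apply NNPP; intros N.
    assert (forall m, m ∈ n -> exists k, k ∈ n /\ m ∈ k) as N'.
    { intros m Hm; apply NNPP; intros N'; apply N; exists m; split; [exact Hm |]; intros k Hk Hmk; eauto. }
    clear N; assert (forall l' : list V, (forall y, In y l' -> y ∈ n) -> exists k, k ∈ n /\ forall y, In y l' -> y ∈ k) as K'.
    { induction l' as [|y l' IHl']; intros Hl'.
      - exists m0; simpl; tauto.
      - destruct IHl' as (k & Hk & Hk'); [simpl in *; auto |].
        destruct (N' y) as (k2 & Hk2 & Hy); [simpl in *; auto |].
        destruct (ord_trichotomy (ord_mem On Hk) (ord_mem On Hk2)) as [T | [T | T]].
        + exists k2; split; [exact Hk2 |]; intros w [<- | Hw]; [exact Hy |].
          exact (ord_transitive (ord_mem On Hk2) k T w (Hk' w Hw)).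
        + subst k2; exists k; split; [exact Hk |]; intros w [<- | Hw]; auto.
        + exists k; split; [exact Hk |]; intros w [<- | Hw]; [| auto].
          exact (ord_transitive (ord_mem On Hk) k2 T y Hy). }
    destruct (K' l) as (k & Hk & Hk'); [intros y; apply Hl |].
    apply (@mem_irrefl V k), Hk', Hl, Hk. }
  pose proof (K m Hm) as Hmx; pose proof (Dtrans Hx Hmx) as Dm.
  destruct (Hs m Dm Hmx) as (s & Ds & Hsx & Es).
  replace n with s; [exact Hsx |].
  apply mem_ext; intros z; split.
  + intros Hz; apply Es in Hz as [Hz | ->]; [exact (ord_transitive On m Hm z Hz) | exact Hm | exact (Dtrans Ds Hz)].
  + intros Hz; apply Es; [exact (Dtrans Hx (K z Hz)) |].
    destruct (ord_trichotomy (ord_mem On Hz) (ord_mem On Hm)) as [T | [T | T]]; auto.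
    destruct (Hmax z Hz T).
- replace n with e; [exact Hex |].
  apply mem_ext; intros z; split; intros Hz.
  + destruct (Hee z (Dtrans He Hz) Hz).
  + destruct N; eauto.
Qed.

Lemma in_omega (n : V) : n ∈ omega <-> ord n /\ finite n.
Proof.
destruct (zfc_inf HZ) as (x & Hx & H1 & H2).
apply (setof_bounded (fun n : V => ord n /\ finite n) x); intros z [Oz Fz].
eapply finite_ord_D; eauto.
Qed.

Lemma f_omega : F0 I D (@omega V).
Proof.
pose proof d_ord; pose proof d_finite; dgoal; apply (df_setof Dtrans HZ); [| dauto].
intros e He _; destruct (zfc_inf HZ) as (x & Hx & H1 & H2); exists x; split; [exact Hx |].
intros z [Oz Fz]; eapply finite_ord_D; eauto.
Qed.

Lemma finite_suc (n : V) : finite n -> finite (suc n).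
Proof.
intros (l & Hl); exists (n :: l); intros y; rewrite in_suc, Hl; simpl; split; intros [H | H]; auto.
Qed.

Lemma omega_suc (n : V) : n ∈ omega -> suc n ∈ omega.
Proof.
rewrite !in_omega; intros [H1 H2]; split; [apply ord_suc, H1 | apply finite_suc, H2].
Qed.

Lemma omega_empty : (@empty V) ∈ omega.
Proof.
apply in_omega; split.
- split; intros y Hy; apply in_empty in Hy; tauto.
- exists []; intros y; rewrite in_empty; simpl; tauto.
Qed.

Lemma ord_omega : ord (@omega V).
Proof.
apply ord_of_subset; [intros y Hy; apply in_omega in Hy; tauto |].
intros y Hy z Hz; apply in_omega in Hy as [Hy1 Hy2]; apply in_omega; split; [exact (ord_mem Hy1 Hz) |].
apply finite_subset with y; [exact Hy2 | exact (ord_transitive Hy1 z Hz)].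
Qed.

(** The closure is reached after omega steps, each adding the values of [F] at earlier elements. It
    supplies bounds in [D] in place of levels of the rank hierarchy: for comparing conditions, for
    the elements of [Q], and for the stock of indices. *)
Lemma D_closure G F : Df (fun e => G (tl e)) (fun e => F (e 0) (tl e)) ->
  forall e X0, ok e -> G e -> D X0 ->
  exists X, D X /\ subset X0 X /\ forall x, x ∈ X -> subset (F x e) X.
Proof.
intros HF e X0 He Ge HX0; pose proof f_omega.
pose (Fs := fun y e => cup (setof (fun t => exists x, x ∈ y /\ t = F x e))).
assert (forall y e z, z ∈ Fs y e <-> exists x, x ∈ y /\ z ∈ F x e) as EFs.
{ intros y e' z; unfold Fs; rewrite in_cup; split.
  - intros (t & Ht & Hz); apply (in_image (fun x => x ∈ y) (fun x => F x e') y) in Ht as (x & Hx & ->); eauto.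
  - intros (x & Hx & Hz); exists (F x e'); split; [| exact Hz].
    apply (in_image (fun x => x ∈ y) (fun x => F x e') y); eauto. }
assert (Df (fun e => G (tl e)) (fun e => Fs (e 0) (tl e))) as HFs.
{ unfold Fs; dstep; apply (df_image Dtrans HZ (G := fun e => G (tl e)) (P := fun x e => x ∈ e 0) (F := fun x e => F x (tl e))).
  - intros e' He' _; exists (e' 0); auto.
  - dauto.
  - apply df_weaken with (fun e => G (tl2 e)); [intros e' _ [H' _]; exact H' |].
    exact (df_rename (fun n => match n with 0 => 0 | Datatypes.S n => Datatypes.S (Datatypes.S n) end) HF). }
(* The initial set is put in front of the environment, so that the steps are definable from it as a
   parameter. *)
pose (Y := fun e : nat -> V => mem_rec (@empty V) (fun n rec => join (e 0)
   (cup (setof (fun t : V => exists m : V, m ∈ n /\ t = Fs (rec m) (tl e)))))).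
assert (forall e n, Y e n = join (e 0)
   (cup (setof (fun t : V => exists m : V, m ∈ n /\ t = Fs (Y e m) (tl e))))) as EY.
{ intros e' n; unfold Y at 1; rewrite mem_rec_below; [reflexivity |].
  intros r r' E; f_equal; f_equal; apply setof_ext; intros t.
  apply ex_iff; intros m; split; intros [Hm ->]; split; auto;
    rewrite (E m (below_mem Hm)); reflexivity. }
assert (Df (fun e => G (tl2 e)) (fun e => Y (tl e) (e 0))) as HY.
{ apply (@df_rec V A I D Dtrans HZ (fun e => G (tl e)) Y
    (fun (n g : V) e => join (e 0) (cup (setof (fun t : V => exists m : V, m ∈ n /\ t = Fs (app1 g m) (tl e)))))).
  - intros e' n He' _ _; rewrite EY at 1; f_equal; f_equal; apply setof_ext; intros t.
    apply ex_iff; intros m; split; intros [Hm ->]; split; auto;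
      rewrite app1_graph by (apply in_tc, below_mem, Hm); reflexivity.
  - dstep; [dauto |]; dstep.
    apply (df_image Dtrans HZ (G := fun e => G (tl3 e) /\ e 1 = graph (Y (tl2 e)) (tc (e 0)))
      (P := fun (m : V) e => m ∈ e 0) (F := fun m e => Fs (app1 (e 1) m) (tl3 e))).
    + intros e' He' _; exists (e' 0); auto.
    + dauto.
    + refine (df_substs (ts := [fun e => app1 (e 2) (e 0)])
        (t := fun e => Fs (e 0) (fun n => e (5 + n))) (G' := fun e => G (fun n => e (5 + n))) _ _ _).
      * simpl; intros t [<- | []]; dauto.
      * exact (df_rename (fun n => match n with 0 => 0 | Datatypes.S n => 5 + n end) HFs).
      * intros e' _ [[G1 _] _]; exact G1. }
pose (X := cup (setof (fun t : V => exists n : V, n ∈ omega /\ t = Y (scons X0 e) n))).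
assert (forall z, z ∈ X <-> exists n, n ∈ omega /\ z ∈ Y (scons X0 e) n) as EX.
{ intros z; unfold X; rewrite in_cup; split.
  - intros (t & Ht & Hz); apply (in_image (fun x : V => x ∈ omega) (Y (scons X0 e)) omega) in Ht as (n & Hn & ->); eauto.
  - intros (n & Hn & Hz); exists (Y (scons X0 e) n); split; [| exact Hz].
    apply (in_image (fun x : V => x ∈ omega) (Y (scons X0 e)) omega); eauto. }
exists X; repeat split.
- assert (Df (fun e => G (tl e)) (fun e => cup (setof (fun t : V => exists n : V, n ∈ omega /\ t = Y e n)))) as HX.
  { dstep; apply (df_image Dtrans HZ (G := fun e => G (tl e)) (P := fun (m : V) e => m ∈ omega) (F := fun m e => Y e m)).
    - intros e' He' _; exists omega; split; [dm | auto].
    - dauto.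
    - apply df_weaken with (fun e => G (tl2 e)); [tauto | exact HY]. }
  exact (proj1 HX (scons X0 e) (over_scons HX0 He) Ge).
- intros z Hz; apply EX; exists empty; split; [apply omega_empty |].
  rewrite EY; apply in_join; auto.
- intros x Hx z Hz; apply EX in Hx as (n & Hn & Hx); apply EX; exists (suc n); split; [apply omega_suc, Hn |].
  rewrite EY; apply in_join; right; apply in_cup; exists (Fs (Y (scons X0 e) n) e); split; [| apply EFs; eauto].
  apply (in_image (fun m => m ∈ suc n) (fun m => Fs (Y (scons X0 e) m) e) (suc n)); [auto |].
  exists n; split; [apply in_suc |]; auto.
Qed.

End Omega.

(** * Cardinals *)

#[export] Hint Resolve f_restr_below d_is_code d_in_code f_elements d_finite d_ord d_is_limit f_omega : dfn.

(** * Smallness and Hartogs ordinals *)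

Section Hartogs.
Context {V : universe} {A : Type} (I : A -> V -> Prop) (D : V -> Prop).
Context (Dtrans : transitive_class D) (HZ : models_ZFC D I).
Notation tl e := (fun n => e (Datatypes.S n)).
Notation tl2 e := (fun n => e (Datatypes.S (Datatypes.S n))).
Notation Dp := (Dp I D).
Notation Df := (Df I D).
Notation ok := (over_D D).

Definition pfun (f : V) := forall z y y', opair z y ∈ f -> opair z y' ∈ f -> y = y'.
(** [f] may be defined outside [Z] and take values outside [x]: a subset of a small set is then
    small with the same witness, and the empty set is no exception. *)
Definition covers (f Z x : V) := pfun f /\ forall y, y ∈ x -> exists z, z ∈ Z /\ opair z y ∈ f.
Definition small (Z x : V) := exists f, D f /\ covers f Z x.
Definition hartogs (Z : V) := setof (fun h => D h /\ ord h /\ small Z h).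

Lemma d_pfun : D1 I D tru1 pfun.
Proof. dgoal; unfold pfun; dauto. Qed.

Lemma d_covers : D3 I D tru3 covers.
Proof. pose proof d_pfun; dgoal; unfold covers; dauto. Qed.

Lemma d_small : D2 I D tru2 small.
Proof. pose proof d_covers; dgoal; unfold small; dstep; apply dp_and; [apply dp_inD |]; dauto. Qed.

Lemma small_subset Z x y : small Z x -> subset y x -> small Z y.
Proof. intros (f & Hf & F1 & F2) H; exists f; split; [exact Hf | split; auto]. Qed.

(** The prewellordering of a part of [Z] induced by the ordinal [h] through [f]. Unlike [h], it
    ranges over a power set that is known in advance. *)
Let rel (f h Z : V) := setof (fun p => p ∈ prod Z Z /\ exists a b v w,
  p = opair a b /\ opair a v ∈ f /\ opair b w ∈ f /\ v ∈ h /\ w ∈ h /\ (v ∈ w \/ v = w)).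

Lemma in_rel f h Z a b : opair a b ∈ rel f h Z <-> a ∈ Z /\ b ∈ Z /\ exists v w,
  opair a v ∈ f /\ opair b w ∈ f /\ v ∈ h /\ w ∈ h /\ (v ∈ w \/ v = w).
Proof.
unfold rel; rewrite (setof_bounded (fun p => p ∈ prod Z Z /\ exists a b v w,
  p = opair a b /\ opair a v ∈ f /\ opair b w ∈ f /\ v ∈ h /\ w ∈ h /\ (v ∈ w \/ v = w)) (prod Z Z)) by tauto.
rewrite opair_in_prod; split.
- intros ((Ha & Hb) & a' & b' & v & w & E & H); apply opair_inj in E as [<- <-]; eauto 8.
- intros (Ha & Hb & v & w & H); eauto 9.
Qed.

(** The prewellordering determines the ordinal: by induction on [v], an index with value [v] under
    [f] has the same value under [f'], since the two orderings give it the same predecessors. *)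
Lemma rel_unique Z f h f' h' : ord h -> ord h' -> covers f Z h -> covers f' Z h' ->
  rel f h Z = rel f' h' Z -> subset h h'.
Proof.
intros O O' [F C] [F' C'] E.
assert (forall v, v ∈ h -> forall a, a ∈ Z -> opair a v ∈ f -> opair a v ∈ f' /\ v ∈ h') as K.
{ intros v; induction (mem_wf V v) as [v _ IH]; intros Hv a Ha Hav.
  assert (opair a a ∈ rel f' h' Z) as H.
  { rewrite <- E; apply in_rel; repeat split; auto; exists v, v; auto 8. }
  apply in_rel in H as (_ & _ & v' & w' & Hv' & Hw' & Hv'' & _ & _).
  assert (v = v') as <-; [| auto].
  apply mem_ext; intros u; split; intros Hu.
  - assert (u ∈ h) as Huh by exact (ord_transitive O v Hv u Hu).
    destruct (C u Huh) as (b & Hb & Hbu).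
    destruct (IH u Hu Huh b Hb Hbu) as [Hbu' Huh'].
    assert (opair b a ∈ rel f' h' Z) as H.
    { rewrite <- E; apply in_rel; repeat split; auto; exists u, v; auto 8. }
    apply in_rel in H as (_ & _ & u1 & v1 & H1 & H2 & H3 & H4 & H5).
    rewrite (F' _ _ _ H1 Hbu'), (F' _ _ _ H2 Hv') in H5; destruct H5 as [H5 | H5]; [exact H5 |].
    exfalso; subst v'.
    assert (opair a b ∈ rel f h Z) as H.
    { rewrite E; apply in_rel; repeat split; auto; exists u, u; auto 8. }
    apply in_rel in H as (_ & _ & v2 & u2 & G1 & G2 & _ & _ & G3).
    rewrite (F _ _ _ G1 Hav), (F _ _ _ G2 Hbu) in G3; destruct G3 as [G3 | ->].
    + exact (mem_asym Hu G3).
    + exact (mem_irrefl Hu).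
  - assert (u ∈ h') as Huh' by exact (ord_transitive O' v' Hv'' u Hu).
    destruct (C' u Huh') as (b & Hb & Hbu).
    assert (opair b a ∈ rel f h Z) as H.
    { rewrite E; apply in_rel; repeat split; auto; exists u, v'; auto 8. }
    apply in_rel in H as (_ & _ & u1 & v1 & H1 & H2 & H3 & H4 & H5).
    rewrite (F _ _ _ H2 Hav) in H5; destruct H5 as [H5 | ->].
    + destruct (IH u1 H5 H3 b Hb H1) as [H6 _].
      rewrite (F' _ _ _ Hbu H6); exact H5.
    + exfalso.
      assert (opair a b ∈ rel f' h' Z) as H.
      { rewrite <- E; apply in_rel; repeat split; auto; exists v, v; auto 8. }
      apply in_rel in H as (_ & _ & v2 & u2 & G1 & G2 & _ & _ & G3).
      rewrite (F' _ _ _ G1 Hv'), (F' _ _ _ G2 Hbu) in G3; destruct G3 as [G3 | ->].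
      * exact (mem_asym Hu G3).
      * exact (mem_irrefl Hu). }
intros v Hv; destruct (C v Hv) as (a & Ha & Hav); exact (proj2 (K v Hv a Ha Hav)).
Qed.

Let coded (r Z h : V) := exists f, D f /\ D h /\ ord h /\ covers f Z h /\ r = rel f h Z.

Lemma coded_unique r Z h h' : coded r Z h -> coded r Z h' -> h = h'.
Proof.
intros (f & Hf & Hh & Oh & C & E) (f' & Hf' & Hh' & Oh' & C' & E').
apply mem_ext; intros z; split; [eapply rel_unique with (f := f) (f' := f') | eapply rel_unique with (f := f') (f' := f)];
  eauto; congruence.
Qed.

(** Small ordinals are the image of a set of relations on [Z] under the map that recovers an ordinal
    from its code, so Replacement bounds them. *)
Lemma hartogs_bound Z : D Z -> exists y, D y /\ forall h, D h /\ ord h /\ small Z h -> h ∈ y.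
Proof.
pose proof d_small; pose proof d_covers.
assert (F3 I D tru3 rel) as Frel.
{ dgoal; unfold rel; apply (df_setof Dtrans HZ); [| dauto].
  intros e He _; exists (prod (e 2) (e 2)); split; [pose proof He 2; dm | tauto]. }
assert (D3 I D tru3 coded) as Dcoded.
{ dgoal; unfold coded; dstep; apply dp_and; [apply dp_inD; dauto |].
  apply dp_and; [apply dp_inD; dauto | dauto]. }
pose (F := fun r Z => setof (fun x => exists h, coded r Z h /\ x ∈ h)).
assert (forall r Z h, coded r Z h -> F r Z = h) as EF.
{ intros r Z0 h Hh; rewrite <- (setof_mem h); apply setof_ext; intros x; split.
  - intros (h' & Hh' & Hx); rewrite (coded_unique Hh Hh'); exact Hx.
  - eauto. }
assert (F2 I D (fun r Z => exists h, coded r Z h) F) as FF.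
{ dgoal; unfold F; apply (df_setof Dtrans HZ).
  - intros e He (h & Hh); exists h; split; [destruct Hh as (f & _ & Hh & _); exact Hh |].
    intros x (h' & Hh' & Hx); rewrite (coded_unique Hh Hh'); exact Hx.
  - apply dp_ex; [intros e h He _ [(f & _ & Hh & _) _]; exact Hh |]; dauto. }
intros DZ; pose (e := fun _ : nat => Z); assert (ok e) as He by (intros n; exact DZ); change Z with (e 0).
  exists (setof (fun z => exists r, (r ∈ powD D (prod (e 0) (e 0)) /\ exists h, coded r (e 0) h) /\ z = F r (e 0))).
  split.
  + assert (Df (fun _ => True) (fun e => setof (fun z => exists r, (r ∈ powD D (prod (e 0) (e 0)) /\
      exists h, coded r (e 0) h) /\ z = F r (e 0)))) as HF.
    { apply (df_image Dtrans HZ (G := fun _ => True) (P := fun r e => r ∈ powD D (prod (e 0) (e 0)) /\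
        exists h, coded r (e 0) h) (F := fun r e => F r (e 0))).
      - intros e' He' _; exists (powD D (prod (e' 0) (e' 0))); split; [pose proof He' 0; dm | tauto].
      - dstep; [dauto |]; apply dp_ex; [intros e' h He' _ (f & _ & Hh & _); exact Hh |]; dauto.
      - eapply df_use2; [exact FF | dauto | dauto |].
        intros e' _ [_ [_ H']]; exact H'. }
    exact (proj1 HF e He Logic.I).
  + intros h (Dh & Oh & f & Df & C).
    assert (coded (rel f h (e 0)) (e 0) h) as Hc by (exists f; auto).
    apply (in_image (fun r => r ∈ powD D (prod (e 0) (e 0)) /\ exists h, coded r (e 0) h)
      (fun r => F r (e 0)) (powD D (prod (e 0) (e 0)))); [tauto |].
    exists (rel f h (e 0)); split; [split; [| eauto] | symmetry; apply EF, Hc].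
    apply in_powD; split.
    * pose proof (He 0); dm.
    * intros p Hp; apply (setof_bounded (fun p => p ∈ prod (e 0) (e 0) /\ exists a b v w,
        p = opair a b /\ opair a v ∈ f /\ opair b w ∈ f /\ v ∈ h /\ w ∈ h /\ (v ∈ w \/ v = w))
        (prod (e 0) (e 0))) in Hp; tauto.
Qed.

Lemma f_hartogs : F1 I D tru1 hartogs.
Proof.
pose proof d_small; dgoal; unfold hartogs; apply (df_setof Dtrans HZ).
- intros e He _; apply hartogs_bound, He.
- apply dp_and; [apply dp_inD |]; dauto.
Qed.

Lemma in_hartogs Z h : D Z -> (h ∈ hartogs Z <-> D h /\ ord h /\ small Z h).
Proof.
intros DZ; destruct (hartogs_bound DZ) as (y & _ & Hy).
apply (setof_bounded (fun h => D h /\ ord h /\ small Z h) y Hy).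
Qed.

Lemma ord_hartogs Z : D Z -> ord (hartogs Z).
Proof.
intros DZ; apply ord_of_subset.
- intros h Hh; apply (in_hartogs h DZ) in Hh; tauto.
- intros h Hh k Hk; apply (in_hartogs _ DZ) in Hh as (H1 & H2 & H3); apply (in_hartogs _ DZ).
  split; [exact (Dtrans H1 Hk) | split; [exact (ord_mem H2 Hk) |]].
  apply small_subset with h; [exact H3 | exact (ord_transitive H2 k Hk)].
Qed.

Lemma small_id Z x : D x -> subset x Z -> small Z x.
Proof.
intros Hx H.
pose (J := fun x : V => setof (fun p => exists z, z ∈ x /\ p = opair z z)).
assert (F1 I D tru1 J) as FJ.
{ dgoal; unfold J; apply (df_image Dtrans HZ (G := fun _ => True) (P := fun z e => z ∈ e 0) (F := fun z e => opair z z)).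
  - intros e He _; exists (e 0); auto.
  - dauto.
  - dauto. }
assert (forall p, p ∈ J x <-> exists z, z ∈ x /\ p = opair z z) as EJ.
{ intros p; apply (in_image (fun z => z ∈ x) (fun z => opair z z) x); auto. }
exists (J x); split; [exact (F1_D FJ Hx Logic.I) | split].
- intros z y y' H1 H2; apply EJ in H1 as (w & _ & E1); apply EJ in H2 as (w' & _ & E2).
  apply opair_inj in E1, E2; destruct E1, E2; congruence.
- intros y Hy; exists y; split; [apply H, Hy | apply EJ; eauto].
Qed.

Definition compose (g f : V) := setof (fun p => exists x y z, p = opair x z /\ opair x y ∈ f /\ opair y z ∈ g).

Lemma in_compose g f x z : opair x z ∈ compose g f <-> exists y, opair x y ∈ f /\ opair y z ∈ g.
Proof.
unfold compose; rewrite (setof_bounded (fun p => exists x y z, p = opair x z /\ opair x y ∈ f /\ opair y z ∈ g)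
  (prod (tc f) (tc g))).
- split.
  + intros (x' & y & z' & E & H); apply opair_inj in E as [-> ->]; eauto.
  + intros (y & H); eauto 6.
- intros p (x' & y & z' & -> & H1 & H2); apply opair_in_prod.
  rewrite !in_tc; split; [exact (below_fst H1) | exact (below_snd H2)].
Qed.

Lemma f_compose : F2 I D tru2 compose.
Proof.
dgoal; unfold compose; apply (df_setof Dtrans HZ); [| dauto].
intros e He _; exists (prod (tc (e 1)) (tc (e 0))); split; [wside |].
intros p (x' & y & z' & -> & H1 & H2); apply opair_in_prod.
rewrite !in_tc; split; [exact (below_fst H1) | exact (below_snd H2)].
Qed.

Lemma pfun_compose g f : pfun g -> pfun f -> pfun (compose g f).
Proof.
intros G F x z z' H H'; apply in_compose in H as (y & H1 & H2); apply in_compose in H' as (y' & H1' & H2').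
rewrite (F _ _ _ H1 H1') in H2; exact (G _ _ _ H2 H2').
Qed.

Lemma small_trans Z m x g : small Z m -> D g -> covers g m x -> small Z x.
Proof.
pose proof f_compose.
intros (f & Hf & F & C) Hg (G & C'); exists (compose g f); split; [dm | split].
- apply pfun_compose; assumption.
- intros y Hy; destruct (C' y Hy) as (w & Hw & Hwy); destruct (C w Hw) as (z & Hz & Hzw).
  exists z; split; [exact Hz | apply in_compose; eauto].
Qed.

Lemma pfun_function_on f a : function_on f a -> pfun f.
Proof.
intros [F1 F2] z y y' H H'; destruct (F1 _ H) as (x & w & E & Hx); apply opair_inj in E as [<- <-].
destruct (F2 z Hx) as (w' & _ & U); rewrite <- (U _ H), <- (U _ H'); reflexivity.
Qed.

(** The Hartogs ordinal of [cup x] joined with [omega] serves. An ordinal in [x] is a subset of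
    [cup x], hence small; and a bijection from a smaller ordinal onto the Hartogs ordinal would make
    the latter small, that is, a member of itself. *)
Lemma inf_card_exists x : D x -> exists k, inf_card D k /\ forall b, b ∈ x -> ord b -> b ∈ k.
Proof.
pose proof f_hartogs.
intros Hx; pose (Z := join (cup x) omega); assert (D Z) as DZ by (unfold Z; dm).
exists (hartogs Z); split; [split; [dm | split; [apply ord_hartogs, DZ | split]] |].
- intros n Hn; pose proof (D_mem Dtrans Hn ltac:(dm)).
  apply in_hartogs; [exact DZ |]; split; [assumption | split].
  + apply in_omega with (1 := Dtrans) (2 := HZ), Hn.
  + apply small_id; [assumption |]; intros w Hw; apply in_join; right.
    exact (ord_transitive (ord_omega Dtrans HZ) n Hn w Hw).
- intros m Hm (g & Hg & [[[G1 G2] _] G3]).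
  apply in_hartogs in Hm as (Dm & Om & Sm); [| exact DZ].
  apply (@mem_irrefl V (hartogs Z)); apply in_hartogs; [exact DZ |]; split; [dm | split; [apply ord_hartogs, DZ |]].
  apply (small_trans Sm Hg); split; [apply pfun_function_on with m, G1 |].
  intros y Hy; destruct (G3 y Hy) as (w & Hw & <-); exists w; split; [exact Hw |].
  apply app_spec, (function_on_functional G1 Hw).
- intros b Hb Ob; pose proof (Dtrans Hx Hb); apply in_hartogs; [exact DZ |]; split; [assumption | split; [exact Ob |]].
  apply small_id; [assumption |]; intros w Hw; apply in_join; left; apply in_cup; eauto.
Qed.

End Hartogs.

#[export] Hint Resolve d_pfun d_covers d_small f_hartogs f_compose : dfn.

Section Functions.
Context {V : universe}.
Implicit Types f a b x : V.

Lemma maps_functional f a b x : maps f a b -> x ∈ a -> functional_at f x.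
Proof. intros [H _]; exact (function_on_functional H). Qed.

Lemma injection_functional f a b x : injection f a b -> x ∈ a -> functional_at f x.
Proof. intros [H _]; exact (maps_functional H). Qed.

Lemma bijection_functional f a b x : bijection f a b -> x ∈ a -> functional_at f x.
Proof. intros [H _]; exact (injection_functional H). Qed.

Lemma maps_in f a b x : maps f a b -> x ∈ a -> app f x ∈ b.
Proof. intros [_ H]; exact (H x). Qed.

Lemma bijection_in f a b x : bijection f a b -> x ∈ a -> app f x ∈ b.
Proof. intros [[H _] _]; exact (maps_in H). Qed.

Lemma bijection_prod f a b : bijection f a b -> subset f (prod a b).
Proof.
intros [[[F H] _] _] z Hz; apply (function_on_in z F) in Hz as (x & Hx & ->).
apply opair_in_prod; auto.
Qed.
End Functions.
#[export] Hint Resolve function_on_functional maps_functional injection_functional bijection_functional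
  maps_in bijection_in : guard.

(** * Definability of functions, cardinals and alephs *)

Section Absolute.
Context {V : universe} {A : Type} (I : A -> V -> Prop) (D : V -> Prop).
Context (Dtrans : transitive_class D) (HZ : models_ZFC D I).

Lemma d_maps : D3 I D tru3 (@maps V).
Proof. dgoal; unfold maps; dauto. Qed.

Lemma d_injection : D3 I D tru3 (@injection V).
Proof. pose proof d_maps; dgoal; unfold injection; dauto. Qed.

Lemma d_bijection : D3 I D tru3 (@bijection V).
Proof. pose proof d_injection; dgoal; unfold bijection; dauto. Qed.

Lemma d_bounded : D2 I D tru2 (@bounded V).
Proof. dgoal; unfold bounded; dauto. Qed.

Lemma d_eqstar : D3 I D tru3 (@eqstar V).
Proof. dgoal; unfold eqstar; dauto. Qed.

Lemma f_image : F2 I D (fun f X => forall x, x ∈ X -> functional_at f x) (@image V).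
Proof.
dgoal; unfold image.
apply (df_image Dtrans HZ (G := fun e => forall x, x ∈ e 1 -> functional_at (e 0) x)
  (P := fun x e => x ∈ e 1) (F := fun x e => app (e 0) x)).
- intros e He _; exists (e 1); auto.
- dauto.
- dauto.
Qed.

Lemma d_same_size : D2 I D tru2 (same_size D).
Proof. pose proof d_bijection; dgoal; unfold same_size; dstep; apply dp_and; [apply dp_inD |]; dauto. Qed.

Lemma d_size_lt : D2 I D tru2 (size_lt D).
Proof. pose proof d_same_size; dgoal; unfold size_lt; dauto. Qed.

Lemma d_inf_card : D1 I D tru1 (inf_card D).
Proof. pose proof d_same_size; dgoal; unfold inf_card; apply dp_and; [apply dp_inD |]; dauto. Qed.

Lemma inf_card_D k : inf_card D k -> D k.
Proof. intros [H _]; exact H. Qed.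

Lemma inf_card_ord k : inf_card D k -> ord k.
Proof. intros [_ [H _]]; exact H. Qed.

(** An intersection of cardinals, which is the least of them because they are ordinals. Both
    [cardsucc] and the steps of [aleph] have this shape. *)
Definition least_card (Q : V -> Prop) : V :=
  setof (fun x => forall k, inf_card D k -> Q k -> x ∈ k).

Lemma least_card_spec Q : (exists k, inf_card D k /\ Q k) ->
  inf_card D (least_card Q) /\ Q (least_card Q) /\
  forall k, inf_card D k -> Q k -> least_card Q = k \/ least_card Q ∈ k.
Proof.
intros H; apply mem_min in H as (k0 & [H1 H2] & Hmin).
assert (forall k, inf_card D k -> Q k -> k0 = k \/ k0 ∈ k) as K.
{ intros k Hk Qk; destruct (ord_trichotomy (inf_card_ord H1) (inf_card_ord Hk)) as [| [|C]]; auto.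
  destruct (Hmin k C); auto. }
assert (least_card Q = k0) as ->; [| auto].
unfold least_card; rewrite <- (setof_mem k0); apply setof_ext; intros x; split; [auto |].
intros Hx k Hk Qk; destruct (K k Hk Qk) as [<- | C]; [exact Hx |].
exact (ord_transitive (inf_card_ord Hk) k0 C x Hx).
Qed.

Lemma df_least_card G (Q : V -> (nat -> V) -> Prop) :
  (forall e, over_D D e -> G e -> exists k, inf_card D k /\ Q k e) ->
  Dp I D (fun e => G (fun n => e (Datatypes.S n))) (fun e => Q (e 0) (fun n => e (Datatypes.S n))) ->
  Df I D G (fun e => least_card (fun k => Q k e)).
Proof.
pose proof d_inf_card; intros HE HQ.
apply (@df_char V A I D G _ (fun y e => inf_card D y /\ Q y e /\
  forall k, inf_card D k -> Q k e -> y = k \/ y ∈ k)).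
- intros e He HG; exact (inf_card_D (proj1 (least_card_spec (HE e He HG)))).
- intros e y He Hy HG; destruct (least_card_spec (HE e He HG)) as (H1 & H2 & H3); split.
  + intros (K1 & K2 & K3); destruct (K3 _ H1 H2) as [E | E]; [exact E |].
    destruct (H3 _ K1 K2) as [E' | E']; [auto | destruct (mem_asym E E')].
  + intros ->; auto.
- dstep; [dauto |]; dstep; [apply (dp_weaken (G' := fun e => G (fun n => e (Datatypes.S n)))); [tauto | exact HQ] |].
  apply dp_all.
  + intros e k He HG N; apply NNPP; intros C; apply N; intros Hk; destruct C; exact (inf_card_D Hk).
  + dstep; [dauto |]; dstep; [| dauto].
    apply (dp_weaken (G' := fun e => G (fun n => e (Datatypes.S (Datatypes.S n))))); [tauto |].
    exact (dp_rename (fun n => match n with 0 => 0 | Datatypes.S n => Datatypes.S (Datatypes.S n) end) HQ).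
Qed.

Lemma cardsucc_eq k : cardsucc D k = least_card (fun m => k ∈ m).
Proof. reflexivity. Qed.

Lemma cardsucc_spec k : D k -> ord k -> inf_card D (cardsucc D k) /\ k ∈ cardsucc D k /\
  forall m, inf_card D m -> k ∈ m -> cardsucc D k = m \/ cardsucc D k ∈ m.
Proof.
intros Dk Ok; apply least_card_spec.
destruct (@inf_card_exists V A I D Dtrans HZ (single k)) as (m & Hm & K); [dm |].
exists m; split; [exact Hm | apply K; [apply in_single; reflexivity | exact Ok]].
Qed.

Lemma f_cardsucc : F1 I D (@ord V) (cardsucc D).
Proof.
dgoal; apply (df_least_card (G := fun e => ord (e 0)) (Q := fun m e => e 0 ∈ m)); [| dauto].
intros e He Oe; exists (cardsucc D (e 0)); split; apply cardsucc_spec; auto.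
Qed.

Definition cards_above (a : V) (r : V -> V) (k : V) := forall b, b ∈ a -> r b ∈ k.

Lemma aleph_eq a : aleph D a = least_card (cards_above a (aleph D)).
Proof.
unfold aleph at 1; rewrite mem_rec_below; [reflexivity |].
intros r r' E; apply setof_ext; intros x; apply all_iff; intros k.
split; intros H Hk Hb; apply H; auto; intros b Hb'; [rewrite E | rewrite <- E]; auto using below_mem.
Qed.

(** For the [setof] in [aleph] to be meaningful there must be a cardinal above the earlier values,
    and Replacement gives one only for a definable operation. The circle is broken by a variant [R]
    that is empty when there is no such cardinal: it is definable outright, and agrees with [aleph]
    by induction. *)
Lemma aleph_spec a : D a -> inf_card D (aleph D a) /\ (forall b, b ∈ a -> aleph D b ∈ aleph D a) /\
  forall k, inf_card D k -> (forall b, b ∈ a -> aleph D b ∈ k) -> aleph D a = k \/ aleph D a ∈ k.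
Proof.
revert a; pose proof d_inf_card.
pose (st := fun a r => setof (fun x => (exists k, inf_card D k /\ cards_above a r k) /\
  forall k, inf_card D k -> cards_above a r k -> x ∈ k)).
pose (R := mem_rec (@empty V) st).
assert (forall a r r', (forall b, b ∈ a -> r b = r' b) -> cards_above a r = cards_above a r') as Eca.
{ intros a r r' E; apply pred_ext; intros k; split; intros K b Hb; [rewrite <- E | rewrite E]; auto. }
assert (forall a, R a = st a R) as ER.
{ intros a; unfold R at 1; rewrite mem_rec_below; [reflexivity |].
  intros r r' E; unfold st; rewrite (Eca a r r'); [reflexivity | auto using below_mem]. }
assert (Df I D (fun _ => True) (fun e => R (e 0))) as FR.
{ apply (@df_rec V A I D Dtrans HZ (fun _ => True) (fun _ a => R a) (fun a g _ => st a (app1 g))).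
  - intros e a _ _ Ha; rewrite ER at 1; unfold st; rewrite (Eca a R (app1 (graph R (tc a)))); [reflexivity |].
    intros b Hb; rewrite app1_graph; [reflexivity | apply in_tc, below_mem, Hb].
  - unfold st, cards_above; apply (df_setof Dtrans HZ).
    + intros e He _; destruct (classic (exists k, inf_card D k /\ forall b, b ∈ e 0 -> app1 (e 1) b ∈ k)) as [(k & Hk & Hk') | N].
      * exists k; split; [exact (inf_card_D Hk) |]; intros x [_ Hx]; auto.
      * exists (e 0); split; [apply He | intros x [Hx _]; contradiction].
    + apply dp_and; [apply dp_ex; [intros e k _ _ [Hk _]; exact (inf_card_D Hk) | dauto] |].
      apply dp_all; [| dauto].
      intros e k He HG N; apply NNPP; intros C; apply N; intros Hk; destruct C; exact (inf_card_D Hk). }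
assert (forall a, D a -> aleph D a = R a /\ exists k, inf_card D k /\ cards_above a (aleph D) k) as K.
{ induction a as [a IH] using below_ind; intros Ha.
  assert (D (setof (fun t => exists b, b ∈ a /\ t = R b))) as Dim.
  { assert (F1 I D tru1 (fun a => setof (fun t => exists b, b ∈ a /\ t = R b))) as F.
    { dgoal; apply (df_image Dtrans HZ (G := fun _ => True) (P := fun b e => b ∈ e 0) (F := fun b _ => R b)).
      - intros e He _; exists (e 0); auto.
      - dauto.
      - apply (df_weaken (G' := fun _ => True)); [auto | exact FR]. }
    exact (F1_D F Ha Logic.I). }
  assert (exists k, inf_card D k /\ cards_above a (aleph D) k) as Hex.
  { destruct (@inf_card_exists V A I D Dtrans HZ _ Dim) as (k & Hk & Hk'); exists k; split; [exact Hk |].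
    intros b Hb; destruct (IH b (below_mem Hb) (Dtrans Ha Hb)) as [E He].
    apply Hk'; [apply (in_image (fun b => b ∈ a) R a); eauto |].
    rewrite aleph_eq; exact (inf_card_ord (proj1 (least_card_spec He))). }
  split; [| exact Hex].
  rewrite aleph_eq, ER; unfold st, least_card.
  rewrite (Eca a R (aleph D)).
  - apply setof_ext; intros x; split; [intros H1; split; auto | tauto].
  - intros b Hb; symmetry; apply IH; [apply below_mem, Hb | exact (Dtrans Ha Hb)]. }
intros a Ha; destruct (K a Ha) as [_ Hex]; rewrite aleph_eq.
destruct (least_card_spec Hex) as (H1 & H2 & H3); split; [exact H1 | split; [| exact H3]].
intros b Hb; apply H2, Hb.
Qed.

Lemma f_aleph : F1 I D tru1 (aleph D).
Proof.
pose proof d_inf_card as Dcard.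
pose (H := fun a g => least_card (cards_above a (app1 g))).
apply (@df_rec V A I D Dtrans HZ (fun _ => True) (fun _ a => aleph D a) (fun a g _ => H a g)).
- intros e a _ _ Ha; rewrite aleph_eq at 1; unfold H, least_card; f_equal.
  assert (cards_above a (aleph D) = cards_above a (app1 (graph (aleph D) (tc a)))) as ->; [| reflexivity].
  apply pred_ext; intros k; split; intros K b Hb; specialize (K b Hb);
    rewrite app1_graph in * by (apply in_tc, below_mem, Hb); exact K.
- unfold H; apply (df_least_card (Q := fun k e => cards_above (e 0) (app1 (e 1)) k)).
  + intros e He [_ E]; exists (aleph D (e 0)); destruct (aleph_spec (He 0)) as (H1 & H2 & _).
    split; [exact H1 |]; intros b Hb; rewrite E, app1_graph by (apply in_tc, below_mem, Hb); auto.
  + unfold cards_above; dauto.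
Qed.

Lemma aleph_card a : D a -> inf_card D (aleph D a).
Proof. apply aleph_spec. Qed.

Lemma aleph_ord a : D a -> ord (aleph D a).
Proof. intros Ha; apply inf_card_ord, aleph_card, Ha. Qed.

Lemma aleph_mono a b : D a -> b ∈ a -> aleph D b ∈ aleph D a.
Proof. intros Ha; apply aleph_spec, Ha. Qed.

Lemma aleph_suc a : D a -> ord a -> aleph D (suc a) = cardsucc D (aleph D a).
Proof.
intros Ha Oa; rewrite aleph_eq, cardsucc_eq; unfold least_card; f_equal.
apply pred_ext; intros x; apply all_iff; intros k; split; intros K Hk H1; apply K; auto.
- intros b Hb; apply in_suc in Hb as [Hb | ->]; [| exact H1].
  exact (ord_transitive (inf_card_ord Hk) _ H1 _ (aleph_mono Ha Hb)).
- apply H1, in_suc; auto.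
Qed.

Lemma cardsucc_card k : inf_card D k -> inf_card D (cardsucc D k).
Proof. intros Hk; apply cardsucc_spec; [apply inf_card_D | apply inf_card_ord]; exact Hk. Qed.

Lemma cardsucc_ord k : D k -> ord k -> ord (cardsucc D k).
Proof. intros H1 H2; apply inf_card_ord, cardsucc_spec; assumption. Qed.

(** If the limit aleph were the successor of [m], some earlier [aleph D d] would not be in [m]; then
    the aleph at [suc d] lies above [m] and still below the limit. Consequently successor cardinals
    carry families, never scales. *)
Lemma aleph_limit_cardsucc b m : D b -> is_limit b -> inf_card D m -> aleph D b <> cardsucc D m.
Proof.
intros Hb (Ob & Nb & Lb) Hm E.
destruct (cardsucc_spec (inf_card_D Hm) (inf_card_ord Hm)) as (C1 & C2 & C3).
assert (exists d, d ∈ b /\ aleph D d ∉ m) as (d & Hd & Hdm).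
{ apply NNPP; intros N; destruct (aleph_spec Hb) as (_ & _ & K).
  destruct (K m Hm) as [E' | E'].
  - intros d Hd; apply NNPP; intros C; apply N; eauto.
  - rewrite <- E, E' in C2; exact (mem_irrefl C2).
  - rewrite E in E'; exact (mem_asym C2 E'). }
pose proof (Lb d Hd) as Hsd; pose proof (Dtrans Hb Hd) as Dd; pose proof (Dtrans Hb Hsd) as Dsd.
assert (m ∈ aleph D (suc d)) as K1.
{ pose proof (aleph_mono Dsd (proj2 (in_suc d d) (or_intror eq_refl))) as K.
  apply (ord_not_mem (aleph_ord Dd) (inf_card_ord Hm)) in Hdm.
  apply (ord_subset (inf_card_ord Hm) (aleph_ord Dd)) in Hdm as [-> | Hdm]; [exact K |].
  exact (ord_transitive (aleph_ord Dsd) _ K _ Hdm). }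
pose proof (aleph_mono Hb Hsd) as K2; rewrite E in K2.
destruct (C3 _ (aleph_card Dsd) K1) as [K3 | K3]; [rewrite K3 in K2; exact (mem_irrefl K2) | exact (mem_asym K2 K3)].
Qed.

End Absolute.

(** * Permutable families and scales *)

#[export] Hint Resolve d_maps d_injection d_bijection d_bounded d_eqstar f_image d_same_size d_size_lt
  d_inf_card f_cardsucc f_aleph : dfn.
#[export] Hint Resolve inf_card_ord aleph_ord : guard.

Definition seq_pred {V : universe} (W : V -> Prop) (S : V -> V) (_ : unit) (z : V) :=
  exists a, W a /\ ord a /\ z = opair a (S a).

Section Combinatorial.
Context {V : universe} (W : V -> Prop) (S : V -> V).
Notation I := (seq_pred W S).
Context (Wtrans : transitive_class W) (HZ : models_ZFC W I).
Notation tl e := (fun n => e (Datatypes.S n)).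

(** The part of being a permutable family that makes the applications of [A] meaningful; it is the
    guard under which groups and generators are definable. *)
Definition fam_ok (k A : V) := ord k /\ function_on A (cardsucc W k) /\
  forall a, a ∈ cardsucc W k -> subset (app A a) k.

Lemma fam_ok_ord k A : fam_ok k A -> ord k.
Proof. intros [H _]; exact H. Qed.
Lemma fam_ok_fun k A a : fam_ok k A -> a ∈ cardsucc W k -> functional_at A a.
Proof. intros [_ [H _]]; exact (function_on_functional H). Qed.
Lemma fam_ok_sub k A a x : fam_ok k A -> a ∈ cardsucc W k -> x ∈ app A a -> x ∈ k.
Proof. intros [_ [_ H]] Ha; exact (H a Ha x). Qed.
Hint Resolve fam_ok_ord fam_ok_fun fam_ok_sub : guard.

Lemma d_bounded_perm : D2 I W tru2 (bounded_perm W).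
Proof. dgoal; unfold bounded_perm; dauto. Qed.
Hint Resolve d_bounded_perm : dfn.

Lemma d_family_implements : D4 I W (fun k A p P => fam_ok k A /\ bijection p k k /\
  bijection P (cardsucc W k) (cardsucc W k)) (family_implements W).
Proof. dgoal; unfold family_implements; dauto. Qed.
Hint Resolve d_family_implements : dfn.

Lemma bounded_perm_bij P k : bounded_perm W P k -> bijection P k k.
Proof. intros [_ [H _]]; exact H. Qed.
Lemma bounded_perm_W P k : bounded_perm W P k -> W P.
Proof. intros [H _]; exact H. Qed.
Hint Resolve bounded_perm_bij bounded_perm_W : guard.

Lemma family_group_spec k A p : p ∈ family_group W k A <-> W p /\ bijection p k k /\
    exists P, bounded_perm W P (cardsucc W k) /\ family_implements W k A p P.
Proof.
destruct (power V (prod k k)) as [w Hw].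
apply (setof_bounded (fun p => W p /\ bijection p k k /\
    exists P, bounded_perm W P (cardsucc W k) /\ family_implements W k A p P) w).
intros q (_ & H & _); apply Hw; exact (bijection_prod H).
Qed.

Lemma f_family_group : F2 I W fam_ok (family_group W).
Proof.
dgoal; unfold family_group; apply (df_setof Wtrans HZ).
- intros e He _; exists (powD W (prod (e 0) (e 0))); split; [wside |].
  intros p (Hp & H & _); apply in_powD; split; [exact Hp | exact (bijection_prod H)].
- dauto.
Qed.
Hint Resolve f_family_group : dfn.

Lemma family_group_bij k A p : p ∈ family_group W k A -> bijection p k k.
Proof. intros H; apply family_group_spec in H; tauto. Qed.
Hint Resolve family_group_bij : guard.

Lemma d_permutable_index : D2 I W (fun k _ => ord k) (permutable_index W).
Proof. dgoal; unfold permutable_index; dauto. Qed.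
Hint Resolve d_permutable_index : dfn.

Lemma permutable_index_in k J x : permutable_index W k J -> x ∈ J -> x ∈ cardsucc W k.
Proof. intros [_ [H _]]; exact (H x). Qed.
Hint Resolve permutable_index_in : guard.

Lemma d_disjoint_approx : D4 I W (fun k A J _ => fam_ok k A /\ permutable_index W k J) (disjoint_approx W).
Proof.
dgoal; unfold disjoint_approx; dauto.
apply (df_setof Wtrans HZ).
- intros e He H; exists (app (e 2) (e 0)); split; [| tauto]; wside.
- dauto.
Qed.
Hint Resolve d_disjoint_approx : dfn.

Lemma disjoint_approx_fun k A J B x : disjoint_approx W k A J B -> x ∈ J -> functional_at B x.
Proof. intros [_ [H _]]; exact (function_on_functional H). Qed.
Lemma disjoint_approx_sub k A J B x z : disjoint_approx W k A J B -> x ∈ J -> z ∈ app B x -> z ∈ k.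
Proof. intros [_ [_ [H _]]] Hx Hz; exact (proj1 (H x Hx) z Hz). Qed.
Hint Resolve disjoint_approx_fun disjoint_approx_sub : guard.

Definition family_fix k A J B := setof (fun p => p ∈ family_group W k A /\
  forall x z, x ∈ J -> z ∈ app B x -> app p z = z).

Lemma f_family_fix : F4 I W (fun k A J B => fam_ok k A /\ permutable_index W k J /\ disjoint_approx W k A J B)
  family_fix.
Proof.
dgoal; unfold family_fix; apply (df_setof Wtrans HZ).
- intros e He (H1 & H2 & H3); exists (family_group W (e 0) (e 1)); split; [wside | tauto].
- dauto.
Qed.
Hint Resolve f_family_fix : dfn.

Lemma d_family_generator : D3 I W (fun k A _ => fam_ok k A) (family_generator W).
Proof.
dgoal; apply dp_ext with (fun e => exists J B, permutable_index W (e 0) J /\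
  disjoint_approx W (e 0) (e 1) J B /\ e 2 = family_fix (e 0) (e 1) J B); [intros e _ _; reflexivity |].
apply dp_ex; [intros e J He _ (B & H & _); exact (proj1 H) |].
apply dp_ex; [intros e J He _ (_ & H & _); exact (proj1 H) |].
dauto.
Qed.
Hint Resolve d_family_generator : dfn.

Lemma in_SC l t : t ∈ SC W l <-> exists m, m ∈ l /\ inf_card W m /\ t = cardsucc W m.
Proof.
unfold SC; rewrite (setof_ext (Q := fun t => exists m, (m ∈ l /\ inf_card W m) /\ t = cardsucc W m)).
- rewrite (in_image (fun m => m ∈ l /\ inf_card W m) (cardsucc W) l) by tauto.
  apply ex_iff; intros m; tauto.
- intros x; apply ex_iff; intros m; tauto.
Qed.

Lemma f_SC : F1 I W tru1 (SC W).
Proof.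
dgoal; apply df_ext with (fun e => setof (fun t => exists m, (m ∈ e 0 /\ inf_card W m) /\ t = cardsucc W m)).
- intros e _ _; apply setof_ext; intros x; apply ex_iff; intros m; tauto.
- apply (df_image Wtrans HZ (G := fun _ => True) (P := fun m e => m ∈ e 0 /\ inf_card W m) (F := fun m e => cardsucc W m)).
  + intros e He _; exists (e 0); split; [apply He | tauto].
  + dauto.
  + dauto.
Qed.
Hint Resolve f_SC : dfn.

Lemma SC_ord l t : t ∈ SC W l -> ord t.
Proof. intros H; apply in_SC in H as (m & _ & Hm & ->); exact (inf_card_ord (cardsucc_card Wtrans HZ Hm)). Qed.
Lemma SC_trans l t y z : t ∈ SC W l -> z ∈ y -> y ∈ t -> z ∈ t.
Proof. intros H Hz Hy; exact (ord_transitive (SC_ord H) y Hy z Hz). Qed.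
Hint Resolve SC_ord SC_trans : guard.

Lemma in_prodSC l f : f ∈ prodSC W l <-> W f /\ function_on f (SC W l) /\ forall t, t ∈ SC W l -> app f t ∈ t.
Proof.
destruct (power V (prod (SC W l) (cup (SC W l)))) as [w Hw].
apply (setof_bounded (fun f => W f /\ function_on f (SC W l) /\ forall t, t ∈ SC W l -> app f t ∈ t) w).
intros q (_ & H & K); apply Hw; intros z Hz; apply (function_on_in z H) in Hz as (x & Hx & ->).
apply opair_in_prod; split; [exact Hx | apply in_cup; eauto].
Qed.

Lemma f_prodSC : F1 I W tru1 (prodSC W).
Proof.
dgoal; unfold prodSC; apply (df_setof Wtrans HZ); [| dauto].
intros e He _; exists (powD W (prod (SC W (e 0)) (cup (SC W (e 0))))); split; [wside |].
intros q (Wq & H & K); apply in_powD; split; [exact Wq |].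
intros z Hz; apply (function_on_in z H) in Hz as (x & Hx & ->).
apply opair_in_prod; split; [exact Hx | apply in_cup; eauto].
Qed.
Hint Resolve f_prodSC : dfn.

Lemma prodSC_fun l f t : f ∈ prodSC W l -> t ∈ SC W l -> functional_at f t.
Proof. intros H; apply in_prodSC in H as (_ & H & _); exact (function_on_functional H). Qed.
Lemma prodSC_in l f t : f ∈ prodSC W l -> t ∈ SC W l -> app f t ∈ t.
Proof. intros H; apply in_prodSC in H as (_ & _ & H); exact (H t). Qed.
Hint Resolve prodSC_fun prodSC_in : guard.

Lemma d_perm_sequence : D2 I W tru2 (perm_sequence W).
Proof. dgoal; unfold perm_sequence; dauto. Qed.
Hint Resolve d_perm_sequence : dfn.

Lemma perm_sequence_fun l p t : perm_sequence W l p -> t ∈ SC W l -> functional_at p t.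
Proof. intros [_ [H _]]; exact (function_on_functional H). Qed.
Lemma perm_sequence_bij l p t : perm_sequence W l p -> t ∈ SC W l -> bijection (app p t) t t.
Proof. intros [_ [_ H]]; exact (H t). Qed.
Hint Resolve perm_sequence_fun perm_sequence_bij : guard.

Definition scale_ok (l F : V) := ord l /\ maps F (cardsucc W l) (prodSC W l).

Lemma scale_ok_ord l F : scale_ok l F -> ord l.
Proof. intros [H _]; exact H. Qed.
Lemma scale_ok_fun l F a : scale_ok l F -> a ∈ cardsucc W l -> functional_at F a.
Proof. intros [_ H]; exact (maps_functional H). Qed.
Lemma scale_ok_in l F a : scale_ok l F -> a ∈ cardsucc W l -> app F a ∈ prodSC W l.
Proof. intros [_ H]; exact (maps_in H). Qed.
Hint Resolve scale_ok_ord scale_ok_fun scale_ok_in : guard.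

Lemma d_scale_implements : D4 I W (fun l F p P => scale_ok l F /\ perm_sequence W l p /\
  bijection P (cardsucc W l) (cardsucc W l)) (scale_implements W).
Proof. dgoal; unfold scale_implements, eventually; dauto. Qed.
Hint Resolve d_scale_implements : dfn.

Context (HS : forall a, W a -> ord a ->
    (is_limit a -> permutable_scale W (aleph W a) (S a)) /\
    (~ is_limit a -> permutable_family W (aleph W a) (S a))).

Lemma f_S : F1 I W (@ord V) S.
Proof.
dgoal; apply (@df_char V unit I W _ _ (fun y e => I tt (opair (e 0) y))).
- intros e He Oe; destruct (HS (He 0) Oe) as [H1 H2].
  destruct (classic (is_limit (e 0))) as [L | L].
  + destruct (H1 L) as [[H _] _]; exact H.
  + destruct (H2 L) as [H _]; exact H.
- intros e y He Hy Oe; split.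
  + intros (a & _ & _ & E); apply opair_inj in E as [-> ->]; reflexivity.
  + intros ->; exists (e 0); auto.
- apply dp_pred; dauto.
Qed.
Hint Resolve f_S : dfn.

Lemma fam_ok_S a : W a -> ord a -> ~ is_limit a -> fam_ok (aleph W a) (S a).
Proof.
intros Ha Oa N; destruct (proj2 (HS Ha Oa) N) as (_ & H1 & H2 & _).
split; [exact (aleph_ord Wtrans HZ Ha) | split; [exact H1 |]].
intros b Hb; apply H2, Hb.
Qed.

Lemma scale_ok_S a : W a -> ord a -> is_limit a -> scale_ok (aleph W a) (S a).
Proof.
intros Ha Oa L; destruct (proj1 (HS Ha Oa) L) as ((_ & H & _) & _).
split; [exact (aleph_ord Wtrans HZ Ha) | exact H].
Qed.
Hint Resolve fam_ok_S scale_ok_S : guard.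

(** At such a [t] the definition of [fam_group_at] only meets families. At a limit index it would
    treat a scale as a family, where applications may be meaningless. *)
Definition at_ok (t : V) := forall b, W b -> ord b -> t = aleph W b -> ~ is_limit b.

Lemma SC_at_ok l t : t ∈ SC W l -> at_ok t.
Proof.
intros H b Wb Ob E L; apply in_SC in H as (m & _ & Hm & ->).
exact (aleph_limit_cardsucc Wtrans HZ Wb L Hm (eq_sym E)).
Qed.
Hint Resolve SC_at_ok : guard.

Lemma at_ok_fam t b : at_ok t -> W b -> ord b -> t = aleph W b -> fam_ok t (S b).
Proof. intros H Wb Ob ->; apply fam_ok_S; auto. Qed.
Hint Resolve at_ok_fam : guard.

Lemma f_fam_group_at : F1 I W at_ok (fam_group_at W S).
Proof.
dgoal; unfold fam_group_at; apply (df_setof Wtrans HZ).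
- intros e He _; exists (powD W (prod (e 0) (e 0))); split; [wside |].
  intros p (b & _ & _ & _ & H); apply family_group_spec in H as (H1 & H2 & _).
  apply in_powD; split; [exact H1 | exact (bijection_prod H2)].
- dauto.
Qed.
Hint Resolve f_fam_group_at : dfn.

Notation GG := (fam_group_at W S).

Lemma scale_group_spec l F p : p ∈ scale_group W GG l F <-> perm_sequence W l p /\
    (forall t, t ∈ SC W l -> app p t ∈ GG t) /\
    exists P, bounded_perm W P (cardsucc W l) /\ scale_implements W l F p P.
Proof.
destruct (power V (prod (SC W l) (cup (setof (fun u => exists t, t ∈ SC W l /\ u = GG t))))) as [w Hw].
apply (setof_bounded (fun p => perm_sequence W l p /\
    (forall t, t ∈ SC W l -> app p t ∈ GG t) /\
    exists P, bounded_perm W P (cardsucc W l) /\ scale_implements W l F p P) w).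
intros q (H & K & _); apply Hw; intros z Hz.
apply (function_on_in z (proj1 (proj2 H))) in Hz as (x & Hx & ->).
apply opair_in_prod; split; [exact Hx | apply in_cup; exists (GG x); split; [| auto]].
apply (in_image (fun t => t ∈ SC W l) GG (SC W l)); eauto.
Qed.

Lemma f_scale_group : F2 I W scale_ok (scale_group W GG).
Proof.
pose (U := fun l => setof (fun u => exists t, t ∈ SC W l /\ u = GG t)).
assert (F1 I W tru1 U) as FU.
{ dgoal; unfold U; apply (df_image Wtrans HZ (G := fun _ => True) (P := fun t e => t ∈ SC W (e 0)) (F := fun t e => GG t)).
  - intros e He _; exists (SC W (e 0)); split; [wside | auto].
  - dauto.
  - dauto. }
dgoal; unfold scale_group; apply (df_setof Wtrans HZ).
- intros e He _.
  exists (powD W (prod (SC W (e 0)) (cup (U (e 0))))); split; [wside |].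
  intros q (H & K & _); apply in_powD; split; [exact (proj1 H) |]; intros z Hz.
  apply (function_on_in z (proj1 (proj2 H))) in Hz as (x & Hx & ->).
  apply opair_in_prod; split; [exact Hx | apply in_cup; exists (GG x); split; [| auto]].
  apply (in_image (fun t => t ∈ SC W (e 0)) GG (SC W (e 0))); eauto.
- dauto.
Qed.
Hint Resolve f_scale_group : dfn.

Lemma scale_group_seq l F p : p ∈ scale_group W GG l F -> perm_sequence W l p.
Proof. intros H; apply scale_group_spec in H; tauto. Qed.
Hint Resolve scale_group_seq : guard.

Definition scale_fix l F h f := setof (fun p => p ∈ scale_group W GG l F /\
          (exists P, bounded_perm W P (cardsucc W l) /\ scale_implements W l F p P /\
             forall a, a ∈ h -> app P a = a) /\
          forall t z, t ∈ SC W l -> z ∈ app f t -> app (app p t) z = z).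

Lemma cardsucc_trans l a h : W l -> ord l -> a ∈ h -> h ∈ cardsucc W l -> a ∈ cardsucc W l.
Proof. intros Wl Ol H1 H2; exact (ord_transitive (cardsucc_ord Wtrans HZ Wl Ol) h H2 a H1). Qed.

Lemma f_scale_fix : F4 I W (fun l F h f => scale_ok l F /\ h ∈ cardsucc W l /\ f ∈ prodSC W l) scale_fix.
Proof.
dgoal; unfold scale_fix; apply (df_setof Wtrans HZ).
- intros e He (H1 & H2 & H3); exists (scale_group W GG (e 0) (e 1)); split; [wside | tauto].
- dauto.
  cbv beta; intros e He H; destruct_all.
  match goal with H : bounded_perm W _ _ |- _ => apply (bijection_functional (bounded_perm_bij H)) end.
  match goal with H : _ ∈ cardsucc W ?l |- _ => refine (cardsucc_trans (He _) _ _ H); eauto with guard end.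
Qed.
Hint Resolve f_scale_fix : dfn.

Lemma d_scale_generator : D3 I W (fun l F _ => scale_ok l F) (scale_generator W GG).
Proof.
dgoal; apply dp_ext with (fun e => exists h f, h ∈ cardsucc W (e 0) /\ f ∈ prodSC W (e 0) /\
  e 2 = scale_fix (e 0) (e 1) h f); [intros e _ _; reflexivity |].
dauto.
Qed.
Hint Resolve d_scale_generator : dfn.

Lemma f_group : F1 I W (@ord V) (group W S).
Proof. dgoal; unfold group; dauto. Qed.
Hint Resolve f_group : dfn.

Lemma d_generator : D2 I W (fun a _ => ord a) (generator W S).
Proof. dgoal; unfold generator; dauto. Qed.
Hint Resolve d_generator : dfn.

Lemma generator_W a K : W a -> ord a -> generator W S a K -> W K.
Proof.
intros Wa Oa; unfold generator, limit_case; destruct excluded_middle_informative as [L | L].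
- intros (h & f & Hh & Hf & E); pose proof (scale_ok_S Wa Oa L) as OK; rewrite E.
  pose proof (F1_D (f_aleph Wtrans HZ) Wa Logic.I).
  assert (W (cardsucc W (aleph W a))) by (exact (inf_card_D (cardsucc_card Wtrans HZ (aleph_card Wtrans HZ Wa)))).
  assert (W h) by dm; assert (W f) by (apply in_prodSC in Hf; tauto).
  assert (W (S a)) by exact (F1_D f_S Wa Oa).
  change (W (scale_fix (aleph W a) (S a) h f)); apply (F4_D f_scale_fix); auto.
- intros (J & B & HJ & HB & E); pose proof (fam_ok_S Wa Oa L) as OK; rewrite E.
  pose proof (F1_D (f_aleph Wtrans HZ) Wa Logic.I).
  assert (W (S a)) by exact (F1_D f_S Wa Oa).
  change (W (family_fix (aleph W a) (S a) J B)); apply (F4_D f_family_fix); auto.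
  + apply HJ.
  + apply HB.
Qed.

Lemma f_index : F1 I W tru1 (index W).
Proof. dgoal; unfold index; dauto. Qed.
Hint Resolve f_index : dfn.

Definition shift_seq (l p i : V) := setof (fun z => exists t, t ∈ SC W l /\
       z = opair t (app (app p t) (app i t))).

Lemma f_shift_seq : F3 I W (fun l p i => perm_sequence W l p /\ i ∈ prodSC W l) shift_seq.
Proof.
dgoal; unfold shift_seq.
apply (df_image Wtrans HZ (G := fun e => perm_sequence W (e 0) (e 1) /\ e 2 ∈ prodSC W (e 0))
  (P := fun t e => t ∈ SC W (e 0)) (F := fun t e => opair t (app (app (e 1) t) (app (e 2) t)))).
- intros e He _; exists (SC W (e 0)); split; [wside | auto].
- dauto.
- dauto.
Qed.
Hint Resolve f_shift_seq : dfn.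

Lemma group_seq a p : is_limit a -> p ∈ group W S a -> perm_sequence W (aleph W a) p.
Proof.
unfold group, limit_case; destruct excluded_middle_informative as [L | L]; [| tauto].
intros _; apply scale_group_seq.
Qed.
Lemma group_bij a p : ~ is_limit a -> p ∈ group W S a -> bijection p (aleph W a) (aleph W a).
Proof.
unfold group, limit_case; destruct excluded_middle_informative as [L | L]; [tauto |].
intros _; apply family_group_bij.
Qed.
Lemma index_limit a i : is_limit a -> i ∈ index W a -> i ∈ prodSC W (aleph W a).
Proof. unfold index, limit_case; destruct excluded_middle_informative; tauto. Qed.
Lemma index_not_limit a i : ~ is_limit a -> i ∈ index W a -> i ∈ aleph W a.
Proof. unfold index, limit_case; destruct excluded_middle_informative; tauto. Qed.
Lemma move_fun a p i : ~ is_limit a -> p ∈ group W S a -> i ∈ index W a -> functional_at p i.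
Proof. intros N Hp Hi; exact (bijection_functional (group_bij N Hp) (index_not_limit N Hi)). Qed.
Hint Resolve group_seq index_limit move_fun : guard.

Lemma f_move : F3 I W (fun a p i => ord a /\ p ∈ group W S a /\ i ∈ index W a) (move W).
Proof.
dgoal; apply df_ext with (fun e => limit_case (e 0) (shift_seq (aleph W (e 0)) (e 1) (e 2)) (app (e 1) (e 2))).
- intros; reflexivity.
- dauto.
Qed.
Hint Resolve f_move : dfn.

Lemma move_index a p i : W a -> ord a -> p ∈ group W S a -> i ∈ index W a -> move W a p i ∈ index W a.
Proof.
intros Wa Oa Hp Hi; destruct (classic (is_limit a)) as [L | L].
- pose proof (group_seq L Hp) as Sp; pose proof (index_limit L Hi) as Pi.
  assert (W (shift_seq (aleph W a) p i)) as Ws.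
  { pose proof (F1_D (f_aleph Wtrans HZ) Wa Logic.I).
    apply (F3_D f_shift_seq); auto; [apply Sp | apply in_prodSC in Pi; tauto]. }
  unfold index, move, limit_case; destruct excluded_middle_informative; [| tauto].
  change (shift_seq (aleph W a) p i ∈ prodSC W (aleph W a)).
  assert (shift_seq (aleph W a) p i = graph (fun t => app (app p t) (app i t)) (SC W (aleph W a))) as E by reflexivity.
  apply in_prodSC; rewrite E in *; split; [exact Ws | split; [apply function_on_graph |]].
  intros t Ht; rewrite app_graph by exact Ht; eauto with guard.
- pose proof (group_bij L Hp) as Sp; pose proof (index_not_limit L Hi) as Pi.
  unfold index, move, limit_case; destruct excluded_middle_informative; [tauto |].
  eauto with guard.
Qed.
Hint Resolve move_index : guard.

Lemma d_subgroup : D2 I W (fun a _ => ord a) (subgroup W S).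
Proof. dgoal; unfold subgroup, subset; dauto. Qed.
Hint Resolve d_subgroup : dfn.

(** The generators behind a member of the filter are listed in the metatheory. Each of them is a set
    of [W], so the list can be traded for a finite set of [W]. *)
Lemma d_in_filter : D2 I W (fun a _ => ord a) (in_filter W S).
Proof.
dgoal; apply dp_ext with (fun e => W (e 1) /\ subgroup W S (e 0) (e 1) /\
  exists k, W k /\ finite k /\ (forall K, K ∈ k -> generator W S (e 0) K) /\
    forall p, p ∈ group W S (e 0) -> (forall K, K ∈ k -> p ∈ K) -> p ∈ e 1).
- intros e He Oe; unfold in_filter; apply and_iff_compat_l, and_iff_compat_l; split.
  + intros (k & Wk & (l & Hl) & H1 & H2); exists l; split.
    * intros K HK; apply H1, Hl, HK.
    * intros p Hp H; apply H2; [exact Hp |]; intros K HK; apply H, Hl, HK.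
  + intros (l & H1 & H2); destruct (list_set l) as (k & Hk); exists k; split; [| split; [exists l; exact Hk | split]].
    * apply (D_list_set Wtrans HZ (l := l)); [| exact Hk].
      intros K HK; exact (generator_W (He 0) Oe (H1 K HK)).
    * intros K HK; apply H1, Hk, HK.
    * intros p Hp H; apply H2; [exact Hp |]; intros K HK; apply H, Hk, HK.
- dauto.
Qed.

End Combinatorial.

(** * Names and forcing *)

#[export] Hint Resolve d_pfun d_covers d_small f_hartogs f_compose : dfn.

Section NameBasics.
Context {V : universe}.
Implicit Types x y z a b : V.

Lemma bullet_image (X : V -> Prop) y : (forall x, X x -> x ∈ y) ->
  forall z, z ∈ bullet X <-> exists x, X x /\ z = opair empty x.
Proof. exact (in_image X (fun x => opair empty x) y). Qed.

Lemma bullet_single x : bullet (fun w => w = x) = single (opair empty x).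
Proof.
apply mem_ext; intros z; rewrite (bullet_image (y := single x)), in_single.
- split; [intros (w & -> & ->); reflexivity | eauto].
- intros w ->; apply in_single; reflexivity.
Qed.

Lemma bullet_pair x y : bullet (fun w => w = x \/ w = y) = upair (opair empty x) (opair empty y).
Proof.
apply mem_ext; intros z; rewrite (bullet_image (y := upair x y)), in_upair.
- split; [intros (w & [-> | ->] & ->); auto | intros [-> | ->]; eauto].
- intros w H; apply in_upair, H.
Qed.

Lemma dpair_eq x y : dpair x y =
  upair (opair empty (single (opair empty x))) (opair empty (upair (opair empty x) (opair empty y))).
Proof. unfold dpair; rewrite bullet_pair, bullet_single, bullet_pair; reflexivity. Qed.

Lemma below_dpair_l x y : below x (dpair x y).
Proof.
rewrite dpair_eq; apply below_trans with (opair empty (single (opair empty x))).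
- apply below_trans with (single (opair empty x)); [| apply below_snd'].
  apply below_trans with (opair empty x); [apply below_snd' | apply below_mem, in_single; reflexivity].
- apply below_mem, in_upair; auto.
Qed.

Lemma below_dpair_r x y : below y (dpair x y).
Proof.
rewrite dpair_eq; apply below_trans with (opair empty (upair (opair empty x) (opair empty y))).
- apply below_trans with (upair (opair empty x) (opair empty y)); [| apply below_snd'].
  apply below_trans with (opair empty y); [apply below_snd' | apply below_mem, in_upair; auto].
- apply below_mem, in_upair; auto.
Qed.

Lemma check_eq x : check x = bullet (fun u => exists y, y ∈ x /\ u = check y).
Proof.
unfold check at 1; rewrite mem_rec_below; [reflexivity |].
intros r r' E; unfold bullet; apply setof_ext; intros z; apply ex_iff; intros u.
apply and_iff_compat_r, ex_iff; intros y; split; intros [Hy ->]; split; auto;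
  rewrite (E y (below_mem Hy)); reflexivity.
Qed.

Lemma in_check x z : z ∈ check x <-> exists y, y ∈ x /\ z = opair empty (check y).
Proof.
rewrite check_eq, (bullet_image (y := setof (fun u => exists y, y ∈ x /\ u = check y))).
- split.
  + intros (u & (y & Hy & ->) & ->); eauto.
  + intros (y & Hy & ->); eauto.
- intros u Hu; apply (in_image (fun y => y ∈ x) (@check V) x); auto.
Qed.

(** A definable left inverse of [check]. It shows that [x] is in the class when [check x] is, so
    that indices can be read off names. *)
Definition uncheck : V -> V :=
  mem_rec empty (fun x rec => setof (fun z => exists y, opair empty y ∈ x /\ z = rec y)).

Lemma uncheck_eq x : uncheck x = setof (fun z => exists y, opair empty y ∈ x /\ z = uncheck y).
Proof.
unfold uncheck at 1; rewrite mem_rec_below; [reflexivity |].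
intros r r' E; apply setof_ext; intros z; apply ex_iff; intros y; split; intros [Hy ->]; split; auto;
  rewrite (E y (below_snd Hy)); reflexivity.
Qed.

Lemma in_uncheck x z : z ∈ uncheck x <-> exists y, opair empty y ∈ x /\ z = uncheck y.
Proof.
rewrite uncheck_eq; apply (in_image (fun y => opair empty y ∈ x) uncheck (tc x)).
intros y Hy; apply in_tc, (below_snd Hy).
Qed.

Lemma uncheck_check x : uncheck (check x) = x.
Proof.
induction (mem_wf V x) as [x _ IH]; apply mem_ext; intros z; rewrite in_uncheck; split.
- intros (y & Hy & ->); apply in_check in Hy as (w & Hw & E); apply opair_inj in E as [_ ->].
  rewrite IH; assumption.
- intros Hz; exists (check z); rewrite IH by exact Hz; split; [| reflexivity].
  apply in_check; eauto.
Qed.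

Lemma oadd_eq a b : oadd a b = join a (cup (setof (fun t => exists y, y ∈ b /\ t = suc (oadd a y)))).
Proof.
unfold oadd at 1; rewrite mem_rec_below.
- apply mem_ext; intros z.
  rewrite in_join, in_cup.
  rewrite (setof_bounded _ (join a (cup (setof (fun t => exists y, y ∈ b /\ t = suc (oadd a y)))))).
  + apply or_iff_compat_l; split.
    * intros (y & Hy & Hz); exists (suc (oadd a y)); split; [| apply in_suc, Hz].
      apply (in_image (fun y => y ∈ b) (fun y => suc (oadd a y)) b); eauto.
    * intros (t & Ht & Hz); apply (in_image (fun y => y ∈ b) (fun y => suc (oadd a y)) b) in Ht as (y & Hy & ->); [| auto].
      exists y; split; [exact Hy | apply in_suc, Hz].
  + intros w [Hw | (y & Hy & Hw)]; apply in_join; [auto | right].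
    apply in_cup; exists (suc (oadd a y)); split; [| apply in_suc, Hw].
    apply (in_image (fun y => y ∈ b) (fun y => suc (oadd a y)) b); eauto.
- intros r r' E; apply setof_ext; intros z; apply or_iff_compat_l, ex_iff; intros y.
  split; intros [Hy H]; split; auto; rewrite (E y (below_mem Hy)) in *; exact H.
Qed.

Lemma name_rank_eq x : name_rank x =
  setof (fun a => exists p y, opair p y ∈ x /\ (a ∈ name_rank y \/ a = name_rank y)).
Proof.
unfold name_rank at 1; rewrite mem_rec_below; [reflexivity |].
intros r r' E; apply setof_ext; intros z; apply ex_iff; intros p; apply ex_iff; intros y.
split; intros [Hy H]; split; auto; rewrite (E y (below_snd Hy)) in *; exact H.
Qed.

Lemma in_name_rank x a : a ∈ name_rank x <->
  exists p y, opair p y ∈ x /\ (a ∈ name_rank y \/ a = name_rank y).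
Proof.
rewrite name_rank_eq.
apply (setof_bounded (fun a => exists p y, opair p y ∈ x /\ (a ∈ name_rank y \/ a = name_rank y))
  (cup (setof (fun t => exists y, y ∈ tc x /\ t = suc (name_rank y))))).
intros w (p & y & Hy & Hw); apply in_cup; exists (suc (name_rank y)); split; [| apply in_suc, Hw].
apply (in_image (fun y => y ∈ tc x) (fun y => suc (name_rank y)) (tc x)); [auto |].
exists y; split; [apply in_tc, (below_snd Hy) | reflexivity].
Qed.

Lemma is_name_eq (P : V -> Prop) x : is_name P x <->
  forall z, z ∈ x -> exists p y, z = opair p y /\ P p /\ is_name P y.
Proof. split; [intros [x' H]; exact H | apply is_name_intro]. Qed.

Definition Pset (C L : V) : poset V := Poset (fun p => p ∈ C) (fun p q => opair p q ∈ L).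

Definition feq_body (P : poset V) (R : V -> V -> V -> Prop) (p x y : V) :=
    (forall s z q, opair s z ∈ x -> cond P q -> le P q p -> le P q s ->
       exists r t w, cond P r /\ le P r q /\ opair t w ∈ y /\ le P r t /\ R r z w) /\
    (forall t w q, opair t w ∈ y -> cond P q -> le P q p -> le P q t ->
       exists r s z, cond P r /\ le P r q /\ opair s z ∈ x /\ le P r s /\ R r z w).

Lemma forces_eq_eq (P : poset V) p x y : forces_eq P p x y <-> feq_body P (forces_eq P) p x y.
Proof.
split; [intros [p' x' y' H1 H2]; split; assumption | intros [H1 H2]; constructor; assumption].
Qed.

(** Forced equality of names in a transitive set that contains the conditions consults the order
    only inside that set. A poset with a class-sized order can therefore be replaced by a pair of
    sets. *)
Lemma forces_eq_transfer (P P' : poset V) X : is_transitive X ->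
  (forall q, cond P q <-> cond P' q) -> (forall q, cond P q -> q ∈ X) ->
  (forall q s, cond P q -> s ∈ X -> (le P q s <-> le P' q s)) ->
  forall x p y, p ∈ X -> x ∈ X -> y ∈ X -> forces_eq P p x y -> forces_eq P' p x y.
Proof.
intros T HC HX HL.
assert (forall u v z, opair u v ∈ z -> z ∈ X -> u ∈ X /\ v ∈ X) as K.
{ intros u v z H Hz; split; apply (below_transitive _ T); apply below_trans with z;
    eauto using below_fst, below_snd, below_mem. }
induction x as [x IH] using below_ind; intros p y Hp Hx Hy.
rewrite !forces_eq_eq; intros [H1 H2]; split.
- intros s z q Hs Hq1 Hq2 Hq3; destruct (K _ _ _ Hs Hx) as [Ks Kz].
  apply HC in Hq1; apply HL in Hq2, Hq3; auto.
  destruct (H1 s z q Hs Hq1 Hq2 Hq3) as (r & t & w & Hr1 & Hr2 & Ht & Hr3 & E).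
  destruct (K _ _ _ Ht Hy); exists r, t, w; rewrite <- HC, <- !HL by auto.
  splits; auto; refine (IH z (below_snd Hs) r w _ _ _ E); auto.
- intros t w q Ht Hq1 Hq2 Hq3; destruct (K _ _ _ Ht Hy) as [Ks Kz].
  apply HC in Hq1; apply HL in Hq2, Hq3; auto.
  destruct (H2 t w q Ht Hq1 Hq2 Hq3) as (r & s & z & Hr1 & Hr2 & Hs & Hr3 & E).
  destruct (K _ _ _ Hs Hx); exists r, s, z; rewrite <- HC, <- !HL by auto.
  splits; auto; refine (IH z (below_snd Hs) r w _ _ _ E); auto.
Qed.

Lemma forces_eq_restrict (P P' : poset V) X : is_transitive X ->
  (forall q, cond P q <-> cond P' q) -> (forall q, cond P q -> q ∈ X) ->
  (forall q s, cond P q -> s ∈ X -> (le P q s <-> le P' q s)) ->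
  forall x p y, p ∈ X -> x ∈ X -> y ∈ X -> (forces_eq P p x y <-> forces_eq P' p x y).
Proof.
intros T HC HX HL x p y Hp Hx Hy; split; [apply forces_eq_transfer with X; assumption |].
apply forces_eq_transfer with X; auto.
- intros q; symmetry; apply HC.
- intros q Hq; apply HX, HC, Hq.
- intros q s Hq Hs; symmetry; apply HL; [apply HC, Hq | exact Hs].
Qed.

End NameBasics.

(** * Definability of names and of forced equality *)

Section DefinableNames.
Context {V : universe} {A : Type} (I : A -> V -> Prop) (D : V -> Prop).
Context (Dtrans : transitive_class D) (HZ : models_ZFC D I).
Notation tl e := (fun n => e (Datatypes.S n)).
Notation tl2 e := (fun n => e (Datatypes.S (Datatypes.S n))).
Notation Dp := (Dp I D).
Notation Df := (Df I D).
Notation ok := (over_D D).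

Lemma df_bullet G X : (forall e, ok e -> G e -> exists y, D y /\ forall x, X x e -> x ∈ y) ->
  Dp (fun e => G (tl e)) (fun e => X (e 0) (tl e)) -> Df G (fun e => bullet (fun x => X x e)).
Proof.
intros HB HX; unfold bullet.
apply (df_image Dtrans HZ (G := G) (P := X) (F := fun x _ => opair empty x)); [exact HB | exact HX | dauto].
Qed.

Lemma f_dpair : F2 I D tru2 (@dpair V).
Proof.
dgoal; apply df_ext with (fun e => upair (opair empty (single (opair empty (e 0))))
  (opair empty (upair (opair empty (e 0)) (opair empty (e 1))))).
- intros e _ _; symmetry; apply dpair_eq.
- dauto.
Qed.

Lemma D_dpair_l x y : D (dpair x y) -> D x.
Proof. apply (D_below Dtrans), below_dpair_l. Qed.

Lemma D_dpair_r x y : D (dpair x y) -> D y.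
Proof. apply (D_below Dtrans), below_dpair_r. Qed.

Lemma f_check : F1 I D tru1 (@check V).
Proof.
apply (@df_rec V A I D Dtrans HZ (fun _ => True) (fun _ x => check x)
  (fun x g _ => bullet (fun u => exists y, y ∈ x /\ u = app1 g y))).
- intros e x _ _ _; rewrite check_eq at 1; f_equal; apply pred_ext; intros u; apply ex_iff; intros y.
  split; intros [Hy ->]; split; auto; rewrite app1_graph by (apply in_tc, below_mem, Hy); reflexivity.
- apply (df_bullet (G := fun e => True /\ e 1 = graph (@check V) (tc (e 0))) (X := fun u e => exists y, y ∈ e 0 /\ u = app1 (e 1) y)).
  + intros e He [_ E]; exists (cup (cup (e 1))); split; [pose proof (He 1); dm |].
    intros u (y & Hy & ->); apply in_opair_snd with y; rewrite E.
    rewrite app1_graph by (apply in_tc, below_mem, Hy); apply opair_in_graph; split; [apply in_tc, below_mem, Hy | reflexivity].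
  + dauto.
Qed.

Lemma f_uncheck : F1 I D tru1 (@uncheck V).
Proof.
apply (@df_rec V A I D Dtrans HZ (fun _ => True) (fun _ x => uncheck x)
  (fun x g _ => setof (fun z => exists y, opair empty y ∈ x /\ z = app1 g y))).
- intros e x _ _ _; rewrite uncheck_eq at 1; apply setof_ext; intros u; apply ex_iff; intros y.
  split; intros [Hy ->]; split; auto; rewrite app1_graph by (apply in_tc, (below_snd Hy)); reflexivity.
- apply (df_image Dtrans HZ (G := fun e => True /\ e 1 = graph uncheck (tc (e 0)))
    (P := fun y e => opair empty y ∈ e 0) (F := fun y e => app1 (e 1) y)).
  + intros e He _; exists (tc (e 0)); split; [pose proof (He 0); dm |].
    intros y Hy; apply in_tc, (below_snd Hy).
  + dauto.
  + dauto.
Qed.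

Lemma D_check x : D (check x) -> D x.
Proof. intros H; rewrite <- (uncheck_check x); exact (F1_D f_uncheck H Logic.I). Qed.

Lemma f_oadd : F2 I D tru2 (@oadd V).
Proof.
cut (F2 I D tru2 (fun b a => @oadd V a b)).
{ intros K; exact (df_use2 K (df_var _ _ _ 1) (df_var _ _ _ 0) (fun _ _ _ => Logic.I)). }
apply (@df_rec V A I D Dtrans HZ (fun _ => True) (fun e b => oadd (e 0) b)
  (fun b g e => join (e 0) (cup (setof (fun t : V => exists y, y ∈ b /\ t = suc (app1 g y)))))).
- intros e x _ _ _; rewrite oadd_eq at 1; f_equal; f_equal; apply setof_ext; intros u; apply ex_iff; intros y.
  split; intros [Hy ->]; split; auto; rewrite app1_graph by (apply in_tc, below_mem, Hy); reflexivity.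
- dstep; [dauto |]; dstep.
  apply (df_image Dtrans HZ (G := fun e => True /\ e 1 = graph (oadd (e 2)) (tc (e 0)))
    (P := fun y e => y ∈ e 0) (F := fun y e => suc (app1 (e 1) y))).
  + intros e He _; exists (e 0); auto.
  + dauto.
  + dauto.
Qed.

Lemma f_name_rank : F1 I D tru1 (@name_rank V).
Proof.
apply (@df_rec V A I D Dtrans HZ (fun _ => True) (fun _ x => name_rank x)
  (fun x g _ => cup (setof (fun t => exists y, (exists p, opair p y ∈ x) /\ t = suc (app1 g y))))).
- intros e x _ _ _; apply mem_ext; intros a; rewrite in_name_rank, in_cup; split.
  + intros (p & y & Hy & Ha); exists (suc (name_rank y)); split; [| apply in_suc, Ha].
    apply (in_image (fun y => exists p, opair p y ∈ x) (fun y => suc (app1 (graph (@name_rank V) (tc x)) y)) (tc x)).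
    * intros z (q & Hz); apply in_tc, (below_snd Hz).
    * exists y; split; [eauto |]; rewrite app1_graph; [reflexivity | apply in_tc, (below_snd Hy)].
  + intros (t & Ht & Ha).
    apply (in_image (fun y => exists p, opair p y ∈ x) (fun y => suc (app1 (graph (@name_rank V) (tc x)) y)) (tc x)) in Ht
      as (y & (p & Hy) & ->); [| intros z (q & Hz); apply in_tc, (below_snd Hz)].
    rewrite app1_graph in Ha by (apply in_tc, (below_snd Hy)); exists p, y; split; [exact Hy | apply in_suc, Ha].
- dstep.
  apply (df_image Dtrans HZ (G := fun e => True /\ e 1 = graph (@name_rank V) (tc (e 0)))
    (P := fun y e => exists p, opair p y ∈ e 0) (F := fun y e => suc (app1 (e 1) y))).
  + intros e He _; exists (tc (e 0)); split; [pose proof (He 0); dm |].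
    intros y (p & Hy); apply in_tc, (below_snd Hy).
  + dauto.
  + dauto.
Qed.

Definition name_over (C x : V) := is_name (fun p => p ∈ C) x.

Lemma d_name_over : D2 I D tru2 name_over.
Proof.
cut (D2 I D tru2 (fun x C => name_over C x)).
{ intros K; exact (dp_use2 K (df_var _ _ _ 1) (df_var _ _ _ 0) (fun _ _ _ => Logic.I)). }
apply (@dp_rec V A I D Dtrans HZ (fun _ => True) (fun e x => name_over (e 0) x)
  (fun x t e => forall z, z ∈ x -> exists p y, z = opair p y /\ p ∈ e 0 /\ y ∈ t)).
- intros e x He _ Hx; unfold name_over; rewrite is_name_eq.
  apply all_iff; intros z; split; intros H Hz; destruct (H Hz) as (p & y & -> & Hp & Hy); exists p, y; splits; auto.
  + apply (setof_bounded (fun y => below y x /\ is_name (fun p => p ∈ e 0) y) (tc x));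
      [intros w [Hw _]; apply in_tc, Hw | split; [exact (below_snd Hz) | exact Hy]].
  + apply (setof_bounded (fun y => below y x /\ is_name (fun p => p ∈ e 0) y) (tc x)) in Hy;
      [tauto | intros w [Hw _]; apply in_tc, Hw].
- dauto.
Qed.

Definition feq_set (C L p x y : V) := forces_eq (Pset C L) p x y.

(** The recursion runs on the first name alone; the condition and the second name vary inside a
    transitive set [X], so that at each name the relation is a set of pairs. *)
Lemma d_feq_set : D5 I D tru5 feq_set.
Proof.
pose (R := fun (X C L x : V) => setof (fun z => exists p y, z = opair p y /\ p ∈ X /\ y ∈ X /\ forces_eq (Pset C L) p x y)).
pose (H := fun (X C L x g : V) => setof (fun z => exists p y, z = opair p y /\ p ∈ X /\ y ∈ X /\
  feq_body (Pset C L) (fun r z w => opair r w ∈ app1 g z) p x y)).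
assert (forall X C L x p y, opair p y ∈ R X C L x <-> p ∈ X /\ y ∈ X /\ forces_eq (Pset C L) p x y) as ER.
{ intros X C L x p y; unfold R.
  rewrite (setof_bounded (fun z => exists p y, z = opair p y /\ p ∈ X /\ y ∈ X /\ forces_eq (Pset C L) p x y) (prod X X)).
  - split; [intros (p' & y' & E & K); apply opair_inj in E as [-> ->]; exact K | eauto].
  - intros w (p' & y' & -> & K1 & K2 & _); apply opair_in_prod; auto. }
assert (Df (fun e => is_transitive (e 1) /\ subset (e 2) (e 1)) (fun e => R (e 1) (e 2) (e 3) (e 0))) as FR.
{ apply (@df_rec V A I D Dtrans HZ (fun e => is_transitive (e 0) /\ subset (e 1) (e 0))
    (fun e x => R (e 0) (e 1) (e 2) x) (fun x g e => H (e 0) (e 1) (e 2) x g)).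
  - intros e x He [T S] Hx; unfold R at 1, H; apply setof_ext; intros z.
    apply ex_iff; intros p; apply ex_iff; intros y.
    apply and_iff_compat_l; rewrite forces_eq_eq; unfold feq_body; simpl.
    assert (forall u v z, opair u v ∈ z -> z ∈ e 0 -> v ∈ e 0) as K.
    { intros u v z' Hz Hz'; apply (below_transitive _ T); apply below_trans with z';
        eauto using below_snd, below_mem. }
    split; intros (Hp & Hy & H1 & H2); splits; auto; simpl in *.
    + intros s w q Hs Q1 Q2 Q3; destruct (H1 s w q Hs Q1 Q2 Q3) as (r & t & v & G1 & G2 & G3 & G4 & G5).
      exists r, t, v; splits; auto; rewrite app1_graph by (apply in_tc, (below_snd Hs)).
      apply ER; splits; eauto.
    + intros t w q Hs Q1 Q2 Q3; destruct (H2 t w q Hs Q1 Q2 Q3) as (r & s & v & G1 & G2 & G3 & G4 & G5).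
      exists r, s, v; splits; auto; rewrite app1_graph by (apply in_tc, (below_snd G3)).
      apply ER; splits; eauto.
    + intros s w q Hs Q1 Q2 Q3; destruct (H1 s w q Hs Q1 Q2 Q3) as (r & t & v & G1 & G2 & G3 & G4 & G5).
      exists r, t, v; splits; auto; rewrite app1_graph in G5 by (apply in_tc, (below_snd Hs)).
      apply ER in G5; tauto.
    + intros t w q Hs Q1 Q2 Q3; destruct (H2 t w q Hs Q1 Q2 Q3) as (r & s & v & G1 & G2 & G3 & G4 & G5).
      exists r, s, v; splits; auto; rewrite app1_graph in G5 by (apply in_tc, (below_snd G3)).
      apply ER in G5; tauto.
  - unfold H; apply (df_setof Dtrans HZ).
    + intros e He _; exists (prod (e 2) (e 2)); split; [pose proof (He 2); dm |].
      intros w (p' & y' & -> & K1 & K2 & _); apply opair_in_prod; auto.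
    + unfold feq_body; simpl; dauto. }
dgoal; apply dp_ext with (fun e =>
   opair (e 2) (e 4) ∈ R (tc (opair (e 0) (opair (e 2) (e 4)))) (e 0) (e 1) (e 3)).
- intros e He _; rewrite ER; unfold feq_set.
  assert (forall z, below z (opair (e 2) (e 4)) -> z ∈ tc (opair (e 0) (opair (e 2) (e 4)))) as K.
  { intros z Hz; apply in_tc, below_trans with (opair (e 2) (e 4)); [exact Hz | apply below_snd']. }
  split; [tauto |]; intros K'; splits; auto; apply K; [apply below_fst' | apply below_snd'].
- dstep; [dauto |].
  refine (df_substs (ts := [fun e => e 3; fun e => tc (opair (e 0) (opair (e 2) (e 4))); fun e => e 0; fun e => e 1])
    _ FR _).
  + simpl; intros t Ht; decompose [or] Ht; subst; try tauto; dauto.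
  + intros e _ _; simpl; split; [apply tc_transitive |].
    intros z Hz; apply in_tc, below_trans with (e 0); [apply below_mem, Hz | apply below_fst'].
Qed.

Lemma dp_forces_eq G (P : (nat -> V) -> poset V) C t1 t2 t3 : Df G C ->
  (forall e q, ok e -> G e -> (cond (P e) q <-> q ∈ C e)) ->
  Dp (fun e => G (tl2 e)) (fun e => le (P (tl2 e)) (e 0) (e 1)) ->
  Df G t1 -> Df G t2 -> Df G t3 -> Dp G (fun e => forces_eq (P e) (t1 e) (t2 e) (t3 e)).
Proof.
intros HC HP HL H1 H2 H3; pose proof d_feq_set.
pose (X := fun e => tc (opair (C e) (opair (t1 e) (opair (t2 e) (t3 e))))).
pose (L := fun e => setof (fun z => z ∈ prod (X e) (X e) /\ exists p q, z = opair p q /\ le (P e) p q)).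
apply dp_ext with (fun e => feq_set (C e) (L e) (t1 e) (t2 e) (t3 e)).
- intros e He Ge; unfold feq_set; symmetry; apply forces_eq_restrict with (X e).
  + apply tc_transitive.
  + intros q; apply HP; assumption.
  + intros q Hq; apply HP in Hq; auto; apply in_tc, below_trans with (C e); [apply below_mem, Hq | apply below_fst'].
  + intros q s Hq Hs; simpl; unfold L.
    rewrite (setof_bounded (fun z => z ∈ prod (X e) (X e) /\ exists p q, z = opair p q /\ le (P e) p q)
      (prod (X e) (X e))) by tauto.
    rewrite opair_in_prod; split.
    * intros K; splits; eauto.
      apply HP in Hq; auto; apply in_tc, below_trans with (C e); [apply below_mem, Hq | apply below_fst'].
    * intros (_ & p & q' & E & K); apply opair_inj in E as [-> ->]; exact K.
  + apply in_tc; eapply below_trans; [apply below_fst' | apply below_snd'].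
  + apply in_tc; eapply below_trans; [eapply below_trans; [apply below_fst' | apply below_snd'] | apply below_snd'].
  + apply in_tc; eapply below_trans; [eapply below_trans; [apply below_snd' | apply below_snd'] | apply below_snd'].
- assert (Df G X) as FX by (unfold X; dauto; assumption).
  eapply dp_use5; [exact H | | | | | | intros; exact Logic.I]; try assumption.
  unfold L; apply (df_setof Dtrans HZ).
  + intros e He Ge; exists (prod (X e) (X e)); split; [| tauto].
    pose proof (proj1 FX e He Ge); dm.
  + pose proof (df_tl FX) as FX'.
    dstep; [dstep; [dauto | dstep; exact FX'] |].
    dstep; dstep; dstep; [dauto |].
    apply dp_weaken with (fun e => G (fun n => e (3 + n))); [tauto |].
    exact (dp_rename (fun n => match n with 0 => 1 | 1 => 0 | Datatypes.S (Datatypes.S n) => 3 + n end) HL).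
Qed.

End DefinableNames.

(** * Codes of the stages of the iteration *)

#[export] Hint Resolve f_dpair f_check f_uncheck f_oadd f_name_rank d_name_over d_feq_set : dfn.

Ltac dm_hook ::=
  match goal with
  | T : transitive_class ?D, H : opair ?s (dpair ?x ?y) ∈ ?v |- ?D ?x =>
      apply (D_dpair_l T (x := x) (y := y)); apply (D_opair2 T H); solve [dm]
  | T : transitive_class ?D, H : opair ?s (dpair ?y ?x) ∈ ?v |- ?D ?x =>
      apply (D_dpair_r T (x := y) (y := x)); apply (D_opair2 T H); solve [dm]
  | T : transitive_class ?D, H : opair ?s (dpair (check ?x) ?y) ∈ ?v |- ?D ?x =>
      eapply D_check; [exact T | eassumption |]; apply (D_dpair_l T (x := check x) (y := y)); apply (D_opair2 T H); solve [dm]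
  | T : transitive_class ?D, H : ?z = opair ?r (dpair ?y ?x) |- ?D ?x =>
      apply (D_dpair_r T (x := y) (y := x)); apply (D_opairr T (x := r) (y := dpair y x)); rewrite <- H; solve [dm]
  | T : transitive_class ?D, H : ?z = opair ?r (dpair (check ?x) ?y) |- ?D ?x =>
      eapply D_check; [exact T | eassumption |];
      apply (D_dpair_l T (x := check x) (y := y)); apply (D_opairr T (x := r) (y := dpair (check x) y)); rewrite <- H; solve [dm]
  end.

Section Decode.
Context {V : universe}.
Implicit Types s b p q x y : V.

Definition no_stage : stage V := Stage (Poset (fun _ => False) (fun _ _ => False)) (fun _ => False).

Definition in_dom s b := exists C Q, opair b (opair C Q) ∈ s.
Definition cset s b := setof (fun q => exists C Q, opair b (opair C Q) ∈ s /\ q ∈ C).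
Definition qset s b := setof (fun q => exists C Q, opair b (opair C Q) ∈ s /\ q ∈ Q).

Lemma in_cset s b q : q ∈ cset s b <-> exists C Q, opair b (opair C Q) ∈ s /\ q ∈ C.
Proof.
apply (setof_bounded (fun q => exists C Q, opair b (opair C Q) ∈ s /\ q ∈ C) (tc s)).
intros z (C & Q & H & Hz); apply in_tc, below_trans with C; [apply below_mem, Hz |].
apply below_trans with (opair C Q); [apply below_fst' | exact (below_snd H)].
Qed.

Lemma in_qset s b q : q ∈ qset s b <-> exists C Q, opair b (opair C Q) ∈ s /\ q ∈ Q.
Proof.
apply (setof_bounded (fun q => exists C Q, opair b (opair C Q) ∈ s /\ q ∈ Q) (tc s)).
intros z (C & Q & H & Hz); apply in_tc, below_trans with Q; [apply below_mem, Hz |].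
apply below_trans with (opair C Q); [apply below_snd' | exact (below_snd H)].
Qed.

(** A sequence of stages up to [b] is coded by the set [s] of the
    triples (index, conditions, elements of [Q]); the order is not coded, as it
    is defined from the earlier stages, and on all sets. *)
Definition decode s : V -> stage V :=
  mem_rec no_stage (fun b rec =>
    if excluded_middle_informative (in_dom s b)
    then Stage (Poset (fun q => q ∈ cset s b) (iter_le rec)) (fun y => y ∈ qset s b)
    else no_stage).

Lemma decode_cond s b q : cond (decode s b) q <-> q ∈ cset s b.
Proof.
unfold decode; rewrite mem_rec_eq; destruct excluded_middle_informative as [H | N]; simpl; [tauto |].
rewrite in_cset; split; [tauto | intros (C & Q & H & _); apply N; exists C, Q; exact H].
Qed.

Lemma decode_Q s b y : stage_Q (decode s b) y <-> y ∈ qset s b.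
Proof.
unfold decode; rewrite mem_rec_eq; destruct excluded_middle_informative as [H | N]; simpl; [tauto |].
rewrite in_qset; split; [tauto | intros (C & Q & H & _); apply N; exists C, Q; exact H].
Qed.

Lemma forces_le_local (st st' : V -> stage V) h r u v : st h = st' h ->
  forces_le st h r u v -> forces_le st' h r u v.
Proof. unfold forces_le; intros ->; auto. Qed.

Lemma forces_le_no_stage (st : V -> stage V) h r u v : st h = no_stage -> forces_le st h r u v.
Proof.
unfold forces_le, forces_sub; intros ->; simpl; unfold limit_case.
destruct excluded_middle_informative; simpl; tauto.
Qed.

(** The restriction to [h] below [b] costs nothing: elsewhere the recursion returns [no_stage],
    which has no conditions and so forces everything. *)
Lemma decode_le s b p q : le (decode s b) p q <-> in_dom s b /\
  forall h v, opair h v ∈ q -> below h b -> forces_le (decode s) h (restrict p h) (coord p h) v.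
Proof.
unfold decode at 1; rewrite mem_rec_eq; destruct excluded_middle_informative as [H | N]; simpl; [| tauto].
unfold iter_le; split.
- intros K; split; [exact H |]; intros h v Hv Hb; eapply forces_le_local; [| exact (K h v Hv)]; cbv beta.
  destruct excluded_middle_informative; [reflexivity | contradiction].
- intros [_ K] h v Hv; destruct (classic (below h b)) as [Hb | Hb].
  + eapply forces_le_local; [| exact (K h v Hv Hb)]; cbv beta.
    destruct excluded_middle_informative; [reflexivity | contradiction].
  + apply forces_le_no_stage; cbv beta; destruct excluded_middle_informative; [contradiction | reflexivity].
Qed.

Section Restrict.
Variables (P P' : poset V) (X : V).
Hypothesis (T : is_transitive X) (HC : forall q, cond P q <-> cond P' q)
  (HX : forall q, cond P q -> q ∈ X)
  (HL : forall q s, cond P q -> s ∈ X -> (le P q s <-> le P' q s)).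

Lemma below_in x y : below x y -> y ∈ X -> x ∈ X.
Proof.
intros H Hy; apply (below_transitive _ T), below_trans with y; [exact H | apply below_mem, Hy].
Qed.

Lemma forces_mem_restrict p x y : p ∈ X -> x ∈ X -> y ∈ X -> forces_mem P p x y -> forces_mem P' p x y.
Proof.
intros Hp Hx Hy H q Hq1 Hq2; apply HC in Hq1; apply HL in Hq2; auto.
destruct (H q Hq1 Hq2) as (r & t & w & Hr1 & Hr2 & Ht & Hr3 & E).
assert (t ∈ X) by (apply below_in with y; [exact (below_fst Ht) | exact Hy]).
assert (w ∈ X) by (apply below_in with y; [exact (below_snd Ht) | exact Hy]).
exists r, t, w; rewrite <- HC, <- !HL by auto; splits; auto.
apply (@forces_eq_transfer V P P' X T HC HX HL x r w); auto.
Qed.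

Lemma forces_sub_restrict p x y : p ∈ X -> x ∈ X -> y ∈ X -> forces_sub P p x y -> forces_sub P' p x y.
Proof.
intros Hp Hx Hy H s z q Hs Hq1 Hq2 Hq3.
assert (s ∈ X) by (apply below_in with x; [exact (below_fst Hs) | exact Hx]).
assert (z ∈ X) by (apply below_in with x; [exact (below_snd Hs) | exact Hx]).
apply HC in Hq1; apply HL in Hq2, Hq3; auto.
apply forces_mem_restrict; eauto.
Qed.

Lemma forces_le_restrict (st st' : V -> stage V) h r u v :
  stage_poset (st h) = P -> stage_poset (st' h) = P' -> r ∈ X -> u ∈ X -> v ∈ X ->
  forces_le st h r u v -> forces_le st' h r u v.
Proof.
unfold forces_le; intros -> -> Hr Hu Hv; unfold limit_case; destruct excluded_middle_informative as [Lim | Lim].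
- intros H s i y q Hs Hq1 Hq2 Hq3.
  assert (s ∈ X) by (apply below_in with v; [exact (below_fst Hs) | exact Hv]).
  assert (y ∈ X).
  { apply below_in with v; [| exact Hv]; apply below_trans with (dpair (check i) y);
      [apply below_dpair_r | exact (below_snd Hs)]. }
  apply HC in Hq1; apply HL in Hq2, Hq3; auto.
  destruct (H s i y q Hs Hq1 Hq2 Hq3) as (q' & s' & y' & Hq1' & Hq2' & Hs' & Hq3' & E).
  assert (s' ∈ X) by (apply below_in with u; [exact (below_fst Hs') | exact Hu]).
  assert (y' ∈ X).
  { apply below_in with u; [| exact Hu]; apply below_trans with (dpair (check i) y');
      [apply below_dpair_r | exact (below_snd Hs')]. }
  exists q', s', y'; rewrite <- HC, <- !HL by auto; splits; auto.
  apply forces_sub_restrict; auto.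
- apply forces_sub_restrict; auto.
Qed.

End Restrict.

Lemma forces_le_restrict_iff (P P' : poset V) X (st st' : V -> stage V) h r u v :
  is_transitive X -> (forall q, cond P q <-> cond P' q) ->
  (forall q, cond P q -> q ∈ X) ->
  (forall q s, cond P q -> s ∈ X -> (le P q s <-> le P' q s)) ->
  stage_poset (st h) = P -> stage_poset (st' h) = P' -> r ∈ X -> u ∈ X -> v ∈ X ->
  (forces_le st h r u v <-> forces_le st' h r u v).
Proof.
intros T HC HX HL E E' Hr Hu Hv; split.
- apply (forces_le_restrict T HC HX HL E E' Hr Hu Hv).
- apply (@forces_le_restrict P' P X T (fun q => iff_sym (HC q))); auto.
  + intros q Hq; apply HX, HC, Hq.
  + intros q s Hq Hs; symmetry; apply HL; [apply HC, Hq | exact Hs].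
Qed.

Definition fle (C L h r u v : V) : Prop := forces_le (fun _ => Stage (Pset C L) (fun _ => False)) h r u v.

Lemma in_restrict p b z : z ∈ restrict p b <-> z ∈ p /\ exists g u, z = opair g u /\ g ∈ b.
Proof. apply (setof_bounded (fun z => z ∈ p /\ exists g u, z = opair g u /\ g ∈ b) p); tauto. Qed.

Lemma in_coord p b z : z ∈ coord p b <-> exists u, opair b u ∈ p /\ z ∈ u.
Proof.
apply (setof_bounded (fun z => exists u, opair b u ∈ p /\ z ∈ u) (cup (cup (cup p)))).
intros w (u & Hu & Hw); apply in_cup; exists u; split; [exact (in_opair_snd Hu) | exact Hw].
Qed.

End Decode.

Lemma and_iff_compat_l' (P Q R : Prop) : (P -> (Q <-> R)) -> (P /\ Q <-> P /\ R).
Proof. tauto. Qed.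

Section DecodeDefinable.
Context {V : universe} {A : Type} (I : A -> V -> Prop) (D : V -> Prop).
Context (Dtrans : transitive_class D) (HZ : models_ZFC D I).
Notation tl e := (fun n => e (Datatypes.S n)).
Notation tl2 e := (fun n => e (Datatypes.S (Datatypes.S n))).
Notation Dp := (Dp I D).
Notation Df := (Df I D).
Notation ok := (over_D D).

Lemma f_restrict : F2 I D tru2 (@restrict V).
Proof.
dgoal; unfold restrict; apply (df_setof Dtrans HZ); [| dauto].
intros e He _; exists (e 0); split; [apply He | tauto].
Qed.

Lemma f_coord : F2 I D tru2 (@coord V).
Proof.
dgoal; unfold coord; apply (df_setof Dtrans HZ); [| dauto].
intros e He _; exists (cup (cup (cup (e 0)))); split; [pose proof (He 0); dm |].
  intros x (u & Hu & Hx); apply in_cup; exists u; split; [exact (in_opair_snd Hu) | exact Hx].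
Qed.

Lemma f_cset : F2 I D tru2 (@cset V).
Proof.
dgoal; unfold cset; apply (df_setof Dtrans HZ).
- intros e He _; exists (tc (e 0)); split; [pose proof (He 0); dm |].
  intros z (C & Q & H & Hz); apply in_tc, below_trans with C; [apply below_mem, Hz |].
  apply below_trans with (opair C Q); [apply below_fst' | exact (below_snd H)].
- dstep; [intros e C He _ (Q & H' & _); pose proof (He 1); pose proof (D_opair2 Dtrans H' ltac:(assumption)) as K; exact (D_opairl Dtrans K) |].
  dstep; [intros e Q He _ (H' & _); pose proof (He 2); pose proof (D_opair2 Dtrans H' ltac:(assumption)) as K; exact (D_opairr Dtrans K) |].
  dauto.
Qed.

Lemma f_qset : F2 I D tru2 (@qset V).
Proof.
dgoal; unfold qset; apply (df_setof Dtrans HZ).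
- intros e He _; exists (tc (e 0)); split; [pose proof (He 0); dm |].
  intros z (C & Q & H & Hz); apply in_tc, below_trans with Q; [apply below_mem, Hz |].
  apply below_trans with (opair C Q); [apply below_snd' | exact (below_snd H)].
- dstep; [intros e C He _ (Q & H' & _); pose proof (He 1); pose proof (D_opair2 Dtrans H' ltac:(assumption)) as K; exact (D_opairl Dtrans K) |].
  dstep; [intros e Q He _ (H' & _); pose proof (He 2); pose proof (D_opair2 Dtrans H' ltac:(assumption)) as K; exact (D_opairr Dtrans K) |].
  dauto.
Qed.

Lemma d_in_dom : D2 I D tru2 (@in_dom V).
Proof.
dgoal; unfold in_dom.
dstep; [intros e C He _ (Q & H'); pose proof (He 0); pose proof (D_opair2 Dtrans H' ltac:(assumption)) as K; exact (D_opairl Dtrans K) |].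
dstep; [intros e Q He _ H'; pose proof (He 1); pose proof (D_opair2 Dtrans H' ltac:(assumption)) as K; exact (D_opairr Dtrans K) |].
dauto.
Qed.

Lemma d_fle : D6 I D tru6 (@fle V).
Proof.
dgoal; unfold fle, forces_le, forces_sub, forces_mem; simpl stage_poset.
change (Dp (fun _ => True) (fun e => limit_case (e 2)
  (forall s i y q, opair s (dpair (check i) y) ∈ e 5 -> q ∈ e 0 -> opair q (e 3) ∈ e 1 -> opair q s ∈ e 1 ->
    exists q' s' y', q' ∈ e 0 /\ opair q' q ∈ e 1 /\ opair s' (dpair (check i) y') ∈ e 4 /\ opair q' s' ∈ e 1 /\
    forall s z q, opair s z ∈ y -> q ∈ e 0 -> opair q q' ∈ e 1 -> opair q s ∈ e 1 ->
      forall q0, q0 ∈ e 0 -> opair q0 q ∈ e 1 ->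
        exists r t w, r ∈ e 0 /\ opair r q0 ∈ e 1 /\ opair t w ∈ y' /\ opair r t ∈ e 1 /\ feq_set (e 0) (e 1) r z w)
  (forall s z q, opair s z ∈ e 5 -> q ∈ e 0 -> opair q (e 3) ∈ e 1 -> opair q s ∈ e 1 ->
      forall q0, q0 ∈ e 0 -> opair q0 q ∈ e 1 ->
        exists r t w, r ∈ e 0 /\ opair r q0 ∈ e 1 /\ opair t w ∈ e 4 /\ opair r t ∈ e 1 /\ feq_set (e 0) (e 1) r z w))).
dauto.
Qed.

Local Hint Resolve f_restrict f_coord f_cset f_qset d_in_dom d_fle : dfn.

(** On such an [X] the recursion for the orders closes up: comparing conditions from [X] involves
    only their restrictions and coordinates, which are again in [X]. *)
Definition closed_for (X s : V) := is_transitive X /\ (forall b, D b -> forall q, q ∈ cset s b -> q ∈ X) /\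
  (forall p, p ∈ X -> forall h, D h -> restrict p h ∈ X /\ coord p h ∈ X).

Lemma closed_for_exists p q s : D p -> D q -> D s -> exists X, D X /\ closed_for X s /\ p ∈ X /\ q ∈ X.
Proof.
intros Hp Hq Hs.
pose (F := fun x : V => join x (join (powD D x) (powD D (cup (cup (cup x)))))).
destruct (@D_closure V A I D Dtrans HZ (fun _ => True) (fun x _ => F x)) with
  (e := fun _ : nat => p) (X0 := join (upair p q) (tc s)) as (X & HX & H0 & HF).
- unfold F; dauto.
- intros n; exact Hp.
- exact Logic.I.
- dm.
- assert (is_transitive X) as T by (intros x Hx z Hz; apply (HF x Hx); apply in_join; auto).
  exists X; split; [exact HX |]; splits.
  + split; [exact T | split].
    * intros b Hb z Hz; apply H0, in_join; right; apply in_tc.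
      apply in_cset in Hz as (C & Q & H & Hz); apply below_trans with C; [apply below_mem, Hz |].
      apply below_trans with (opair C Q); [apply below_fst' | exact (below_snd H)].
    * intros x Hx h Hh; pose proof (Dtrans HX Hx); split; apply (HF x Hx); apply in_join; right; apply in_join.
      -- left; apply in_powD; split; [dm |]; intros z Hz; apply in_restrict in Hz; tauto.
      -- right; apply in_powD; split; [dm |]; intros z Hz; apply in_coord in Hz as (u & Hu & Hz).
         apply in_cup; exists u; split; [exact (in_opair_snd Hu) | exact Hz].
  + apply H0, in_join; left; apply in_upair; auto.
  + apply H0, in_join; left; apply in_upair; auto.
Qed.

Definition LX (X s b : V) := setof (fun z => z ∈ prod X X /\ exists p q, z = opair p q /\ le (decode s b) p q).

Lemma in_LX X s b p q : opair p q ∈ LX X s b <-> p ∈ X /\ q ∈ X /\ le (decode s b) p q.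
Proof.
unfold LX; rewrite (setof_bounded (fun z => z ∈ prod X X /\ exists p q, z = opair p q /\ le (decode s b) p q)
  (prod X X)) by tauto.
rewrite opair_in_prod; split.
- intros ((H1 & H2) & p' & q' & E & H); apply opair_inj in E as [-> ->]; auto.
- intros (H1 & H2 & H3); eauto 6.
Qed.

(** The order at [b] compares the coordinates at [h] by means of the order at [h], and [forces_le]
    consults that order only within [X]. So the orders cut down to [X] obey a recursion between
    sets, although each full order is defined on all sets. *)
Lemma LX_eq X s b : closed_for X s -> D X -> D b ->
  LX X s b = setof (fun z => z ∈ prod X X /\ exists p q, z = opair p q /\ in_dom s b /\
    forall h v, opair h v ∈ q -> below h b ->
      fle (cset s h) (app1 (graph (LX X s) (tc b)) h) h (restrict p h) (coord p h) v).
Proof.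
intros (T & HC & HR) HX Hb; apply setof_ext; intros z; apply and_iff_compat_l'; intros Hz.
apply ex_iff; intros p; apply ex_iff; intros q; apply and_iff_compat_l'; intros ->.
apply opair_in_prod in Hz as [Hp Hq]; rewrite decode_le; apply and_iff_compat_l.
apply all_iff; intros h; apply all_iff; intros v.
assert (forall Hv : opair h v ∈ q, below h b -> (forces_le (decode s) h (restrict p h) (coord p h) v <->
  fle (cset s h) (app1 (graph (LX X s) (tc b)) h) h (restrict p h) (coord p h) v)) as E.
{ intros Hv Hh; rewrite app1_graph by (apply in_tc, Hh).
  assert (D h) as Dh by exact (D_below Dtrans Hh Hb).
  destruct (HR p Hp h Dh) as [K1 K2].
  assert (v ∈ X) as Kv by (apply (below_in T (y := q)); [exact (below_snd Hv) | exact Hq]).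
  apply (@forces_le_restrict_iff V (decode s h) (Pset (cset s h) (LX X s h)) X); auto; simpl.
  - intros r; apply decode_cond.
  - intros r Hr; apply decode_cond in Hr; exact (HC h Dh r Hr).
  - intros r t Hr Ht; apply decode_cond in Hr; rewrite in_LX; split; [| tauto]; intros K; splits; auto; exact (HC h Dh r Hr). }
split; intros H Hv Hh; apply (E Hv Hh), H; assumption.
Qed.

Lemma f_LX : F3 I D (fun X s b => closed_for X s) LX.
Proof.
assert (Df (fun e => closed_for (e 1) (e 2)) (fun e => LX (e 1) (e 2) (e 0))) as F.
{ apply (@df_rec V A I D Dtrans HZ (fun e => closed_for (e 0) (e 1)) (fun e b => LX (e 0) (e 1) b)
    (fun b g e => setof (fun z => z ∈ prod (e 0) (e 0) /\ exists p q, z = opair p q /\ in_dom (e 1) b /\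
    forall h v, opair h v ∈ q -> below h b ->
      fle (cset (e 1) h) (app1 g h) h (restrict p h) (coord p h) v))).
  - intros e b He HX Hb; apply LX_eq; auto.
  - apply (df_setof Dtrans HZ).
    + intros e He _; exists (prod (e 2) (e 2)); split; [pose proof (He 2); dm | tauto].
    + dauto. }
refine (df_substs (ts := [fun e => e 2; fun e => e 0; fun e => e 1]) _ F _).
- simpl; intros t Ht; decompose [or] Ht; subst; try tauto; dauto.
- intros e _ H; exact H.
Qed.
Local Hint Resolve f_LX : dfn.

Definition sle (s b p q : V) : Prop := le (decode s b) p q.

(** Any two conditions lie in some closed [X], and the verdict of [LX] does not depend on the choice
    of [X]. *)
Lemma d_sle : D4 I D tru4 sle.
Proof.
dgoal; apply dp_ext with (fun e => exists X, D X /\ closed_for X (e 0) /\ opair (e 2) (e 3) ∈ LX X (e 0) (e 1)).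
- intros e He _; unfold sle; split.
  + intros (X & _ & _ & H); apply in_LX in H; tauto.
  + intros H; destruct (@closed_for_exists (e 2) (e 3) (e 0)) as (X & HX & HX' & K1 & K2); auto.
    exists X; split; [exact HX | split; [exact HX' |]]; apply in_LX; auto.
- unfold closed_for; dauto.
  intros e He H; destruct_all; unfold closed_for; auto.
Qed.

Definition scond (s b q : V) : Prop := cond (decode s b) q.
Definition sQ (s b y : V) : Prop := stage_Q (decode s b) y.
Definition sfeq (s b p x y : V) : Prop := forces_eq (decode s b) p x y.
Definition sfmem (s b p x y : V) : Prop := forces_mem (decode s b) p x y.
Definition sfsub (s b p x y : V) : Prop := forces_sub (decode s b) p x y.
Definition sfle (s b r u v : V) : Prop := forces_le (decode s) b r u v.

Lemma d_scond : D3 I D tru3 scond.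
Proof.
dgoal; apply dp_ext with (fun e => e 2 ∈ cset (e 0) (e 1)); [| dauto].
intros e _ _; symmetry; apply decode_cond.
Qed.

Lemma d_sQ : D3 I D tru3 sQ.
Proof.
dgoal; apply dp_ext with (fun e => e 2 ∈ qset (e 0) (e 1)); [| dauto].
intros e _ _; symmetry; apply decode_Q.
Qed.
Local Hint Resolve d_sle d_scond d_sQ : dfn.

Lemma d_sfeq : D5 I D tru5 sfeq.
Proof.
dgoal; unfold sfeq; apply (dp_forces_eq Dtrans HZ (C := fun e => cset (e 0) (e 1)) (P := fun e => decode (e 0) (e 1)));
  try dauto.
- intros e q _ _; apply decode_cond.
- change (Dp (fun _ => True) (fun e => sle (e 2) (e 3) (e 0) (e 1))); dauto.
Qed.
Local Hint Resolve d_sfeq : dfn.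

Lemma scond_D s b q : scond s b q -> D s -> D q.
Proof.
intros H Hs; apply decode_cond, in_cset in H as (C & Q & H & Hq); apply (D_below Dtrans (y := s)); [| exact Hs].
apply below_trans with C; [apply below_mem, Hq |].
apply below_trans with (opair C Q); [apply below_fst' | exact (below_snd H)].
Qed.

Lemma sQ_D s b q : sQ s b q -> D s -> D q.
Proof.
intros H Hs; apply decode_Q, in_qset in H as (C & Q & H & Hq); apply (D_below Dtrans (y := s)); [| exact Hs].
apply below_trans with Q; [apply below_mem, Hq |].
apply below_trans with (opair C Q); [apply below_snd' | exact (below_snd H)].
Qed.
Hint Resolve scond_D sQ_D : guard.

Lemma d_sfmem : D5 I D tru5 sfmem.
Proof.
dgoal; change (Dp (fun _ => True) (fun e => forall q, scond (e 0) (e 1) q -> sle (e 0) (e 1) q (e 2) ->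
    exists r t w, scond (e 0) (e 1) r /\ sle (e 0) (e 1) r q /\ opair t w ∈ e 4 /\ sle (e 0) (e 1) r t /\
      sfeq (e 0) (e 1) r (e 3) w)).
dauto.
Qed.
Local Hint Resolve d_sfmem : dfn.

Lemma d_sfsub : D5 I D tru5 sfsub.
Proof.
dgoal; change (Dp (fun _ => True) (fun e => forall s z q, opair s z ∈ e 3 -> scond (e 0) (e 1) q ->
  sle (e 0) (e 1) q (e 2) -> sle (e 0) (e 1) q s -> sfmem (e 0) (e 1) q z (e 4))).
dauto.
Qed.
Local Hint Resolve d_sfsub : dfn.

Lemma d_sfle : D5 I D tru5 sfle.
Proof.
dgoal; change (Dp (fun _ => True) (fun e => limit_case (e 1)
  (forall s i y q, opair s (dpair (check i) y) ∈ e 4 ->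
       scond (e 0) (e 1) q -> sle (e 0) (e 1) q (e 2) -> sle (e 0) (e 1) q s ->
       exists q' s' y', scond (e 0) (e 1) q' /\ sle (e 0) (e 1) q' q /\
         opair s' (dpair (check i) y') ∈ e 3 /\ sle (e 0) (e 1) q' s' /\
         sfsub (e 0) (e 1) q' y y')
    (sfsub (e 0) (e 1) (e 2) (e 4) (e 3)))).
dauto.
Qed.

End DecodeDefinable.

#[export] Hint Resolve f_restrict f_coord f_cset f_qset d_in_dom d_sle d_scond d_sQ d_sfeq d_sfmem d_sfsub d_sfle : dfn.
#[export] Hint Resolve d_bounded_perm f_SC f_prodSC d_perm_sequence f_S f_group d_generator f_index f_move d_in_filter : dfn.
#[export] Hint Resolve prodSC_fun prodSC_in SC_ord SC_trans group_seq index_limit move_fun move_index : guard.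

Section Projections.
Context {V : universe}.
Definition pfst (z : V) := setof (fun w => exists x y, z = opair x y /\ w ∈ x).
Definition psnd (z : V) := setof (fun w => exists x y, z = opair x y /\ w ∈ y).

Lemma pfst_opair (x y : V) : pfst (opair x y) = x.
Proof.
unfold pfst; transitivity (setof (fun w => w ∈ x)); [| apply setof_mem]; apply setof_ext; intros w; split; [| eauto].
intros (x' & y' & E & H); apply opair_inj in E as [-> _]; exact H.
Qed.

Lemma psnd_opair (x y : V) : psnd (opair x y) = y.
Proof.
unfold psnd; transitivity (setof (fun w => w ∈ y)); [| apply setof_mem]; apply setof_ext; intros w; split; [| eauto].
intros (x' & y' & E & H); apply opair_inj in E as [_ ->]; exact H.
Qed.

Context {A : Type} (I : A -> V -> Prop) (D : V -> Prop).
Context (Dtrans : transitive_class D) (HZ : models_ZFC D I).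

Lemma f_pfst : F1 I D tru1 pfst.
Proof.
dgoal; unfold pfst; apply (df_setof Dtrans HZ); [| dauto].
intros e He _; exists (tc (e 0)); split; [pose proof (He 0); dm |].
intros w (x & y & -> & Hw); apply in_tc, below_trans with x; [apply below_mem, Hw | apply below_fst'].
Qed.

Lemma f_psnd : F1 I D tru1 psnd.
Proof.
dgoal; unfold psnd; apply (df_setof Dtrans HZ); [| dauto].
intros e He _; exists (tc (e 0)); split; [pose proof (He 0); dm |].
intros w (x & y & -> & Hw); apply in_tc, below_trans with y; [apply below_mem, Hw | apply below_snd'].
Qed.

Definition img (F : V -> V) (X : V) := setof (fun z => exists x, x ∈ X /\ z = F x).

Lemma in_img F X z : z ∈ img F X <-> exists x, x ∈ X /\ z = F x.
Proof. apply (in_image (fun x => x ∈ X) F X); auto. Qed.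

Lemma df_img G (F : V -> (nat -> V) -> V) X : Df I D G X ->
  Df I D (fun e => G (fun n => e (Datatypes.S n)) /\ e 0 ∈ X (fun n => e (Datatypes.S n)))
    (fun e => F (e 0) (fun n => e (Datatypes.S n))) ->
  Df I D G (fun e => img (fun x => F x e) (X e)).
Proof.
intros HX HF; unfold img; apply (df_image Dtrans HZ (G := G) (P := fun x e => x ∈ X e) (F := F)).
- intros e He Ge; exists (X e); split; [apply HX; assumption | auto].
- pose proof (df_tl HX); dstep; [dstep | assumption].
- exact HF.
Qed.

End Projections.
#[export] Hint Resolve f_pfst f_psnd : dfn.

(** * Full names, automorphisms and supports in coded form *)

Section Steps.
Context {V : universe} (W : V -> Prop) (S : V -> V).
Notation I := (seq_pred W S).
Context (Wtrans : transitive_class W) (HZ : models_ZFC W I).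
Context (HS : forall a, W a -> ord a ->
    (is_limit a -> permutable_scale W (aleph W a) (S a)) /\
    (~ is_limit a -> permutable_family W (aleph W a) (S a))).
Notation tl e := (fun n => e (Datatypes.S n)).
Notation tl2 e := (fun n => e (Datatypes.S (Datatypes.S n))).
Notation Dp := (Dp I W).
Notation Df := (Df I W).
Notation ok := (over_D W).
Implicit Types s b a t u x y z p q : V.

Lemma scond_W s b q : scond s b q -> W s -> W q.
Proof. exact (scond_D Wtrans (s := s) (b := b) (q := q)). Qed.
Lemma sQ_W s b q : sQ s b q -> W s -> W q.
Proof. exact (sQ_D Wtrans (s := s) (b := b) (q := q)). Qed.
Hint Resolve scond_W sQ_W : guard.

Definition svalue s b x : Prop := is_value W (decode s) b x.

Lemma svalue_below s b x : svalue s b x -> below x s.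
Proof.
intros (y & i & Hy & Hi & H); apply decode_Q, in_qset in Hy as (C & Q & H1 & H2).
apply below_trans with (dpair (check i) x); [apply below_dpair_r |].
apply below_trans with y; [exact (below_snd H) |].
apply below_trans with Q; [apply below_mem, H2 |].
apply below_trans with (opair C Q); [apply below_snd' | exact (below_snd H1)].
Qed.

Lemma d_svalue : D3 I W tru3 svalue.
Proof.
dgoal; change (Dp (fun _ => True) (fun e => exists y i, sQ (e 0) (e 1) y /\ i ∈ index W (e 1) /\
  opair empty (dpair (check i) (e 2)) ∈ y)).
dauto.
Qed.
Hint Resolve d_svalue : dfn.

Definition valset s b := setof (fun x => svalue s b x).

Lemma in_valset s b x : x ∈ valset s b <-> svalue s b x.
Proof.
apply (setof_bounded (fun x => svalue s b x) (tc s)); intros z Hz; apply in_tc, (svalue_below Hz).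
Qed.

Lemma f_valset : F2 I W tru2 valset.
Proof.
dgoal; unfold valset; apply (df_setof Wtrans HZ); [| dauto].
intros e He _; exists (tc (e 0)); split; [pose proof (He 0); dm |].
intros z Hz; apply in_tc, (svalue_below Hz).
Qed.
Hint Resolve f_valset : dfn.

Definition entries s b := prod (cset s b)
  (cup (img (fun i => img (fun x => dpair (check i) x) (valset s b)) (index W b))).

Lemma in_entries s b r i x : r ∈ cset s b -> i ∈ index W b -> svalue s b x ->
  opair r (dpair (check i) x) ∈ entries s b.
Proof.
intros Hr Hi Hx; apply opair_in_prod; split; [exact Hr | apply in_cup].
exists (img (fun x => dpair (check i) x) (valset s b)); split; apply in_img; [eauto |].
exists x; split; [apply in_valset, Hx | reflexivity].
Qed.

Lemma f_entries : F2 I W tru2 entries.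
Proof.
dgoal; unfold entries; dstep; [dauto | dstep].
apply (df_img Wtrans HZ (G := fun _ => True) (X := fun e => index W (e 1))
  (F := fun i e => img (fun x => dpair (check i) x) (valset (e 0) (e 1)))); [dauto |].
apply (df_img Wtrans HZ (G := fun e => True /\ e 0 ∈ index W (e 2)) (X := fun e => valset (e 1) (e 2))
  (F := fun x e => dpair (check (e 0)) x)); dauto.
Qed.
Hint Resolve f_entries : dfn.

Definition sfull s b y : V := full W (decode s) b y.

Lemma sfull_entries s b y : subset (sfull s b y) (entries s b) /\
  forall z, z ∈ sfull s b y <-> exists r i x, z = opair r (dpair (check i) x) /\
    scond s b r /\ i ∈ index W b /\ svalue s b x /\ sfmem s b r (dpair (check i) x) y.
Proof.
assert (forall z, (exists r i x, z = opair r (dpair (check i) x) /\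
    scond s b r /\ i ∈ index W b /\ svalue s b x /\ sfmem s b r (dpair (check i) x) y) -> z ∈ entries s b) as H.
{ intros z (r & i & x & -> & Hr & Hi & Hx & _); apply in_entries; auto; apply decode_cond, Hr. }
pose proof (setof_bounded (fun z => exists r i x, z = opair r (dpair (check i) x) /\
    scond s b r /\ i ∈ index W b /\ svalue s b x /\ sfmem s b r (dpair (check i) x) y) _ H) as E.
split; [| exact E]; intros z Hz; apply H, E, Hz.
Qed.

Lemma f_sfull : F3 I W tru3 sfull.
Proof.
dgoal; change (Df (fun _ => True) (fun e => setof (fun z => exists r i x, z = opair r (dpair (check i) x) /\
    scond (e 0) (e 1) r /\ i ∈ index W (e 1) /\ svalue (e 0) (e 1) x /\
    sfmem (e 0) (e 1) r (dpair (check i) x) (e 2)))).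
apply (df_setof Wtrans HZ); [| dauto].
intros e He _; exists (entries (e 0) (e 1)); split; [wside |].
intros z Hz; apply (sfull_entries (e 0) (e 1) (e 2)), sfull_entries, Hz.
Qed.
Hint Resolve f_sfull : dfn.

(** What the action of the permutation named by [t] depends on. *)
Definition decided s b t := setof (fun z => exists q p, z = opair q p /\ scond s b q /\
  p ∈ group W S b /\ sfeq s b q t (check p)).

Lemma in_decided s b t q p : opair q p ∈ decided s b t <-> scond s b q /\ p ∈ group W S b /\ sfeq s b q t (check p).
Proof.
unfold decided; rewrite (setof_bounded (fun z => exists q p, z = opair q p /\ scond s b q /\
  p ∈ group W S b /\ sfeq s b q t (check p)) (prod (cset s b) (group W S b))).
- split; [intros (q' & p' & E & H); apply opair_inj in E as [-> ->]; exact H | eauto].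
- intros z (q' & p' & -> & H1 & H2 & _); apply opair_in_prod; split; [apply decode_cond, H1 | exact H2].
Qed.

Lemma f_decided : F3 I W (fun _ b _ => ord b) decided.
Proof.
dgoal; unfold decided; apply (df_setof Wtrans HZ); [| dauto].
intros e He Hb; exists (prod (cset (e 0) (e 1)) (group W S (e 1))); split; [wside |].
intros z (q' & p' & -> & H1 & H2 & _); apply opair_in_prod; split; [apply decode_cond, H1 | exact H2].
Qed.
Hint Resolve f_decided : dfn.

Definition actd s b F u := setof (fun z => exists r j x, z = opair r (dpair (check j) x) /\
  scond s b r /\ j ∈ index W b /\ svalue s b x /\
  forall q, scond s b q -> sle s b q r ->
    exists q' p i, scond s b q' /\ sle s b q' q /\ p ∈ group W S b /\ i ∈ index W b /\
      opair q' p ∈ F /\ move W b p i = j /\ opair q' (dpair (check i) x) ∈ u).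

Lemma act_actd s b t u : act W S (decode s) b t u = actd s b (decided s b t) u.
Proof.
apply setof_ext; intros z; do 3 (apply ex_iff; intros ?).
do 4 apply and_iff_compat_l.
apply all_iff; intros q; apply all_iff; intros _; apply all_iff; intros _.
do 3 (apply ex_iff; intros ?); rewrite in_decided; unfold scond, sle, sfeq; tauto.
Qed.

Lemma f_actd : F4 I W (fun _ b _ _ => ord b) actd.
Proof.
dgoal; unfold actd; apply (df_setof Wtrans HZ).
- intros e He Hb; exists (entries (e 0) (e 1)); split; [wside |].
  intros z (r & i & x & -> & Hr & Hi & Hx & _); apply in_entries; auto; apply decode_cond, Hr.
- dauto.
Qed.
Hint Resolve f_actd : dfn.

Definition aut1d s b F : V -> V * V :=
  mem_rec (empty, empty) (fun x rec =>
    (setof (fun z => exists g u, opair g u ∈ x /\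
       ((g ∈ b /\ z = opair g u) \/
        (g = b /\ z = opair g (actd s b F u)) \/
        (b ∈ g /\ z = opair g (snd (rec u))))),
     setof (fun z => exists p y, opair p y ∈ x /\
       z = opair (fst (rec p)) (snd (rec y))))).

(** Names of permutations form a class, but a name acts only through [decided], a set of pairs of a
    condition and a group element. This leaves a set of possible actions at [b], which later bounds
    the elements of [Q]. *)
Lemma aut1_aut1d s b t : aut1 W S (decode s) b t = aut1d s b (decided s b t).
Proof.
assert (act W S (decode s) b t = actd s b (decided s b t)) as E by (extensionality u; apply act_actd).
unfold aut1, aut1d; rewrite E; reflexivity.
Qed.

Lemma aut1d_eq s b F x : aut1d s b F x =
    (setof (fun z => exists g u, opair g u ∈ x /\
       ((g ∈ b /\ z = opair g u) \/
        (g = b /\ z = opair g (actd s b F u)) \/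
        (b ∈ g /\ z = opair g (snd (aut1d s b F u))))),
     setof (fun z => exists p y, opair p y ∈ x /\
       z = opair (fst (aut1d s b F p)) (snd (aut1d s b F y)))).
Proof.
unfold aut1d at 1; rewrite mem_rec_below; [reflexivity |].
intros r r' E; f_equal; apply setof_ext; intros z; do 2 (apply ex_iff; intros ?);
  split; intros (H1 & H2); split; auto; rewrite ?(E _ (below_fst H1)), ?(E _ (below_snd H1)) in *; exact H2.
Qed.

(** The actions on conditions and on names are mutually recursive; packed into one set they fall
    under the recursion theorem for sets. *)
Definition autp s b F x := opair (fst (aut1d s b F x)) (snd (aut1d s b F x)).

Lemma f_autp : F4 I W (fun _ b _ _ => ord b) autp.
Proof.
pose (H1 := fun s b F x G => setof (fun z => exists g u, opair g u ∈ x /\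
       ((g ∈ b /\ z = opair g u) \/
        (g = b /\ z = opair g (actd s b F u)) \/
        (b ∈ g /\ z = opair g (psnd (app1 G u)))))).
pose (H2 := fun x G => setof (fun z => exists p y, opair p y ∈ x /\
       z = opair (pfst (app1 G p)) (psnd (app1 G y)))).
assert (F2 I W tru2 (fun x G => img (fun u => psnd (app1 G u)) (tc x))) as FP.
{ apply (df_img Wtrans HZ (G := fun _ => True) (X := fun e => tc (e 0)) (F := fun u e => psnd (app1 (e 1) u))); dauto. }
assert (F2 I W tru2 (fun x G => img (fun u => pfst (app1 G u)) (tc x))) as FQ.
{ apply (df_img Wtrans HZ (G := fun _ => True) (X := fun e => tc (e 0)) (F := fun u e => pfst (app1 (e 1) u))); dauto. }
assert (F4 I W (fun _ b _ _ => ord b) (fun s b F x => img (fun u => actd s b F u) (tc x))) as FR.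
{ apply (df_img Wtrans HZ (G := fun e => ord (e 1)) (X := fun e => tc (e 3))
    (F := fun u e => actd (e 0) (e 1) (e 2) u)); dauto. }
assert (F5 I W (fun _ b _ _ _ => ord b) H1) as FH1.
{ dgoal; unfold H1; apply (df_setof Wtrans HZ); [| dauto].
  intros e He Ob.
  exists (prod (tc (e 3)) (join (tc (e 3)) (join (img (fun u => psnd (app1 (e 4) u)) (tc (e 3)))
    (img (fun u => actd (e 0) (e 1) (e 2) u) (tc (e 3)))))); split.
  - pose proof (He 0); pose proof (He 1); pose proof (He 2); pose proof (He 3); pose proof (He 4).
    assert (W (img (fun u => psnd (app1 (e 4) u)) (tc (e 3)))) by (apply (F2_D FP); auto; exact Logic.I).
    assert (W (img (fun u => actd (e 0) (e 1) (e 2) u) (tc (e 3)))) by (apply (F4_D FR); auto).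
    dm.
  - intros z (g & u & H & K).
    pose proof (proj2 (in_tc _ _) (below_fst H)) as Kg; pose proof (proj2 (in_tc _ _) (below_snd H)) as Ku.
    destruct K as [[_ ->] | [[_ ->] | [_ ->]]]; apply opair_in_prod; (split; [exact Kg |]); rewrite !in_join, !in_img; eauto. }
assert (F2 I W tru2 H2) as FH2.
{ dgoal; unfold H2; apply (df_setof Wtrans HZ); [| dauto].
  intros e He _.
  exists (prod (img (fun u => pfst (app1 (e 1) u)) (tc (e 0))) (img (fun u => psnd (app1 (e 1) u)) (tc (e 0)))); split.
  - pose proof (He 0); pose proof (He 1).
    assert (W (img (fun u => psnd (app1 (e 1) u)) (tc (e 0)))) by (apply (F2_D FP); auto; exact Logic.I).
    assert (W (img (fun u => pfst (app1 (e 1) u)) (tc (e 0)))) by (apply (F2_D FQ); auto; exact Logic.I).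
    dm.
  - intros z (g & u & H & ->).
    pose proof (proj2 (in_tc _ _) (below_fst H)) as Kg; pose proof (proj2 (in_tc _ _) (below_snd H)) as Ku.
    apply opair_in_prod; rewrite !in_img; split; eexists; (split; [| reflexivity]); assumption. }
assert (Df (fun e => ord (e 2)) (fun e => autp (e 1) (e 2) (e 3) (e 0))) as F.
{ apply (@df_rec V unit I W Wtrans HZ (fun e => ord (e 1)) (fun e x => autp (e 0) (e 1) (e 2) x)
    (fun x G e => opair (H1 (e 0) (e 1) (e 2) x G) (H2 x G))).
  - intros e x He Ob Hx; unfold autp at 1; rewrite aut1d_eq; simpl; unfold H1, H2; f_equal;
      apply setof_ext; intros z; do 2 (apply ex_iff; intros ?); apply and_iff_compat_l'; intros K;
      rewrite !app1_graph by (apply in_tc; solve [exact (below_fst K) | exact (below_snd K)]);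
      unfold autp; rewrite ?pfst_opair, ?psnd_opair; tauto.
  - dauto. }
refine (df_substs (ts := [fun e => e 3; fun e => e 0; fun e => e 1; fun e => e 2]) _ F _).
- simpl; intros t Ht; decompose [or] Ht; subst; try tauto; dauto.
- intros e _ H; exact H.
Qed.
Hint Resolve f_autp : dfn.

(** The list is reversed because [aut] applies its last entry outermost: stripping the head of the
    code undoes the last application. *)
Definition pi_code (pi : list (V * V)) : V := code (map (fun bt => opair (fst bt) (snd bt)) (rev pi)).

Lemma pair_map_inj (l l' : list (V * V)) :
  map (fun bt => opair (fst bt) (snd bt)) l = map (fun bt => opair (fst bt) (snd bt)) l' -> l = l'.
Proof.
revert l'; induction l as [|[b t] l IH]; intros [|[b' t'] l'] H; simpl in H; try discriminate; [reflexivity |].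
injection H as E H; apply opair_inj in E as [-> ->]; rewrite (IH l' H); reflexivity.
Qed.

Lemma pi_code_inj pi pi' : pi_code pi = pi_code pi' -> pi = pi'.
Proof.
intros H; apply code_inj, pair_map_inj in H; rewrite <- (rev_involutive pi), H; apply rev_involutive.
Qed.

Lemma pi_code_snoc pi b t : pi_code (pi ++ [(b, t)]) = opair (opair b t) (pi_code pi).
Proof. unfold pi_code; rewrite rev_app_distr; reflexivity. Qed.

Lemma pi_code_elements pi b t : opair b t ∈ elements (pi_code pi) <-> In (b, t) pi.
Proof.
unfold pi_code; rewrite in_elements, in_map_iff; split.
- intros ([b' t'] & E & H); apply opair_inj in E as [E1 E2]; simpl in *; subst; apply in_rev, H.
- intros H; exists (b, t); split; [reflexivity | apply in_rev in H; exact H].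
Qed.

Lemma pi_code_element pi y : y ∈ elements (pi_code pi) -> exists b t, y = opair b t /\ In (b, t) pi.
Proof.
unfold pi_code; rewrite in_elements, in_map_iff; intros ([b t] & <- & H).
exists b, t; split; [reflexivity | apply in_rev, H].
Qed.

Definition is_pi z := exists pi, z = pi_code pi.

Lemma is_pi_eq z : is_pi z <-> is_code z /\ forall y, y ∈ elements z -> exists b t, y = opair b t.
Proof.
split.
- intros (pi & ->); split; [eexists; reflexivity |].
  intros y Hy; apply pi_code_element in Hy as (b & t & -> & _); eauto.
- intros ((l & ->) & H).
  assert (exists l', l = map (fun bt => opair (fst bt) (snd bt)) l') as (l' & ->).
  { induction l as [|y l IH]; [exists []; reflexivity |].
    destruct IH as (l' & El).
    - intros z Hz; apply H; apply in_elements; right; apply in_elements, Hz.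
    - destruct (H y) as (b & t & ->); [apply in_elements; left; reflexivity |].
      exists ((b, t) :: l'); rewrite El; reflexivity. }
  exists (rev l'); unfold pi_code; rewrite rev_involutive; reflexivity.
Qed.

Lemma d_is_pi : D1 I W tru1 is_pi.
Proof.
dgoal; apply dp_ext with (fun e => is_code (e 0) /\ forall y, y ∈ elements (e 0) -> exists b t, y = opair b t).
- intros e _ _; symmetry; apply is_pi_eq.
- dauto.
Qed.
Hint Resolve d_is_pi : dfn.

Definition ord_pi z := is_pi z /\ forall b t, opair b t ∈ elements z -> ord b.

Lemma d_ord_pi : D1 I W tru1 ord_pi.
Proof. dgoal; unfold ord_pi; dauto. Qed.
Hint Resolve d_ord_pi : dfn.

(** Total on all sets: the value is empty when [z] codes no sequence with ordinal coordinates, so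
    the recursion on the code needs no guard. *)
Definition autc s x z := setof (fun w => exists pi, z = pi_code pi /\ ord_pi z /\ w ∈ aut W S (decode s) pi x).

Lemma autc_eq s x pi : ord_pi (pi_code pi) -> autc s x (pi_code pi) = aut W S (decode s) pi x.
Proof.
intros H; unfold autc; transitivity (setof (fun w => w ∈ aut W S (decode s) pi x)); [| apply setof_mem]; apply setof_ext; intros w; split.
- intros (pi' & E & _ & Hw); rewrite (pi_code_inj E); exact Hw.
- eauto.
Qed.

Lemma aut_snoc s pi b t x : aut W S (decode s) (pi ++ [(b, t)]) x =
  snd (aut1d s b (decided s b t) (aut W S (decode s) pi x)).
Proof. unfold aut; rewrite fold_left_app; simpl; rewrite aut1_aut1d; reflexivity. Qed.

Lemma ord_pi_snoc pi b t : ord_pi (pi_code (pi ++ [(b, t)])) <-> ord b /\ ord_pi (pi_code pi).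
Proof.
split.
- intros [_ H]; split.
  + apply (H b t), pi_code_elements, in_app_iff; simpl; auto.
  + split; [eexists; reflexivity |]; intros b' t' H'; apply (H b' t').
    apply pi_code_elements, in_app_iff; left; apply pi_code_elements, H'.
- intros [Ob [_ H]]; split; [eexists; reflexivity |]; intros b' t' H'.
  apply pi_code_elements, in_app_iff in H' as [H' | [H' | []]].
  + apply (H b' t'), pi_code_elements, H'.
  + injection H' as -> _; exact Ob.
Qed.

Lemma snoc_case (l : list (V * V)) : l = [] \/ exists l' b t, l = l' ++ [(b, t)].
Proof.
destruct (rev l) as [|[b t] r] eqn:E; [left | right].
- rewrite <- (rev_involutive l), E; reflexivity.
- exists (rev r), b, t; rewrite <- (rev_involutive l), E; reflexivity.
Qed.

Lemma autc_rec s x z : autc s x z = setof (fun w => (z = empty /\ w ∈ x) \/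
  exists b t z', z = opair (opair b t) z' /\ ord b /\ ord_pi z' /\
    w ∈ psnd (autp s b (decided s b t) (autc s x z'))).
Proof.
apply setof_ext; intros w; split.
- intros (pi & -> & O & Hw); destruct (snoc_case pi) as [-> | (pi' & b & t & ->)].
  + left; auto.
  + right; exists b, t, (pi_code pi'); apply ord_pi_snoc in O as [Ob O'].
    rewrite pi_code_snoc, aut_snoc in *; splits; auto.
    unfold autp; rewrite psnd_opair, autc_eq; assumption.
- intros [[-> Hw] | (b & t & z' & -> & Ob & O & Hw)].
  + exists []; split; [reflexivity |]; split; [| exact Hw].
    split; [exists []; reflexivity |]; intros b t Hb; change empty with (pi_code []) in Hb.
    apply pi_code_elements in Hb; destruct Hb.
  + destruct (proj1 O) as (pi & ->); exists (pi ++ [(b, t)]).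
    rewrite aut_snoc, <- pi_code_snoc; splits; auto; [apply ord_pi_snoc; auto |].
    unfold autp in Hw; rewrite psnd_opair, autc_eq in Hw; assumption.
Qed.

Lemma f_autc : F3 I W tru3 autc.
Proof.
pose (H := fun s x z g => setof (fun w => (z = empty /\ w ∈ x) \/
  exists b t z', z = opair (opair b t) z' /\ ord b /\ ord_pi z' /\
    w ∈ psnd (autp s b (decided s b t) (app1 g z')))).
assert (Df (fun _ => True) (fun e => autc (e 1) (e 2) (e 0))) as F.
{ apply (@df_rec V unit I W Wtrans HZ (fun _ => True) (fun e z => autc (e 0) (e 1) z) (fun z g e => H (e 0) (e 1) z g)).
  - intros e z _ _ _; rewrite autc_rec at 1; unfold H; apply setof_ext; intros w; apply or_iff_compat_l.
    do 3 (apply ex_iff; intros ?); apply and_iff_compat_l'; intros ->.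
    rewrite app1_graph by (apply in_tc, below_snd'); tauto.
  - unfold H; apply (df_setof Wtrans HZ).
    + intros e He _; destruct (classic (exists b t z', e 0 = opair (opair b t) z' /\ ord b)) as [(b & t & z' & E & Ob) | N].
      * pose proof (He 0); pose proof (He 1); pose proof (He 2); pose proof (He 3).
        assert (W z') by dm; assert (W (opair b t)) by dm.
        assert (W b) by exact (D_opairl Wtrans (x := b) (y := t) ltac:(assumption)).
        assert (W t) by exact (D_opairr Wtrans (x := b) (y := t) ltac:(assumption)).
        exists (join (e 3) (psnd (autp (e 2) b (decided (e 2) b t) (app1 (e 1) z')))); split; [dm |].
        intros w [[_ Hw] | (b1 & t1 & z1 & E1 & _ & _ & Hw)]; apply in_join; [auto | right].
        rewrite E1 in E; apply opair_inj in E as [E E']; apply opair_inj in E as [-> ->]; subst; exact Hw.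
      * exists (e 3); split; [apply He |]; intros w [[_ Hw] | (b1 & t1 & z1 & E1 & Ob & _)]; [exact Hw |].
        destruct N; eauto.
    + assert (forall b t z', W (opair (opair b t) z') -> W b /\ W t /\ W z') as K.
      { intros b t z' Hw; pose proof (D_opairl Wtrans Hw) as Hbt; splits;
          [exact (D_opairl Wtrans Hbt) | exact (D_opairr Wtrans Hbt) | exact (D_opairr Wtrans Hw)]. }
      dstep; [dauto |].
      dstep; [intros e b He _ (t & z' & E & _); apply (K b t z'); rewrite <- E; apply He |].
      dstep; [intros e t He _ (z' & E & _); apply (K (e 0) t z'); rewrite <- E; apply He |].
      dauto. }
refine (df_substs (ts := [fun e => e 2; fun e => e 0; fun e => e 1]) _ F _).
- simpl; intros t Ht; decompose [or] Ht; subst; try tauto; dauto.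
- auto.
Qed.
Hint Resolve f_autc : dfn.

Lemma StronglySorted_snoc {B : Type} (R : B -> B -> Prop) (l : list B) (x : B) :
  StronglySorted R (l ++ [x]) <-> StronglySorted R l /\ forall y : B, In y l -> R y x.
Proof.
induction l as [|y l IH]; simpl.
- split; [intros _; split; [constructor | tauto] | intros _; constructor; constructor].
- split.
  + intros H; inversion H as [|? ? H1 H2]; subst; apply IH in H1 as [H1 H3].
    rewrite Forall_app in H2; destruct H2 as [H2 H4]; split; [constructor; assumption |].
    intros z [<- | Hz]; [inversion H4; assumption | auto].
  + intros [H1 H2]; inversion H1; subst; constructor; [apply IH; auto |].
    rewrite Forall_app; split; [assumption | constructor; auto].
Qed.

Definition sorted_pi z := exists pi, z = pi_code pi /\ StronglySorted (fun x y : V * V => fst x ∈ fst y) pi.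

Lemma sorted_pi_eq z : sorted_pi z <-> z = empty \/ exists b t z', z = opair (opair b t) z' /\
  sorted_pi z' /\ forall b' t', opair b' t' ∈ elements z' -> b' ∈ b.
Proof.
split.
- intros (pi & -> & Hs); destruct (snoc_case pi) as [-> | (pi' & b & t & ->)]; [auto | right].
  apply StronglySorted_snoc in Hs as [Hs1 Hs2].
  exists b, t, (pi_code pi'); split; [apply pi_code_snoc | split; [eexists; eauto |]].
  intros b' t' H; apply pi_code_elements in H; exact (Hs2 (b', t') H).
- intros [-> | (b & t & z' & -> & (pi & -> & Hs) & H)].
  + exists []; split; [reflexivity | constructor].
  + exists (pi ++ [(b, t)]); split; [symmetry; apply pi_code_snoc |].
    apply StronglySorted_snoc; split; [exact Hs |].
    intros [b' t'] Hb; apply (H b' t'), pi_code_elements, Hb.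
Qed.

Lemma d_sorted_pi : D1 I W tru1 sorted_pi.
Proof.
apply (@dp_rec V unit I W Wtrans HZ (fun _ => True) (fun _ z => sorted_pi z)
  (fun z T e => z = empty \/ exists b t z', z = opair (opair b t) z' /\
  z' ∈ T /\ forall b' t', opair b' t' ∈ elements z' -> b' ∈ b)).
- intros e z He _ Hz; rewrite sorted_pi_eq at 1; apply or_iff_compat_l; do 3 (apply ex_iff; intros ?).
  apply and_iff_compat_l'; intros ->; apply and_iff_compat_r.
  rewrite (setof_bounded (fun y => below y (opair (opair x x0) x1) /\ sorted_pi y) (tc (opair (opair x x0) x1))).
  + split; [intros H; split; [apply below_snd' | exact H] | tauto].
  + intros w [Hw _]; apply in_tc, Hw.
- assert (forall b t z', W (opair (opair b t) z') -> W b /\ W t /\ W z') as K.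
  { intros b t z' Hw; pose proof (D_opairl Wtrans Hw) as Hbt; splits;
      [exact (D_opairl Wtrans Hbt) | exact (D_opairr Wtrans Hbt) | exact (D_opairr Wtrans Hw)]. }
  dstep; [dauto |].
  dstep; [intros e b He _ (t & z' & E & _); apply (K b t z'); rewrite <- E; apply He |].
  dstep; [intros e t He _ (z' & E & _); apply (K (e 0) t z'); rewrite <- E; apply He |].
  dauto.
Qed.
Hint Resolve d_sorted_pi : dfn.

Definition saut_seq s a z : Prop := exists pi, z = pi_code pi /\ aut_seq W S (decode s) a pi.

Lemma saut_seq_eq s a z : saut_seq s a z <-> sorted_pi z /\ forall b t, opair b t ∈ elements z ->
  b ∈ a /\ W t /\ name_over (cset s b) t /\ sfmem s b empty t (check (group W S b)).
Proof.
assert (forall b, cond (decode s b) = (fun q => q ∈ cset s b)) as EC.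
{ intros b; apply pred_ext; intros q; apply decode_cond. }
split.
- intros (pi & -> & H1 & H2); split; [exists pi; auto |].
  intros b t Hb; apply pi_code_elements in Hb; destruct (H2 b t Hb) as (K1 & K2 & K3 & K4).
  rewrite EC in K3; splits; auto.
- intros ((pi & -> & H1) & H2); exists pi; split; [reflexivity | split; [exact H1 |]].
  intros b t Hb; apply pi_code_elements in Hb; destruct (H2 b t Hb) as (K1 & K2 & K3 & K4).
  rewrite EC; splits; auto.
Qed.

Lemma d_saut_seq : D3 I W (fun _ a _ => ord a) saut_seq.
Proof.
pose proof (@ord_mem V).
dgoal; apply dp_ext with (fun e => sorted_pi (e 2) /\ forall b t, opair b t ∈ elements (e 2) ->
  b ∈ e 1 /\ W t /\ name_over (cset (e 0) b) t /\ sfmem (e 0) b empty t (check (group W S b))).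
- intros e _ _; symmetry; apply saut_seq_eq.
- dauto.
Qed.
Hint Resolve d_saut_seq : dfn.

Lemma saut_seq_ord s a z : ord a -> saut_seq s a z -> ord_pi z.
Proof.
intros Oa (pi & -> & _ & H); split; [eexists; reflexivity |].
intros b t Hb; apply pi_code_elements in Hb; exact (ord_mem Oa (proj1 (H b t Hb))).
Qed.

Lemma saut_seq_W s a z : W a -> saut_seq s a z -> W z.
Proof.
intros Wa (pi & -> & _ & H); apply (D_code Wtrans HZ); intros x Hx.
apply in_map_iff in Hx as ([b t] & <- & Hb); apply in_rev in Hb; destruct (H b t Hb) as (H1 & H2 & _).
pose proof (Wtrans Wa H1); simpl; dm.
Qed.

(** An excellent support is coded by its finitely many non-trivial values. *)
Definition supp h b := setof (fun w => (exists K, opair b K ∈ h /\ w ∈ K) \/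
  ((~ exists K, opair b K ∈ h) /\ w ∈ group W S b)).

Lemma supp_in h b K : pfun h -> opair b K ∈ h -> supp h b = K.
Proof.
intros F H; unfold supp; transitivity (setof (fun w => w ∈ K)); [| apply setof_mem]; apply setof_ext; intros w; split; [| eauto].
intros [(K' & H' & Hw) | [N _]]; [rewrite (F _ _ _ H H'); exact Hw | destruct N; eauto].
Qed.

Lemma supp_out h b : (forall K, opair b K ∉ h) -> supp h b = group W S b.
Proof.
intros N; unfold supp; transitivity (setof (fun w => w ∈ group W S b)); [| apply setof_mem]; apply setof_ext; intros w; split; [| intros Hw; right; split; [intros (K & HK); exact (N K HK) | exact Hw]].
intros [(K' & H' & Hw) | [_ Hw]]; [destruct (N K' H') | exact Hw].
Qed.

Lemma f_supp : F2 I W (fun _ b => ord b) supp.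
Proof.
dgoal; unfold supp; apply (df_setof Wtrans HZ); [| dauto].
intros e He Ob; exists (join (cup (cup (cup (e 0)))) (group W S (e 1))); split; [wside |].
intros w [(K & H & Hw) | [_ Hw]]; apply in_join; [left | auto].
apply in_cup; exists K; split; [exact (in_opair_snd H) | exact Hw].
Qed.
Hint Resolve f_supp : dfn.

(** A support is a function of the metatheory. Being trivial at almost all coordinates, it is
    recovered by [supp] from a finite set [h] of pairs, and the quantifier over supports becomes one
    over sets of [W]. *)
Lemma respected_eq s P a x : W a -> ord a ->
  (respected W S (decode s) P a x <->
   exists h, W h /\ finite h /\ pfun h /\ (forall b, b ∈ a -> in_filter W S b (supp h b)) /\
     forall p z, cond P p -> saut_seq s a z ->
       (forall b t, opair b t ∈ elements z -> sfmem s b (restrict p b) t (check (supp h b))) ->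
       forces_eq P p (autc s x z) x).
Proof.
intros Wa Oa; split.
- intros (H & (Hs1 & (l & Hs2)) & HR).
  destruct (list_set (map (fun b => opair b (H b))
    (filter (fun b => if excluded_middle_informative (b ∈ a) then true else false) l))) as (h & Hh).
  assert (forall b K, opair b K ∈ h <-> In b l /\ b ∈ a /\ K = H b) as Eh.
  { intros b K; rewrite Hh, in_map_iff; split.
    - intros (b' & E & Hb'); apply opair_inj in E as [-> <-]; apply filter_In in Hb' as [Hb1 Hb2].
      destruct excluded_middle_informative; [auto | discriminate].
    - intros (H1 & H2 & ->); exists b; split; [reflexivity | apply filter_In; split; [exact H1 |]].
      destruct excluded_middle_informative; [reflexivity | contradiction]. }
  assert (pfun h) as Fh.
  { intros b K K' H1 H2; apply Eh in H1 as (_ & _ & ->); apply Eh in H2 as (_ & _ & ->); reflexivity. }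
  assert (forall b, b ∈ a -> supp h b = H b) as Es.
  { intros b Hb; destruct (classic (In b l)) as [C | C].
    - apply supp_in; [exact Fh | apply Eh; auto].
    - rewrite (Hs2 b Hb C); apply supp_out; intros K HK; apply Eh in HK; tauto. }
  exists h; splits.
  + apply (D_list_set Wtrans HZ (l := map (fun b => opair b (H b))
      (filter (fun b => if excluded_middle_informative (b ∈ a) then true else false) l))); [| exact Hh].
    intros y Hy; apply in_map_iff in Hy as (b & <- & Hb); apply filter_In in Hb as [_ Hb].
    destruct excluded_middle_informative as [Hb' | Hb']; [| discriminate].
    pose proof (Wtrans Wa Hb'); destruct (Hs1 b Hb') as (WH & _); dm.
  + eexists; exact Hh.
  + exact Fh.
  + intros b Hb; rewrite (Es b Hb); auto.
  + intros p z Hp Hz K; pose proof (saut_seq_ord Oa Hz) as Oz; destruct Hz as (pi & -> & Hpi).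
    rewrite autc_eq by exact Oz; apply HR; auto.
    intros b t Hb; pose proof (proj2 (pi_code_elements pi b t) Hb) as Hb'; specialize (K b t Hb').
    rewrite Es in K; [exact K | apply (proj2 Hpi b t Hb)].
- intros (h & Wh & (l & Fh) & Ph & Hs & HR).
  exists (supp h); split.
  + split; [exact Hs |].
    exists (map pfst l); intros b Hb N; apply supp_out; intros K HK; apply N.
    apply in_map_iff; exists (opair b K); split; [apply pfst_opair | apply Fh, HK].
  + intros p pi Hp Hpi K; pose proof (saut_seq_ord (s := s) Oa (ex_intro _ pi (conj eq_refl Hpi))) as Oz.
    rewrite <- autc_eq by exact Oz; apply HR; [exact Hp | exists pi; auto |].
    intros b t Hb; apply pi_code_elements in Hb; exact (K b t Hb).
Qed.

End Steps.

#[export] Hint Resolve d_svalue f_valset f_entries f_sfull f_decided f_actd f_autp d_is_pi d_ord_pi f_autc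
  d_saut_seq f_supp : dfn.

(** * Iteration conditions and canonical names of the generic objects *)

Section Stages.
Context {V : universe} (W : V -> Prop) (S : V -> V).
Notation I := (seq_pred W S).
Context (Wtrans : transitive_class W) (HZ : models_ZFC W I).
Context (HS : forall a, W a -> ord a ->
    (is_limit a -> permutable_scale W (aleph W a) (S a)) /\
    (~ is_limit a -> permutable_family W (aleph W a) (S a))).
Notation tl e := (fun n => e (Datatypes.S n)).
Notation tl2 e := (fun n => e (Datatypes.S (Datatypes.S n))).
Notation Dp := (Dp I W).
Notation Df := (Df I W).
Notation ok := (over_D W).
Implicit Types s b a t u x y z p q : V.

Let scond_W s b q : scond s b q -> W s -> W q.
Proof. exact (scond_D Wtrans (s := s) (b := b) (q := q)). Qed.
Let sQ_W s b q : sQ s b q -> W s -> W q.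
Proof. exact (sQ_D Wtrans (s := s) (b := b) (q := q)). Qed.
Let saut_seq_W s a z : saut_seq W S s a z -> W a -> W z.
Proof. intros H Wa; exact (saut_seq_W Wtrans HZ Wa H). Qed.
Hint Resolve scond_W sQ_W saut_seq_W : guard.
Let ord_in x y : ord x -> y ∈ x -> ord y := @ord_mem V x y.
Hint Resolve ord_in ord_suc : guard.

Definition bulQ s b := bullet (fun y => y ∈ qset s b).

Lemma f_bulQ : F2 I W tru2 bulQ.
Proof.
dgoal; unfold bulQ; apply (df_bullet Wtrans HZ (G := fun _ => True) (X := fun y e => y ∈ qset (e 0) (e 1))).
- intros e He _; exists (qset (e 0) (e 1)); split; [wside | auto].
- dauto.
Qed.
Hint Resolve f_bulQ : dfn.

Definition siter_cond s a p : Prop := iter_cond W (decode s) a p.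
Definition siter_le s p q : Prop := iter_le (decode s) p q.

Lemma siter_cond_eq s a p : siter_cond s a p <->
  W p /\ finite p /\
  (forall z, z ∈ p -> exists b u, z = opair b u /\ b ∈ a) /\
  (forall b u v, opair b u ∈ p -> opair b v ∈ p -> u = v) /\
  (forall b u, opair b u ∈ p -> sfull W s b u = u /\ sfmem s b empty u (bulQ s b)).
Proof.
unfold siter_cond, iter_cond, sfull, sfmem, bulQ.
assert (forall b, stage_Q (decode s b) = (fun y => y ∈ qset s b)) as E.
{ intros b; apply pred_ext; intros y; apply decode_Q. }
do 4 apply and_iff_compat_l; apply all_iff; intros b; rewrite E; tauto.
Qed.

Lemma d_siter_cond : D3 I W tru3 siter_cond.
Proof.
dgoal; apply dp_ext with (fun e => W (e 2) /\ finite (e 2) /\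
  (forall z, z ∈ e 2 -> exists b u, z = opair b u /\ b ∈ e 1) /\
  (forall b u v, opair b u ∈ e 2 -> opair b v ∈ e 2 -> u = v) /\
  (forall b u, opair b u ∈ e 2 -> sfull W (e 0) b u = u /\ sfmem (e 0) b empty u (bulQ (e 0) b))).
- intros e _ _; symmetry; apply siter_cond_eq.
- dauto.
Qed.
Hint Resolve d_siter_cond : dfn.

Lemma siter_cond_W s a p : siter_cond s a p -> W p.
Proof. intros [H _]; exact H. Qed.
Hint Resolve siter_cond_W : guard.

Lemma d_siter_le : D3 I W tru3 siter_le.
Proof.
dgoal; change (Dp (fun _ => True) (fun e => forall b v, opair b v ∈ e 2 ->
  sfle (e 0) b (restrict (e 1) b) (coord (e 1) b) v)).
dauto.
Qed.
Hint Resolve d_siter_le : dfn.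

Definition all_entries s a := cup (img (fun b => entries W s b) a).

Lemma f_all_entries : F2 I W tru2 all_entries.
Proof.
dgoal; unfold all_entries; dstep.
apply (df_img Wtrans HZ (G := fun _ => True) (X := fun e => e 1) (F := fun b e => entries W (e 0) b)); dauto.
Qed.
Hint Resolve f_all_entries : dfn.

Definition iter_set s a := setof (fun p => siter_cond s a p).

(** Here the requirement of full names pays off: a coordinate equal to its full name is a subset of
    [entries], so the conditions form a set. *)
Lemma siter_cond_bound s a p : siter_cond s a p -> subset p (prod a (powD W (all_entries s a))).
Proof.
rewrite siter_cond_eq; intros (H1 & _ & H3 & _ & H5) z Hz.
destruct (H3 z Hz) as (b & u & -> & Hb); destruct (H5 b u Hz) as [E _].
apply opair_in_prod; split; [exact Hb | apply in_powD; split].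
- exact (D_opair2 Wtrans Hz H1).
- intros w Hw; rewrite <- E in Hw; apply in_cup; exists (entries W s b); split.
  + apply in_img; eauto.
  + exact (proj1 (sfull_entries W s b u) w Hw).
Qed.

Lemma in_iter_set s a p : p ∈ iter_set s a <-> siter_cond s a p.
Proof.
destruct (power V (prod a (powD W (all_entries s a)))) as [w Hw].
apply (setof_bounded (fun p => siter_cond s a p) w).
intros q Hq; apply Hw; exact (siter_cond_bound Hq).
Qed.

Lemma f_iter_set : F2 I W tru2 iter_set.
Proof.
dgoal; unfold iter_set; apply (df_setof Wtrans HZ); [| dauto].
intros e He _; exists (powD W (prod (e 1) (powD W (all_entries (e 0) (e 1))))); split; [wside |].
intros q Hq; apply in_powD; split; [exact (siter_cond_W Hq) | exact (siter_cond_bound Hq)].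
Qed.
Hint Resolve f_iter_set : dfn.

Definition ifeq s a p x y : Prop := forces_eq (iter W (decode s) a) p x y.

Lemma d_ifeq : D5 I W tru5 ifeq.
Proof.
dgoal; unfold ifeq; apply (dp_forces_eq Wtrans HZ (C := fun e => iter_set (e 0) (e 1))
  (P := fun e => iter W (decode (e 0)) (e 1))); try dauto.
- intros e q _ _; symmetry; apply in_iter_set.
- change (Dp (fun _ => True) (fun e => siter_le (e 2) (e 0) (e 1))); dauto.
Qed.
Hint Resolve d_ifeq : dfn.

(** [x] is respected, as a [P_a']-name, by the coordinates below [a]. *)
Definition srespected s a' a x : Prop := respected W S (decode s) (iter W (decode s) a') a x.

Lemma d_srespected : D4 I W (fun _ _ a _ => ord a) srespected.
Proof.
assert (D1 I W tru1 (@pfun V)) by (apply d_pfun; assumption).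
dgoal; apply dp_ext with (fun e =>
   exists h, W h /\ finite h /\ pfun h /\ (forall b, b ∈ e 2 -> in_filter W S b (supp W S h b)) /\
     forall p z, siter_cond (e 0) (e 1) p -> saut_seq W S (e 0) (e 2) z ->
       (forall b t, opair b t ∈ elements z -> sfmem (e 0) b (restrict p b) t (check (supp W S h b))) ->
       ifeq (e 0) (e 1) p (autc W S (e 0) (e 3) z) (e 3)).
- intros e He Oa; symmetry; apply (respected_eq Wtrans HZ (e 0) (iter W (decode (e 0)) (e 1)) (e 3) (He 2) Oa).
- dauto.
  cbv beta; intros e He K; destruct_all.
  match goal with H : saut_seq _ _ _ _ _, H' : opair _ _ ∈ elements _ |- _ =>
    apply saut_seq_eq in H as [_ H]; exact (ord_in ltac:(eassumption) (proj1 (H _ _ H'))) end.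
Qed.
Hint Resolve d_srespected : dfn.

Definition sgen s b A x : Prop := IS_gen W S (decode s) b A x.

Lemma sgen_eq s b A x : sgen s b A x <-> W x /\
    (forall z, z ∈ x -> exists p y, z = opair p y /\ sgen s b A y /\
       siter_cond s (suc b) p /\
       forall r i v, opair r (dpair (check i) v) ∈ coord p b -> i ∈ A) /\
    srespected s (suc b) b x.
Proof.
split; [intros [x' H1 H2 H3]; auto | intros (H1 & H2 & H3); apply IS_gen_intro; auto].
Qed.

Lemma d_sgen : D4 I W (fun _ b _ _ => ord b) sgen.
Proof.
assert (Dp (fun e => ord (e 2)) (fun e => sgen (e 1) (e 2) (e 3) (e 0))) as F.
{ apply (@dp_rec V unit I W Wtrans HZ (fun e => ord (e 1)) (fun e x => sgen (e 0) (e 1) (e 2) x)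
    (fun x T e => (forall z, z ∈ x -> exists p y, z = opair p y /\ y ∈ T /\
       siter_cond (e 0) (suc (e 1)) p /\
       forall r i v, opair r (dpair (check i) v) ∈ coord p (e 1) -> i ∈ e 2) /\
    srespected (e 0) (suc (e 1)) (e 1) x)).
  - intros e x He Ob Hx; rewrite sgen_eq at 1; split.
    + intros (_ & H1 & H2); split; [| exact H2]; intros z Hz; destruct (H1 z Hz) as (p & y & -> & Hy & Hp & HA).
      exists p, y; splits; auto.
      apply (setof_bounded (fun y => below y x /\ sgen (e 0) (e 1) (e 2) y) (tc x));
        [intros w [Hw _]; apply in_tc, Hw | split; [exact (below_snd Hz) | exact Hy]].
    + intros (H1 & H2); splits; auto; intros z Hz; destruct (H1 z Hz) as (p & y & -> & Hy & Hp & HA).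
      exists p, y; splits; auto.
      apply (setof_bounded (fun y => below y x /\ sgen (e 0) (e 1) (e 2) y) (tc x)) in Hy;
        [tauto | intros w [Hw _]; apply in_tc, Hw].
  - dauto. }
refine (dp_substs (ts := [fun e => e 3; fun e => e 0; fun e => e 1; fun e => e 2]) _ F _).
- simpl; intros t Ht; decompose [or] Ht; subst; try tauto; dauto.
- intros e _ H; exact H.
Qed.
Hint Resolve d_sgen : dfn.

(** A cumulative hierarchy of names over [C]. It turns the rank bound in [Rname] into a set of names
    of [W]. *)
Definition names_below (C r : V) := mem_rec empty (fun r rec =>
  powD W (prod C (cup (img rec r)))) r.

Lemma names_below_eq C r : names_below C r = powD W (prod C (cup (img (names_below C) r))).
Proof.
unfold names_below at 1; rewrite mem_rec_below; [reflexivity |].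
intros f f' E; do 3 f_equal; apply setof_ext; intros z; apply ex_iff; intros x.
split; intros [Hx ->]; split; auto; rewrite (E x (below_mem Hx)); reflexivity.
Qed.

Lemma f_names_below : F2 I W tru2 names_below.
Proof.
assert (Df (fun _ => True) (fun e => names_below (e 1) (e 0))) as F.
{ apply (@df_rec V unit I W Wtrans HZ (fun _ => True) (fun e r => names_below (e 0) r)
    (fun r g e => powD W (prod (e 0) (cup (img (app1 g) r))))).
  - intros e r _ _ _; rewrite names_below_eq at 1; do 3 f_equal; apply setof_ext; intros z; apply ex_iff; intros x.
    split; intros [Hx ->]; split; auto; rewrite app1_graph by (apply in_tc, below_mem, Hx); reflexivity.
  - dstep; dstep; [dauto | dstep].
    apply (df_img Wtrans HZ (G := fun e => True /\ e 1 = graph (names_below (e 2)) (tc (e 0)))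
      (X := fun e => e 0) (F := fun x e => app1 (e 1) x)); dauto. }
exact (df_use2 (G0 := tru2) (f := fun r C => names_below C r) F (df_var _ _ _ 1) (df_var _ _ _ 0) (fun _ _ _ => Logic.I)).
Qed.
Hint Resolve f_names_below : dfn.

Lemma sgen_bound s b A x : sgen s b A x -> x ∈ names_below (iter_set s (suc b)) (name_rank x).
Proof.
induction x as [x IH] using below_ind; intros H; apply sgen_eq in H as (Wx & H & _).
rewrite names_below_eq; apply in_powD; split; [exact Wx |]; intros z Hz.
destruct (H z Hz) as (p & y & -> & Hy & Hp & _).
apply opair_in_prod; split; [apply in_iter_set, Hp | apply in_cup].
exists (names_below (iter_set s (suc b)) (name_rank y)); split; [apply in_img | apply IH; [exact (below_snd Hz) | exact Hy]].
exists (name_rank y); split; [apply in_name_rank; eauto | reflexivity].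
Qed.

Definition sRname s b xi := Rname W S (decode s) b xi.

Lemma f_gen_part : F2 I W (fun b xi => ord b /\ functional_at (S b) xi) (gen_part S).
Proof. dgoal; unfold gen_part; dauto. Qed.
Hint Resolve f_gen_part : dfn.

Lemma f_sRname : F3 I W (fun _ b xi => ord b /\ functional_at (S b) xi) sRname.
Proof.
dgoal; change (Df (fun e => ord (e 1) /\ functional_at (S (e 1)) (e 2)) (fun e => bullet (fun x =>
  sgen (e 0) (e 1) (gen_part S (e 1) (e 2)) x /\ name_rank x ∈ oadd omega (suc (e 1))))).
apply (df_bullet Wtrans HZ (G := fun e => ord (e 1) /\ functional_at (S (e 1)) (e 2))
  (X := fun x e => sgen (e 0) (e 1) (gen_part S (e 1) (e 2)) x /\ name_rank x ∈ oadd omega (suc (e 1)))).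
- pose (B := fun s b => cup (img (names_below (iter_set s (suc b))) (oadd omega (suc b)))).
  assert (F2 I W tru2 B) as FB.
  { dgoal; unfold B; dstep.
    apply (df_img Wtrans HZ (G := fun _ => True) (X := fun e => oadd omega (suc (e 1)))
      (F := fun r e => names_below (iter_set (e 0) (suc (e 1))) r)); dauto. }
  intros e He _; exists (B (e 0) (e 1)); split; [apply (F2_D FB); auto; exact Logic.I |].
  intros x [Hx Hr]; apply in_cup; exists (names_below (iter_set (e 0) (suc (e 1))) (name_rank x)).
  split; [apply in_img; eauto | exact (sgen_bound Hx)].
- dauto.
Qed.
Hint Resolve f_sRname : dfn.

Lemma S_functional b xi : W b -> ord b -> xi ∈ aleph W (suc b) -> functional_at (S b) xi.
Proof.
intros Wb Ob; rewrite (aleph_suc Wtrans HZ Wb Ob); intros H.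
destruct (HS Wb Ob) as [H1 H2]; destruct (classic (is_limit b)) as [L | L].
- destruct (H1 L) as ((_ & M & _) & _); exact (maps_functional M H).
- destruct (H2 L) as (_ & M & _); exact (function_on_functional M H).
Qed.

Definition srho_succ s b J := rho_succ W S (decode s) b J.

Lemma f_srho_succ : F3 I W (fun _ b J => ord b /\ forall xi, xi ∈ J -> functional_at (S b) xi) srho_succ.
Proof.
dgoal; change (Df (fun e => ord (e 1) /\ forall xi, xi ∈ e 2 -> functional_at (S (e 1)) xi)
  (fun e => bullet (fun u => exists xi, xi ∈ e 2 /\ u = dpair (check xi) (sRname (e 0) (e 1) xi)))).
assert (F3 I W (fun _ b J => ord b /\ forall xi, xi ∈ J -> functional_at (S b) xi)
  (fun s b J => img (fun xi => dpair (check xi) (sRname s b xi)) J)) as FI.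
{ apply (df_img Wtrans HZ (G := fun e => ord (e 1) /\ forall xi, xi ∈ e 2 -> functional_at (S (e 1)) xi)
    (X := fun e => e 2) (F := fun xi e => dpair (check xi) (sRname (e 0) (e 1) xi))); dauto. }
apply (df_bullet Wtrans HZ (G := fun e => ord (e 1) /\ forall xi, xi ∈ e 2 -> functional_at (S (e 1)) xi)
  (X := fun u e => exists xi, xi ∈ e 2 /\ u = dpair (check xi) (sRname (e 0) (e 1) xi))).
- intros e He H; eexists; split; [apply (F3_D FI (He 0) (He 1) (He 2) H) |].
  intros u Hu; apply in_img, Hu.
- dauto.
Qed.
Hint Resolve f_srho_succ : dfn.

Definition srho_limit s E A := rho_limit W S (decode s) E A.
Definition limit_guard E A := forall b, b ∈ A -> ord b /\ forall f, f ∈ E ->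
  functional_at f (aleph W (suc b)) /\ functional_at (S b) (app f (aleph W (suc b))).

Lemma f_srho_limit : F3 I W (fun _ => limit_guard) srho_limit.
Proof.
pose (inner := fun s f A => bullet (fun w => exists b, b ∈ A /\
  w = dpair (check b) (sRname s b (app f (aleph W (suc b)))))).
pose (Gi := fun (s f A : V) => forall b, b ∈ A -> ord b /\
  functional_at f (aleph W (suc b)) /\ functional_at (S b) (app f (aleph W (suc b)))).
assert (F3 I W Gi inner) as Fi.
{ assert (F3 I W Gi (fun s f A => img (fun b => dpair (check b) (sRname s b (app f (aleph W (suc b))))) A)) as FI.
  { apply (df_img Wtrans HZ (G := fun e => Gi (e 0) (e 1) (e 2)) (X := fun e => e 2)
      (F := fun b e => dpair (check b) (sRname (e 0) b (app (e 1) (aleph W (suc b)))))); [dauto |].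
    unfold Gi; dauto; cbv beta; intros e He [H Hb]; destruct (H _ Hb) as (? & ? & ?); auto. }
  apply (df_bullet Wtrans HZ (G := fun e => Gi (e 0) (e 1) (e 2)) (X := fun w e => exists b, b ∈ e 2 /\
    w = dpair (check b) (sRname (e 0) b (app (e 1) (aleph W (suc b)))))).
  - intros e He H; eexists; split; [apply (F3_D FI (He 0) (He 1) (He 2) H) |].
    intros u Hu; apply in_img, Hu.
  - unfold Gi; dauto; cbv beta; intros e He [H Hb]; destruct (H _ Hb) as (? & ? & ?); auto. }
assert (F3 I W (fun _ => limit_guard) (fun s E A => img (fun f => dpair (check f) (inner s f A)) E)) as FI.
{ apply (df_img Wtrans HZ (G := fun e => limit_guard (e 1) (e 2)) (X := fun e => e 1)
    (F := fun f e => dpair (check f) (inner (e 0) f (e 2)))); [dauto |].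
  dauto; cbv beta; intros e He [H Hf] b Hb; destruct (H b Hb); auto. }
dgoal; change (Df (fun e => limit_guard (e 1) (e 2)) (fun e => bullet (fun u => exists f, f ∈ e 1 /\
  u = dpair (check f) (inner (e 0) f (e 2))))).
apply (df_bullet Wtrans HZ (G := fun e => limit_guard (e 1) (e 2)) (X := fun u e => exists f, f ∈ e 1 /\
  u = dpair (check f) (inner (e 0) f (e 2)))).
- intros e He H; eexists; split; [apply (F3_D FI (He 0) (He 1) (He 2) H) |].
  intros u Hu; apply in_img, Hu.
- dauto; cbv beta; intros e He [H Hf] b Hb; destruct (H b Hb); auto.
Qed.
Hint Resolve f_srho_limit : dfn.

Lemma d_bounded_family : D2 I W tru2 (bounded_family W).
Proof. dgoal; unfold bounded_family, subset; dauto. Qed.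
Hint Resolve d_bounded_family : dfn.

Lemma suc_ord a b : ord a -> a = suc b -> ord b.
Proof. intros Oa ->; apply (ord_mem Oa), in_suc; auto. Qed.

Lemma rho_succ_guard a b J : W a -> ord a -> a = suc b -> subset J (aleph W a) ->
  ord b /\ forall xi, xi ∈ J -> functional_at (S b) xi.
Proof.
intros Wa Oa E H; pose proof (suc_ord Oa E) as Ob; split; [exact Ob |]; intros xi Hxi.
apply S_functional; [| exact Ob | rewrite <- E; auto].
apply (Wtrans Wa); rewrite E; apply in_suc; auto.
Qed.

Lemma rho_limit_guard a E A : W a -> ord a -> is_limit a -> subset E (prodSC W (aleph W a)) -> subset A a -> limit_guard E A.
Proof.
intros Wa Oa L HE HA b Hb; pose proof (HA b Hb) as Hba; pose proof (Wtrans Wa Hba) as Wb.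
pose proof (ord_mem Oa Hba) as Ob; split; [exact Ob |]; intros f Hf.
assert (aleph W (suc b) ∈ SC W (aleph W a)) as Ht.
{ apply in_SC; exists (aleph W b); split; [apply (aleph_mono Wtrans HZ Wa Hba) |].
  split; [apply (aleph_card Wtrans HZ Wb) | apply (aleph_suc Wtrans HZ Wb Ob)]. }
split; [exact (prodSC_fun (HE f Hf) Ht) |].
apply S_functional; auto; exact (prodSC_in (HE f Hf) Ht).
Qed.

Definition srho s a y : Prop := rho_restriction W S (decode s) a y.

Lemma d_srho : D3 I W (fun _ a _ => ord a) srho.
Proof.
dgoal; change (Dp (fun e => ord (e 1)) (fun e =>
  (exists b J, e 1 = suc b /\ W J /\ subset J (aleph W (e 1)) /\ size_lt W J (aleph W (e 1)) /\
     e 2 = srho_succ (e 0) b J) \/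
  (is_limit (e 1) /\ exists E A, bounded_family W (e 1) E /\
     W A /\ subset A (e 1) /\ bounded (e 1) A /\ e 2 = srho_limit (e 0) E A))).
dauto.
- intros e b He Oa (J & E & _); apply (Wtrans (He 1)); rewrite E; apply in_suc; auto.
- intros e He K; destruct_all; eapply rho_succ_guard with (a := e 3); auto.
- intros e E He _ (A & (H & _) & _); exact H.
- intros e He K; destruct_all; match goal with H : bounded_family _ _ _ |- _ => destruct H as (_ & H & _) end;
  eapply rho_limit_guard with (a := e 3); auto.
Qed.
Hint Resolve d_srho : dfn.

End Stages.

(** * Notions at a stage depend only on the earlier stages *)

Section NameLocality.
Context {V : universe} (W : V -> Prop) (S : V -> V).
Implicit Types s b a t u x y z p q : V.

(** For names of this kind the forcing relation consults the stages only at coordinates in [a]. *)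
Inductive name_in (a : V) : V -> Prop :=
| name_in_intro x :
    (forall z, z ∈ x -> exists p y, z = opair p y /\
       (forall g u, opair g u ∈ p -> g ∈ a) /\ name_in a y) -> name_in a x.

Lemma name_in_opair a x p y : name_in a x -> opair p y ∈ x ->
  (forall g u, opair g u ∈ p -> g ∈ a) /\ name_in a y.
Proof.
intros [x' H] Hp; destruct (H _ Hp) as (p' & y' & E & K); apply opair_inj in E as [-> ->]; exact K.
Qed.

Variables (st st' : V -> stage V) (a : V).
Hypothesis (agree : forall g, g ∈ a -> st g = st' g).

Lemma iter_cond_local a' p : subset a' a -> iter_cond W st a' p -> iter_cond W st' a' p.
Proof.
intros Ha (H1 & H2 & H3 & H4 & H5); split; [exact H1 | split; [exact H2 | split; [exact H3 | split; [exact H4 |]]]].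
intros b u Hb; destruct (H5 b u Hb) as [E1 E2].
assert (b ∈ a) as Hba by (destruct (H3 _ Hb) as (b' & u' & E & Hb'); apply opair_inj in E as [-> _]; auto).
unfold full, is_value in *; rewrite <- (agree Hba); auto.
Qed.

Lemma iter_le_local p q : (forall g u, opair g u ∈ q -> g ∈ a) -> iter_le st p q -> iter_le st' p q.
Proof.
intros Hq H g v Hg; eapply forces_le_local; [apply agree, (Hq g v Hg) | exact (H g v Hg)].
Qed.

Lemma aut1_local b t : b ∈ a -> aut1 W S st b t = aut1 W S st' b t.
Proof.
intros Hb; assert (act W S st b t = act W S st' b t) as E.
{ extensionality u; unfold act, is_value; rewrite (agree Hb); reflexivity. }
unfold aut1; rewrite E; reflexivity.
Qed.

Lemma aut1_eq b t x : aut1 W S st b t x =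
    (setof (fun z => exists g u, opair g u ∈ x /\
       ((g ∈ b /\ z = opair g u) \/
        (g = b /\ z = opair g (act W S st b t u)) \/
        (b ∈ g /\ z = opair g (snd (aut1 W S st b t u))))),
     setof (fun z => exists p y, opair p y ∈ x /\
       z = opair (fst (aut1 W S st b t p)) (snd (aut1 W S st b t y)))).
Proof.
unfold aut1 at 1; rewrite mem_rec_below; [reflexivity |].
intros r r' E; f_equal; apply setof_ext; intros z; do 2 (apply ex_iff; intros ?);
  split; intros (H1 & H2); split; auto; rewrite ?(E _ (below_fst H1)), ?(E _ (below_snd H1)) in *; exact H2.
Qed.

Lemma aut1_fst_coord b t p g u : opair g u ∈ fst (aut1 W S st b t p) -> exists u', opair g u' ∈ p.
Proof.
rewrite aut1_eq; simpl; intros H.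
apply (setof_bounded (fun z => exists g u, opair g u ∈ p /\
       ((g ∈ b /\ z = opair g u) \/
        (g = b /\ z = opair g (act W S st b t u)) \/
        (b ∈ g /\ z = opair g (snd (aut1 W S st b t u))))) (prod (tc p) (join (tc p) (join
          (img (act W S st b t) (tc p)) (img (fun u => snd (aut1 W S st b t u)) (tc p)))))) in H.
- destruct H as (g' & u' & H & [[_ E] | [[_ E] | [_ E]]]); apply opair_inj in E as [-> _]; eauto.
- clear g u H; intros z (g & u & H & K).
  pose proof (proj2 (in_tc _ _) (below_fst H)) as Kg; pose proof (proj2 (in_tc _ _) (below_snd H)) as Ku.
  destruct K as [[_ ->] | [[_ ->] | [_ ->]]]; apply opair_in_prod; (split; [exact Kg |]); rewrite !in_join, !in_img; eauto.
Qed.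

Lemma in_aut1_snd b t x z : z ∈ snd (aut1 W S st b t x) <-> exists p y, opair p y ∈ x /\
       z = opair (fst (aut1 W S st b t p)) (snd (aut1 W S st b t y)).
Proof.
rewrite aut1_eq at 1; simpl.
apply (setof_bounded (fun z => exists p y, opair p y ∈ x /\
       z = opair (fst (aut1 W S st b t p)) (snd (aut1 W S st b t y)))
  (prod (img (fun u => fst (aut1 W S st b t u)) (tc x)) (img (fun u => snd (aut1 W S st b t u)) (tc x)))).
clear z; intros z (g & u & H & ->).
pose proof (proj2 (in_tc _ _) (below_fst H)) as Kg; pose proof (proj2 (in_tc _ _) (below_snd H)) as Ku.
apply opair_in_prod; rewrite !in_img; split; eexists; (split; [| reflexivity]); assumption.
Qed.

Lemma name_in_aut1 a' b t x : name_in a' x -> name_in a' (snd (aut1 W S st b t x)).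
Proof.
induction x as [x IH] using below_ind; intros H; constructor; intros z Hz.
apply in_aut1_snd in Hz as (p & y & Hp & ->); destruct (name_in_opair H Hp) as [H1 H2].
do 2 eexists; split; [reflexivity |]; split; [| apply IH; [exact (below_snd Hp) | exact H2]].
intros g u Hg; apply aut1_fst_coord in Hg as (u' & Hg); exact (H1 g u' Hg).
Qed.

Lemma name_in_aut a' pi x : name_in a' x -> name_in a' (aut W S st pi x).
Proof.
unfold aut; revert x; induction pi as [|bt pi IH]; intros x H; simpl; [exact H | apply IH, name_in_aut1, H].
Qed.

Lemma aut_local pi x : (forall b t, In (b, t) pi -> b ∈ a) -> aut W S st pi x = aut W S st' pi x.
Proof.
unfold aut; revert x; induction pi as [|[b t] pi IH]; intros x H; simpl; [reflexivity |].
rewrite (aut1_local t (H b t (or_introl eq_refl))); apply IH; intros b' t' Hb; apply (H b' t'); right; exact Hb.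
Qed.

Lemma forces_eq_local a' : subset a' a -> (forall q, iter_cond W st' a' q -> iter_cond W st a' q) ->
  (forall p q, (forall g u, opair g u ∈ q -> g ∈ a) -> iter_le st' p q -> iter_le st p q) ->
  forall x p y, iter_cond W st a' p -> name_in a' x -> name_in a' y ->
  forces_eq (iter W st a') p x y -> forces_eq (iter W st' a') p x y.
Proof.
intros Ha HC HL; induction x as [x IH] using below_ind; intros p y Hp Hx Hy H.
assert (forall q g u, iter_cond W st a' q -> opair g u ∈ q -> g ∈ a) as Kc.
{ intros q g u (_ & _ & H3 & _) Hg; destruct (H3 _ Hg) as (g' & u' & E & Hg'); apply opair_inj in E as [-> _]; auto. }
assert (forall x s z, name_in a' x -> opair s z ∈ x -> forall g u, opair g u ∈ s -> g ∈ a) as Kn.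
{ intros x' s z Hn Hs g u Hg; apply Ha, (proj1 (name_in_opair Hn Hs) g u Hg). }
apply forces_eq_eq in H as [H1 H2]; apply forces_eq_eq; split; simpl in *.
- intros s z q Hs Q1 Q2 Q3; apply HC in Q1.
  destruct (H1 s z q Hs Q1) as (r & t & w & R1 & R2 & Ht & R3 & R4).
  + apply HL; [intros g u; exact (Kc p g u Hp) | exact Q2].
  + apply HL; [exact (Kn x s z Hx Hs) | exact Q3].
  + exists r, t, w; split; [apply iter_cond_local; assumption |].
    split; [apply iter_le_local; [intros g u; exact (Kc q g u Q1) | exact R2] |].
    split; [exact Ht |]; split; [apply iter_le_local; [exact (Kn y t w Hy Ht) | exact R3] |].
    apply (IH z (below_snd Hs) r w R1 (proj2 (name_in_opair Hx Hs)) (proj2 (name_in_opair Hy Ht)) R4).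
- intros t w q Ht Q1 Q2 Q3; apply HC in Q1.
  destruct (H2 t w q Ht Q1) as (r & s & z & R1 & R2 & Hs & R3 & R4).
  + apply HL; [intros g u; exact (Kc p g u Hp) | exact Q2].
  + apply HL; [exact (Kn y t w Hy Ht) | exact Q3].
  + exists r, s, z; split; [apply iter_cond_local; assumption |].
    split; [apply iter_le_local; [intros g u; exact (Kc q g u Q1) | exact R2] |].
    split; [exact Hs |]; split; [apply iter_le_local; [exact (Kn x s z Hx Hs) | exact R3] |].
    apply (IH z (below_snd Hs) r w R1 (proj2 (name_in_opair Hx Hs)) (proj2 (name_in_opair Hy Ht)) R4).
Qed.

End NameLocality.

Section IterationLocality.
Context {V : universe} (W : V -> Prop) (S : V -> V).
Variables (st st' : V -> stage V) (a : V).
Hypothesis (Oa : ord a) (agree : forall g, g ∈ a -> st g = st' g).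
Implicit Types s b t u x y z p q : V.

Let agree' g (H : g ∈ a) : st' g = st g := eq_sym (agree H).

Lemma forces_eq_local' a' x p y : subset a' a -> iter_cond W st a' p -> name_in a' x -> name_in a' y ->
  forces_eq (iter W st a') p x y -> forces_eq (iter W st' a') p x y.
Proof.
intros Ha; apply (forces_eq_local agree Ha).
- intros q; exact (iter_cond_local agree' Ha).
- intros q q' H; exact (iter_le_local agree' H).
Qed.

Lemma sgen_name_in (b A x : V) : IS_gen W S st b A x -> name_in (suc b) x.
Proof.
induction x as [x IH] using below_ind; intros H; inversion H as [x' _ H2 _ E]; subst; constructor; intros z Hz.
destruct (H2 z Hz) as (p & y & -> & Hy & Hp & _); exists p, y; split; [reflexivity | split].
- intros g u Hg; destruct Hp as (_ & _ & H3 & _); destruct (H3 _ Hg) as (g' & u' & E & Hg').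
  apply opair_inj in E as [-> _]; exact Hg'.
- apply IH; [exact (below_snd Hz) | exact Hy].
Qed.

(** Being respected involves conditions of [P_(b+1)] and automorphisms with coordinates below [b].
    Both are the same for two sequences of stages that agree below [a], and forced equality follows
    because the names only mention coordinates in [suc b]. *)
Lemma IS_gen_local b A x : suc b ∈ suc a -> IS_gen W S st b A x -> IS_gen W S st' b A x.
Proof.
intros Hb; assert (subset (suc b) a) as Hsub.
{ apply in_suc in Hb as [Hb | <-]; [exact (ord_transitive Oa _ Hb) | intros z Hz; exact Hz]. }
assert (forall g, g ∈ b -> g ∈ a) as Hba by (intros g Hg; apply Hsub, in_suc; auto).
induction x as [x IH] using below_ind; intros H; pose proof (sgen_name_in H) as Hn.
inversion H as [x' H1 H2 (Hs & HS & HR) E]; subst; constructor; [exact H1 | |].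
- intros z Hz; destruct (H2 z Hz) as (p & y & -> & Hy & Hp & HA); exists p, y; splits; auto.
  + apply IH; [exact (below_snd Hz) | exact Hy].
  + exact (iter_cond_local agree Hsub Hp).
- exists Hs; split; [exact HS |]; intros p pi Hp Hpi Hf.
  assert (forall b t, In (b, t) pi -> b ∈ a) as Hin by (intros b' t Ht; apply Hba, (proj2 Hpi b' t Ht)).
  apply (iter_cond_local agree' Hsub) in Hp.
  rewrite <- (aut_local W S agree) by exact Hin.
  apply forces_eq_local'; auto; [apply name_in_aut, Hn |].
  apply HR; [exact Hp | |].
  + destruct Hpi as [P1 P2]; split; [exact P1 |]; intros b' t Ht; destruct (P2 b' t Ht) as (K1 & K2 & K3 & K4).
    rewrite (agree (Hin b' t Ht)); auto.
  + intros b' t Ht; specialize (Hf b' t Ht); rewrite (agree (Hin b' t Ht)); exact Hf.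
Qed.

End IterationLocality.

Section RestrictionLocality.
Context {V : universe} (W : V -> Prop) (S : V -> V).
Variables (st st' : V -> stage V) (a : V).
Hypothesis (Oa : ord a) (agree : forall g, g ∈ a -> st g = st' g).

Lemma Rname_local b xi : suc b ∈ suc a -> Rname W S st b xi = Rname W S st' b xi.
Proof.
intros Hb; unfold Rname; f_equal; apply pred_ext; intros x; apply and_iff_compat_r.
split; [apply (IS_gen_local Oa agree Hb) |].
apply IS_gen_local with a; auto; intros g Hg; symmetry; auto.
Qed.

(** The model is defined from the whole sequence [stages], while a code covers only an initial
    segment; this bridges the two. *)
Lemma rho_restriction_local y : rho_restriction W S st a y -> rho_restriction W S st' a y.
Proof.
intros [(b & J & E & H1 & H2 & H3 & ->) | (L & E & A & H1 & H2 & H3 & H4 & ->)].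
- left; exists b, J; splits; auto.
  unfold rho_succ; f_equal; apply pred_ext; intros u; apply ex_iff; intros xi; apply and_iff_compat_l.
  rewrite Rname_local; [tauto | rewrite E; apply in_suc; auto].
- right; split; [exact L |]; exists E, A; splits; auto.
  unfold rho_limit; f_equal; apply pred_ext; intros u; apply ex_iff; intros f; apply and_iff_compat_l.
  assert (bullet (fun w => exists b, b ∈ A /\ w = dpair (check b) (Rname W S st b (app f (aleph W (suc b))))) =
    bullet (fun w => exists b, b ∈ A /\ w = dpair (check b) (Rname W S st' b (app f (aleph W (suc b)))))) as ->; [| tauto].
  f_equal; apply pred_ext; intros w; apply ex_iff; intros b; apply and_iff_compat_l'; intros Hb.
  rewrite Rname_local; [tauto |]; apply in_suc; left; apply L, H3, Hb.
Qed.

End RestrictionLocality.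

#[export] Hint Resolve f_bulQ d_siter_cond d_siter_le f_iter_set d_srho f_srho_succ f_srho_limit : dfn.

(** * The elements of the forcings and the recursion along the stages *)

Section QNames.
Context {V : universe} (W : V -> Prop) (S : V -> V).
Notation I := (seq_pred W S).
Context (Wtrans : transitive_class W) (HZ : models_ZFC W I).
Context (HS : forall a, W a -> ord a ->
    (is_limit a -> permutable_scale W (aleph W a) (S a)) /\
    (~ is_limit a -> permutable_family W (aleph W a) (S a))).
Notation tl e := (fun n => e (Datatypes.S n)).
Notation tl2 e := (fun n => e (Datatypes.S (Datatypes.S n))).
Notation Dp := (Dp I W).
Notation Df := (Df I W).
Notation ok := (over_D W).
Implicit Types s b a t u x y z p q : V.

Let saut_seq_W s a z : saut_seq W S s a z -> W a -> W z.
Proof. intros H Wa; exact (saut_seq_W Wtrans HZ Wa H). Qed.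
Hint Resolve saut_seq_W : guard.

Lemma d_Add : D1 I W tru1 (@Add V).
Proof. dgoal; unfold Add; dauto. Qed.
Hint Resolve d_Add : dfn.

Definition two := suc (suc (@empty V)).

Lemma Add_prod x : Add x -> subset x (prod omega two).
Proof.
intros (_ & H & _) z Hz; destruct (H z Hz) as (n & i & Hn & Hi & ->); apply opair_in_prod.
split; [exact Hn |]; unfold two; rewrite !in_suc, in_empty; tauto.
Qed.

Lemma Add_W x : Add x -> W x.
Proof.
intros H; pose proof (Add_prod H) as K; destruct H as ((l & Hl) & _).
apply (D_list_set Wtrans HZ (l := l)); [| exact Hl].
intros y Hy; apply Hl, K in Hy; assert (W (prod omega two)) as Wp by (unfold two; dm).
exact (Wtrans Wp Hy).
Qed.
Hint Resolve Add_W : guard.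

Definition AddSet := setof (fun x : V => Add x).

Lemma in_AddSet x : x ∈ AddSet <-> Add x.
Proof.
destruct (power V (prod omega two)) as [w Hw]; apply (setof_bounded (fun x : V => Add x) w).
intros z Hz; apply Hw, Add_prod, Hz.
Qed.

Lemma f_AddSet : F0 I W AddSet.
Proof.
dgoal; apply (df_setof Wtrans HZ); [| dauto].
intros e He _; exists (powD W (prod omega two)); split; [unfold two; dm |].
intros x Hx; apply in_powD; split; [exact (Add_W Hx) | exact (Add_prod Hx)].
Qed.
Hint Resolve f_AddSet : dfn.

Definition sQn s a y : Prop := Q_names W S (decode s) a y.

Lemma sQn_eq s a y : ord a -> (sQn s a y <-> (a = empty /\ exists x, Add x /\ y = check x) \/
  (a <> empty /\ exists z x, saut_seq W S s a z /\ srho W S s a x /\ y = autc W S s x z)).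
Proof.
intros Oa; unfold sQn, Q_names; apply or_iff_compat_l, and_iff_compat_l; split.
- intros (pi & x & H1 & H2 & ->); exists (pi_code pi), x.
  assert (saut_seq W S s a (pi_code pi)) as K by (exists pi; auto).
  rewrite autc_eq by exact (saut_seq_ord Oa K); auto.
- intros (z & x & K & H2 & ->); pose proof (saut_seq_ord Oa K) as Oz; destruct K as (pi & -> & K).
  exists pi, x; rewrite autc_eq by exact Oz; auto.
Qed.

Lemma srho_W s a x : W s -> W a -> ord a -> srho W S s a x -> W x.
Proof.
intros Ws Wa Oa [(b & J & E & H1 & H2 & H3 & ->) | (L & E & A & H1 & H2 & H3 & H4 & ->)].
- assert (W b) by (apply (Wtrans Wa); rewrite E; apply in_suc; auto).
  apply (F3_D (f_srho_succ Wtrans HZ HS)); auto; apply (rho_succ_guard Wtrans HZ HS Wa Oa E H2).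
- apply (F3_D (f_srho_limit Wtrans HZ HS)); auto; [apply H1 |].
  exact (rho_limit_guard Wtrans HZ HS Wa Oa L (proj1 (proj2 H1)) H3).
Qed.

Lemma d_sQn : D3 I W (fun s a _ => ord a) sQn.
Proof.
dgoal; apply dp_ext with (fun e => (e 1 = empty /\ exists x, Add x /\ e 2 = check x) \/
  (e 1 <> empty /\ exists z x, saut_seq W S (e 0) (e 1) z /\ srho W S (e 0) (e 1) x /\ e 2 = autc W S (e 0) x z)).
- intros e He Oa; symmetry; apply sQn_eq, Oa.
- dauto.
  intros e x He [Oa _] (_ & Hx & _); exact (srho_W (He 1) (He 2) Oa Hx).
Qed.
Hint Resolve d_sQn : dfn.

Lemma srho_bound s a : W s -> W a -> ord a -> exists y, W y /\ forall x, srho W S s a x -> x ∈ y.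
Proof.
intros Ws Wa Oa; destruct (classic (exists b, a = suc b)) as [(b & E) | N].
- assert (F3 I W (fun _ b X => ord b /\ forall J, J ∈ X -> forall xi, xi ∈ J -> functional_at (S b) xi)
    (fun s b X => img (fun J => srho_succ W S s b J) X)) as FI.
  { apply (df_img Wtrans HZ (G := fun e => ord (e 1) /\ forall J, J ∈ e 2 -> forall xi, xi ∈ J -> functional_at (S (e 1)) xi)
      (X := fun e => e 2) (F := fun J e => srho_succ W S (e 0) (e 1) J)); [dauto |].
    dauto; cbv beta; intros e He [[H1 H2] H3]; auto. }
  assert (W b) as Wb by (apply (Wtrans Wa); rewrite E; apply in_suc; auto).
  exists (img (fun J => srho_succ W S s b J) (powD W (aleph W a))); split.
  + apply (F3_D FI Ws Wb); [dm |]; split; [exact (suc_ord Oa E) |].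
    intros J HJ; apply in_powD in HJ as [HJ1 HJ2].
    apply (rho_succ_guard Wtrans HZ HS Wa Oa E HJ2).
  + intros x [(b' & J & E' & H1 & H2 & H3 & ->) | (L & _)].
    * assert (b' = b) as ->.
      { assert (b ∈ suc b' /\ b' ∈ suc b) as [K1 K2] by (split; [rewrite <- E', E | rewrite <- E, E']; apply in_suc; auto).
        apply in_suc in K1 as [K1 | K1]; [apply in_suc in K2 as [K2 | K2]; [destruct (mem_asym K1 K2) | exact K2] | auto]. }
      apply in_img; exists J; split; [apply in_powD; auto | reflexivity].
    * destruct L as (_ & _ & L); assert (suc b ∈ a) as K by (apply L; rewrite E; apply in_suc; auto).
      rewrite <- E in K; destruct (mem_irrefl K).
- destruct (classic (is_limit a)) as [L | NL].
  + assert (F3 I W (fun _ E X => forall A, A ∈ X -> limit_guard W S E A)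
      (fun s E X => img (fun A => srho_limit W S s E A) X)) as F1.
    { apply (df_img Wtrans HZ (G := fun e => forall A, A ∈ e 2 -> limit_guard W S (e 1) A)
        (X := fun e => e 2) (F := fun A e => srho_limit W S (e 0) (e 1) A)); [dauto |].
      dauto; cbv beta; intros e He [H1 H2]; auto. }
    assert (F3 I W (fun _ Y X => forall E A, E ∈ Y -> A ∈ X -> limit_guard W S E A)
      (fun s Y X => img (fun E => img (fun A => srho_limit W S s E A) X) Y)) as F2.
    { apply (df_img Wtrans HZ (G := fun e => forall E A, E ∈ e 1 -> A ∈ e 2 -> limit_guard W S E A)
        (X := fun e => e 1) (F := fun E e => img (fun A => srho_limit W S (e 0) E A) (e 2))); [dauto |].
      refine (df_use3 (f := fun s E X => img (fun A => srho_limit W S s E A) X) F1 _ _ _ _); [dauto | dauto | dauto |].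
      cbv beta; intros e He [H1 H2]; auto. }
    exists (cup (img (fun E => img (fun A => srho_limit W S s E A) (powD W a)) (powD W (prodSC W (aleph W a))))); split.
    * assert (W (img (fun E => img (fun A => srho_limit W S s E A) (powD W a)) (powD W (prodSC W (aleph W a))))); [| dm].
      apply (F3_D F2 Ws); [dm | dm |].
      intros E A HE HA; apply in_powD in HE as [_ HE]; apply in_powD in HA as [_ HA].
      exact (rho_limit_guard Wtrans HZ HS Wa Oa L HE HA).
    * intros x [(b' & J & E' & _) | (_ & E & A & H1 & H2 & H3 & H4 & ->)]; [destruct N; eauto |].
      apply in_cup; exists (img (fun A => srho_limit W S s E A) (powD W a)); split; apply in_img.
      -- exists E; split; [apply in_powD; split; [apply H1 | exact (proj1 (proj2 H1))] | reflexivity].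
      -- exists A; split; [apply in_powD; auto | reflexivity].
  + exists a; split; [exact Wa |]; intros x [(b' & J & E' & _) | (L & _)]; [destruct N; eauto | contradiction].
Qed.

Lemma in_decided_pow s b t : W s -> W b -> W t -> ord b ->
  decided W S s b t ∈ powD W (prod (cset s b) (group W S b)).
Proof.
intros Ws Wb Wt Ob; apply in_powD; split; [apply (F3_D (f_decided Wtrans HZ HS)); auto |].
intros z Hz; unfold decided in Hz.
apply (setof_bounded (fun z => exists q p, z = opair q p /\ scond s b q /\
  p ∈ group W S b /\ sfeq s b q t (check p)) (prod (cset s b) (group W S b))) in Hz.
- destruct Hz as (q' & p' & -> & H1 & H2 & _); apply opair_in_prod; split; [apply decode_cond, H1 | exact H2].
- clear z Hz; intros z (q' & p' & -> & H1 & H2 & _); apply opair_in_prod; split; [apply decode_cond, H1 | exact H2].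
Qed.

(** A set containing the restrictions of the generic object is closed under single automorphisms
    with arbitrary decided data at coordinates below [a]. Products of automorphisms are finite, so
    their values stay inside by induction on the length. *)
Lemma sQn_bound s a : W s -> W a -> ord a -> exists y, W y /\ forall q, sQn s a q -> q ∈ y.
Proof.
intros Ws Wa Oa.
destruct (srho_bound Ws Wa Oa) as (X0 & WX0 & HX0).
pose (K := fun s b x => img (fun F => psnd (autp W S s b F x)) (powD W (prod (cset s b) (group W S b)))).
assert (F3 I W (fun _ b _ => ord b) K) as FK.
{ apply (df_img Wtrans HZ (G := fun e => ord (e 1)) (X := fun e => powD W (prod (cset (e 0) (e 1)) (group W S (e 1))))
    (F := fun F e => psnd (autp W S (e 0) (e 1) F (e 2)))); dauto. }
pose (F := fun x s a => cup (img (fun b => K s b x) a)).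
assert (F3 I W (fun _ _ a => ord a) F) as FF.
{ dgoal; unfold F; dstep.
  apply (df_img Wtrans HZ (G := fun e => ord (e 2)) (X := fun e => e 2) (F := fun b e => K (e 1) b (e 0))); [dauto |].
  dauto; cbv beta; intros e He [H1 H2]; exact (ord_mem H1 H2). }
destruct (@D_closure V unit I W Wtrans HZ (fun e => ord (e 1)) (fun x e => F x (e 0) (e 1)) FF (scons s (fun _ => a)) X0)
  as (X & WX & HX1 & HX2); auto.
{ intros [|n]; simpl; assumption. }
simpl in HX2.
pose proof f_AddSet.
assert (F1 I W tru1 (fun _ => img (@check V) AddSet)) as FA.
{ apply (df_img Wtrans HZ (G := fun _ => True) (X := fun _ => AddSet) (F := fun x _ => check x)); dauto. }
assert (W (img (@check V) AddSet)) as WA by exact (F1_D FA Wa Logic.I).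
exists (join X (img (@check V) AddSet)); split; [dm |].
intros q Hq; apply in_join; destruct Hq as [(-> & x & Hx & ->) | (_ & pi & x & (_ & Hpi) & Hx & ->)].
- right; apply in_img; exists x; split; [apply in_AddSet, Hx | reflexivity].
- left; apply HX0, HX1 in Hx.
  revert Hpi; induction pi as [|[b t] pi IH] using rev_ind; intros Hpi; [exact Hx |].
  assert (aut W S (decode s) pi x ∈ X) as Hy.
  { apply IH; intros b' t' H'; apply Hpi, in_app_iff; auto. }
  destruct (Hpi b t) as (Hb & Wt & _); [apply in_app_iff; simpl; auto |].
  rewrite aut_snoc; apply (HX2 _ Hy), in_cup.
  exists (K s b (aut W S (decode s) pi x)); split; [apply in_img; eauto |].
  apply in_img; exists (decided W S s b t); split.
  + apply in_decided_pow; auto; [exact (Wtrans Wa Hb) | exact (ord_mem Oa Hb)].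
  + unfold autp; rewrite psnd_opair; reflexivity.
Qed.

Definition Qset s a := setof (fun y => sQn s a y).

Lemma in_Qset s a y : W s -> W a -> ord a -> (y ∈ Qset s a <-> sQn s a y).
Proof.
intros Ws Wa Oa; destruct (sQn_bound Ws Wa Oa) as (B & _ & HB).
exact (setof_bounded (fun y => sQn s a y) B HB y).
Qed.

Lemma f_Qset : F2 I W (fun _ a => ord a) Qset.
Proof.
dgoal; unfold Qset; apply (df_setof Wtrans HZ).
- intros e He Oa; apply sQn_bound; auto.
- apply dp_ext with (fun e => W (e 0) /\ sQn (e 1) (e 2) (e 0)).
  + intros e He Oa; split; [tauto |]; intros H; split; [apply He | exact H].
  + dauto.
Qed.
Hint Resolve f_Qset : dfn.

(** The clause [ord a] makes the step total, empty off the ordinals, since the recursion runs over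
    all sets. *)
Definition stage_code_step s a := setof (fun w => ord a /\ w ∈ opair (iter_set W s a) (Qset s a)).

Lemma f_stage_code_step : F2 I W tru2 stage_code_step.
Proof.
dgoal; unfold stage_code_step; apply (df_setof Wtrans HZ).
- intros e He _; destruct (classic (ord (e 1))) as [O | N].
  + exists (opair (iter_set W (e 0) (e 1)) (Qset (e 0) (e 1))); split; [wside | tauto].
  + exists (e 0); split; [apply He | tauto].
- dauto.
Qed.
Hint Resolve f_stage_code_step : dfn.

Definition stage_code : V -> V := mem_rec empty (fun a rec => stage_code_step (graph rec (tc a)) a).

Lemma stage_code_eq a : stage_code a = stage_code_step (graph stage_code (tc a)) a.
Proof.
unfold stage_code at 1; rewrite mem_rec_below; [reflexivity |].
intros r r' E; f_equal; apply graph_ext; intros y Hy; apply E, in_tc, Hy.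
Qed.

Lemma f_stage_code : F1 I W tru1 stage_code.
Proof.
apply (@df_rec V unit I W Wtrans HZ (fun _ => True) (fun _ a => stage_code a) (fun a g _ => stage_code_step g a)).
- intros e a _ _ _; apply stage_code_eq.
- dauto.
Qed.
Hint Resolve f_stage_code : dfn.

Definition stage_seq a := graph stage_code a.

Lemma f_stage_seq : F1 I W tru1 stage_seq.
Proof.
dgoal; unfold stage_seq, graph.
apply (df_image Wtrans HZ (G := fun _ => True) (P := fun y e => y ∈ e 0) (F := fun y _ => opair y (stage_code y))).
- intros e He _; exists (e 0); auto.
- dauto.
- dauto.
Qed.

Lemma stage_code_ord a : ord a -> stage_code a = opair (iter_set W (stage_seq a) a) (Qset (stage_seq a) a).
Proof.
intros Oa; rewrite stage_code_eq; unfold stage_code_step, stage_seq; rewrite (ord_tc Oa).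
transitivity (setof (fun w => w ∈ opair (iter_set W (graph stage_code a) a) (Qset (graph stage_code a) a))); [| apply setof_mem].
apply setof_ext; tauto.
Qed.

Definition stages_below a : V -> stage V :=
  fun b => if excluded_middle_informative (below b a) then stages W S b else no_stage.

Lemma stages_eq a : stages W S a = Stage (iter W (stages_below a) a) (Q_names W S (stages_below a) a).
Proof. unfold stages at 1; rewrite mem_rec_eq; reflexivity. Qed.

Lemma in_dom_stage_seq a b : ord a -> (in_dom (stage_seq a) b <-> b ∈ a).
Proof.
intros Oa; unfold in_dom, stage_seq; split.
- intros (C & Q & H); apply opair_in_graph in H; tauto.
- intros H; exists (iter_set W (stage_seq b) b), (Qset (stage_seq b) b).
  apply opair_in_graph; split; [exact H | symmetry; apply stage_code_ord, (ord_mem Oa H)].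
Qed.

Lemma cset_stage_seq a b : ord a -> b ∈ a -> cset (stage_seq a) b = iter_set W (stage_seq b) b.
Proof.
intros Oa Hb; apply mem_ext; intros q; rewrite in_cset; split.
- intros (C & Q & H & Hq); apply opair_in_graph in H as [_ E].
  rewrite stage_code_ord in E by exact (ord_mem Oa Hb); apply opair_inj in E as [-> _]; exact Hq.
- intros Hq; exists (iter_set W (stage_seq b) b), (Qset (stage_seq b) b); split; [| exact Hq].
  apply opair_in_graph; split; [exact Hb | symmetry; apply stage_code_ord, (ord_mem Oa Hb)].
Qed.

Lemma qset_stage_seq a b : ord a -> b ∈ a -> qset (stage_seq a) b = Qset (stage_seq b) b.
Proof.
intros Oa Hb; apply mem_ext; intros q; rewrite in_qset; split.
- intros (C & Q & H & Hq); apply opair_in_graph in H as [_ E].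
  rewrite stage_code_ord in E by exact (ord_mem Oa Hb); apply opair_inj in E as [_ ->]; exact Hq.
- intros Hq; exists (iter_set W (stage_seq b) b), (Qset (stage_seq b) b); split; [| exact Hq].
  apply opair_in_graph; split; [exact Hb | symmetry; apply stage_code_ord, (ord_mem Oa Hb)].
Qed.

(** Two inductions are nested. The outer one says that the shorter code [stage_seq b] decodes to
    [stages_below b], which gives the ingredients of stage [b]; the inner one identifies the stages
    that [decode] has already built from the longer code. *)
Lemma decode_stage_seq a : W a -> ord a -> decode (stage_seq a) = stages_below a.
Proof.
induction a as [a IH] using below_ind; intros Wa Oa; extensionality b.
unfold stages_below; destruct excluded_middle_informative as [Hb | Hb].
- apply (ord_below _ Oa) in Hb; revert Hb; induction b as [b IHb] using below_ind; intros Hb.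
  pose proof (ord_mem Oa Hb) as Ob; pose proof (Wtrans Wa Hb) as Wb.
  assert (W (stage_seq b)) as Wsb by exact (F1_D f_stage_seq Wb Logic.I).
  unfold decode; rewrite mem_rec_eq; fold (decode (stage_seq a)); destruct excluded_middle_informative as [H | N].
  + assert ((fun y => if excluded_middle_informative (below y b) then decode (stage_seq a) y else no_stage) = stages_below b) as ->.
    { extensionality y; unfold stages_below; destruct excluded_middle_informative as [Hy | Hy]; [| reflexivity].
      apply IHb; [exact Hy |]; apply (ord_below _ Oa); apply below_trans with b; [exact Hy | apply below_mem, Hb]. }
    rewrite stages_eq, <- (IH b (below_mem Hb) Wb Ob); unfold iter; f_equal; [f_equal |]; apply pred_ext; intros q.
    * rewrite (cset_stage_seq Oa Hb), (in_iter_set Wtrans); reflexivity.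
    * rewrite (qset_stage_seq Oa Hb), in_Qset by assumption; reflexivity.
  + destruct N; apply in_dom_stage_seq; assumption.
- unfold decode; rewrite mem_rec_eq; destruct excluded_middle_informative as [H | N]; [| reflexivity].
  destruct Hb; apply below_mem, (in_dom_stage_seq b Oa), H.
Qed.

Lemma stages_decode a b : W a -> ord a -> b ∈ a -> stages W S b = decode (stage_seq a) b.
Proof.
intros Wa Oa Hb; rewrite decode_stage_seq by assumption; unfold stages_below.
destruct excluded_middle_informative as [H | N]; [reflexivity | destruct N; apply below_mem, Hb].
Qed.

End QNames.

#[export] Hint Resolve d_Add f_AddSet f_stage_seq : dfn.

(** * The generic filter computed from finite parts of the Cohen real *)

Section GenericFilter.
Context {V : universe} (W : V -> Prop) (S : V -> V).
Notation I := (seq_pred W S).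
Context (Wtrans : transitive_class W) (HZ : models_ZFC W I).
Context (HS : forall a, W a -> ord a ->
    (is_limit a -> permutable_scale W (aleph W a) (S a)) /\
    (~ is_limit a -> permutable_family W (aleph W a) (S a))).
Notation Dp := (Dp I W).
Notation Df := (Df I W).
Notation ok := (over_D W).
Implicit Types s b a t u x y z p q : V.

Let scond_W s b q : scond s b q -> W s -> W q.
Proof. exact (scond_D Wtrans (s := s) (b := b) (q := q)). Qed.
Let Add_W' x : Add x -> W x := @Add_W V W S Wtrans HZ x.
Hint Resolve scond_W Add_W' : guard.

(** [opair t p] is in this set when the finite part [t] of [c] puts [p] in the
    filter. *)
Definition forced_filter s a := setof (fun z => exists t p, z = opair t p /\ Add t /\ scond s a p /\
  exists q, scond s a q /\ sle s a q p /\
    forall b u, opair b u ∈ q -> b ∈ a /\ exists y,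
      ((b = empty /\ exists t', Add t' /\ subset t' t /\ y = check t') \/ (b <> empty /\ srho W S s b y)) /\
      u = sfull W s b y).

Lemma in_forced_filter s a t p : opair t p ∈ forced_filter s a <-> Add t /\ scond s a p /\
  exists q, scond s a q /\ sle s a q p /\
    forall b u, opair b u ∈ q -> b ∈ a /\ exists y,
      ((b = empty /\ exists t', Add t' /\ subset t' t /\ y = check t') \/ (b <> empty /\ srho W S s b y)) /\
      u = sfull W s b y.
Proof.
unfold forced_filter; rewrite (setof_bounded _ (prod AddSet (cset s a))).
- split; [intros (t' & p' & E & H); apply opair_inj in E as [-> ->]; exact H | intros H; exists t, p; auto].
- intros z (t' & p' & -> & H1 & H2 & _); apply opair_in_prod; split; [apply in_AddSet, H1 | apply decode_cond, H2].
Qed.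

Lemma f_forced_filter : F2 I W (fun _ a => ord a) forced_filter.
Proof.
assert (forall x y : V, ord x -> y ∈ x -> ord y) by apply ord_mem.
dgoal; unfold forced_filter; apply (df_setof Wtrans HZ).
- intros e He _; exists (prod AddSet (cset (e 0) (e 1))); split; [wside |].
  intros z (t' & p' & -> & H1 & H2 & _); apply opair_in_prod; split; [apply in_AddSet, H1 | apply decode_cond, H2].
- dauto.
  + intros e y He K [[(_ & t' & Ht & _ & ->) | (_ & Hy)] _]; destruct_all.
    * assert (W t') by eauto with guard; dm.
    * assert (ord (e 1)) by eauto.
      exact (srho_W Wtrans HZ HS (He 6) (He 1) ltac:(assumption) Hy).
Qed.

Lemma full_local (st st' : V -> stage V) b y : st b = st' b -> full W st b y = full W st' b y.
Proof. intros E; unfold full, is_value; rewrite E; reflexivity. Qed.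

Lemma Add_empty : Add (@empty V).
Proof.
split; [exists []; intros y; rewrite in_empty; simpl; tauto | split].
- intros z Hz; apply in_empty in Hz; destruct Hz.
- intros n i j Hn; apply in_empty in Hn; destruct Hn.
Qed.

(** In a condition whose coordinates are approximations only coordinate 0 mentions [c], and it does
    so through one finite part; the other coordinates are canonical names, which [W] knows. *)
Lemma generic_filter_forced c a p : W a -> ord a ->
  (generic_filter W S c a p <-> exists t, Add t /\ subset t c /\ opair t p ∈ forced_filter (stage_seq W S (suc a)) a).
Proof.
(* The code runs up to [suc a] in order to include stage [a], whose conditions make up the
   filter. *)
intros Wa Oa; set (s := stage_seq W S (suc a)).
assert (W (suc a)) as Wsa by dm.
assert (ord (suc a)) as Osa by (apply ord_suc, Oa).
assert (forall b, b ∈ suc a -> stages W S b = decode s b) as E by (intros b Hb; apply (stages_decode Wtrans HZ HS); auto).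
assert (stages W S a = decode s a) as Ea by (apply E, in_suc; auto).
assert (forall b y, b ∈ a -> (rho_restriction W S (stages W S) b y <-> srho W S s b y)) as Erho.
{ intros b y Hb; pose proof (ord_mem Oa Hb) as Ob.
  assert (forall g, g ∈ b -> stages W S g = decode s g) as Eb.
  { intros g Hg; apply E, in_suc; left; exact (ord_transitive Oa b Hb g Hg). }
  split; apply (rho_restriction_local Ob); [exact Eb | intros g Hg; symmetry; exact (Eb g Hg)]. }
assert (forall b y, b ∈ a -> full W (stages W S) b y = sfull W s b y) as Efull.
{ intros b y Hb; apply full_local, E, in_suc; auto. }
unfold generic_filter; rewrite Ea; split.
- intros (Hp & q & Hq & Hle & Happ).
  assert (cond (stages W S a) q) as Hq' by (rewrite Ea; exact Hq).
  rewrite (stages_eq W S a) in Hq'; destruct Hq' as (_ & _ & Hq1 & Hq2 & _).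
  assert (forall b u, opair b u ∈ q -> b ∈ a) as Hba.
  { intros b u Hb; destruct (Hq1 _ Hb) as (b' & u' & Eb & Hb'); apply opair_inj in Eb as [-> _]; exact Hb'. }
  (* Coordinate 0 may be missing from [q]; then the empty part of [c] is enough. *)
  assert (exists t, Add t /\ subset t c /\ forall u, opair empty u ∈ q ->
    exists t', Add t' /\ subset t' t /\ u = sfull W s empty (check t')) as (t & Ht & Htc & Htu).
  { destruct (classic (exists u, opair empty u ∈ q)) as [(u & Hu) | N].
    - destruct (Happ _ _ Hu) as (y & [(_ & t & Ht & Htc & ->) | (N & _)] & Eu); [| destruct N; reflexivity].
      exists t; splits; auto; intros u' Hu'; rewrite (Hq2 _ _ _ Hu' Hu).
      exists t; splits; auto; [intros z Hz; exact Hz |].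
      rewrite Eu; apply Efull, (Hba _ _ Hu).
    - exists empty; split; [exact Add_empty | split].
      + intros z Hz; apply in_empty in Hz; destruct Hz.
      + intros u Hu; destruct N; eauto. }
  exists t; splits; auto; apply in_forced_filter; splits; auto.
  exists q; splits; auto; intros b u Hb; pose proof (Hba _ _ Hb) as Hb'; split; [exact Hb' |].
  destruct (classic (b = empty)) as [-> | Nb].
  + destruct (Htu u Hb) as (t' & H1 & H2 & H3); exists (check t'); split; [left; split; [reflexivity | eauto] | exact H3].
  + destruct (Happ _ _ Hb) as (y & [(C & _) | (_ & Hy)] & Eu); [contradiction |].
    exists y; split; [right; split; [exact Nb | apply Erho; assumption] | rewrite Eu; apply Efull, Hb'].
- intros (t & _ & Htc & Ht); apply in_forced_filter in Ht as (At & Hp & q & Hq & Hle & Happ).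
  split; [exact Hp |]; exists q; split; [exact Hq | split; [exact Hle |]].
  intros b u Hb; destruct (Happ b u Hb) as (Hb' & y & Hy & Eu); exists y; split; [| rewrite Efull; assumption].
  destruct Hy as [(-> & t' & H1 & H2 & ->) | (Nb & Hy)].
  + left; split; [reflexivity |]; exists t'; splits; auto; intros z Hz; auto.
  + right; split; [exact Nb | apply Erho; assumption].
Qed.

End GenericFilter.

(** * Cohen forcing *)

Section Cohen.
Context {V : universe} (W : V -> Prop) (S : V -> V).
Notation I := (seq_pred W S).
Context (Wtrans : transitive_class W) (HZ : models_ZFC W I).
Notation Dp := (Dp I W).
Notation Df := (Df I W).
Notation ok := (over_D W).
Implicit Types s t u v x y z p q : V.
Let Add_W' x : Add x -> W x := @Add_W V W S Wtrans HZ x.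
Hint Resolve Add_W' : guard.

Context (c : V) (Hc : cohen_real W c).

Definition Addc t := Add t /\ subset t c.

Lemma Addc_join t t' : Addc t -> Addc t' -> Addc (join t t').
Proof.
intros [(F1 & H1 & _) S1] [(F2 & H2 & _) S2]; split; [split; [| split] |].
- destruct F1 as (l1 & E1), F2 as (l2 & E2); exists (l1 ++ l2); intros y.
  rewrite in_join, in_app_iff, E1, E2; tauto.
- intros z Hz; apply in_join in Hz as [Hz | Hz]; auto.
- destruct Hc as [[[_ Fc] _] _].
  assert (forall z, z ∈ join t t' -> z ∈ c) as K by (intros z Hz; apply in_join in Hz as [Hz | Hz]; auto).
  intros n i j Hi Hj.
  assert (n ∈ omega) as Hn.
  { assert (exists n' i', n' ∈ omega /\ opair n i = opair n' i') as (n' & i' & Hn' & E).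
    { apply in_join in Hi as [Hi | Hi]; [destruct (H1 _ Hi) as (n' & i' & ? & _ & ->) | destruct (H2 _ Hi) as (n' & i' & ? & _ & ->)]; eauto. }
    apply opair_inj in E as [-> _]; exact Hn'. }
  destruct (Fc n Hn) as (w & _ & U); rewrite <- (U i (K _ Hi)), <- (U j (K _ Hj)); reflexivity.
- intros z Hz; apply in_join in Hz as [Hz | Hz]; auto.
Qed.

Lemma Addc_empty : Addc empty.
Proof. split; [apply Add_empty | intros z Hz; apply in_empty in Hz; destruct Hz]. Qed.

Lemma join_l x y : subset x (join x y).
Proof. intros z Hz; apply in_join; auto. Qed.
Lemma join_r x y : subset y (join x y).
Proof. intros z Hz; apply in_join; auto. Qed.
Lemma subset_trans x y z : subset x y -> subset y z -> subset x z.
Proof. intros H1 H2 w Hw; auto. Qed.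
Lemma subset_refl x : subset x x.
Proof. intros w Hw; exact Hw. Qed.
Hint Resolve join_l join_r subset_refl : core.

(** Density is assumed only below [t]. Adding the conditions without a common extension with [t]
    makes a dense set, and a finite part of [c] cannot be one of those, since parts of [c] are
    compatible. *)
Lemma generic_below B t : W B -> Addc t ->
  (forall t1, Add t1 -> subset t t1 -> exists t2, t2 ∈ B /\ Add t2 /\ subset t1 t2) ->
  exists t2, t2 ∈ B /\ Addc t2.
Proof.
intros WB Ht HB.
pose (E := fun B t => setof (fun r => Add r /\ (r ∈ B \/ forall t2, Add t2 -> subset r t2 -> ~ subset t t2))).
assert (F2 I W tru2 E) as FE.
{ dgoal; unfold E; apply (df_setof Wtrans HZ); [| dauto].
  intros e He _; exists AddSet; split; [dm |]; intros x [Hx _]; apply in_AddSet, Hx. }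
assert (forall r, r ∈ E B t <-> Add r /\ (r ∈ B \/ forall t2, Add t2 -> subset r t2 -> ~ subset t t2)) as EE.
{ apply (setof_bounded (fun r => Add r /\ (r ∈ B \/ forall t2, Add t2 -> subset r t2 -> ~ subset t t2)) AddSet).
  intros x [Hx _]; apply in_AddSet, Hx. }
assert (W t) as Wt by (apply Add_W', Ht).
destruct (proj2 Hc (E B t)) as (r & Hr & Hrc).
- exact (F2_D FE WB Wt Logic.I).
- intros r Hr; apply EE in Hr; tauto.
- intros r Hr; destruct (classic (exists t1, Add t1 /\ subset r t1 /\ subset t t1)) as [(t1 & A1 & A2 & A3) | N].
  + destruct (HB t1 A1 A3) as (t2 & B1 & B2 & B3); exists t2; split; [apply EE; auto | exact (subset_trans A2 B3)].
  + exists r; split; [| auto]; apply EE; split; [exact Hr | right].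
    intros t2 A1 A2 A3; apply N; eauto.
- apply EE in Hr as [Ar [Hr | Hr]]; [exists r; split; [exact Hr | split; assumption] |].
  assert (Addc r) as Hr' by (split; assumption).
  destruct (Hr (join r t)); auto; apply (Addc_join Hr' Ht).
Qed.

(** [v] satisfies the statement forced by the pairs of [E]. *)
Definition ctrue (E v : V) := exists t, Addc t /\ opair t v ∈ E.

Definition below_c (E t v : V) := exists t', Add t' /\ subset t' t /\ opair t' v ∈ E.

Lemma d_below_c : D3 I W tru3 below_c.
Proof. dgoal; unfold below_c; dauto. Qed.
Hint Resolve d_below_c : dfn.

Lemma below_c_true E t v : subset t c -> below_c E t v -> ctrue E v.
Proof. intros H (r & H1 & H2 & H3); exists r; split; [split; [exact H1 | exact (subset_trans H2 H)] | exact H3]. Qed.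

(** Forced negation: [v] is excluded by a condition none of whose extensions puts it into the set
    named by [E]. *)
Definition compl (E X : V) := setof (fun q => exists t v, q = opair t v /\ Add t /\ v ∈ X /\
  forall t1, Add t1 -> subset t t1 -> ~ below_c E t1 v).

Lemma in_compl E X t v : opair t v ∈ compl E X <-> Add t /\ v ∈ X /\
  forall t1, Add t1 -> subset t t1 -> ~ below_c E t1 v.
Proof.
unfold compl; rewrite (setof_bounded _ (prod AddSet X)).
- split; [intros (t' & p' & E' & H); apply opair_inj in E' as [-> ->]; exact H | intros H; exists t, v; auto].
- intros z (t' & p' & -> & H1 & H2 & _); apply opair_in_prod; split; [apply in_AddSet, H1 | exact H2].
Qed.

Lemma f_compl : F2 I W tru2 compl.
Proof.
dgoal; unfold compl; apply (df_setof Wtrans HZ); [| dauto].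
intros e He _; exists (prod AddSet (e 1)); split; [wside |].
intros z (t' & p' & -> & H1 & H2 & _); apply opair_in_prod; split; [apply in_AddSet, H1 | exact H2].
Qed.
Hint Resolve f_compl : dfn.

Definition hits (E v : V) := setof (fun t => Add t /\ below_c E t v).

Lemma in_hits E v t : t ∈ hits E v <-> Add t /\ below_c E t v.
Proof.
apply (setof_bounded (fun t => Add t /\ below_c E t v) AddSet); intros x [Hx _]; apply in_AddSet, Hx.
Qed.

Lemma f_hits : F2 I W tru2 hits.
Proof.
dgoal; unfold hits; apply (df_setof Wtrans HZ); [| dauto].
intros e He _; exists AddSet; split; [dm |]; intros x [Hx _]; apply in_AddSet, Hx.
Qed.
Hint Resolve f_hits : dfn.

(** The conditions that decide [v] are dense, for one without an extension putting [v] in belongs to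
    [compl]. That both answers cannot occur follows by joining two parts of [c]. *)
Lemma compl_true E X v : W E -> W X -> v ∈ X -> (ctrue (compl E X) v <-> ~ ctrue E v).
Proof.
intros WE WX Hv; assert (W v) as Wv by exact (Wtrans WX Hv); split.
- intros (t & Ht & H) (t' & Ht' & H'); apply in_compl in H as (_ & _ & H).
  apply (H (join t t')); [apply (Addc_join Ht Ht') | auto |].
  exists t'; splits; auto; apply Ht'.
- intros N.
  assert (W (join (hits E v) (hits (compl E X) v))) as WB by dm.
  destruct (@generic_below (join (hits E v) (hits (compl E X) v)) empty WB Addc_empty) as (t & Ht & Hc').
  + intros t1 A1 _; destruct (classic (exists t2, Add t2 /\ subset t1 t2 /\ below_c E t2 v)) as [(t2 & A2 & S2 & B2) | N'].
    * exists t2; splits; auto; apply in_join; left; apply in_hits; auto.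
    * exists t1; splits; auto; apply in_join; right; apply in_hits; split; [exact A1 |].
      exists t1; splits; auto; apply in_compl; splits; auto.
      intros t2 A2 S2 B2; apply N'; eauto.
  + apply in_join in Ht as [Ht | Ht]; apply in_hits in Ht as [_ Ht];
      [destruct N | ]; exact (below_c_true (proj2 Hc') Ht).
Qed.

(** Hamkins' approximation property, for a set [B] with the Cohen name [E]; [E'] is a
    name of its complement. *)
Lemma approximation_lemma (E E' Y B : V) : W E -> W E' -> W Y ->
  (forall v, v ∈ Y -> (v ∈ B <-> ctrue E v)) -> (forall v, v ∈ Y -> (v ∉ B <-> ctrue E' v)) -> subset B Y ->
  (forall h, W h -> pfun h -> (forall q, q ∈ h -> exists t v, q = opair t v /\ Add t /\ v ∈ Y) ->
     exists r, W r /\ forall t, Add t -> (t ∈ r <-> exists v, opair t v ∈ h /\ v ∈ B)) ->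
  (forall r, W r -> exists k, W k /\ pfun k /\ subset k r /\ forall x y, opair x y ∈ r -> exists y', opair x y' ∈ k) ->
  W B.
Proof.
intros WE WE' WY HE HE' HB Happ HAC.
(* Here [t] forces that [v] is not in the set named by [E]. Applied to [E] and [E'], it makes [U]
   below the set of pairs in which the condition leaves the element undecided. *)
pose (dec := fun E t v => forall t1, Add t1 -> subset t t1 -> ~ below_c E t1 v).
assert (D3 I W tru3 dec) as Ddec by (dgoal; unfold dec; dauto).
pose (P := fun E Y t => setof (fun v => v ∈ Y /\ dec E t v)).
assert (F3 I W tru3 P) as FP.
{ dgoal; unfold P; apply (df_setof Wtrans HZ); [| dauto]; intros e He _; exists (e 1); split; [apply He | tauto]. }
pose (U := fun E E' Y => setof (fun q => exists t v, q = opair t v /\ Add t /\ v ∈ Y /\ ~ dec E t v /\ ~ dec E' t v)).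
assert (F3 I W tru3 U) as FU.
{ dgoal; unfold U; apply (df_setof Wtrans HZ); [| dauto].
  intros e He _; exists (prod AddSet (e 2)); split; [wside |].
  intros z (t' & p' & -> & H1 & H2 & _); apply opair_in_prod; split; [apply in_AddSet, H1 | exact H2]. }
assert (forall t v, opair t v ∈ U E E' Y <-> Add t /\ v ∈ Y /\ ~ dec E t v /\ ~ dec E' t v) as EU.
{ intros t v; unfold U; rewrite (setof_bounded _ (prod AddSet Y)).
  - split; [intros (t' & p' & Eq & H); apply opair_inj in Eq as [-> ->]; exact H | intros H; exists t, v; auto].
  - intros z (t' & p' & -> & H1 & H2 & _); apply opair_in_prod; split; [apply in_AddSet, H1 | exact H2]. }
assert (W (U E E' Y)) as WU by (apply (F3_D FU); auto; exact Logic.I).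
destruct (classic (exists t, Addc t /\ forall v, opair t v ∉ U E E' Y)) as [(t & Ht & N) | N].
- assert (W t) as Wt by (apply Add_W', Ht).
  replace B with (P E' Y t); [apply (F3_D FP); auto; exact Logic.I |].
  apply mem_ext; intros v; unfold P; rewrite (setof_bounded _ Y) by tauto; split.
  + intros [Hv Hd]; apply NNPP; intros Nv; apply HE' in Nv as (t' & Ht' & H'); [| exact Hv].
    apply (Hd (join t t')); [apply (Addc_join Ht Ht') | auto |]; exists t'; splits; auto; apply Ht'.
  + intros Hv; pose proof (HB v Hv) as HvY; split; [exact HvY |].
    apply NNPP; intros Nd; apply (N v), EU; splits; auto; [apply Ht |].
    intros Hd; apply HE in Hv as (t' & Ht' & H'); [| exact HvY].
    apply (Hd (join t t')); [apply (Addc_join Ht Ht') | auto |]; exists t'; splits; auto; apply Ht'.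
- destruct (HAC _ WU) as (h & Wh & Fh & Sh & Th).
  destruct (Happ h Wh Fh) as (r & Wr & Hr).
  { intros q Hq; pose proof (Sh q Hq) as HqU; unfold U in HqU; rewrite (setof_bounded _ (prod AddSet Y)) in HqU.
    - destruct HqU as (t & v & -> & H1 & H2 & _); eauto.
    - intros z (t' & p' & -> & H1 & H2 & _); apply opair_in_prod; split; [apply in_AddSet, H1 | exact H2]. }
  (* The conditions that contradict [r] about the element chosen for some [s]. As [r] tells the
     truth about [B], no part of [c] is among them. *)
  pose (Q := fun h r E E' => setof (fun t => Add t /\ exists s v, opair s v ∈ h /\
    ((s ∈ r /\ below_c E' t v) \/ (s ∉ r /\ below_c E t v)))).
  assert (F4 I W tru4 Q) as FQ.
  { dgoal; unfold Q; apply (df_setof Wtrans HZ); [| dauto].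
    intros e He _; exists AddSet; split; [dm |]; intros x [Hx _]; apply in_AddSet, Hx. }
  assert (forall t, t ∈ Q h r E E' <-> Add t /\ exists s v, opair s v ∈ h /\
    ((s ∈ r /\ below_c E' t v) \/ (s ∉ r /\ below_c E t v))) as EQ.
  { apply (setof_bounded (fun t => Add t /\ exists s v, opair s v ∈ h /\
    ((s ∈ r /\ below_c E' t v) \/ (s ∉ r /\ below_c E t v))) AddSet); intros x [Hx _]; apply in_AddSet, Hx. }
  assert (W (Q h r E E')) as WQ by (apply (F4_D FQ); auto; exact Logic.I).
  assert (forall t, t ∈ Q h r E E' -> ~ subset t c) as NQ.
  { intros t Ht Htc; apply EQ in Ht as (At & s & v & Hsv & Ht).
    pose proof (proj1 (EU s v) (Sh _ Hsv)) as (As & HvY & _).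
    destruct Ht as [[Hs Hb] | [Hs Hb]]; apply (below_c_true Htc) in Hb.
    - apply HE' in Hb; [| exact HvY]; apply (Hr s As) in Hs as (v' & H1 & H2).
      rewrite (Fh _ _ _ Hsv H1) in Hb; contradiction.
    - apply HE in Hb; [| exact HvY]; apply Hs, (Hr s As); eauto. }
  exfalso.
  (* By genericity some part [t] of [c] has no extension in [Q]. But then [t] decides the element
     chosen for [t] itself, in the way that [r] tells, although it was chosen as undecided. *)
  assert (exists t, Addc t /\ forall t2, Add t2 -> subset t t2 -> t2 ∉ Q h r E E') as (t & Ht & Nt).
  { apply NNPP; intros Nt.
    pose (R := fun Q => setof (fun t => Add t /\ (t ∈ Q \/ forall t2, Add t2 -> subset t t2 -> t2 ∉ Q))).
    assert (F1 I W tru1 R) as FR.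
    { dgoal; unfold R; apply (df_setof Wtrans HZ); [| dauto].
      intros e He _; exists AddSet; split; [dm |]; intros x [Hx _]; apply in_AddSet, Hx. }
    assert (forall t, t ∈ R (Q h r E E') <-> Add t /\ (t ∈ Q h r E E' \/ forall t2, Add t2 -> subset t t2 -> t2 ∉ Q h r E E')) as ER.
    { apply (setof_bounded (fun t => Add t /\ (t ∈ Q h r E E' \/ forall t2, Add t2 -> subset t t2 -> t2 ∉ Q h r E E')) AddSet);
        intros x [Hx _]; apply in_AddSet, Hx. }
    assert (W (R (Q h r E E'))) as WR by exact (F1_D FR WQ Logic.I).
    destruct (@generic_below (R (Q h r E E')) empty WR Addc_empty) as (t & Ht & Htc).
    - intros t1 A1 _; destruct (classic (exists t2, Add t2 /\ subset t1 t2 /\ t2 ∈ Q h r E E')) as [(t2 & A2 & S2 & B2) | N'].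
      + exists t2; splits; auto; apply ER; auto.
      + exists t1; splits; auto; apply ER; split; [exact A1 | right]; intros t2 A2 S2 B2; apply N'; eauto.
    - apply ER in Ht as [_ [Ht | Ht]]; [exact (NQ t Ht (proj2 Htc)) | apply Nt; eauto]. }
  assert (exists v, opair t v ∈ U E E' Y) as (v0 & Hv0).
  { apply NNPP; intros N'; apply N; exists t; split; [exact Ht |]; intros v Hv; apply N'; eauto. }
  destruct (Th t v0 Hv0) as (v & Hv); pose proof (Sh _ Hv) as HvU; apply EU in HvU as (_ & HvY & N1 & N2).
  destruct (classic (t ∈ r)) as [C | C].
  + apply N2; intros t1 A1 S1 B1; apply (Nt t1 A1 S1), EQ; split; [exact A1 |]; exists t, v; auto.
  + apply N1; intros t1 A1 S1 B1; apply (Nt t1 A1 S1), EQ; split; [exact A1 |]; exists t, v; auto.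
Qed.

End Cohen.

#[export] Hint Resolve d_below_c f_compl f_hits f_forced_filter : dfn.
#[export] Hint Resolve join_l join_r subset_refl : core.

(** * Values of names and their ranks *)

Section Interp.
Context {V : universe}.
Implicit Types v x y z p : V.

Lemma in_interp (G : V -> Prop) x v : v ∈ interp G x <-> exists p y, opair p y ∈ x /\ G p /\ v = interp G y.
Proof.
assert (interp G x = setof (fun v => exists p y, opair p y ∈ x /\ G p /\ v = interp G y)) as ->.
{ unfold interp at 1; rewrite mem_rec_below; [reflexivity |].
  intros r r' E; apply setof_ext; intros z; do 2 (apply ex_iff; intros ?).
  split; intros (H1 & H2 & ->); splits; auto; rewrite (E _ (below_snd H1)); reflexivity. }
apply (setof_bounded (fun v => exists p y, opair p y ∈ x /\ G p /\ v = interp G y) (img (interp G) (tc x))).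
intros z (p & y & H & _ & ->); apply in_img; exists y; split; [apply in_tc, (below_snd H) | reflexivity].
Qed.

Lemma ord_name_rank x : ord (name_rank x).
Proof.
induction x as [x IH] using below_ind; apply ord_of_subset.
- intros a Ha; apply in_name_rank in Ha as (p & z & H & [Ha | ->]).
  + exact (ord_mem (IH z (below_snd H)) Ha).
  + exact (IH z (below_snd H)).
- intros a Ha b Hb; apply in_name_rank in Ha as (p & z & H & [Ha | ->]); apply in_name_rank; exists p, z;
    split; auto; left; auto; exact (ord_transitive (IH z (below_snd H)) a Ha b Hb).
Qed.

Lemma interp_rank (G : V -> Prop) x : ord (interp G x) -> subset (interp G x) (name_rank x).
Proof.
induction x as [x IH] using below_ind; intros O v Hv; pose proof (ord_mem O Hv) as Ov.
apply in_interp in Hv as (p & y & H & _ & ->); apply in_name_rank; exists p, y; split; [exact H |].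
apply (ord_subset Ov (ord_name_rank y)) in IH; [tauto | exact (below_snd H) | exact Ov].
Qed.

End Interp.

(** * The forcing theorem for Cohen names *)

Section Forcing.
Context {V : universe} (W : V -> Prop) (S : V -> V).
Notation I := (seq_pred W S).
Context (Wtrans : transitive_class W) (HZ : models_ZFC W I).
Notation Dp := (Dp I W).
Notation Df := (Df I W).
Notation ok := (over_D W).
Implicit Types s t u v x y z p q : V.
Let Add_W' x : Add x -> W x := @Add_W V W S Wtrans HZ x.
Hint Resolve Add_W' : guard.
Context (c : V) (Hc : cohen_real W c).

(** The clauses of forced equality between a name and an actual set [v], with [T] naming the filter:
    the check name of [v] is never formed. *)
Definition eq_body T (R : V -> V) y v t :=
  (forall p z, opair p z ∈ y -> forall t1, Add t1 -> subset t t1 -> below_c T t1 p ->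
     exists t2 w, Add t2 /\ subset t1 t2 /\ w ∈ v /\ below_c (R z) t2 w) /\
  (forall w, w ∈ v -> forall t1, Add t1 -> subset t t1 ->
     exists t2 p z, Add t2 /\ subset t1 t2 /\ opair p z ∈ y /\ below_c T t2 p /\ below_c (R z) t2 w).

(** [opair t v] is in [forced_eq T Y y] when [t] forces, of [v] in [Y], that it
    is the value of the name [y]; here [T] is a name of the filter. *)
Definition forced_eq T Y : V -> V := mem_rec empty (fun y rec =>
  setof (fun q => exists t v, q = opair t v /\ Add t /\ v ∈ Y /\ eq_body T rec y v t)).

Lemma eq_body_ext T R R' y v t : (forall z, below z y -> R z = R' z) -> eq_body T R y v t -> eq_body T R' y v t.
Proof.
intros E [H1 H2]; split.
- intros p z Hz t1 A1 S1 B1; rewrite <- (E z (below_snd Hz)); eauto.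
- intros w Hw t1 A1 S1; destruct (H2 w Hw t1 A1 S1) as (t2 & p & z & A2 & S2 & Hz & B2 & B3).
  exists t2, p, z; rewrite <- (E z (below_snd Hz)); splits; auto.
Qed.

Lemma forced_eq_eq T Y y : forced_eq T Y y =
  setof (fun q => exists t v, q = opair t v /\ Add t /\ v ∈ Y /\ eq_body T (forced_eq T Y) y v t).
Proof.
unfold forced_eq at 1; rewrite mem_rec_below; [reflexivity |].
intros r r' E; apply setof_ext; intros q; do 2 (apply ex_iff; intros ?); do 3 apply and_iff_compat_l.
split; apply eq_body_ext; auto; intros z Hz; symmetry; auto.
Qed.

Lemma in_forced_eq T Y y t v : opair t v ∈ forced_eq T Y y <->
  Add t /\ v ∈ Y /\ eq_body T (forced_eq T Y) y v t.
Proof.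
rewrite forced_eq_eq, (setof_bounded _ (prod AddSet Y)).
- split; [intros (t' & v' & E & H); apply opair_inj in E as [-> ->]; exact H | intros H; exists t, v; auto].
- intros z (t' & p' & -> & H1 & H2 & _); apply opair_in_prod; split; [apply in_AddSet, H1 | exact H2].
Qed.

Lemma f_forced_eq : F3 I W tru3 forced_eq.
Proof.
assert (Df (fun _ => True) (fun e => forced_eq (e 1) (e 2) (e 0))) as F.
{ apply (@df_rec V unit I W Wtrans HZ (fun _ => True) (fun e y => forced_eq (e 0) (e 1) y)
    (fun y g e => setof (fun q => exists t v, q = opair t v /\ Add t /\ v ∈ e 1 /\ eq_body (e 0) (app1 g) y v t))).
  - intros e y _ _ _; rewrite forced_eq_eq at 1; apply setof_ext; intros q; do 2 (apply ex_iff; intros ?); do 3 apply and_iff_compat_l.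
    split; apply eq_body_ext; intros z Hz; rewrite app1_graph by (apply in_tc, Hz); reflexivity.
  - apply (df_setof Wtrans HZ).
    + intros e He _; exists (prod AddSet (e 3)); split; [wside |].
      intros z (t' & p' & -> & H1 & H2 & _); apply opair_in_prod; split; [apply in_AddSet, H1 | exact H2].
    + unfold eq_body; dauto. }
refine (df_substs (ts := [fun e => e 2; fun e => e 0; fun e => e 1]) _ F _).
- simpl; intros t Ht; decompose [or] Ht; subst; try tauto; dauto.
- auto.
Qed.
Hint Resolve f_forced_eq : dfn.

Context (T : V) (G : V -> Prop) (WT : W T) (HG : forall p, G p <-> ctrue c T p).

(** The forcing theorem for equality with a set of [W], by induction on the name. Transitivity of
    [Y] keeps the elements of [v] within reach of the induction hypothesis. *)
Lemma forced_eq_true Y y : W Y -> is_transitive Y -> W y ->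
  forall v, v ∈ Y -> (interp G y = v <-> ctrue c (forced_eq T Y y) v).
Proof.
intros WY TY; induction y as [y IH] using below_ind; intros Wy v Hv.
assert (W v) as Wv by exact (Wtrans WY Hv).
assert (forall p z, opair p z ∈ y -> below z y /\ W z) as Kz.
{ intros p z Hz; split; [exact (below_snd Hz) | exact (D_opair2 Wtrans Hz Wy)]. }
assert (forall w, w ∈ v -> w ∈ Y) as Kw by (intros w Hw; exact (TY v Hv w Hw)).
split.
- intros E.
  (* [N1] and [N2] are the two ways in which a condition can rule out the equality. The conditions
     that force it or rule it out are dense, and a part of [c] cannot rule out what is true. *)
  pose (N1 := fun T Y y v t => exists p z, opair p z ∈ y /\ below_c T t p /\
    forall t2 w, Add t2 -> subset t t2 -> w ∈ v -> ~ below_c (forced_eq T Y z) t2 w).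
  pose (N2 := fun T Y y v t => exists w, w ∈ v /\ forall t2 p z, Add t2 -> subset t t2 -> opair p z ∈ y ->
    below_c T t2 p -> ~ below_c (forced_eq T Y z) t2 w).
  pose (B := fun T Y y v => setof (fun t => Add t /\ (opair t v ∈ forced_eq T Y y \/ N1 T Y y v t \/ N2 T Y y v t))).
  assert (F4 I W tru4 B) as FB.
  { dgoal; unfold B, N1, N2; apply (df_setof Wtrans HZ); [| dauto].
    intros e He _; exists AddSet; split; [dm |]; intros x [Hx _]; apply in_AddSet, Hx. }
  assert (forall t, t ∈ B T Y y v <-> Add t /\ (opair t v ∈ forced_eq T Y y \/ N1 T Y y v t \/ N2 T Y y v t)) as EB.
  { apply (setof_bounded (fun t => Add t /\ (opair t v ∈ forced_eq T Y y \/ N1 T Y y v t \/ N2 T Y y v t)) AddSet).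
    intros x [Hx _]; apply in_AddSet, Hx. }
  destruct (@generic_below V W S Wtrans HZ c Hc (B T Y y v) empty) as (t & Ht & Htc).
  + apply (F4_D FB); auto; exact Logic.I.
  + apply Addc_empty.
  + intros r Ar _; apply NNPP; intros N.
    assert (forall t2, Add t2 -> subset r t2 -> ~ (opair t2 v ∈ forced_eq T Y y \/ N1 T Y y v t2 \/ N2 T Y y v t2)) as N'.
    { intros t2 A2 S2 C; apply N; exists t2; splits; auto; apply EB; auto. }
    apply (N' r Ar); auto; left; apply in_forced_eq; splits; auto; split.
    * intros p z Hz t1 A1 S1 B1; apply NNPP; intros C; apply (N' t1 A1 S1); right; left; exists p, z; splits; auto.
      intros t2 w A2 S2 Hw B2; apply C; exists t2, w; auto.
    * intros w Hw t1 A1 S1; apply NNPP; intros C; apply (N' t1 A1 S1); right; right; exists w; split; [exact Hw |].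
      intros t2 p z A2 S2 Hz B2 B3; apply C; exists t2, p, z; auto.
  + apply EB in Ht as [_ [Ht | [(p & z & Hz & B1 & N) | (w & Hw & N)]]].
    * exists t; auto.
    * exfalso; destruct (Kz _ _ Hz) as [Kz1 Kz2].
      assert (interp G z ∈ v) as Hw.
      { rewrite <- E; apply in_interp; exists p, z; splits; auto; apply HG; exact (below_c_true (proj2 Htc) B1). }
      destruct (proj1 (IH z Kz1 Kz2 _ (Kw _ Hw)) eq_refl) as (t3 & H3 & H4).
      apply (N (join t t3) (interp G z)); auto; [apply (Addc_join Hc Htc H3) |].
      exists t3; splits; auto; apply H3.
    * exfalso; assert (w ∈ interp G y) as Hw' by (rewrite E; exact Hw).
      apply in_interp in Hw' as (p & z & Hz & Gp & Ew); destruct (Kz _ _ Hz) as [Kz1 Kz2].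
      apply HG in Gp as (t0 & H0 & H0').
      destruct (proj1 (IH z Kz1 Kz2 _ (Kw _ Hw)) (eq_sym Ew)) as (t3 & H3 & H4).
      pose proof (Addc_join Hc H0 H3) as H5.
      apply (N (join t (join t0 t3)) p z); auto.
      -- apply (Addc_join Hc Htc H5).
      -- exists t0; splits; auto; [apply H0 |]; eapply subset_trans; [apply join_l | apply join_r].
      -- exists t3; splits; auto; [apply H3 |]; eapply subset_trans; [apply join_r | apply join_r].
- intros (t & Ht & H); apply in_forced_eq in H as (_ & _ & H1 & H2).
  apply mem_ext; intros w; rewrite in_interp; split.
  + intros (p & z & Hz & Gp & ->); destruct (Kz _ _ Hz) as [Kz1 Kz2].
    apply HG in Gp as (t0 & H0 & H0').
    pose (B := fun v F => setof (fun t2 => Add t2 /\ exists w, w ∈ v /\ below_c F t2 w)).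
    assert (F2 I W tru2 B) as FB.
    { dgoal; unfold B; apply (df_setof Wtrans HZ); [| dauto].
      intros e He _; exists AddSet; split; [dm |]; intros x [Hx _]; apply in_AddSet, Hx. }
    assert (forall t, t ∈ B v (forced_eq T Y z) <-> Add t /\ exists w, w ∈ v /\ below_c (forced_eq T Y z) t w) as EB.
    { apply (setof_bounded (fun t => Add t /\ exists w, w ∈ v /\ below_c (forced_eq T Y z) t w) AddSet).
      intros x [Hx _]; apply in_AddSet, Hx. }
    destruct (@generic_below V W S Wtrans HZ c Hc (B v (forced_eq T Y z)) (join t t0)) as (t2 & Ht2 & Htc).
    * apply (F2_D FB); auto; [dm | exact Logic.I].
    * apply (Addc_join Hc Ht H0).
    * intros t1 A1 S1; destruct (H1 p z Hz t1 A1) as (t2 & w & A2 & S2 & Hw & B2).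
      -- exact (subset_trans (@join_l V t t0) S1).
      -- exists t0; splits; auto; [apply H0 | exact (subset_trans (@join_r V t t0) S1)].
      -- exists t2; splits; auto; apply EB; eauto.
    * apply EB in Ht2 as (_ & w & Hw & B2); apply (below_c_true (proj2 Htc)) in B2.
      apply (IH z Kz1 Kz2 w (Kw w Hw)) in B2; rewrite B2; exact Hw.
  + intros Hw.
    pose (B := fun T Y y w => setof (fun t2 => Add t2 /\ exists p z, opair p z ∈ y /\ below_c T t2 p /\ below_c (forced_eq T Y z) t2 w)).
    assert (F4 I W tru4 B) as FB.
    { dgoal; unfold B; apply (df_setof Wtrans HZ); [| dauto].
      intros e He _; exists AddSet; split; [dm |]; intros x [Hx _]; apply in_AddSet, Hx. }
    assert (forall t, t ∈ B T Y y w <-> Add t /\ exists p z, opair p z ∈ y /\ below_c T t p /\ below_c (forced_eq T Y z) t w) as EB.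
    { apply (setof_bounded (fun t => Add t /\ exists p z, opair p z ∈ y /\ below_c T t p /\ below_c (forced_eq T Y z) t w) AddSet).
      intros x [Hx _]; apply in_AddSet, Hx. }
    destruct (@generic_below V W S Wtrans HZ c Hc (B T Y y w) t) as (t2 & Ht2 & Htc).
    * apply (F4_D FB); auto; [exact (Wtrans Wv Hw) | exact Logic.I].
    * exact Ht.
    * intros t1 A1 S1; destruct (H2 w Hw t1 A1 S1) as (t2 & p & z & A2 & S2 & Hz & B2 & B3).
      exists t2; splits; auto; apply EB; split; [exact A2 | exists p, z; auto].
    * apply EB in Ht2 as (_ & p & z & Hz & B2 & B3).
      apply (below_c_true (proj2 Htc)) in B2, B3; destruct (Kz _ _ Hz) as [Kz1 Kz2].
      exists p, z; splits; auto; [apply HG, B2 |].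
      symmetry; apply (IH z Kz1 Kz2 w (Kw w Hw)), B3.
Qed.

(** One name for the membership relation between all the names up to [x] and the elements of [Y].
    With the name [z] kept as an argument, [W] can treat a whole family of values at once, such as
    the elements of an approximator. *)
Definition forced_mem T Y x := setof (fun q => exists t z v, q = opair t (opair z v) /\ Add t /\ (z = x \/ below z x) /\
  v ∈ Y /\ exists p z', opair p z' ∈ z /\ below_c T t p /\ below_c (forced_eq T Y z') t v).

Lemma in_forced_mem Y x t z v : opair t (opair z v) ∈ forced_mem T Y x <-> Add t /\ (z = x \/ below z x) /\
  v ∈ Y /\ exists p z', opair p z' ∈ z /\ below_c T t p /\ below_c (forced_eq T Y z') t v.
Proof.
unfold forced_mem; rewrite (setof_bounded _ (prod AddSet (prod (join (tc x) (single x)) Y))).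
- split; [| intros H; exists t, z, v; auto].
  intros (t' & z' & v' & E & H); apply opair_inj in E as [-> E]; apply opair_inj in E as [-> ->]; exact H.
- intros q (t' & z' & v' & -> & H1 & H2 & H3 & _); rewrite !opair_in_prod, in_AddSet, in_join, in_tc, in_single; tauto.
Qed.

Lemma f_forced_mem : F3 I W tru3 forced_mem.
Proof.
dgoal; unfold forced_mem; apply (df_setof Wtrans HZ).
- intros e He _; exists (prod AddSet (prod (join (tc (e 2)) (single (e 2))) (e 1))); split; [wside |].
  intros q (t' & z' & v' & -> & H1 & H2 & H3 & _); rewrite !opair_in_prod, in_AddSet, in_join, in_tc, in_single; tauto.
- dauto.
  intros e z He _ (v & _ & _ & [-> | Hz] & _); [apply He | exact (D_below Wtrans Hz (He 4))].
Qed.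

Lemma forced_mem_true Y x z v : W Y -> is_transitive Y -> W x -> z = x \/ below z x -> v ∈ Y ->
  (v ∈ interp G z <-> ctrue c (forced_mem T Y x) (opair z v)).
Proof.
intros WY TY Wx Hz Hv.
assert (W z) as Wz by (destruct Hz as [-> | Hz]; [exact Wx | exact (D_below Wtrans Hz Wx)]).
rewrite in_interp; split.
- intros (p & z' & H & Gp & E); apply HG in Gp as (t0 & H0 & H0').
  assert (W z') as Wz' by exact (D_opair2 Wtrans H Wz).
  destruct (proj1 (forced_eq_true WY TY Wz' Hv) (eq_sym E)) as (t1 & H1 & H1').
  exists (join t0 t1); split; [apply (Addc_join Hc H0 H1) |]; apply in_forced_mem; splits; auto.
  + apply (Addc_join Hc H0 H1).
  + exists p, z'; splits; auto; [exists t0 | exists t1]; splits; auto; [apply H0 | apply H1].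
- intros (t & Ht & H); apply in_forced_mem in H as (_ & _ & _ & p & z' & H & B1 & B2).
  assert (W z') as Wz' by exact (D_opair2 Wtrans H Wz).
  exists p, z'; splits; auto; [apply HG; exact (below_c_true (proj2 Ht) B1) |].
  symmetry; apply (forced_eq_true WY TY Wz' Hv); exact (below_c_true (proj2 Ht) B2).
Qed.

End Forcing.

(** * Small sets and order types *)

Section Separation.
Context {V : universe} {A : Type} (I : A -> V -> Prop) (D : V -> Prop).
Context (Dtrans : transitive_class D) (HZ : models_ZFC D I).
Notation tl e := (fun n => e (Datatypes.S n)).
Notation Dp := (Dp I D).
Notation Df := (Df I D).

Definition sep (X : V) (P : V -> Prop) := setof (fun z => z ∈ X /\ P z).

Lemma in_sep (X : V) (P : V -> Prop) z : z ∈ sep X P <-> z ∈ X /\ P z.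
Proof. apply (setof_bounded (fun z => z ∈ X /\ P z) X); tauto. Qed.

Lemma df_sep G (X : (nat -> V) -> V) (P : V -> (nat -> V) -> Prop) : Df G X ->
  Dp (fun e => G (tl e) /\ e 0 ∈ X (tl e)) (fun e => P (e 0) (tl e)) ->
  Df G (fun e => sep (X e) (fun z => P z e)).
Proof.
intros HX HP; unfold sep; apply (df_setof Dtrans HZ).
- intros e He Ge; exists (X e); split; [exact (proj1 HX e He Ge) | tauto].
- apply dp_and; [| exact HP].
  eapply dp_use2; [apply d_mem | apply df_var | apply df_tl, HX | intros; exact Logic.I].
Qed.

End Separation.

Ltac dsep :=
  cbv beta;
  lazymatch goal with
  | |- Df ?I ?D ?G (fun e => sep (@?X e) (@?P e)) =>
    match goal with
    | T : transitive_class D, HZ : models_ZFC D _ |- _ => apply (df_sep T HZ (G := G) (X := X) (P := fun z e => P e z))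
    end
  | |- Df ?I ?D ?G (fun e => img (@?F e) (@?X e)) =>
    match goal with
    | T : transitive_class D, HZ : models_ZFC D _ |- _ => apply (df_img T HZ (G := G) (X := X) (F := fun z e => F e z))
    end
  end.
Ltac dauto ::= repeat first [dsep | dstep].

(** * The ideal of small sets *)

Section Small.
Context {V : universe} {A : Type} (I : A -> V -> Prop) (D : V -> Prop).
Context (Dtrans : transitive_class D) (HZ : models_ZFC D I).
Notation tl e := (fun n => e (Datatypes.S n)).
Notation tl2 e := (fun n => e (Datatypes.S (Datatypes.S n))).
Notation Dp := (Dp I D).
Notation Df := (Df I D).
Notation ok := (over_D D).
Implicit Types x y z f g h k r s t u v X Y Z : V.

(** The fibres of [r] are disjoint, so the axiom of choice gives a selector for them, and its
    intersection with [r] is the required partial function. *)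
Lemma uniformize r : D r -> exists k, D k /\ pfun k /\ subset k r /\
  forall x y, opair x y ∈ r -> exists y', opair x y' ∈ k.
Proof.
intros Hr.
pose (fib := fun r x => sep r (fun q => exists y, q = opair x y)).
assert (F2 I D tru2 fib) as Ffib by (dgoal; unfold fib; dauto).
pose (Fam := fun r => setof (fun s => exists x, (exists y, opair x y ∈ r) /\ s = fib r x)).
assert (F1 I D tru1 Fam) as FF.
{ dgoal; unfold Fam; apply (df_image Dtrans HZ (G := fun _ => True) (P := fun x e => exists y, opair x y ∈ e 0)
    (F := fun x e => fib (e 0) x)); [| dauto | dauto].
  intros e He _; exists (tc (e 0)); split; [wside |]; intros x (y & Hy); apply in_tc, (below_fst Hy). }
assert (forall s, s ∈ Fam r <-> exists x, (exists y, opair x y ∈ r) /\ s = fib r x) as EF.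
{ intros s; apply (in_image (fun x => exists y, opair x y ∈ r) (fib r) (tc r)).
  intros x (y & Hy); apply in_tc, (below_fst Hy). }
assert (D (Fam r)) as DF by exact (F1_D FF Hr Logic.I).
destruct (zfc_choice HZ (Fam r) DF) as (s & Ds & Hs).
- intros y _ Hy; apply EF in Hy as (x & (z & Hz) & ->); exists (opair x z).
  split; [exact (Dtrans Hr Hz) | apply in_sep; eauto].
- intros y y' z _ _ _ Hy Hy' Hz Hz'; apply EF in Hy as (x & _ & ->); apply EF in Hy' as (x' & _ & ->).
  apply in_sep in Hz as (_ & w & ->); apply in_sep in Hz' as (_ & w' & E); apply opair_inj in E as [-> _]; reflexivity.
- exists (inter r s); split; [dm |]; split; [| split].
  + assert (forall q, q ∈ inter r s <-> q ∈ r /\ q ∈ s) as Ei.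
    { apply (setof_bounded (fun q => q ∈ r /\ q ∈ s) r); tauto. }
    intros x y y' H H'; apply Ei in H as [H1 H2]; apply Ei in H' as [H1' H2'].
    assert (fib r x ∈ Fam r) as K by (apply EF; exists x; split; [eauto | reflexivity]).
    destruct (Hs _ (Dtrans DF K) K) as (z & _ & U).
    assert (opair x y = opair x y') as E; [| apply opair_inj in E; tauto].
    rewrite <- (U (opair x y)), <- (U (opair x y')); [reflexivity | |]; splits; auto;
      first [exact (Dtrans Hr H1) | exact (Dtrans Hr H1') | apply in_sep; eauto].
  + intros q; unfold inter; rewrite (setof_bounded _ r) by tauto; tauto.
  + intros x y H; assert (fib r x ∈ Fam r) as K by (apply EF; exists x; split; [eauto | reflexivity]).
    destruct (Hs _ (Dtrans DF K) K) as (z & (_ & Hz & Hzs) & _).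
    apply in_sep in Hz as (Hzr & y' & ->); exists y'.
    unfold inter; apply (setof_bounded (fun q => q ∈ r /\ q ∈ s) r); tauto.
Qed.

Notation small := (small D).

Lemma small_intro Z x f : D f -> pfun f -> (forall y, y ∈ x -> exists z, z ∈ Z /\ opair z y ∈ f) -> small Z x.
Proof. intros H1 H2 H3; exists f; split; [exact H1 | split; assumption]. Qed.

Lemma small_upair Z a b x y : a ∈ Z -> b ∈ Z -> a <> b -> D Z -> D x -> D y -> small Z (upair x y).
Proof.
intros Ha Hb N DZ Dx Dy; assert (D a) as Da by dm; assert (D b) as Db by dm.
apply (@small_intro Z (upair x y) (upair (opair a x) (opair b y))); [dm | |].
- intros z w w' H H'; apply in_upair in H as [H | H]; apply in_upair in H' as [H' | H'];
    apply opair_inj in H as [-> ->], H' as [E ->]; congruence.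
- intros w Hw; apply in_upair in Hw as [-> | ->]; [exists a | exists b]; rewrite in_upair; auto.
Qed.

(** A covering function must be chosen for each [x] in [X]. The candidates are cut down to subsets
    of [prod Z (cup X)], so that they form a set to choose from. *)
Lemma small_cup Y Z X : D Y -> D X -> D Z -> small Y X -> (forall x, x ∈ X -> small Z x) -> small (prod Y Z) (cup X).
Proof.
intros DY DX DZ (g & Dg & Pg & Cg) HX.
pose (r := fun X Z => sep (prod X (powD D (prod Z (cup X)))) (fun p => exists x f, p = opair x f /\ covers f Z x)).
assert (F2 I D tru2 r) as Fr by (dgoal; unfold r; dauto).
destruct (@uniformize (r X Z)) as (k & Dk & Pk & Sk & Tk); [exact (F2_D Fr DX DZ Logic.I) |].
pose (h := fun g k Y Z X => sep (prod (prod Y Z) (cup X)) (fun p => exists y z v x f, p = opair (opair y z) v /\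
  opair y x ∈ g /\ opair x f ∈ k /\ opair z v ∈ f)).
assert (F5 I D tru5 h) as Fh by (dgoal; unfold h; dauto).
apply (@small_intro (prod Y Z) (cup X) (h g k Y Z X)).
- apply (F5_D Fh); auto; exact Logic.I.
- intros q v v' H H'; apply in_sep in H as (_ & y & z & v1 & x & f & E & H1 & H2 & H3).
  apply in_sep in H' as (_ & y' & z' & v1' & x' & f' & E' & H1' & H2' & H3').
  apply opair_inj in E as [-> ->]; apply opair_inj in E' as [E ->]; apply opair_inj in E as [-> ->].
  rewrite (Pg _ _ _ H1 H1') in H2; pose proof (Pk _ _ _ H2 H2') as Ef; subst f'.
  pose proof (Sk _ H2') as K; apply in_sep in K as (_ & x1 & f1 & E & [Pf _]); apply opair_inj in E as [-> ->].
  exact (Pf _ _ _ H3 H3').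
- intros v Hv; apply in_cup in Hv as (x & Hx & Hv); destruct (Cg x Hx) as (y & Hy & Hyx).
  assert (exists f, opair x f ∈ r X Z) as (f0 & Hf0).
  { destruct (HX x Hx) as (f & Df & Pf & Cf).
    assert (forall q, q ∈ inter f (prod Z x) <-> q ∈ f /\ q ∈ prod Z x) as Ei.
    { apply (setof_bounded (fun q => q ∈ f /\ q ∈ prod Z x) f); tauto. }
    assert (D x) as Dx by exact (Dtrans DX Hx).
    exists (inter f (prod Z x)); apply in_sep; split.
    - apply opair_in_prod; split; [exact Hx |]; apply in_powD; split; [dm |].
      intros q Hq; apply Ei in Hq as [_ Hq]; apply in_prod in Hq as (z & w & Hz & Hw & ->).
      apply opair_in_prod; split; [exact Hz | apply in_cup; eauto].
    - exists x, (inter f (prod Z x)); split; [reflexivity | split].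
      + intros z w w' H H'; apply Ei in H as [H _]; apply Ei in H' as [H' _]; exact (Pf _ _ _ H H').
      + intros w Hw; destruct (Cf w Hw) as (z & Hz & Hzw); exists z; split; [exact Hz |].
        apply Ei; rewrite opair_in_prod; auto. }
  destruct (Tk x f0 Hf0) as (f & Hf); pose proof (Sk _ Hf) as K; apply in_sep in K as (_ & x1 & f1 & E & [Pf Cf]).
  apply opair_inj in E as [<- <-]; destruct (Cf v Hv) as (z & Hz & Hzv).
  exists (opair y z); split; [apply opair_in_prod; auto |]; apply in_sep; split.
  + rewrite !opair_in_prod; splits; auto; apply in_cup; eauto.
  + exists y, z, v, x, f; auto.
Qed.

(** A stock of indices: [Z] is large enough for the [small] sets to form an ideal
    closed under unions of [small] families. *)
Definition stock Z := D Z /\ small Z (prod Z Z) /\ exists a b, a ∈ Z /\ b ∈ Z /\ a <> b.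

Lemma small_prod Z x : stock Z -> small (prod Z Z) x -> small Z x.
Proof. intros (_ & HZ2 & _) (f & Df & Cf); exact (small_trans Dtrans HZ HZ2 Df Cf). Qed.

Lemma stock_upair Z x y : stock Z -> D x -> D y -> small Z (upair x y).
Proof. intros (DZ & _ & a & b & Ha & Hb & N); apply (small_upair Ha Hb N DZ). Qed.

Lemma stock_cup Z X : stock Z -> D X -> small Z X -> (forall x, x ∈ X -> small Z x) -> small Z (cup X).
Proof. intros HZ' DX SX H; apply (small_prod HZ'), small_cup; auto; apply HZ'. Qed.

Lemma stock_join Z x y : stock Z -> D x -> D y -> small Z x -> small Z y -> small Z (join x y).
Proof.
intros HZ' Dx Dy Sx Sy; apply (stock_cup HZ'); [dm | apply (stock_upair HZ'); assumption |].
intros z Hz; apply in_upair in Hz as [-> | ->]; assumption.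
Qed.

(** The ordinals below [hartogs D Z] are the small ones, and a small union of small sets is small;
    so the supremum of [X] is still below. *)
Lemma hartogs_regular Z X : stock Z -> D X -> subset X (hartogs D Z) -> small Z X ->
  exists a, a ∈ hartogs D Z /\ forall x, x ∈ X -> x ∈ a.
Proof.
intros HZ' DX SX Sm; pose proof (proj1 HZ') as DZ.
assert (forall x, x ∈ X -> D x /\ ord x /\ small Z x) as K.
{ intros x Hx; apply (in_hartogs Dtrans HZ x DZ), SX, Hx. }
exists (join X (cup X)); split; [| intros x Hx; apply in_join; auto].
apply (in_hartogs Dtrans HZ _ DZ); split; [dm | split].
- apply ord_of_subset.
  + intros y Hy; apply in_join in Hy as [Hy | Hy]; [apply K, Hy |].
    apply in_cup in Hy as (x & Hx & Hy); exact (ord_mem (proj1 (proj2 (K x Hx))) Hy).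
  + intros y Hy z Hz; apply in_join; right; apply in_cup.
    apply in_join in Hy as [Hy | Hy]; [eauto |]; apply in_cup in Hy as (x & Hx & Hy).
    exists x; split; [exact Hx |]; exact (ord_transitive (proj1 (proj2 (K x Hx))) y Hy z Hz).
- apply (stock_join HZ'); [exact DX | dm | exact Sm |].
  apply (stock_cup HZ' DX Sm); intros x Hx; apply K, Hx.
Qed.

(** [Z] is the power set of a set closed under two tagging maps. Two subsets merge into a disjoint
    union, from which both can be read off, so [Z] maps onto its square. *)
Lemma stock_exists X0 : D X0 -> exists Z, stock Z /\ forall x, D x -> subset x X0 -> x ∈ Z.
Proof.
intros DX0.
destruct (@D_closure V A I D Dtrans HZ (fun _ => True) (fun x _ => upair (opair empty x) (opair (single empty) x)))
  with (e := fun _ : nat => X0) (X0 := join X0 (single empty)) as (X & DX & SX & CX); auto; [dauto | intros n; exact DX0 | dm |].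
assert (forall x, x ∈ X -> opair empty x ∈ X /\ opair (single empty) x ∈ X) as CX'.
{ intros x Hx; split; apply (CX x Hx), in_upair; auto. }
assert (forall z, z ∈ powD D X <-> D z /\ subset z X) as EP by (intros z; apply in_powD).
assert (empty <> @single V empty) as N01.
{ intros E; apply (@in_empty V empty); rewrite E at 2; apply in_single; reflexivity. }
pose (part := fun X i z => sep X (fun x => opair i x ∈ z)).
assert (F3 I D tru3 part) as Fpart by (dgoal; unfold part; dauto).
pose (pi := fun X Z => sep (prod Z (prod Z Z)) (fun p => exists z, p = opair z (opair (part X empty z) (part X (single empty) z)))).
assert (F2 I D tru2 pi) as Fpi by (dgoal; unfold pi; dauto).
pose (merge := fun X x y => sep X (fun p => (exists u, u ∈ x /\ p = opair empty u) \/ (exists u, u ∈ y /\ p = opair (single empty) u))).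
assert (F3 I D tru3 merge) as Fmerge by (dgoal; unfold merge; dauto).
assert (D (powD D X)) as DP by dm.
exists (powD D X); split; [split; [exact DP | split] |].
- apply (@small_intro _ _ (pi X (powD D X))); [exact (F2_D Fpi DX DP Logic.I) | |].
  + intros z v v' H H'; apply in_sep in H as (_ & w & E); apply in_sep in H' as (_ & w' & E').
    apply opair_inj in E as [-> ->]; apply opair_inj in E' as [-> ->]; reflexivity.
  + intros v Hv; apply in_prod in Hv as (x & y & Hx & Hy & ->).
    apply EP in Hx as [Dx Sx]; apply EP in Hy as [Dy Sy].
    assert (merge X x y ∈ powD D X) as Hm.
    { apply EP; split; [exact (F3_D Fmerge DX Dx Dy Logic.I) | intros q Hq; apply in_sep in Hq; tauto]. }
    assert (part X empty (merge X x y) = x) as E1.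
    { apply mem_ext; intros u; unfold part; rewrite in_sep; unfold merge; rewrite in_sep; split.
      - intros (_ & _ & [(u' & Hu & E) | (u' & _ & E)]); apply opair_inj in E as [E1 E2]; [subst; exact Hu | contradiction].
      - intros Hu; splits; auto; [apply CX', Sx, Hu | left; eauto]. }
    assert (part X (single empty) (merge X x y) = y) as E2.
    { apply mem_ext; intros u; unfold part; rewrite in_sep; unfold merge; rewrite in_sep; split.
      - intros (_ & _ & [(u' & _ & E) | (u' & Hu & E)]); apply opair_inj in E as [E3 E4]; [symmetry in E3; contradiction | subst; exact Hu].
      - intros Hu; splits; auto; [apply CX', Sy, Hu | right; eauto]. }
    exists (merge X x y); split; [exact Hm |]; apply in_sep; split.
    * rewrite !opair_in_prod, !EP; apply EP in Hm; tauto.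
    * exists (merge X x y); rewrite E1, E2; reflexivity.
- exists empty, (single empty); rewrite !EP; splits; auto; try dm.
  + intros z Hz; apply in_empty in Hz; destruct Hz.
  + intros z Hz; apply in_single in Hz as ->; apply SX, in_join; right; apply in_single; reflexivity.
- intros x Dx Hx; apply EP; split; [exact Dx |]; intros z Hz; apply SX, in_join; auto.
Qed.

End Small.

(** * Long chains, order types and decoding *)

Section WellOrder.
Context {V : universe} {A : Type} (I : A -> V -> Prop) (D : V -> Prop).
Context (Dtrans : transitive_class D) (HZ : models_ZFC D I).
Notation tl e := (fun n => e (Datatypes.S n)).
Notation tl2 e := (fun n => e (Datatypes.S (Datatypes.S n))).
Notation Dp := (Dp I D).
Notation Df := (Df I D).
Notation ok := (over_D D).
Notation small := (small D).
Implicit Types a b f g h k r s t u v w x y z X Y Z U : V.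

Lemma img_ext (F G : V -> V) X : (forall x, x ∈ X -> F x = G x) -> img F X = img G X.
Proof.
intros E; apply setof_ext; intros z; apply ex_iff; intros x; split; intros [Hx ->]; split; auto; rewrite (E x Hx); reflexivity.
Qed.

Lemma small_img Y (F : V -> V) X : D (img (fun x => opair x (F x)) X) -> small Y X -> small Y (img F X).
Proof.
intros DG SX; apply (small_trans Dtrans HZ SX DG); split.
- intros x y y' H H'; apply in_img in H as (z & _ & E); apply in_img in H' as (z' & _ & E').
  apply opair_inj in E as [-> ->]; apply opair_inj in E' as [-> ->]; reflexivity.
- intros y Hy; apply in_img in Hy as (x & Hx & ->); exists x; split; [exact Hx | apply in_img; eauto].
Qed.

Definition chain Phi u0 : V -> V := mem_rec empty (fun xi rec =>
  join u0 (cup (img (fun z => join (rec z) (app1 Phi (rec z))) xi))).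

Lemma chain_eq Phi u0 xi : chain Phi u0 xi =
  join u0 (cup (img (fun z => join (chain Phi u0 z) (app1 Phi (chain Phi u0 z))) xi)).
Proof.
unfold chain at 1; rewrite mem_rec_below; [reflexivity |].
intros r r' E; do 2 f_equal; apply img_ext; intros z Hz; rewrite (E z (below_mem Hz)); reflexivity.
Qed.

Lemma in_chain Phi u0 xi v : v ∈ chain Phi u0 xi <->
  v ∈ u0 \/ exists z, z ∈ xi /\ (v ∈ chain Phi u0 z \/ v ∈ app1 Phi (chain Phi u0 z)).
Proof.
rewrite chain_eq, in_join, in_cup; apply or_iff_compat_l; split.
- intros (w & Hw & Hv); apply in_img in Hw as (z & Hz & ->); apply in_join in Hv; eauto.
- intros (z & Hz & Hv); exists (join (chain Phi u0 z) (app1 Phi (chain Phi u0 z))); rewrite in_img, in_join; eauto.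
Qed.

Lemma f_chain : F3 I D tru3 chain.
Proof.
assert (Df (fun _ => True) (fun e => chain (e 1) (e 2) (e 0))) as F.
{ apply (@df_rec V A I D Dtrans HZ (fun _ => True) (fun e y => chain (e 0) (e 1) y)
    (fun xi g e => join (e 1) (cup (img (fun z => join (app1 g z) (app1 (e 0) (app1 g z))) xi)))).
  - intros e y _ _ _; rewrite chain_eq at 1; do 2 f_equal; apply img_ext; intros z Hz.
    rewrite app1_graph by (apply in_tc, below_mem, Hz); reflexivity.
  - dstep; [dauto |]; dstep.
    dauto. }
refine (df_substs (ts := [fun e => e 2; fun e => e 0; fun e => e 1]) _ F _).
- simpl; intros t Ht; decompose [or] Ht; subst; try tauto; dauto.
- auto.
Qed.
Hint Resolve f_chain : dfn.

Lemma f_chain_step : F3 I D tru3 (fun Phi u0 xi => img (fun z => join (chain Phi u0 z) (app1 Phi (chain Phi u0 z))) xi) /\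
  F3 I D tru3 (fun Phi u0 xi => img (fun z => opair z (join (chain Phi u0 z) (app1 Phi (chain Phi u0 z)))) xi) /\
  F3 I D tru3 (fun Phi u0 xi => img (fun z => join u0 (join (chain Phi u0 z) (app1 Phi (chain Phi u0 z)))) xi) /\
  F3 I D tru3 (fun Phi u0 xi => img (fun z => opair z (join u0 (join (chain Phi u0 z) (app1 Phi (chain Phi u0 z))))) xi).
Proof.
splits; dgoal.
- dauto.
- dauto.
- dauto.
- dauto.
Qed.

(** By regularity of [hartogs D Z], a small subset of the union of the chain is
    included in one of its members. *)
Lemma chain_exists Z T Phi u0 : stock D Z -> D T -> D Phi -> D u0 -> subset u0 T -> small Z u0 ->
  (forall u, D u -> subset u T -> small Z u -> small Z (app1 Phi u) /\ subset (app1 Phi u) T) ->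
  exists U, D U /\ subset U T /\ subset u0 U /\ small (prod (hartogs D Z) Z) U /\
    forall s, D s -> subset s U -> small Z s ->
      exists u, D u /\ small Z u /\ subset u T /\ subset s u /\ subset u U /\ subset (app1 Phi u) U.
Proof.
intros HS DT DPhi Du0 Su0 Smu0 HPhi; pose proof (proj1 HS) as DZ; pose proof f_chain_step as (FS1 & FS2 & FS3 & FS4).
set (d := hartogs D Z); assert (D d) as Dd by (unfold d; dm).
assert (ord d) as Od by (apply (ord_hartogs Dtrans HZ DZ)).
assert (forall xi, xi ∈ d -> D xi /\ ord xi /\ small Z xi) as Kd by (intros xi; apply (in_hartogs Dtrans HZ xi DZ)).
assert (forall xi, D xi -> D (chain Phi u0 xi)) as Dc by (intros xi Dxi; dm).
assert (forall xi, xi ∈ d -> small Z (chain Phi u0 xi) /\ subset (chain Phi u0 xi) T) as K.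
{ intros xi; induction (mem_wf V xi) as [xi _ IH]; intros Hxi; destruct (Kd xi Hxi) as (Dxi & Oxi & Sxi).
  assert (forall z, z ∈ xi -> D z /\ small Z (chain Phi u0 z) /\ subset (chain Phi u0 z) T /\
    small Z (app1 Phi (chain Phi u0 z)) /\ subset (app1 Phi (chain Phi u0 z)) T) as IH'.
  { intros z Hz; assert (D z) as Dz by exact (Dtrans Dxi Hz).
    destruct (IH z Hz (ord_transitive Od xi Hxi z Hz)) as [H1 H2].
    destruct (HPhi _ (Dc z Dz) H2 H1) as [H3 H4]; auto. }
  split.
  - rewrite chain_eq; apply (stock_join Dtrans HZ HS); [exact Du0 | | exact Smu0 |].
    + pose proof (F3_D FS1 DPhi Du0 Dxi Logic.I); dm.
    + apply (stock_cup Dtrans HZ HS).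
      * exact (F3_D FS1 DPhi Du0 Dxi Logic.I).
      * apply small_img; [exact (F3_D FS2 DPhi Du0 Dxi Logic.I) | exact Sxi].
      * intros w Hw; apply in_img in Hw as (z & Hz & ->); destruct (IH' z Hz) as (Dz & H1 & _ & H2 & _).
        apply (stock_join Dtrans HZ HS); auto; pose proof (Dc z Dz); dm.
  - intros v Hv; apply in_chain in Hv as [Hv | (z & Hz & [Hv | Hv])]; [auto | |];
      destruct (IH' z Hz) as (_ & _ & H1 & _ & H2); auto. }
exists (chain Phi u0 d); splits.
- apply Dc, Dd.
- intros v Hv; apply in_chain in Hv as [Hv | (z & Hz & [Hv | Hv])]; [auto | |]; destruct (K z Hz) as [H1 H2].
  + auto.
  + destruct (HPhi (chain Phi u0 z)) as [_ H3]; auto; apply Dc, (Dtrans Dd Hz).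
- intros v Hv; apply in_chain; auto.
- assert (empty ∈ d) as H0.
  { apply (in_hartogs Dtrans HZ _ DZ); split; [dm | split].
    - apply ord_of_subset; intros y Hy; apply in_empty in Hy; destruct Hy.
    - apply (small_id Dtrans HZ); [dm |]; intros y Hy; apply in_empty in Hy; destruct Hy. }
  apply small_subset with (cup (img (fun z => join u0 (join (chain Phi u0 z) (app1 Phi (chain Phi u0 z)))) d)).
  + apply (small_cup Dtrans HZ); auto.
    * exact (F3_D FS3 DPhi Du0 Dd Logic.I).
    * apply small_img; [exact (F3_D FS4 DPhi Du0 Dd Logic.I) |]; apply (small_id Dtrans HZ Dd); apply subset_refl.
    * intros w Hw; apply in_img in Hw as (z & Hz & ->); destruct (K z Hz) as [H1 H2].
      assert (D z) as Dz by exact (Dtrans Dd Hz); pose proof (Dc z Dz).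
      destruct (HPhi (chain Phi u0 z)) as [H3 _]; auto.
      apply (stock_join Dtrans HZ HS); auto; [dm |]; apply (stock_join Dtrans HZ HS); auto; dm.
  + intros v Hv; apply in_cup; apply in_chain in Hv as [Hv | (z & Hz & Hv)].
    * exists (join u0 (join (chain Phi u0 empty) (app1 Phi (chain Phi u0 empty)))); rewrite in_img, in_join; eauto.
    * exists (join u0 (join (chain Phi u0 z) (app1 Phi (chain Phi u0 z)))); rewrite in_img, !in_join; eauto.
- intros s Ds Ss Sms.
  (* Each element of [s] is sent to the first index at which it has appeared. The image is small,
     hence bounded by some [a] below [d], and the link at [a] contains all of [s]. *)
  pose (at_ := fun Phi u0 v z => v ∈ u0 \/ v ∈ chain Phi u0 z \/ v ∈ app1 Phi (chain Phi u0 z)).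
  assert (D4 I D tru4 at_) as Fat by (dgoal; unfold at_; dauto).
  pose (g := fun Phi u0 s d => sep (prod s d) (fun p => exists v z, p = opair v z /\ at_ Phi u0 v z /\
    forall z', z' ∈ z -> ~ at_ Phi u0 v z')).
  assert (F4 I D tru4 g) as Fg by (dgoal; unfold g; dauto).
  pose (X := fun g d => sep d (fun z => exists v, opair v z ∈ g)).
  assert (F2 I D tru2 X) as FX by (dgoal; unfold X; dauto).
  assert (D (g Phi u0 s d)) as Dg by (apply (F4_D Fg); auto; exact Logic.I).
  destruct (@hartogs_regular V A I D Dtrans HZ Z (X (g Phi u0 s d) d)) as (a & Ha & Ka); auto.
  + exact (F2_D FX Dg Dd Logic.I).
  + intros z Hz; apply in_sep in Hz; tauto.
  + apply (small_trans Dtrans HZ Sms Dg); split.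
    * intros v z z' H H'; apply in_sep in H as (Hp & v1 & z1 & E & H1 & H2); apply in_sep in H' as (Hp' & v2 & z2 & E' & H1' & H2').
      apply opair_inj in E as [-> ->]; apply opair_inj in E' as [-> ->]; apply opair_in_prod in Hp as [_ Hp]; apply opair_in_prod in Hp' as [_ Hp'].
      destruct (ord_trichotomy (ord_mem Od Hp) (ord_mem Od Hp')) as [T1 | [T1 | T1]]; auto; exfalso.
      -- exact (H2' _ T1 H1).
      -- exact (H2 _ T1 H1').
    * intros z Hz; apply in_sep in Hz as (_ & v & Hv); exists v; split; [| exact Hv].
      apply in_sep in Hv as (Hv & _); apply opair_in_prod in Hv; tauto.
  + destruct (Kd a Ha) as (Da & _ & _); destruct (K a Ha) as [K1 K2].
    exists (chain Phi u0 a); splits; auto.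
    * intros v Hv.
      assert (exists z, z ∈ d /\ at_ Phi u0 v z) as Hex.
      { pose proof (Ss v Hv) as HvU; apply in_chain in HvU as [HvU | (z & Hz & HvU)]; [exists a | exists z]; unfold at_; auto. }
      destruct (@mem_min V (fun z => z ∈ d /\ at_ Phi u0 v z) Hex) as (z & (Hz & Hat) & Hmin).
      assert (z ∈ a) as Hza.
      { apply Ka, in_sep; split; [exact Hz |]; exists v; apply in_sep; split; [apply opair_in_prod; auto |].
        exists v, z; splits; auto; intros z' Hz' Hat'; apply (Hmin z' Hz'); split; [exact (ord_transitive Od z Hz z' Hz') | exact Hat']. }
      apply in_chain; destruct Hat as [Hat | Hat]; eauto.
    * intros v Hv; apply in_chain; right; eauto.
    * intros v Hv; apply in_chain; right; eauto.
Qed.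

Definition order_iso (e n U : V) :=
  (forall q, q ∈ e -> exists a b, q = opair a b /\ a ∈ n /\ b ∈ U) /\
  (forall a, a ∈ n -> exists b, opair a b ∈ e) /\
  (forall b, b ∈ U -> exists a, opair a b ∈ e) /\
  (forall a b a' b', opair a b ∈ e -> opair a' b' ∈ e -> (a ∈ a' <-> b ∈ b')).

Lemma order_iso_mem (e n : V) U a b : order_iso e n U -> opair a b ∈ e -> a ∈ n /\ b ∈ U.
Proof. intros (H & _) Hab; destruct (H _ Hab) as (a' & b' & E & H'); apply opair_inj in E as [-> ->]; exact H'. Qed.

(** As both domains are transitive, the preimage of [b] is the set of preimages of the elements of
    [b] in [U]; induction on [b] identifies the two. *)
Lemma order_iso_unique (e e' n n' : V) U : order_iso e n U -> order_iso e' n' U -> is_transitive n -> is_transitive n' ->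
  forall b a a', opair a b ∈ e -> opair a' b ∈ e' -> a = a'.
Proof.
intros He He' Tn Tn' b; induction (mem_wf V b) as [b _ IH]; intros a a' Ha Ha'.
pose proof He as (_ & He2 & He3 & He4); pose proof He' as (_ & He2' & He3' & He4').
apply mem_ext; intros z; split; intros Hz.
- assert (z ∈ n) as Hzn by exact (Tn a (proj1 (order_iso_mem He Ha)) z Hz).
  destruct (He2 z Hzn) as (g & Hg); pose proof (proj1 (He4 _ _ _ _ Hg Ha) Hz) as Hgb.
  destruct (He3' g (proj2 (order_iso_mem He Hg))) as (z' & Hz').
  rewrite (IH g Hgb _ _ Hg Hz'); apply (He4' _ _ _ _ Hz' Ha'), Hgb.
- assert (z ∈ n') as Hzn by exact (Tn' a' (proj1 (order_iso_mem He' Ha')) z Hz).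
  destruct (He2' z Hzn) as (g & Hg); pose proof (proj1 (He4' _ _ _ _ Hg Ha') Hz) as Hgb.
  destruct (He3 g (proj2 (order_iso_mem He' Hg))) as (z' & Hz').
  rewrite <- (IH g Hgb _ _ Hz' Hg); apply (He4 _ _ _ _ Hz' Ha), Hgb.
Qed.

Lemma order_iso_sub (e e' n n' : V) U : order_iso e n U -> order_iso e' n' U -> is_transitive n -> is_transitive n' -> subset e e'.
Proof.
intros He He' Tn Tn' q Hq; pose proof He as (He1 & _); pose proof He' as (_ & _ & He3' & _).
destruct (He1 q Hq) as (a & b & -> & _ & Hb); destruct (He3' b Hb) as (a' & Ha').
rewrite (order_iso_unique He He' Tn Tn' Hq Ha'); exact Ha'.
Qed.

(** The Mostowski collapse relative to [U]; on a set of ordinals it produces the order type. *)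
Definition collapse U : V -> V := mem_rec empty (fun b rec => img rec (inter b U)).

Lemma collapse_eq U b : collapse U b = img (collapse U) (inter b U).
Proof.
unfold collapse at 1; rewrite mem_rec_below; [reflexivity |].
intros r r' E; apply img_ext; intros z Hz; apply E, below_mem.
unfold inter in Hz; apply (setof_bounded (fun z => z ∈ b /\ z ∈ U) b) in Hz; tauto.
Qed.

Lemma in_collapse U b a : a ∈ collapse U b <-> exists g, g ∈ b /\ g ∈ U /\ a = collapse U g.
Proof.
rewrite collapse_eq, in_img; apply ex_iff; intros g; unfold inter.
rewrite (setof_bounded (fun z => z ∈ b /\ z ∈ U) b) by tauto; tauto.
Qed.

Lemma f_collapse : F2 I D tru2 collapse.
Proof.
assert (Df (fun _ => True) (fun e => collapse (e 1) (e 0))) as F.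
{ apply (@df_rec V A I D Dtrans HZ (fun _ => True) (fun e y => collapse (e 0) y) (fun b g e => img (app1 g) (inter b (e 0)))).
  - intros e y _ _ _; rewrite collapse_eq at 1; apply img_ext; intros z Hz; rewrite app1_graph; [reflexivity |].
    apply in_tc, below_mem; unfold inter in Hz; apply (setof_bounded (fun z => z ∈ y /\ z ∈ e 0) y) in Hz; tauto.
  - dauto. }
refine (df_substs (ts := [fun e => e 1; fun e => e 0]) _ F _).
- simpl; intros t Ht; decompose [or] Ht; subst; try tauto; dauto.
- auto.
Qed.
Hint Resolve f_collapse : dfn.

Lemma collapse_exists Y U : D U -> (forall b, b ∈ U -> ord b) -> small Y U ->
  exists e n, D e /\ D n /\ ord n /\ small Y n /\ order_iso e n U.
Proof.
intros DU OU SU.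
assert (F1 I D tru1 (fun U => img (collapse U) U)) as F by (dgoal; dauto).
assert (F1 I D tru1 (fun U => img (fun b => opair (collapse U b) b) U)) as F' by (dgoal; dauto).
assert (F1 I D tru1 (fun U => img (fun b => opair b (collapse U b)) U)) as F'' by (dgoal; dauto).
exists (img (fun b => opair (collapse U b) b) U), (img (collapse U) U); splits.
- exact (F1_D F' DU Logic.I).
- exact (F1_D F DU Logic.I).
- assert (forall b, ord b -> ord (collapse U b)) as K.
  { intros b; induction (mem_wf V b) as [b _ IH]; intros Ob; apply ord_of_subset.
    - intros y Hy; apply in_collapse in Hy as (g & Hg & HgU & ->); exact (IH g Hg (ord_mem Ob Hg)).
    - intros y Hy z Hz; apply in_collapse in Hy as (g & Hg & HgU & ->); apply in_collapse in Hz as (g' & Hg' & HgU' & ->).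
      apply in_collapse; exists g'; splits; auto; exact (ord_transitive Ob g Hg g' Hg'). }
  apply ord_of_subset.
  + intros y Hy; apply in_img in Hy as (b & Hb & ->); apply K, OU, Hb.
  + intros y Hy z Hz; apply in_img in Hy as (b & Hb & ->); apply in_collapse in Hz as (g & _ & Hg & ->); apply in_img; eauto.
- apply small_img; [exact (F1_D F'' DU Logic.I) | exact SU].
- assert (forall a b, opair a b ∈ img (fun b => opair (collapse U b) b) U <-> b ∈ U /\ a = collapse U b) as E.
  { intros a b; rewrite in_img; split; [intros (b' & Hb & E); apply opair_inj in E as [-> ->]; auto | intros [Hb ->]; eauto]. }
  assert (forall b b', b ∈ U -> b' ∈ U -> b ∈ b' -> collapse U b ∈ collapse U b') as K.
  { intros b b' Hb Hb' H; apply in_collapse; eauto. }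
  unfold order_iso; splits.
  + intros q Hq; apply in_img in Hq as (b & Hb & ->); exists (collapse U b), b; rewrite in_img; eauto.
  + intros a Ha; apply in_img in Ha as (b & Hb & ->); exists b; apply E; auto.
  + intros b Hb; exists (collapse U b); apply E; auto.
  + intros a b a' b' H H'; apply E in H as [Hb ->]; apply E in H' as [Hb' ->]; split; [| apply K; assumption].
    intros H; destruct (ord_trichotomy (OU b Hb) (OU b' Hb')) as [T1 | [T1 | T1]]; auto; exfalso.
    * subst b'; exact (mem_irrefl H).
    * exact (mem_asym H (K _ _ Hb' Hb T1)).
Qed.

(** [f] relates the transitive closure of [x] with ordinals on which [E] copies the
    membership relation. *)
Definition codes (E : V) f x := (exists b, opair x b ∈ f) /\ forall y b, opair y b ∈ f ->
  (forall y', y' ∈ y -> exists b', b' ∈ b /\ opair y' b' ∈ f /\ opair b' b ∈ E) /\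
  (forall a, a ∈ b -> opair a b ∈ E -> exists y', y' ∈ y /\ opair y' a ∈ f).

Definition decoded (E : V) : V -> V := mem_rec empty (fun b rec => img rec (sep b (fun a => opair a b ∈ E))).

Lemma decoded_eq E b : decoded E b = img (decoded E) (sep b (fun a => opair a b ∈ E)).
Proof.
unfold decoded at 1; rewrite mem_rec_below; [reflexivity |].
intros r r' H; apply img_ext; intros z Hz; apply H, below_mem; apply in_sep in Hz; tauto.
Qed.

Lemma f_decoded : F2 I D tru2 decoded.
Proof.
assert (Df (fun _ => True) (fun e => decoded (e 1) (e 0))) as F.
{ apply (@df_rec V A I D Dtrans HZ (fun _ => True) (fun e y => decoded (e 0) y)
    (fun b g e => img (app1 g) (sep b (fun a => opair a b ∈ e 0)))).
  - intros e y _ _ _; rewrite decoded_eq at 1; apply img_ext; intros z Hz; rewrite app1_graph; [reflexivity |].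
    apply in_tc, below_mem; apply in_sep in Hz; tauto.
  - dauto. }
refine (df_substs (ts := [fun e => e 1; fun e => e 0]) _ F _).
- simpl; intros t Ht; decompose [or] Ht; subst; try tauto; dauto.
- auto.
Qed.

(** The code is read back in [D] by recursion on the code point, along [E]. Only [E] and the point
    [b] have to lie in [D]; [f] may come from a larger model. *)
Lemma codes_decoded (E : V) f x : D E -> (forall y b, opair y b ∈ f -> D b) -> codes E f x -> D x.
Proof.
intros DE Df ((b & Hb) & H).
assert (forall y, forall b, opair y b ∈ f -> y = decoded E b) as K.
{ intros y; induction (mem_wf V y) as [y _ IH]; intros b' Hb'; destruct (H y b' Hb') as [H1 H2].
  rewrite decoded_eq; apply mem_ext; intros z; rewrite in_img; split.
  - intros Hz; destruct (H1 z Hz) as (a & Ha & Haf & HaE); exists a; rewrite in_sep; splits; auto.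
  - intros (a & Ha & ->); apply in_sep in Ha as [Ha HaE]; destruct (H2 a Ha HaE) as (y' & Hy' & Hf).
    rewrite <- (IH y' Hy' a Hf); exact Hy'. }
rewrite (K x b Hb); apply (F2_D f_decoded); [exact DE | exact (Df x b Hb) | exact Logic.I].
Qed.

End WellOrder.

(** * Coding a set by a relation on an ordinal *)

Section Enumeration.
Context {V : universe} {A : Type} (I : A -> V -> Prop) (D : V -> Prop).
Context (Dtrans : transitive_class D) (HZ : models_ZFC D I).
Notation tl e := (fun n => e (Datatypes.S n)).
Notation Dp := (Dp I D).
Notation Df := (Df I D).
Notation ok := (over_D D).
Implicit Types a b f g h k r s t u v w x y z X Y Z U : V.

(** The elements of [t] that may be listed next, when those in [R] have been listed. *)
Definition minimal_in t (R : V) := sep t (fun y => y ∉ R /\ subset y R).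

Lemma f_minimal_in : F2 I D tru2 minimal_in.
Proof.
pose proof (@d_subset V A I D Dtrans).
dgoal; unfold minimal_in; dauto.
Qed.
Hint Resolve f_minimal_in : dfn.

(** [k] is a choice function; every element of [t] comes after its own elements. *)
Definition enumeration k t : V -> V := mem_rec empty (fun a rec => app1 k (minimal_in t (img rec a))).

Lemma enumeration_eq k t a : enumeration k t a = app1 k (minimal_in t (img (enumeration k t) a)).
Proof.
unfold enumeration at 1; rewrite mem_rec_below; [reflexivity |].
intros r r' E; do 2 f_equal; apply img_ext; intros z Hz; exact (E z (below_mem Hz)).
Qed.

Lemma f_enumeration : F3 I D tru3 enumeration.
Proof.
assert (F2 I D tru2 (fun g a => img (app1 g) a)) as Fi by (dgoal; dauto).
assert (Df (fun _ => True) (fun e => enumeration (e 1) (e 2) (e 0))) as F.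
{ apply (@df_rec V A I D Dtrans HZ (fun _ => True) (fun e y => enumeration (e 0) (e 1) y)
    (fun a g e => app1 (e 0) (minimal_in (e 1) (img (app1 g) a)))).
  - intros e y _ _ _; rewrite enumeration_eq at 1; do 2 f_equal; apply img_ext; intros z Hz.
    rewrite app1_graph by (apply in_tc, below_mem, Hz); reflexivity.
  - dstep; [dauto |]; dstep; [dauto |].
    eapply (df_use2 (f := fun g a => img (app1 g) a) (t1 := fun e => e 1) (t2 := fun e => e 0));
      [exact Fi | dauto | dauto | intros; exact Logic.I]. }
refine (df_substs (ts := [fun e => e 2; fun e => e 0; fun e => e 1]) _ F _).
- simpl; intros t Ht; decompose [or] Ht; subst; try tauto; dauto.
- auto.
Qed.
Hint Resolve f_enumeration : dfn.

(** The transitive closure of [x] is listed in an order compatible with membership. The listing is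
    injective, so it cannot go on through the Hartogs ordinal of [t]; [T] is the first ordinal at
    which nothing is left, and by induction on membership everything has then been listed. *)
Lemma codes_exists x : D x -> exists T E f : V, D T /\ D E /\ D f /\ ord T /\ subset E (prod T T) /\
  (forall y b, opair y b ∈ f -> b ∈ T) /\ codes E f x.
Proof.
intros Dx; pose (t := join (tc x) (single x)).
assert (D t) as Dt by (unfold t; dm).
assert (forall y, y ∈ t <-> below y x \/ y = x) as Et by (intros y; unfold t; rewrite in_join, in_tc, in_single; tauto).
assert (is_transitive t) as Tt.
{ intros y Hy z Hz; apply Et; left; apply Et in Hy as [Hy | ->]; [| exact (below_mem Hz)].
  exact (below_trans (below_mem Hz) Hy). }
pose (r := fun t => sep (prod (powD D t) t) (fun p => exists a y, p = opair a y /\ y ∈ a)).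
assert (F1 I D tru1 r) as Fr by (dgoal; unfold r; dauto).
destruct (@uniformize V A I D Dtrans HZ (r t)) as (k & Dk & Pk & Sk & Tk); [exact (F1_D Fr Dt Logic.I) |].
assert (forall a y, opair a y ∈ r t <-> D a /\ subset a t /\ y ∈ a) as Er.
{ intros a y; unfold r; rewrite in_sep, opair_in_prod, in_powD; split.
  - intros (H & a' & y' & E & Hy); apply opair_inj in E as [<- <-]; tauto.
  - intros (H1 & H2 & H3); splits; auto; exists a, y; auto. }
set (g := enumeration k t).
assert (F3 I D tru3 (fun k t a => img (enumeration k t) a)) as Fi by (dgoal; dauto).
assert (forall a, D a -> D (img g a)) as Di by (intros a Da; exact (F3_D Fi Dk Dt Da Logic.I)).
pose (M := fun a => minimal_in t (img g a)).
assert (forall a y, y ∈ M a <-> y ∈ t /\ y ∉ img g a /\ subset y (img g a)) as EM by (intros a y; unfold M, minimal_in; rewrite in_sep; tauto).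
assert (forall a, D a -> (exists y, y ∈ M a) -> g a ∈ M a) as Hg.
{ intros a Da (y & Hy); pose proof (Di a Da).
  assert (opair (M a) y ∈ r t) as Hr.
  { apply Er; splits; auto; [unfold M; dm | intros z Hz; apply EM in Hz; tauto]. }
  destruct (Tk _ _ Hr) as (y' & Hy').
  assert (g a = y') as ->; [| apply Sk, Er in Hy'; tauto].
  unfold g; rewrite enumeration_eq; fold g; fold (M a); apply app1_eq; [| exact Hy'].
  exists y'; split; [exact Hy' | intros z Hz; exact (Pk _ _ _ Hy' Hz)]. }
assert (F3 I D tru3 (fun k t a => img (fun z => opair (enumeration k t z) z) a)) as Ff by (dgoal; dauto).
assert (forall T, D T -> D (img (fun z => opair (g z) z) T)) as Df' by (intros T DT; exact (F3_D Ff Dk Dt DT Logic.I)).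
assert (forall T y b, opair y b ∈ img (fun z => opair (g z) z) T <-> b ∈ T /\ y = g b) as Ef.
{ intros T y b; rewrite in_img; split; [intros (z & Hz & E); apply opair_inj in E as [-> ->]; auto | intros [Hb ->]; eauto]. }
assert (exists T, D T /\ ord T /\ forall y, y ∉ M T) as Hex.
{ apply NNPP; intros N.
  pose (T := hartogs D t); assert (D T) as DT by (unfold T; dm).
  assert (ord T) as OT by exact (ord_hartogs Dtrans HZ Dt).
  assert (forall a, a ∈ T -> g a ∈ M a) as HgT.
  { intros a Ha; assert (D a) as Da by exact (Dtrans DT Ha); apply (Hg a Da); apply NNPP; intros N'; apply N.
    exists a; splits; [exact Da | exact (ord_mem OT Ha) |]; intros y Hy; apply N'; eauto. }
  apply (@mem_irrefl V T); apply (in_hartogs Dtrans HZ _ Dt); splits; auto.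
  apply (@small_intro V D t T (img (fun z => opair (g z) z) T)); [exact (Df' T DT) | |].
  - intros y a b Ha Hb; apply Ef in Ha as [Ha ->]; apply Ef in Hb as [Hb E].
    pose proof (HgT a Ha) as H1; pose proof (HgT b Hb) as H2; apply EM in H1 as (_ & H1 & _); apply EM in H2 as (_ & H2 & _).
    destruct (ord_trichotomy (ord_mem OT Ha) (ord_mem OT Hb)) as [T1 | [T1 | T1]]; auto; exfalso.
    + apply H2, in_img; exists a; auto.
    + apply H1, in_img; exists b; auto.
  - intros a Ha; exists (g a); split; [apply (EM a), HgT, Ha | apply Ef; auto]. }
destruct (@mem_min V _ Hex) as (T & (DT & OT & NT) & Hmin).
assert (forall a, a ∈ T -> g a ∈ M a) as HgT.
{ intros a Ha; assert (D a) as Da by exact (Dtrans DT Ha); apply (Hg a Da); apply NNPP; intros N'.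
  apply (Hmin a Ha); splits; [exact Da | exact (ord_mem OT Ha) |]; intros y Hy; apply N'; eauto. }
assert (forall y, y ∈ t -> y ∈ img g T) as Hall.
{ intros y; induction (mem_wf V y) as [y _ IH]; intros Hy; apply NNPP; intros N; apply (NT y), EM; splits; auto.
  intros z Hz; exact (IH z Hz (Tt y Hy z Hz)). }
pose (E := fun k t T => sep (prod T T) (fun p => exists a b, p = opair a b /\ enumeration k t a ∈ enumeration k t b)).
assert (F3 I D tru3 E) as FE by (dgoal; unfold E; dauto).
assert (forall a b, opair a b ∈ E k t T <-> a ∈ T /\ b ∈ T /\ g a ∈ g b) as EE.
{ intros a b; unfold E; rewrite in_sep, opair_in_prod; split.
  - intros ((H1 & H2) & a' & b' & Eq & H3); apply opair_inj in Eq as [<- <-]; auto.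
  - intros (H1 & H2 & H3); splits; auto; exists a, b; auto. }
exists T, (E k t T), (img (fun z => opair (g z) z) T); splits; auto.
- exact (F3_D FE Dk Dt DT Logic.I).
- intros p Hp; apply in_sep in Hp; tauto.
- intros y b H; apply Ef in H; tauto.
- split.
  + pose proof (Hall x ltac:(apply Et; auto)) as Hx; apply in_img in Hx as (b & Hb & Eb); exists b; apply Ef; auto.
  + intros y b H; apply Ef in H as [Hb ->]; pose proof (HgT b Hb) as Hgb; apply EM in Hgb as (_ & _ & Hgb); split.
    * intros y' Hy'; pose proof (Hgb y' Hy') as H; apply in_img in H as (b' & Hb' & ->).
      assert (b' ∈ T) as HbT by exact (ord_transitive OT b Hb b' Hb').
      exists b'; rewrite Ef, EE; auto.
    * intros a Ha HaE; apply EE in HaE as (HaT & _ & Hga); exists (g a); rewrite Ef; auto.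
Qed.

End Enumeration.

(** * Covering and approximation *)

#[export] Hint Resolve f_chain f_collapse f_forced_eq f_forced_mem : dfn.

Ltac below_pair := first [apply below_fst' | apply below_snd'
  | eapply below_trans; [| apply below_fst']; below_pair | eapply below_trans; [| apply below_snd']; below_pair].

Ltac dm_hook ::=
  match goal with
  | T : transitive_class ?D, H : opair ?a ?b ∈ ?k |- ?D ?x =>
      apply (D_below T (x := x) (y := opair a b)); [solve [below_pair] | apply (D_mem T H); solve [dm]]
  | T : transitive_class ?D, H : ?z = opair ?a ?b |- ?D ?x =>
      apply (D_below T (x := x) (y := opair a b)); [solve [below_pair] | rewrite <- H; solve [dm]]
  end.

(** * Transport of relations along functions *)

Section Transport.
Context {V : universe} {A : Type} (I : A -> V -> Prop) (D : V -> Prop).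
Context (Dtrans : transitive_class D) (HZ : models_ZFC D I).
Notation Dp := (Dp I D).
Notation Df := (Df I D).
Notation small := (small D).
Implicit Types a b f g h k r s t u v w x y z X Y Z U : V.

Definition rng f v := exists j, opair j v ∈ f.

Definition converse f := sep (prod (tc f) (tc f)) (fun p => exists a b, p = opair b a /\ opair a b ∈ f).

Lemma in_converse f a b : opair b a ∈ converse f <-> opair a b ∈ f.
Proof.
unfold converse; rewrite in_sep, opair_in_prod, !in_tc; split.
- intros (_ & a' & b' & E & H); apply opair_inj in E as [-> ->]; exact H.
- intros H; splits; [exact (below_snd H) | exact (below_fst H) | exists a, b; auto].
Qed.

Lemma f_converse : F1 I D tru1 converse.
Proof.
dgoal; unfold converse; dauto.
Qed.

(** With the order isomorphism [e] of [n] and [U], or its converse, as [f], this moves relations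
    from [n] to [U] and back. *)
Definition transport f X t := sep (prod X X) (fun p => exists a b a' b', p = opair a b /\
  opair a' b' ∈ t /\ opair a' a ∈ f /\ opair b' b ∈ f).

Lemma in_transport f X t a b : opair a b ∈ transport f X t <-> a ∈ X /\ b ∈ X /\
  exists a' b', opair a' b' ∈ t /\ opair a' a ∈ f /\ opair b' b ∈ f.
Proof.
unfold transport; rewrite in_sep, opair_in_prod; split.
- intros ((H1 & H2) & a1 & b1 & a' & b' & E & H); apply opair_inj in E as [<- <-]; eauto.
- intros (H1 & H2 & a' & b' & H); splits; auto; exists a, b, a', b'; auto.
Qed.

Lemma f_transport : F3 I D tru3 transport.
Proof.
dgoal; unfold transport; dauto.
Qed.

Lemma small_transport Z f X t : D f -> D X -> D t -> pfun f -> small Z t -> small Z (transport f X t).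
Proof.
intros DF DX DT PF ST.
pose (g := fun f X t => sep (prod t (prod X X)) (fun p => exists a b a' b', p = opair (opair a' b') (opair a b) /\
  opair a' a ∈ f /\ opair b' b ∈ f)).
assert (F3 I D tru3 g) as Fg by (dgoal; unfold g; dauto).
apply (small_trans Dtrans HZ ST (F3_D Fg DF DX DT Logic.I)); split.
- intros q v v' H H'; apply in_sep in H as (_ & a & b & a' & b' & E & H1 & H2).
  apply in_sep in H' as (_ & a1 & b1 & a1' & b1' & E' & H1' & H2').
  apply opair_inj in E as [-> ->]; apply opair_inj in E' as [E ->]; apply opair_inj in E as [-> ->].
  rewrite (PF _ _ _ H1 H1'), (PF _ _ _ H2 H2'); reflexivity.
- intros p Hp; pose proof Hp as Hp'; apply in_sep in Hp' as (_ & a & b & a' & b' & -> & _).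
  apply in_transport in Hp as (Ha & Hb & a1 & b1 & H1 & H2 & H3).
  exists (opair a1 b1); split; [exact H1 |]; apply in_sep; split.
  + rewrite !opair_in_prod; auto.
  + exists a, b, a1, b1; auto.
Qed.

(** A cover of [s], used in both coordinates, covers the square of [s] by that of [Z], which the
    stock absorbs. *)
Lemma small_square Z s : stock D Z -> D s -> small Z s -> small Z (prod s s).
Proof.
intros HS Ds (f & DF & PF & CF); apply (small_prod Dtrans HZ HS).
assert (F1 I D tru1 (fun Z => prod Z Z)) as Fp by (dgoal; dauto).
apply small_subset with (transport f s (prod Z Z)).
- apply small_transport; auto; [exact (F1_D Fp (proj1 HS) Logic.I) |].
  apply (small_id Dtrans HZ); [exact (F1_D Fp (proj1 HS) Logic.I) | apply subset_refl].
- intros p Hp; apply in_prod in Hp as (a & b & Ha & Hb & ->).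
  destruct (CF a Ha) as (i & Hi & Hia); destruct (CF b Hb) as (j & Hj & Hjb).
  apply in_transport; splits; auto; exists i, j; rewrite opair_in_prod; auto.
Qed.

Lemma small_cover Z u : D Z -> D u -> small Z u -> exists f, D f /\ pfun f /\ subset f (prod Z u) /\ forall v, rng f v <-> v ∈ u.
Proof.
intros DZ Du (f & DF & PF & CF).
assert (forall q, q ∈ inter f (prod Z u) <-> q ∈ f /\ q ∈ prod Z u) as Ei.
{ apply (setof_bounded (fun q => q ∈ f /\ q ∈ prod Z u) f); tauto. }
exists (inter f (prod Z u)); splits.
- dm.
- intros x y y' H H'; apply Ei in H as [H _]; apply Ei in H' as [H' _]; exact (PF _ _ _ H H').
- intros q Hq; apply Ei in Hq; tauto.
- intros v; split; [intros (j & Hj); apply Ei in Hj as [_ Hj]; apply opair_in_prod in Hj; tauto |].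
  intros Hv; destruct (CF v Hv) as (j & Hj & Hjv); exists j; apply Ei; rewrite opair_in_prod; auto.
Qed.

Lemma order_iso_converse (e n : V) U : order_iso e n U -> is_transitive n -> pfun (converse e).
Proof.
intros He Tn b a a' H H'; rewrite in_converse in H, H'.
exact (order_iso_unique He He Tn Tn H H').
Qed.

Lemma order_iso_pfun (e n : V) U : order_iso e n U -> (forall b, b ∈ U -> ord b) -> pfun e.
Proof.
intros He OU a b b' H H'; destruct (order_iso_mem He H) as [_ Hb]; destruct (order_iso_mem He H') as [_ Hb'].
pose proof He as (_ & _ & _ & He4).
destruct (ord_trichotomy (OU b Hb) (OU b' Hb')) as [T1 | [T1 | T1]]; auto; exfalso.
- apply (He4 _ _ _ _ H H') in T1; exact (mem_irrefl T1).
- apply (He4 _ _ _ _ H' H) in T1; exact (mem_irrefl T1).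
Qed.

End Transport.
#[export] Hint Resolve f_converse f_transport : dfn.

(** * Approximation and covering between [W] and [W[c]] *)

Section Approximation.
Context {V : universe} (W : V -> Prop) (S : V -> V).
Notation I := (seq_pred W S).
Context (Wtrans : transitive_class W) (HZ : models_ZFC W I).
Notation Dp := (Dp I W).
Notation Df := (Df I W).
Notation small := (small W).
Implicit Types s t u v x y z p q h k j K U Y Z : V.
Let Add_W' x : Add x -> W x := @Add_W V W S Wtrans HZ x.
Hint Resolve Add_W' : guard.
Context (c : V) (Hc : cohen_real W c).

Definition cohen_named v := exists (T x : V) (G : V -> Prop), W T /\ W x /\ (forall p, G p <-> ctrue c T p) /\ v = interp G x.

(** The full value of a name may have elements outside [W]. On a set [Y] of [W] only the question
    which elements of [Y] belong to it remains, and [forced_mem] answers it by a relation in [W]. *)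
Lemma cohen_representation B Y : cohen_named B -> W Y -> exists E, W E /\ forall v, v ∈ Y -> (v ∈ B <-> ctrue c E v).
Proof.
intros (T & x & G & WT & Wx & HG & ->) WY.
pose (E := fun F Y x => sep (prod AddSet Y) (fun p => exists t v, p = opair t v /\ opair t (opair x v) ∈ F)).
assert (F3 I W tru3 E) as FE by (dgoal; unfold E; dauto).
exists (E (forced_mem T (tc Y) x) Y x); split; [apply (F3_D FE); [dm | auto | auto | exact Logic.I] |].
intros v Hv; rewrite (forced_mem_true Wtrans HZ Hc WT HG (Y := tc Y) (x := x) (z := x));
  [| dm | apply tc_transitive | exact Wx | auto | apply in_tc, below_mem, Hv].
apply ex_iff; intros t; split; intros [Ht H]; split; auto.
- unfold E; rewrite in_sep, opair_in_prod, in_AddSet; splits; [apply Ht | exact Hv | exists t, v; auto].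
- apply in_sep in H as (_ & t' & v' & Eq & H); apply opair_inj in Eq as [-> ->]; exact H.
Qed.

Context (Z : V) (HS : stock W Z) (HA : forall t, Add t -> t ∈ Z).
Let WZ : W Z := proj1 HS.

(** Since [Z] contains the Cohen conditions, the partial function on conditions that approximation
    requires is a function on [Z]; knowing [B] on its range in [W] tells at which conditions it hits
    [B]. *)
Lemma named_approximation B Y : cohen_named B -> W Y -> subset B Y ->
  (forall h, W h -> pfun h -> subset h (prod Z Y) -> exists s, W s /\ forall v, rng h v -> (v ∈ s <-> v ∈ B)) -> W B.
Proof.
intros HB WY SB H; destruct (cohen_representation HB WY) as (E & WE & HE).
apply (@approximation_lemma V W S Wtrans HZ c Hc E (compl E Y) Y B); auto.
- dm.
- intros v Hv; rewrite (compl_true Wtrans HZ Hc WE WY Hv), (HE v Hv); tauto.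
- intros h Wh Ph Hh; destruct (H h Wh Ph) as (s & Ws & Hs).
  { intros q Hq; destruct (Hh q Hq) as (t & v & -> & At & Hv); apply opair_in_prod; auto. }
  pose (R := fun h s => sep AddSet (fun t => exists v, opair t v ∈ h /\ v ∈ s)).
  assert (F2 I W tru2 R) as FR by (dgoal; unfold R; dauto).
  exists (R h s); split; [exact (F2_D FR Wh Ws Logic.I) |]; intros t At; unfold R; rewrite in_sep, in_AddSet; split.
  + intros (_ & v & Hv & Hvs); exists v; split; [exact Hv |]; apply Hs; [exists t |]; assumption.
  + intros (v & Hv & HvB); split; [exact At |]; exists v; split; [exact Hv |]; apply Hs; [exists t |]; assumption.
- exact (@uniformize V unit I W Wtrans HZ).
Qed.

(** [k] guesses the values [v] of all the partial functions named by the sections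
    of [F], for each condition [t] and argument [j]. *)
Lemma cover_family F N Y : W F -> W N -> W Y -> exists k, W k /\ pfun k /\
  (forall q, q ∈ k -> exists t z j v, q = opair (opair t (opair z j)) v /\ Add t /\ z ∈ N /\ j ∈ Z /\ v ∈ Y) /\
  forall z g, z ∈ N -> pfun g -> (forall q, q ∈ prod Z Y -> (q ∈ g <-> ctrue c F (opair z q))) ->
    forall j v, j ∈ Z -> v ∈ Y -> opair j v ∈ g -> exists t, Add t /\ opair (opair t (opair z j)) v ∈ k.
Proof.
intros WF WN WY.
pose (r := fun F N Y Z => sep (prod (prod AddSet (prod N Z)) Y) (fun p => exists t z j v,
  z ∈ N /\ j ∈ Z /\ p = opair (opair t (opair z j)) v /\ opair t (opair z (opair j v)) ∈ F)).
assert (F4 I W tru4 r) as Fr by (dgoal; unfold r; dauto).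
assert (forall t z j v, opair (opair t (opair z j)) v ∈ r F N Y Z <->
  Add t /\ z ∈ N /\ j ∈ Z /\ v ∈ Y /\ opair t (opair z (opair j v)) ∈ F) as Er.
{ intros t z j v; unfold r; rewrite in_sep, !opair_in_prod, in_AddSet; split.
  - intros (H & t' & z' & j' & v' & _ & _ & E & H'); apply opair_inj in E as [E ->]; apply opair_inj in E as [-> E];
      apply opair_inj in E as [-> ->]; tauto.
  - intros (H1 & H2 & H3 & H4 & H5); splits; auto; exists t, z, j, v; auto. }
destruct (@uniformize V unit I W Wtrans HZ (r F N Y Z)) as (k & Wk & Pk & Sk & Tk); [apply (F4_D Fr); auto; exact Logic.I |].
exists k; splits; auto.
- intros q Hq; pose proof (Sk q Hq) as H; unfold r in H; apply in_sep in H as (H & t & z & j & v & _ & _ & -> & _).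
  rewrite !opair_in_prod, in_AddSet in H; exists t, z, j, v; tauto.
- intros z g Hz Pg Hg j v Hj Hv Hjv.
  assert (opair j v ∈ prod Z Y) as Hq by (apply opair_in_prod; auto).
  destruct (proj1 (Hg _ Hq) Hjv) as (t & Ht & HtF); exists t; split; [apply Ht |].
  destruct (Tk (opair t (opair z j)) v) as (v' & Hv'); [apply Er; splits; auto; apply Ht |].
  replace v with v'; [exact Hv' |].
  pose proof (Sk _ Hv') as H; apply Er in H as (_ & _ & _ & HvY & H).
  apply (Pg j); [| exact Hjv]; apply Hg; [apply opair_in_prod; auto |]; exists t; auto.
Qed.

Definition guesses k Y z := sep Y (fun v => exists t j, opair (opair t (opair z j)) v ∈ k).

Lemma f_guesses : F3 I W tru3 guesses.
Proof.
dgoal; unfold guesses; dauto.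
Qed.
Hint Resolve f_guesses : dfn.

(** For a fixed name [z] a guess is determined by a condition and an argument, both in [Z]. *)
Lemma small_guesses k N Y z : W k -> W Y -> W z -> pfun k ->
  (forall q, q ∈ k -> exists t z j v, q = opair (opair t (opair z j)) v /\ Add t /\ z ∈ N /\ j ∈ Z /\ v ∈ Y) ->
  small Z (guesses k Y z).
Proof.
intros Wk WY Wz Pk Hk; apply (small_prod Wtrans HZ HS).
pose (f := fun k Y Z z => sep (prod (prod Z Z) Y) (fun p => exists t j v, p = opair (opair t j) v /\ opair (opair t (opair z j)) v ∈ k)).
assert (F4 I W tru4 f) as Ff by (dgoal; unfold f; dauto).
apply (@small_intro V W (prod Z Z) (guesses k Y z) (f k Y Z z)).
- apply (F4_D Ff); auto; exact Logic.I.
- intros q v v' H H'; apply in_sep in H as (_ & t & j & v1 & E & H); apply in_sep in H' as (_ & t' & j' & v1' & E' & H').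
  apply opair_inj in E as [-> ->]; apply opair_inj in E' as [E ->]; apply opair_inj in E as [-> ->]; exact (Pk _ _ _ H H').
- intros v Hv; apply in_sep in Hv as (Hv & t & j & H).
  destruct (Hk _ H) as (t' & z' & j' & v' & E & At & _ & Hj & _).
  apply opair_inj in E as [E ->]; apply opair_inj in E as [-> E]; apply opair_inj in E as [_ ->].
  exists (opair t' j'); rewrite opair_in_prod; split; [auto |]; apply in_sep; rewrite !opair_in_prod; splits; auto.
  exists t', j', v'; auto.
Qed.

(** The covering property, as the case of [cover_family] with a single member, whose dummy index is
    [empty]. *)
Lemma small_range g Y : cohen_named g -> W Y -> pfun g ->
  exists s, W s /\ small Z s /\ subset s Y /\ forall j v, j ∈ Z -> v ∈ Y -> opair j v ∈ g -> v ∈ s.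
Proof.
intros Hg WY Pg; destruct (@cohen_representation g (prod Z Y) Hg) as (E & WE & HE); [dm |].
pose (F := fun E X => sep (prod AddSet (prod (single empty) X)) (fun p => exists t q, p = opair t (opair empty q) /\ opair t q ∈ E)).
assert (F2 I W tru2 F) as FF by (dgoal; unfold F; dauto).
assert (W (F E (prod Z Y))) as WF by (apply (F2_D FF); [auto | dm | exact Logic.I]).
destruct (@cover_family (F E (prod Z Y)) (single empty) Y) as (k & Wk & Pk & Hk & Ck); auto; [dm |].
exists (guesses k Y empty); splits.
- dm.
- apply (small_guesses (N := single empty)); auto; dm.
- intros v Hv; apply in_sep in Hv; tauto.
- intros j v Hj Hv Hjv; apply in_sep; split; [exact Hv |].
  destruct (Ck empty g) with (j := j) (v := v) as (t & At & H); auto.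
  + apply in_single; reflexivity.
  + intros q Hq; rewrite (HE q Hq); apply ex_iff; intros t; split; intros [Ht H]; split; auto.
    * unfold F; rewrite in_sep, !opair_in_prod, in_AddSet, in_single; splits; auto; [apply Ht | exists t, q; auto].
    * apply in_sep in H as (_ & t' & q' & E' & H); apply opair_inj in E' as [-> E']; apply opair_inj in E' as [_ ->]; exact H.
  + eauto.
Qed.

End Approximation.

(** * Recognising the ground model *)

#[export] Hint Resolve f_guesses : dfn.

Section Characterization.
Context {V : universe}.
Implicit Types a b g h k s t u v w x y z T K U Z : V.

Definition copies (e t h : V) := forall a b, rng h (opair a b) <->
  exists a' b', opair a' b' ∈ t /\ opair a' a ∈ e /\ opair b' b ∈ e.

Definition pair_in U v := exists a b, a ∈ U /\ b ∈ U /\ v = opair a b.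

(** The first-order properties, in a model [M] between [W] and [W[c]], of a set [K]
    of functions whose ranges are the small subsets of [T * T] of [W]. *)
Record approximator (M : V -> Prop) (Z w r T K : V) : Prop := {
  approx_functions : forall h, h ∈ K -> pfun h /\ forall j v, opair j v ∈ h -> j ∈ Z /\ pair_in T v;
  approx_cover : forall g, M g -> pfun g -> (forall j v, opair j v ∈ g -> j ∈ Z /\ v ∈ T) ->
    exists h, h ∈ K /\ forall a b, rng g a -> rng g b -> rng h (opair a b);
  approx_inter : forall h h', h ∈ K -> h' ∈ K -> exists h'', h'' ∈ K /\ forall v, rng h'' v <-> rng h v /\ rng h' v;
  approx_copies : forall U e n, M U -> M e -> n ∈ w -> subset U T -> order_iso e n U ->
    (forall h, h ∈ K -> exists h', h' ∈ K /\ forall v, rng h' v <-> rng h v /\ pair_in U v) ->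
    (forall h, h ∈ K -> (forall v, rng h v -> pair_in U v) -> exists t, t ∈ r /\ copies e t h) /\
    (forall t, t ∈ r -> (forall a b, opair a b ∈ t -> a ∈ n /\ b ∈ n) -> exists h, h ∈ K /\ copies e t h)
}.

Definition exact (W : V -> Prop) Z T K :=
  (forall h, h ∈ K -> exists u, W u /\ small W Z u /\ subset u (prod T T) /\ forall v, rng h v <-> v ∈ u) /\
  (forall u, W u -> small W Z u -> subset u (prod T T) -> exists h, h ∈ K /\ forall v, rng h v <-> v ∈ u).

(** A union of [hartogs W Z] many small sets is covered by the product inside, so the order type of
    such a set of ordinals is below this bound. *)
Definition order_bound (W : V -> Prop) Z := hartogs W (prod (hartogs W Z) Z).
Definition small_relations (W : V -> Prop) Z w := sep (powD W (prod w w)) (small W Z).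

End Characterization.

(** * The intended set satisfies the characterising properties *)

Section ExactIsApproximator.
Context {V : universe} (W : V -> Prop) (S : V -> V).
Notation I := (seq_pred W S).
Context (Wtrans : transitive_class W) (HZ : models_ZFC W I).
Notation Dp := (Dp I W).
Notation Df := (Df I W).
Notation small := (small W).
Implicit Types s t u v x y z p q h k j K U Y Z T : V.
Let Add_W' x : Add x -> W x := @Add_W V W S Wtrans HZ x.
Hint Resolve Add_W' : guard.
Context (c : V) (Hc : cohen_real W c).
Context (M : V -> Prop) (Mtrans : transitive_class M) (WM : forall x, W x -> M x).
Context (MN : forall x, M x -> cohen_named W c x).
Context (Z : V) (HS : stock W Z) (HA : forall t, Add t -> t ∈ Z).
Let WZ : W Z := proj1 HS.
Notation w := (order_bound W Z).
Notation r := (small_relations W Z w).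

Lemma order_bound_W : W w.
Proof. unfold order_bound; dm. Qed.

Lemma order_bound_ord n : n ∈ w -> ord n.
Proof. intros Hn; apply (in_hartogs Wtrans HZ) in Hn; [tauto | dm]. Qed.

Lemma in_small_relations t : t ∈ r <-> W t /\ subset t (prod w w) /\ small Z t.
Proof. unfold small_relations; rewrite in_sep, in_powD; tauto. Qed.

Lemma small_relations_W : W r.
Proof.
pose proof order_bound_W; pose proof (@d_small V unit I W Wtrans HZ) as Ds.
assert (F2 I W tru2 (fun Z w => small_relations W Z w)) as F by (dgoal; unfold small_relations; dauto).
apply (F2_D F); auto; exact Logic.I.
Qed.

Section Level.
Context (T : V) (WT : W T) (OT : ord T).
Let OT' b : b ∈ T -> ord b := fun H => ord_mem OT H.

Lemma pair_in_prod U v : pair_in U v <-> v ∈ prod U U.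
Proof.
rewrite in_prod; split; intros (a & b & H1 & H2 & H3); exists a, b; auto.
Qed.

(** The substance is in the clause on copies: [U] and [e] are only given in [M], and have to be
    found in [W] before relations can be moved along [e] there. *)
Lemma exact_approximator K : exact W Z T K ->
  (forall h, h ∈ K -> pfun h /\ forall j v, opair j v ∈ h -> j ∈ Z /\ pair_in T v) -> approximator M Z w r T K.
Proof.
intros [E1 E2] HK; split; [exact HK | | |].
- intros g Mg Pg Hg; destruct (small_range Wtrans HZ Hc HS HA (MN Mg) WT Pg) as (s & Ws & Ss & Hs & Hgs).
  destruct (E2 (prod s s)) as (h & Hh & Eh).
  + dm.
  + apply (small_square Wtrans HZ HS Ws Ss).
  + intros q Hq; apply in_prod in Hq as (a & b & Ha & Hb & ->); apply opair_in_prod; auto.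
  + exists h; split; [exact Hh |]; intros a b (i & Ha) (j & Hb); apply Eh, opair_in_prod.
    destruct (Hg _ _ Ha) as [Hi HaT], (Hg _ _ Hb) as [Hj HbT]; split; [exact (Hgs i a Hi HaT Ha) | exact (Hgs j b Hj HbT Hb)].
- intros h h' Hh Hh'; destruct (E1 h Hh) as (u & Wu & Su & SuT & Eu); destruct (E1 h' Hh') as (u' & Wu' & Su' & SuT' & Eu').
  assert (forall v, v ∈ inter u u' <-> v ∈ u /\ v ∈ u') as Ei.
  { apply (setof_bounded (fun v => v ∈ u /\ v ∈ u') u); tauto. }
  assert (subset (inter u u') u) as Si by (intros v Hv; apply Ei in Hv; tauto).
  destruct (E2 (inter u u')) as (h'' & Hh'' & E''); [dm | exact (small_subset Su Si) | intros v Hv; auto |].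
  exists h''; split; [exact Hh'' |]; intros v; rewrite E'', Ei, Eu, Eu'; tauto.
- intros U e n MU Me Hn SU He HU.
  pose proof (order_bound_ord Hn) as On; assert (W n) as Wn by exact (Wtrans order_bound_W Hn).
  assert (W U) as WU.
  { apply (named_approximation Wtrans HZ Hc HA (MN MU) WT SU); intros h Wh Ph Sh.
    pose (diag := fun X => setof (fun p => exists v, v ∈ X /\ p = opair v v)).
    (* Pieces of [U] are read off the diagonal: the pairs [opair v v] with [v] in the range of [h]
       form a small relation, and its intersection with the square of [U] shows which of these [v]
       are in [U]. *)
    pose (d := fun h T => sep (prod T T) (fun p => exists v, p = opair v v /\ exists j, opair j v ∈ h)).
    assert (F2 I W tru2 d) as Fd by (dgoal; unfold d; dauto).
    pose (g := fun h T => sep (prod (tc h) (prod T T)) (fun p => exists j v, p = opair j (opair v v) /\ opair j v ∈ h)).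
    assert (F2 I W tru2 g) as Fg by (dgoal; unfold g; dauto).
    destruct (E2 (d h T)) as (h1 & Hh1 & Eh1).
    - exact (F2_D Fd Wh WT Logic.I).
    - apply (@small_intro V W Z (d h T) (g h T)); [exact (F2_D Fg Wh WT Logic.I) | |].
      + intros j v v' H H'; apply in_sep in H as (_ & i & x & E & H); apply in_sep in H' as (_ & i' & x' & E' & H').
        apply opair_inj in E as [-> ->]; apply opair_inj in E' as [-> ->]; rewrite (Ph _ _ _ H H'); reflexivity.
      + intros p Hp; apply in_sep in Hp as (Hp & v & -> & j & Hj); apply opair_in_prod in Hp as [Hv _].
        exists j; pose proof (Sh _ Hj) as Hj'; apply opair_in_prod in Hj' as [Hj' _]; split; [exact Hj' |].
        apply in_sep; rewrite !opair_in_prod, in_tc; splits; auto; [exact (below_fst Hj) | exists j, v; auto].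
    - intros p Hp; apply in_sep in Hp; tauto.
    - destruct (HU h1 Hh1) as (h2 & Hh2 & Eh2); destruct (E1 h2 Hh2) as (u & Wu & _ & _ & Eu).
      pose (s := fun u T => sep T (fun v => opair v v ∈ u)).
      assert (F2 I W tru2 s) as Fs by (dgoal; unfold s; dauto).
      exists (s u T); split; [exact (F2_D Fs Wu WT Logic.I) |]; intros v (j & Hj).
      assert (v ∈ T) as Hv by (apply Sh, opair_in_prod in Hj; tauto).
      unfold s; rewrite in_sep, <- Eu, Eh2, Eh1, pair_in_prod, opair_in_prod; unfold d; rewrite in_sep, opair_in_prod; split; [tauto |].
      intros HvU; splits; auto; exists v; split; [reflexivity | eauto]. }
  (* [W] has an order isomorphism of [U] with an ordinal, and there is only one. *)
  assert (W e) as We.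
  { destruct (@collapse_exists V unit I W Wtrans HZ U U WU) as (e' & n' & We' & _ & On' & _ & He').
    - intros b Hb; apply OT', SU, Hb.
    - apply (small_id Wtrans HZ WU), subset_refl.
    - replace e with e'; [exact We' |]; apply mem_ext; intros q.
      split; [apply (order_iso_sub He' He) | apply (order_iso_sub He He')]; apply ord_transitive; assumption. }
  assert (pfun e) as Pe by (apply (order_iso_pfun He); intros b Hb; apply OT', SU, Hb).
  assert (pfun (converse e)) as Pe' by (apply (order_iso_converse He), ord_transitive, On).
  split.
  + intros h Hh HhU; destruct (E1 h Hh) as (u & Wu & Su & SuT & Eu).
    exists (transport (converse e) n u); split.
    * apply in_small_relations; splits; [dm | | apply (small_transport Wtrans HZ); auto; dm].
      intros p Hp; pose proof Hp as Hp'; apply in_sep in Hp' as (_ & a & b & _ & _ & -> & _); apply in_transport in Hp as (Ha & Hb & _).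
      pose proof (ord_transitive (ord_hartogs Wtrans HZ (Z := prod (hartogs W Z) Z) ltac:(dm)) n Hn) as Sn; apply opair_in_prod; split; apply Sn; assumption.
    * intros a b; rewrite Eu; split.
      -- intros Hu; assert (pair_in U (opair a b)) as HU' by (apply HhU, Eu, Hu).
         apply pair_in_prod, opair_in_prod in HU' as [HaU HbU]; pose proof He as (_ & _ & He3 & _).
         destruct (He3 a HaU) as (a' & Ha'), (He3 b HbU) as (b' & Hb'); exists a', b'; splits; auto.
         apply in_transport; splits; [exact (proj1 (order_iso_mem He Ha')) | exact (proj1 (order_iso_mem He Hb')) |].
         exists a, b; rewrite !in_converse; auto.
      -- intros (a' & b' & H & Ha & Hb); apply in_transport in H as (_ & _ & a1 & b1 & H & Ha1 & Hb1).
         rewrite in_converse in Ha1, Hb1; rewrite (Pe _ _ _ Ha Ha1), (Pe _ _ _ Hb Hb1); exact H.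
  + intros t Ht Htn; apply in_small_relations in Ht as (Wt & _ & St).
    destruct (E2 (transport e T t)) as (h & Hh & Eh).
    * dm.
    * apply (small_transport Wtrans HZ); auto.
    * intros p Hp; apply in_sep in Hp; tauto.
    * exists h; split; [exact Hh |]; intros a b; rewrite Eh, in_transport; split; [tauto |].
      intros (a' & b' & H & Ha & Hb); splits; [apply SU, (order_iso_mem He Ha) | apply SU, (order_iso_mem He Hb) |].
      exists a', b'; auto.
Qed.

Definition all_functions := sep (powD W (prod Z (prod T T))) pfun.

Lemma all_functions_W : W all_functions.
Proof.
assert (F2 I W tru2 (fun Z T => sep (powD W (prod Z (prod T T))) pfun)) as F by (dgoal; dauto).
exact (F2_D F WZ WT Logic.I).
Qed.

Lemma all_functions_exact : exact W Z T all_functions /\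
  forall h, h ∈ all_functions -> pfun h /\ forall j v, opair j v ∈ h -> j ∈ Z /\ pair_in T v.
Proof.
assert (forall h, h ∈ all_functions <-> W h /\ subset h (prod Z (prod T T)) /\ pfun h) as E.
{ intros h; unfold all_functions; rewrite in_sep, in_powD; tauto. }
split; [split |].
- intros h Hh; apply E in Hh as (Wh & Sh & Ph).
  assert (F2 I W tru2 (fun h T => sep (prod T T) (fun v => exists j, opair j v ∈ h))) as F by (dgoal; dauto).
  exists (sep (prod T T) (fun v => exists j, opair j v ∈ h)); splits.
  + exact (F2_D F Wh WT Logic.I).
  + exists h; split; [exact Wh | split; [exact Ph |]]; intros v Hv; apply in_sep in Hv as (_ & j & Hj); exists j.
    split; [| exact Hj]; apply Sh, opair_in_prod in Hj; tauto.
  + intros v Hv; apply in_sep in Hv; tauto.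
  + intros v; rewrite in_sep; split; [| intros [_ H]; exact H]; intros (j & Hj); split; [| eauto].
    apply Sh, opair_in_prod in Hj; tauto.
- intros u Wu Su SuT; destruct (small_cover Wtrans HZ WZ Wu Su) as (f & Wf & Pf & Sf & Ef).
  exists f; split; [| exact Ef]; apply E; splits; auto.
  intros q Hq; pose proof (Sf q Hq) as H; apply in_prod in H as (j & v & Hj & Hv & ->); apply opair_in_prod; auto.
- intros h Hh; apply E in Hh as (Wh & Sh & Ph); split; [exact Ph |]; intros j v Hjv.
  apply Sh, opair_in_prod in Hjv; rewrite pair_in_prod; exact Hjv.
Qed.

End Level.
End ExactIsApproximator.

#[export] Hint Resolve d_below_c f_compl f_chain f_collapse f_guesses f_forced_mem : dfn.

(** * Every set with the characterising properties is exact *)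

Section ApproximatorIsExact.
Context {V : universe} (W : V -> Prop) (S : V -> V).
Notation I := (seq_pred W S).
Context (Wtrans : transitive_class W) (HZ : models_ZFC W I).
Notation Dp := (Dp I W).
Notation Df := (Df I W).
Notation small := (small W).
Implicit Types s t u v x y z p q h k j K U Y Z T : V.
Let Add_W' x : Add x -> W x := @Add_W V W S Wtrans HZ x.
Hint Resolve Add_W' : guard.
Context (c : V) (Hc : cohen_real W c).
Context (M : V -> Prop) (Mtrans : transitive_class M) (WM : forall x, W x -> M x).
Context (MN : forall x, M x -> cohen_named W c x).
Context (Z : V) (HS : stock W Z) (HA : forall t, Add t -> t ∈ Z).
Let WZ : W Z := proj1 HS.
Notation w := (order_bound W Z).
Notation r := (small_relations W Z w).
Let Ww : W w := order_bound_W Wtrans HZ HS.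

Context (T : V) (WT : W T) (OT : ord T).

(** The field of a relation: Kuratowski pairs are taken apart by two unions. *)
Definition field u := cup (cup u).

Lemma in_field u b : subset u (prod T T) -> (b ∈ field u <-> exists a a', opair a a' ∈ u /\ (b = a \/ b = a')).
Proof.
intros Su; unfold field; rewrite in_cup; split.
- intros (y & Hy & Hb); apply in_cup in Hy as (v & Hv & Hy); pose proof (Su v Hv) as H.
  apply in_prod in H as (a & a' & _ & _ & ->); exists a, a'; split; [exact Hv |].
  apply in_upair in Hy as [-> | ->]; apply in_upair in Hb; tauto.
- intros (a & a' & H & Hb); exists (upair a a'); split; [| apply in_upair, Hb].
  apply in_cup; exists (opair a a'); split; [exact H | apply in_upair; auto].
Qed.

Lemma field_subset u : subset u (prod T T) -> subset (field u) T.
Proof.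
intros Su b Hb; apply (in_field b Su) in Hb as (a & a' & H & Hb); apply Su, opair_in_prod in H as [Ha Ha'].
destruct Hb as [-> | ->]; assumption.
Qed.

Lemma small_field u : W u -> subset u (prod T T) -> small Z u -> small Z (field u).
Proof.
intros Wu Su Smu; unfold field; apply (stock_cup Wtrans HZ HS); [dm | |].
- apply (stock_cup Wtrans HZ HS Wu Smu); intros v Hv; pose proof (Su v Hv) as H.
  apply in_prod in H as (a & a' & Ha & Ha' & ->).
  assert (W a) by exact (Wtrans WT Ha); assert (W a') by exact (Wtrans WT Ha').
  unfold opair; apply (stock_upair Wtrans HZ HS); dm.
- intros y Hy; apply in_cup in Hy as (v & Hv & Hy); pose proof (Su v Hv) as H.
  apply in_prod in H as (a & a' & Ha & Ha' & ->).
  assert (W a) by exact (Wtrans WT Ha); assert (W a') by exact (Wtrans WT Ha').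
  apply in_upair in Hy as [-> | ->]; apply (stock_upair Wtrans HZ HS); assumption.
Qed.

Lemma f_field : F1 I W tru1 field.
Proof. dgoal; unfold field; dauto. Qed.
Hint Resolve f_field : dfn.

(** The pairs [(u, z)] such that [z] is a name, in [x], of a function whose range
    contains [u * u]. *)
Lemma covering_name F N Tn x : W F -> W Tn -> W x -> W N -> exists E, W E /\
  forall u z, subset u T -> W u -> z ∈ N -> (ctrue c E (opair u z) <->
    (exists p, opair p z ∈ x /\ ctrue c Tn p) /\
    forall a b, a ∈ u -> b ∈ u -> exists j, j ∈ Z /\ ctrue c F (opair z (opair j (opair a b)))).
Proof.
intros WF WTn Wx WN; pose (PT := prod T T); assert (W PT) as WPT by (unfold PT; dm).
assert (W (powD W T)) as WP by dm.
(* The statement is assembled from names of its parts. [E1] says that [v] is in the range of [z],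
   [E2] denies it, [E3] says that some pair from [u] is missed, [E4] that none is; the last set adds
   that [z] names an element of the set named by [x]. *)
pose (A1 := fun F N PT Z => sep (prod AddSet (prod N PT)) (fun p => exists t z v j, p = opair t (opair z v) /\ j ∈ Z /\
  opair t (opair z (opair j v)) ∈ F)).
assert (F4 I W tru4 A1) as FA1 by (dgoal; unfold A1; dauto).
set (E1 := A1 F N PT Z); assert (W E1) as WE1 by (apply (F4_D FA1); auto; exact Logic.I).
assert (forall z v, z ∈ N -> v ∈ PT -> (ctrue c E1 (opair z v) <-> exists j, j ∈ Z /\ ctrue c F (opair z (opair j v)))) as C1.
{ intros z v Hz Hv; split.
  - intros (t & Ht & H); apply in_sep in H as (_ & t' & z' & v' & j & E & Hj & H).
    apply opair_inj in E as [-> E]; apply opair_inj in E as [-> ->]; exists j; split; [exact Hj | exists t'; auto].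
  - intros (j & Hj & t & Ht & H); exists t; split; [exact Ht |]; unfold E1, A1.
    rewrite in_sep, !opair_in_prod, in_AddSet; splits; auto; [apply Ht | exists t, z, v, j; auto]. }
assert (W (prod N PT)) as WNP by dm.
set (E2 := compl E1 (prod N PT)); assert (W E2) as WE2 by (unfold E2; dm).
assert (forall z v, z ∈ N -> v ∈ PT -> (ctrue c E2 (opair z v) <-> ~ exists j, j ∈ Z /\ ctrue c F (opair z (opair j v)))) as C2.
{ intros z v Hz Hv; unfold E2; rewrite (compl_true Wtrans HZ Hc WE1 WNP), C1; [tauto | auto | auto |]; apply opair_in_prod; auto. }
pose (A3 := fun E N P => sep (prod AddSet (prod P N)) (fun p => exists t u z a b, p = opair t (opair u z) /\ a ∈ u /\ b ∈ u /\
  opair t (opair z (opair a b)) ∈ E)).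
assert (F3 I W tru3 A3) as FA3 by (dgoal; unfold A3; dauto).
set (E3 := A3 E2 N (powD W T)); assert (W E3) as WE3 by (apply (F3_D FA3); auto; exact Logic.I).
assert (forall u z, u ∈ powD W T -> z ∈ N -> (ctrue c E3 (opair u z) <-> exists a b, a ∈ u /\ b ∈ u /\
  ~ exists j, j ∈ Z /\ ctrue c F (opair z (opair j (opair a b))))) as C3.
{ intros u z Hu Hz; pose proof (proj1 (in_powD _ _ _) Hu) as [_ Su]; split.
  - intros (t & Ht & H); apply in_sep in H as (_ & t' & u' & z' & a & b & E & Ha & Hb & H).
    apply opair_inj in E as [-> E]; apply opair_inj in E as [-> ->]; exists a, b; splits; auto.
    apply C2; [exact Hz | unfold PT; rewrite opair_in_prod; auto | exists t'; auto].
  - intros (a & b & Ha & Hb & H); apply C2 in H as (t & Ht & H); [| exact Hz | unfold PT; rewrite opair_in_prod; auto].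
    exists t; split; [exact Ht |]; unfold E3, A3; rewrite in_sep, !opair_in_prod, in_AddSet; splits; auto; [apply Ht |].
    exists t, u, z, a, b; auto. }
assert (W (prod (powD W T) N)) as WPN by dm.
set (E4 := compl E3 (prod (powD W T) N)); assert (W E4) as WE4 by (unfold E4; dm).
pose (A5 := fun E Tn x P N => sep (prod AddSet (prod P N)) (fun q => exists t u z, q = opair t (opair u z) /\
  below_c E t (opair u z) /\ exists p, opair p z ∈ x /\ below_c Tn t p)).
assert (F5 I W tru5 A5) as FA5 by (dgoal; unfold A5; dauto).
exists (A5 E4 Tn x (powD W T) N); split; [apply (F5_D FA5); auto; exact Logic.I |].
intros u z Su Wu Hz; assert (u ∈ powD W T) as Hu by (apply in_powD; auto).
assert (ctrue c E4 (opair u z) <-> forall a b, a ∈ u -> b ∈ u -> exists j, j ∈ Z /\ ctrue c F (opair z (opair j (opair a b)))) as C4.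
{ unfold E4; rewrite (compl_true Wtrans HZ Hc WE3 WPN) by (apply opair_in_prod; auto); rewrite (C3 u z Hu Hz); split.
  - intros N' a b Ha Hb; apply NNPP; intros N''; apply N'; exists a, b; auto.
  - intros H (a & b & Ha & Hb & N'); apply N', H; assumption. }
rewrite <- C4; split.
- intros (t & Ht & H); apply in_sep in H as (_ & t' & u' & z' & E & H1 & p & H2 & H3).
  apply opair_inj in E as [-> E]; apply opair_inj in E as [-> ->]; split; [| exact (below_c_true (proj2 Ht) H1)].
  exists p; split; [exact H2 | exact (below_c_true (proj2 Ht) H3)].
- intros ((p & Hp & t1 & Ht1 & H1) & t2 & Ht2 & H2); exists (join t1 t2); split; [exact (Addc_join Hc Ht1 Ht2) |].
  unfold A5; rewrite in_sep, !opair_in_prod, in_AddSet; splits; auto; [apply (Addc_join Hc Ht1 Ht2) |].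
  exists (join t1 t2), u, z; splits; auto.
  + exists t2; splits; auto; apply Ht2.
  + exists p; split; [exact Hp |]; exists t1; splits; auto; apply Ht1.
Qed.

Context (K : V) (MK : M K) (HK : approximator M Z w r T K).

(** Every small [u0] is included in a set [U] of [W] which, for the sets covered by
    [K], is indistinguishable from the union of a long chain of such sets. *)
Lemma closed_set_exists u0 : W u0 -> subset u0 T -> small Z u0 ->
  (exists U, W U /\ subset U T /\ subset u0 U /\ small (prod (hartogs W Z) Z) U /\
    forall h, h ∈ K -> exists h', h' ∈ K /\ forall v, rng h' v <-> rng h v /\ pair_in U v) /\
  forall h, h ∈ K -> exists u, W u /\ small Z u /\ subset u (prod T T) /\ forall v, rng h v -> v ∈ u.
Proof.
intros Wu0 Su0 Smu0.
destruct (MN MK) as (Tn & x & G & WTn & Wx & HG & EK).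
pose (PT := prod T T); assert (W PT) as WPT by (unfold PT; dm).
pose (N := tc x); assert (W N) as WN by (unfold N; dm).
pose (Y' := tc (prod Z PT)); assert (W Y') as WY' by (unfold Y'; dm).
set (F := forced_mem Tn Y' x); assert (W F) as WF by (unfold F; dm).
assert (forall z q, z ∈ N -> q ∈ prod Z PT -> (q ∈ interp G z <-> ctrue c F (opair z q))) as HF.
{ intros z q Hz Hq; apply (forced_mem_true Wtrans HZ Hc WTn HG); auto.
  - apply tc_transitive.
  - right; apply in_tc, Hz.
  - apply in_tc, below_mem, Hq. }
assert (forall p z, opair p z ∈ x -> z ∈ N) as HN by (intros p z Hz; apply in_tc, (below_snd Hz)).
assert (forall h, h ∈ K <-> exists p z, opair p z ∈ x /\ G p /\ h = interp G z) as EK'.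
{ intros h; rewrite EK; apply in_interp. }
(* [k1] guesses the ranges of all elements of [K] at once, so that each range lies in a small set of
   [W] attached to the name of the element. *)
destruct (cover_family Wtrans HZ c HS WF WN WPT) as (k1 & Wk1 & Pk1 & Sk1 & Hk1).
assert (forall h p z, opair p z ∈ x -> G p -> h = interp G z -> forall v, rng h v -> v ∈ guesses k1 PT z) as Hguess.
{ intros h p z Hz Gp -> v (j & Hj).
  assert (interp G z ∈ K) as HzK by (apply EK'; eauto).
  destruct (approx_functions HK HzK) as [Ph Hh]; destruct (Hh _ _ Hj) as [HjZ Hv]; apply pair_in_prod in Hv; fold PT in Hv.
  destruct (Hk1 z (interp G z) (HN _ _ Hz) Ph) with (j := j) (v := v) as (t & At & Ht); auto.
  { intros q Hq; exact (HF z q (HN _ _ Hz) Hq). }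
  unfold guesses; rewrite in_sep; eauto. }
assert (forall z, z ∈ N -> W (guesses k1 PT z) /\ small Z (guesses k1 PT z) /\ subset (guesses k1 PT z) PT) as Kg.
{ intros z Hz; assert (W z) as Wz by exact (Wtrans WN Hz); splits; [dm | |].
  - exact (small_guesses Wtrans HZ HS HA Wk1 WPT Wz Pk1 Sk1).
  - intros v Hv; apply in_sep in Hv; tauto. }
split; [| intros h Hh; apply EK' in Hh as (p & z & Hz & Gp & Eh); exists (guesses k1 PT z);
  destruct (Kg z (HN _ _ Hz)) as (H1 & H2 & H3); splits; auto; exact (Hguess h p z Hz Gp Eh)].
destruct (covering_name WF WTn Wx WN) as (E5 & WE5 & HE5).
(* Uniformizing [R] selects, for a condition and a set [u], one name that the condition places in
   [K] with a range covering the square of [u]. *)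
pose (R := fun E P N => sep (prod (prod AddSet P) N) (fun q => exists t u z, q = opair (opair t u) z /\ opair t (opair u z) ∈ E)).
assert (F3 I W tru3 R) as FR by (dgoal; unfold R; dauto).
assert (W (powD W T)) as WP by dm.
assert (forall t u z, opair (opair t u) z ∈ R E5 (powD W T) N <-> Add t /\ u ∈ powD W T /\ z ∈ N /\ opair t (opair u z) ∈ E5) as ER.
{ intros t u z; unfold R; rewrite in_sep, !opair_in_prod, in_AddSet; split.
  - intros (H & t' & u' & z' & E & H'); apply opair_inj in E as [E ->]; apply opair_inj in E as [-> ->]; tauto.
  - intros (H1 & H2 & H3 & H4); splits; auto; exists t, u, z; auto. }
destruct (@uniformize V unit I W Wtrans HZ (R E5 (powD W T) N)) as (k5 & Wk5 & Pk5 & Sk5 & Tk5); [apply (F3_D FR); auto; exact Logic.I |].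
pose (Zs := fun k u => sep (tc k) (fun z => exists t, opair (opair t u) z ∈ k)).
assert (F2 I W tru2 Zs) as FZs by (dgoal; unfold Zs; dauto).
assert (forall u z, z ∈ Zs k5 u <-> exists t, opair (opair t u) z ∈ k5) as EZs.
{ intros u z; unfold Zs; rewrite in_sep, in_tc; split; [tauto |]; intros (t & Ht); split; [exact (below_snd Ht) | eauto]. }
pose (Vs := fun k k1 PT u => cup (img (guesses k1 PT) (Zs k u))).
assert (F4 I W tru4 (fun k k1 PT u => img (guesses k1 PT) (Zs k u))) as FI by (dgoal; dauto).
assert (F4 I W tru4 (fun k k1 PT u => img (fun z => opair z (guesses k1 PT z)) (Zs k u))) as FI' by (dgoal; dauto).
assert (F4 I W tru4 Vs) as FVs.
{ dgoal; unfold Vs; dstep.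
  dauto. }
assert (F4 I W tru4 (fun k k1 PT P => img (fun u => opair u (field (Vs k k1 PT u))) P)) as FPhi by (dgoal; dauto).
(* [Phi] sends [u] to the field of all guesses for the names selected for [u], of which there is at
   most one for each condition, so the value is small. It contains the field of an element of [K]
   whose range covers the square of [u], provided the condition that selected its name is a part of
   [c]. *)
set (Phi := img (fun u => opair u (field (Vs k5 k1 PT u))) (powD W T)).
assert (W Phi) as WPhi by (exact (F4_D FPhi Wk5 Wk1 WPT WP Logic.I)).
assert (forall u, W u -> subset u T -> app1 Phi u = field (Vs k5 k1 PT u)) as EPhi.
{ intros u Wu Su; assert (forall y, opair u y ∈ Phi <-> y = field (Vs k5 k1 PT u)) as E.
  { intros y; unfold Phi; rewrite in_img; split.
    - intros (u' & _ & E); apply opair_inj in E as [-> ->]; reflexivity.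
    - intros ->; exists u; split; [apply in_powD; auto | reflexivity]. }
  apply app1_eq; [exists (field (Vs k5 k1 PT u)); split; [apply E; reflexivity | intros y Hy; symmetry; apply E, Hy] | apply E; reflexivity]. }
assert (forall u z, z ∈ Zs k5 u -> z ∈ N) as ZN.
{ intros u z Hz; apply EZs in Hz as (t & Ht); apply Sk5, ER in Ht; tauto. }
assert (forall u, W u -> subset u T -> small Z (Vs k5 k1 PT u) /\ W (Vs k5 k1 PT u) /\ subset (Vs k5 k1 PT u) PT) as KV.
{ intros u Wu Su; splits.
  - unfold Vs; apply (stock_cup Wtrans HZ HS); [exact (F4_D FI Wk5 Wk1 WPT Wu Logic.I) | |].
    + apply (small_img Wtrans HZ); [exact (F4_D FI' Wk5 Wk1 WPT Wu Logic.I) |].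
      pose (f := fun k u => sep (prod AddSet (tc k)) (fun q => exists t z, q = opair t z /\ opair (opair t u) z ∈ k)).
      assert (F2 I W tru2 f) as Ff by (dgoal; unfold f; dauto).
      apply (@small_intro V W Z (Zs k5 u) (f k5 u)); [exact (F2_D Ff Wk5 Wu Logic.I) | |].
      * intros q z z' H H'; apply in_sep in H as (_ & t & z1 & E & H); apply in_sep in H' as (_ & t' & z1' & E' & H').
        apply opair_inj in E as [-> ->]; apply opair_inj in E' as [-> ->]; exact (Pk5 _ _ _ H H').
      * intros z Hz; apply EZs in Hz as (t & Ht); pose proof (Sk5 _ Ht) as H; apply ER in H as (At & _).
        exists t; split; [apply HA, At |]; apply in_sep; rewrite opair_in_prod, in_tc, in_AddSet; splits; auto; [exact (below_snd Ht) | eauto].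
    + intros y Hy; apply in_img in Hy as (z & Hz & ->); apply Kg, (ZN u z Hz).
  - exact (F4_D FVs Wk5 Wk1 WPT Wu Logic.I).
  - intros v Hv; apply in_cup in Hv as (y & Hy & Hv); apply in_img in Hy as (z & Hz & ->); apply in_sep in Hv; tauto. }
destruct (@chain_exists V unit I W Wtrans HZ Z T Phi u0) as (U & WU & SU & Su0U & SmU & HU); auto.
{ intros u Wu Su _; rewrite (EPhi u Wu Su); destruct (KV u Wu Su) as (K1 & K2 & K3).
  split; [apply small_field | apply field_subset]; assumption. }
exists U; splits; auto.
intros h Hh; pose proof Hh as Hh'; apply EK' in Hh' as (p & z & Hz & Gp & Eh).
destruct (Kg z (HN _ _ Hz)) as (Wg & Sg & SgT).
assert (forall b, b ∈ inter U (field (guesses k1 PT z)) <-> b ∈ U /\ b ∈ field (guesses k1 PT z)) as Ei.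
{ apply (setof_bounded (fun b => b ∈ U /\ b ∈ field (guesses k1 PT z)) U); tauto. }
(* The part of [U] relevant to [h] is small, so it lies in some [u] whose image under [Phi] is
   included in [U]. The element of [K] selected for [u] covers the square of [u] and stays in the
   square of [U]; intersecting [h] with it has therefore the same effect as intersecting with the
   square of [U]. *)
destruct (HU (inter U (field (guesses k1 PT z)))) as (u & Wu & Smu & Su & Hsu & HuU & HPhiU).
- dm.
- intros b Hb; apply Ei in Hb; tauto.
- apply small_subset with (field (guesses k1 PT z)); [apply small_field; assumption | intros b Hb; apply Ei in Hb; tauto].
- destruct (small_cover Wtrans HZ WZ Wu Smu) as (g & Wg' & Pg & Sg' & Eg).
  destruct (approx_cover HK (WM Wg') Pg) as (h0 & Hh0 & Eh0).
  { intros j v Hjv; pose proof (Sg' _ Hjv) as H; apply opair_in_prod in H as [H1 H2]; auto. }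
  apply EK' in Hh0 as (p0 & z0 & Hz0 & Gp0 & ->).
  assert (interp G z0 ∈ K) as Hz0K by (apply EK'; eauto).
  assert (ctrue c E5 (opair u z0)) as (t & Ht & HtE).
  { apply (HE5 u z0 Su Wu (HN _ _ Hz0)); split; [exists p0; split; [exact Hz0 | apply HG, Gp0] |].
    intros a b Ha Hb; destruct (Eh0 a b) as (j & Hj); [apply Eg, Ha | apply Eg, Hb |].
    destruct (approx_functions HK Hz0K) as [_ Hf]; destruct (Hf _ _ Hj) as [HjZ Hv]; apply pair_in_prod in Hv.
    exists j; split; [exact HjZ |]; apply (HF _ _ (HN _ _ Hz0)); [apply opair_in_prod; auto | exact Hj]. }
  assert (u ∈ powD W T) as HuP by (apply in_powD; auto).
  destruct (Tk5 (opair t u) z0) as (z1 & Hz1); [apply ER; splits; auto; [apply Ht | exact (HN _ _ Hz0)] |].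
  pose proof (Sk5 _ Hz1) as H; apply ER in H as (_ & _ & HzN & HtE1).
  destruct (proj1 (HE5 u z1 Su Wu HzN)) as ((p1 & Hp1 & Gp1) & Hcov); [exists t; auto |].
  apply HG in Gp1.
  assert (interp G z1 ∈ K) as Hz1K by (apply EK'; eauto).
  assert (forall v, rng (interp G z1) v -> pair_in U v) as Hin.
  { intros v Hv; pose proof (Hguess _ _ _ Hp1 Gp1 eq_refl v Hv) as Hv'.
    assert (v ∈ Vs k5 k1 PT u) as HvV.
    { unfold Vs; apply in_cup; exists (guesses k1 PT z1); split; [| exact Hv']; apply in_img; exists z1.
      split; [apply EZs; eauto | reflexivity]. }
    destruct (KV u Wu Su) as (_ & _ & K3); pose proof (K3 v HvV) as HvT; apply in_prod in HvT as (a & b & _ & _ & ->).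
    apply pair_in_prod, opair_in_prod; split; apply HPhiU; rewrite (EPhi u Wu Su); apply (in_field _ K3); exists a, b; auto. }
  destruct (approx_inter HK Hh Hz1K) as (h2 & Hh2 & Eh2); exists h2; split; [exact Hh2 |].
  intros v; rewrite Eh2; split; [intros [H1 H2]; auto |]; intros [H1 H2]; split; [exact H1 |].
  destruct H2 as (a & b & Ha & Hb & ->); pose proof (Hguess h p z Hz Gp Eh _ H1) as Hv.
  destruct (Hcov a b) as (j & Hj & HjF).
  + apply Hsu, Ei; split; [exact Ha |]; apply (in_field _ SgT); exists a, b; auto.
  + apply Hsu, Ei; split; [exact Hb |]; apply (in_field _ SgT); exists a, b; auto.
  + exists j; apply (HF _ _ HzN); [| exact HjF].
    rewrite !opair_in_prod; unfold PT; rewrite opair_in_prod; auto.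
Qed.

(** The field of any small relation lies in a set [U] to which the clause on copies applies. An
    element of [K] living on [U] is then the transport of a relation in [r], hence has its range in
    [W]; conversely a small relation of [W] pulled back to [n] is in [r], so it is copied into
    [K]. *)
Lemma approximator_exact : exact W Z T K.
Proof.
assert (forall u0, W u0 -> subset u0 T -> small Z u0 -> exists U e n, W U /\ subset U T /\ subset u0 U /\ W e /\ n ∈ w /\ order_iso e n U /\
  pfun e /\ pfun (converse e) /\ 
  forall h, h ∈ K -> exists h', h' ∈ K /\ forall v, rng h' v <-> rng h v /\ pair_in U v) as HU.
{ intros u0 Wu0 Su0 Smu0; destruct (closed_set_exists Wu0 Su0 Smu0) as [(U & WU & SU & Su0U & SmU & H) _].
  assert (forall b, b ∈ U -> ord b) as OU by (intros b Hb; exact (ord_mem OT (SU b Hb))).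
  destruct (@collapse_exists V unit I W Wtrans HZ (prod (hartogs W Z) Z) U WU OU SmU) as (e & n & We & Wn & On & Smn & He).
  exists U, e, n; splits; auto.
  - unfold order_bound; apply (in_hartogs Wtrans HZ); [dm | auto].
  - exact (order_iso_pfun He OU).
  - exact (order_iso_converse He (ord_transitive On)). }
split.
- intros h Hh.
  assert (exists u, W u /\ small Z u /\ subset u (prod T T) /\ forall v, rng h v -> v ∈ u) as (u & Wu & Smu & Su & Hu).
  (* The bound on the ranges, the second half of [closed_set_exists], does not involve [u0]; the
     empty set serves. *)
  { assert (forall X : V, subset empty X) as S0 by (intros X v Hv; apply in_empty in Hv; destruct Hv).
    assert (W empty) as We by dm.
    exact (proj2 (closed_set_exists We (S0 T) (small_id Wtrans HZ We (S0 Z))) h Hh). }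
  destruct (HU (field u)) as (U & e & n & WU & SU & SuU & We & Hn & He & Pe & Pe' & Hclosed); [dm | apply field_subset, Su | apply small_field; assumption |].
  destruct (approx_copies HK (WM WU) (WM We) Hn SU He Hclosed) as [Hcopy _].
  destruct (Hcopy h Hh) as (t & Ht & Ct).
  { intros v Hv; pose proof (Su v (Hu v Hv)) as H; apply in_prod in H as (a & b & _ & _ & ->).
    exists a, b; splits; auto; apply SuU, (in_field _ Su); exists a, b; split; auto. }
  apply in_small_relations in Ht as (Wt & _ & Smt).
  exists (transport e T t); splits.
  + dm.
  + apply (small_transport Wtrans HZ); auto.
  + intros v Hv; apply in_sep in Hv; tauto.
  + intros v; split.
    * intros Hv; pose proof (Su v (Hu v Hv)) as H; apply in_prod in H as (a & b & Ha & Hb & ->).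
      apply in_transport; splits; auto; apply Ct, Hv.
    * intros Hv; pose proof Hv as H; apply in_sep in H as (H & _); apply in_prod in H as (a & b & _ & _ & ->).
      apply Ct; apply in_transport in Hv; tauto.
- intros u Wu Smu Su.
  destruct (HU (field u)) as (U & e & n & WU & SU & SuU & We & Hn & He & Pe & Pe' & Hclosed); [dm | apply field_subset, Su | apply small_field; assumption |].
  destruct (approx_copies HK (WM WU) (WM We) Hn SU He Hclosed) as [_ Hcopy].
  assert (W n) as Wn by exact (Wtrans Ww Hn).
  destruct (Hcopy (transport (converse e) n u)) as (h & Hh & Ch).
  + apply in_small_relations; splits; [dm | | apply (small_transport Wtrans HZ); auto; dm].
    intros p Hp; apply in_sep in Hp as (Hp & _); apply in_prod in Hp as (a & b & Ha & Hb & ->).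
    pose proof (ord_transitive (ord_hartogs Wtrans HZ (Z := prod (hartogs W Z) Z) ltac:(dm)) n Hn) as Sn; apply opair_in_prod; split; apply Sn; assumption.
  + intros a b H; apply in_transport in H; tauto.
  + assert (forall a b, rng h (opair a b) <-> opair a b ∈ u) as E.
    { intros a b; rewrite (Ch a b); split.
      - intros (a' & b' & H & Ha & Hb); apply in_transport in H as (_ & _ & a1 & b1 & H & Ha1 & Hb1).
        rewrite in_converse in Ha1, Hb1; rewrite (Pe _ _ _ Ha Ha1), (Pe _ _ _ Hb Hb1); exact H.
      - intros H; pose proof He as (_ & _ & He3 & _).
        assert (a ∈ U) as HaU by (apply SuU, (in_field _ Su); exists a, b; auto).
        assert (b ∈ U) as HbU by (apply SuU, (in_field _ Su); exists a, b; auto).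
        destruct (He3 a HaU) as (a' & Ha'), (He3 b HbU) as (b' & Hb'); exists a', b'; splits; auto.
        apply in_transport; splits; [exact (proj1 (order_iso_mem He Ha')) | exact (proj1 (order_iso_mem He Hb')) |].
        exists a, b; rewrite !in_converse; auto. }
    exists h; split; [exact Hh |]; intros v; split.
    * intros Hv; pose proof Hv as (j & Hj); destruct (approx_functions HK Hh) as [_ Hf]; destruct (Hf _ _ Hj) as [_ (a & b & _ & _ & ->)].
      apply E, Hv.
    * intros Hv; pose proof (Su v Hv) as H; apply in_prod in H as (a & b & _ & _ & ->); apply E, Hv.
Qed.

End ApproximatorIsExact.

(** * The Bristol model *)

Section Model.
Context {V : universe} (W : V -> Prop) (S : V -> V).
Notation I := (seq_pred W S).
Context (Wtrans : transitive_class W) (HZ : models_ZFC W I).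
Context (HS : forall a, W a -> ord a ->
    (is_limit a -> permutable_scale W (aleph W a) (S a)) /\
    (~ is_limit a -> permutable_family W (aleph W a) (S a))).
Context (c : V).
Implicit Types a b p q x y z v : V.
Notation M := (bristol_model W S c).

Lemma IS_W st a x : IS W S st a x -> W x.
Proof. intros [y Wy _ _]; exact Wy. Qed.

Lemma bristol_transitive : transitive_class M.
Proof.
intros v u (a & Wa & Oa & x & Hx & ->) Hu; apply in_interp in Hu as (p & y & Hy & _ & ->).
exists a; splits; auto; exists y; split; [| reflexivity].
destruct Hx as [x _ Hx _]; destruct (Hx _ Hy) as (p' & y' & E & _ & H); apply opair_inj in E as [-> ->]; exact H.
Qed.

(** [forced_filter] is a set of [W] that names the filter on [P_a], so a name in the iteration is
    evaluated as a Cohen name. *)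
Lemma bristol_cohen_named v : M v -> cohen_named W c v.
Proof.
intros (a & Wa & Oa & x & Hx & ->).
assert (W (suc a)) as Wsa by dm.
pose proof (ord_suc Oa) as Osa.
pose proof (f_forced_filter Wtrans HZ HS) as Ff.
exists (forced_filter W S (stage_seq W S (suc a)) a), x, (generic_filter W S c a); splits.
- apply (F2_D Ff); auto; dm.
- exact (IS_W Hx).
- intros p; rewrite (generic_filter_forced Wtrans HZ HS c p Wa Oa); unfold ctrue, Addc.
  apply ex_iff; intros t; tauto.
- reflexivity.
Qed.

Lemma cond_empty st p : cond (iter W st empty) p -> p = empty.
Proof.
intros (_ & _ & H & _); apply mem_ext; intros z; rewrite in_empty; split; [| tauto].
intros Hz; destruct (H z Hz) as (b & u & _ & Hb); apply in_empty in Hb; exact Hb.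
Qed.

Lemma empty_cond st : cond (iter W st empty) empty.
Proof.
unfold iter, cond, iter_cond; splits; try (intros; exfalso; eapply in_empty; eassumption).
- dm.
- exists []; intros y; rewrite in_empty; simpl; tauto.
Qed.

Lemma le_empty st p : le (iter W st empty) p empty.
Proof. intros b v Hb; apply in_empty in Hb; destruct Hb. Qed.

Lemma forces_eq_empty st p x : forces_eq (iter W st empty) p x x.
Proof.
revert p; induction x as [x IH] using below_ind; intros p; constructor; intros s z q Hz Hq _ Hs;
  apply cond_empty in Hq as ->; exists empty, s, z; splits; auto using empty_cond, le_empty; apply IH, (below_snd Hz).
Qed.

(** [W] appears at stage 0 already: [P_0] has only the empty condition, and no coordinate is left
    for an automorphism, so check names are respected and have the expected values. *)
Lemma W_bristol x : W x -> M x.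
Proof.
intros Wx; exists empty.
splits; [dm | apply ord_of_subset; intros u Hu; apply in_empty in Hu; destruct Hu |].
exists (check x); split.
- induction x as [x IH] using below_ind; constructor.
  + dm.
  + intros z Hz; apply in_check in Hz as (y & Hy & ->); exists empty, (check y); splits; [reflexivity | |].
    * apply empty_cond.
    * apply IH; [exact (below_mem Hy) | exact (Wtrans Wx Hy)].
  + exists (fun _ => empty); split; [split; [| exists []]; intros b Hb; apply in_empty in Hb; destruct Hb |].
    intros p pi _ [_ Hpi] _; destruct pi as [|[b t] pi].
    * apply forces_eq_empty.
    * destruct (Hpi b t (or_introl eq_refl)) as [Hb _]; apply in_empty in Hb; destruct Hb.
- clear Wx; induction x as [x IH] using below_ind; apply mem_ext; intros v; rewrite in_interp; split.
  + intros Hv; exists empty, (check v); splits.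
    * apply in_check; eauto.
    * unfold generic_filter; rewrite stages_eq; split; [apply empty_cond |].
      exists empty; splits; [apply empty_cond | apply le_empty |].
      intros b u Hb; apply in_empty in Hb; destruct Hb.
    * exact (IH v (below_mem Hv)).
  + intros (p & y & Hy & _ & ->); apply in_check in Hy as (y' & Hy' & E); apply opair_inj in E as [_ ->].
    rewrite <- (IH y' (below_mem Hy')); exact Hy'.
Qed.

End Model.

(** * The defining formula *)

(** [x] is coded by a relation [E] on an ordinal all of whose small pieces belong
    to the ground model. *)
Definition ground {V : universe} (M : V -> Prop) (Z w r x : V) := exists T K E f, M T /\ M K /\ M E /\ M f /\
  ord T /\ approximator M Z w r T K /\ (forall p, p ∈ E -> pair_in T p) /\
  (forall h, h ∈ K -> exists h', h' ∈ K /\ forall v, rng h' v <-> rng h v /\ v ∈ E) /\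
  (forall y b, opair y b ∈ f -> b ∈ T) /\ codes E f x.

(** * Correctness of the definition of the ground model *)

Section Ground.
Context {V : universe} (W : V -> Prop) (S : V -> V).
Notation I := (seq_pred W S).
Context (Wtrans : transitive_class W) (HZ : models_ZFC W I).
Context (c : V) (Hc : cohen_real W c).
Context (M : V -> Prop) (Mtrans : transitive_class M) (WM : forall x : V, W x -> M x).
Context (MN : forall x : V, M x -> cohen_named W c x).
Context (Z : V) (HS : stock W Z) (HA : forall t : V, Add t -> t ∈ Z).
Let WZ : W Z := proj1 HS.
Notation w := (order_bound W Z).
Notation r := (small_relations W Z w).

(** The rank of a name bounds the ordinal that it names, and this rank is computed in [W]. *)
Lemma ord_M a : M a -> ord a -> W a.
Proof.
intros Ma Oa; destruct (MN Ma) as (T & x & G & _ & Wx & _ & ->).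
pose proof (f_name_rank Wtrans HZ) as Fr; pose proof (F1_D Fr Wx Logic.I) as Wr.
destruct (proj1 (ord_subset Oa (ord_name_rank x)) (interp_rank Oa)) as [-> | H]; [exact Wr | exact (Wtrans Wr H)].
Qed.

(** For a set of [W] the code and the set [all_functions] serve as witnesses. Conversely [T] is in
    [W] as an ordinal and [K] is exact, so the demand on [E] becomes the hypothesis of the
    approximation property; then [E] is in [W], and [x] is decoded from it there. *)
Lemma ground_iff x : W x <-> M x /\ ground M Z w r x.
Proof.
split.
- intros Wx; split; [auto |]; destruct (codes_exists Wtrans HZ Wx) as (T & E & f & WT & WE & Wf & OT & SE & Hf & Hcode).
  destruct (all_functions_exact Wtrans HZ HS WT) as [HX HF].
  exists T, (all_functions W Z T), E, f; splits; auto.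
  + apply WM, (all_functions_W Wtrans HZ HS WT).
  + exact (exact_approximator Wtrans HZ Hc MN HS HA WT OT HX HF).
  + intros p Hp; apply pair_in_prod, SE, Hp.
  + intros h Hh; destruct HX as [HX1 HX2]; destruct (HX1 h Hh) as (u & Wu & Su & SuT & Eu).
    assert (forall v, v ∈ inter u E <-> v ∈ u /\ v ∈ E) as Ei.
    { apply (setof_bounded (fun v => v ∈ u /\ v ∈ E) u); tauto. }
    assert (subset (inter u E) u) as Si by (intros v Hv; apply Ei in Hv; tauto).
    destruct (HX2 (inter u E)) as (h' & Hh' & Eh'); [dm | exact (small_subset Su Si) | intros v Hv; auto |].
    exists h'; split; [exact Hh' |]; intros v; rewrite Eh', Ei, Eu; tauto.
- intros (_ & T & K & E & f & MT & MK & ME & Mf & OT & HK & HE & HEK & Hf & Hcode).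
  assert (W T) as WT by exact (ord_M MT OT).
  destruct (approximator_exact Wtrans HZ Hc WM MN HS HA WT OT MK HK) as [HX1 HX2].
  assert (W (prod T T)) as WTT by dm.
  assert (subset E (prod T T)) as SE by (intros p Hp; apply pair_in_prod, HE, Hp).
  assert (W E) as WE.
  { apply (named_approximation Wtrans HZ Hc HA (MN ME) WTT SE); intros h Wh Ph Sh.
    assert (F2 I W tru2 (fun h X => sep X (fun v => exists j, opair j v ∈ h))) as F by (dgoal; dauto).
    destruct (HX2 (sep (prod T T) (fun v => exists j, opair j v ∈ h))) as (h1 & Hh1 & Eh1).
    - exact (F2_D F Wh WTT Logic.I).
    - exists h; split; [exact Wh | split; [exact Ph |]]; intros v Hv; apply in_sep in Hv as (_ & j & Hj); exists j.
      split; [| exact Hj]; apply Sh, opair_in_prod in Hj; tauto.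
    - intros v Hv; apply in_sep in Hv; tauto.
    - destruct (HEK h1 Hh1) as (h2 & Hh2 & Eh2); destruct (HX1 h2 Hh2) as (u & Wu & _ & _ & Eu).
      exists u; split; [exact Wu |]; intros v (j & Hj); rewrite <- Eu, Eh2, Eh1, in_sep; split; [tauto |].
      intros HvE; splits; auto; eauto. }
  apply (codes_decoded Wtrans HZ WE (f := f)); [| exact Hcode].
  intros y b Hb; exact (Wtrans WT (Hf y b Hb)).
Qed.

End Ground.

(** * The definition as a formula over [M] *)

Section Formula.
Context {V : universe} (M : V -> Prop) (Mtrans : transitive_class M).
Notation Dp := (Dp no_pred M).

(** The earlier definability lemmas for pairs rest on ZFC, which is not at hand for [M]. Over [M]
    pairs are therefore recognised by bounded formulas and never formed. *)
Definition is_opair (q a b : V) := q = opair a b.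
Definition opair_mem (a b f : V) := opair a b ∈ f.
Definition rng_opair (h a b : V) := rng h (opair a b).
Lemma m_is_opair : D3 no_pred M tru3 is_opair.
Proof.
dgoal; apply dp_ext with (fun e => (forall z, z ∈ e 0 -> (forall y, y ∈ z -> y = e 1) \/ forall y, y ∈ z -> y = e 1 \/ y = e 2) /\
  (exists z, z ∈ e 0 /\ e 1 ∈ z /\ forall y, y ∈ z -> y = e 1) /\
  (exists z, z ∈ e 0 /\ e 1 ∈ z /\ e 2 ∈ z /\ forall y, y ∈ z -> y = e 1 \/ y = e 2) /\
  (forall z, z ∈ e 0 -> e 1 ∈ z) /\ (forall z y, z ∈ e 0 -> y ∈ z -> y <> e 1 -> e 2 ∈ z)); [| dauto].
intros e He _; unfold is_opair, opair; split.
- intros (H1 & (z1 & Hz1 & Ha1 & E1) & (z2 & Hz2 & Ha2 & Hb2 & E2) & H4 & H5); apply mem_ext; intros z; rewrite in_upair.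
  assert (z1 = upair (e 1) (e 1)) as ->.
  { apply mem_ext; intros y; rewrite in_upair; split; [intros Hy; left; auto | intros [-> | ->]; exact Ha1]. }
  assert (z2 = upair (e 1) (e 2)) as ->.
  { apply mem_ext; intros y; rewrite in_upair; split; [auto | intros [-> | ->]; assumption]. }
  split; [| intros [-> | ->]; assumption]; intros Hz.
  destruct (classic (exists y, y ∈ z /\ y <> e 1)) as [(y & Hy & N) | N].
  + right; apply mem_ext; intros v; rewrite in_upair; split.
    * intros Hv; destruct (H1 z Hz) as [K | K]; [left | ]; apply K, Hv.
    * intros [-> | ->]; [exact (H4 z Hz) | exact (H5 z y Hz Hy N)].
  + left; apply mem_ext; intros v; rewrite in_upair; split.
    * intros Hv; left; apply NNPP; intros Nv; apply N; eauto.
    * intros [-> | ->]; exact (H4 z Hz).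
- intros ->; splits.
  + intros z Hz; apply in_upair in Hz as [-> | ->]; [left | right]; intros y Hy; apply in_upair in Hy; tauto.
  + exists (upair (e 1) (e 1)); rewrite !in_upair; splits; auto; intros y Hy; apply in_upair in Hy; tauto.
  + exists (upair (e 1) (e 2)); rewrite !in_upair; splits; auto; intros y Hy; apply in_upair in Hy; tauto.
  + intros z Hz; apply in_upair in Hz as [-> | ->]; apply in_upair; auto.
  + intros z y Hz Hy N; apply in_upair in Hz as [-> | ->]; apply in_upair in Hy; apply in_upair; auto.
    destruct Hy; contradiction.
Qed.
Hint Resolve m_is_opair : dfn.

Lemma m_opair_mem : D3 no_pred M tru3 opair_mem.
Proof.
dgoal; apply dp_ext with (fun e => exists q, q ∈ e 2 /\ is_opair q (e 0) (e 1)); [| dauto].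
intros e _ _; unfold is_opair, opair_mem; split; [intros (q & Hq & ->); exact Hq | eauto].
Qed.
Hint Resolve m_opair_mem : dfn.

Lemma opair_mem_l a b f : opair_mem a b f -> M f -> M a.
Proof. exact (D_opair1 Mtrans (x := a) (y := b) (z := f)). Qed.

Lemma opair_mem_r a b f : opair_mem a b f -> M f -> M b.
Proof. exact (D_opair2 Mtrans (x := a) (y := b) (z := f)). Qed.

Lemma rng_M f v : rng f v -> M f -> M v.
Proof. intros (j & Hj); exact (D_opair2 Mtrans Hj). Qed.

Lemma rng_opair_l f a b : rng_opair f a b -> M f -> M a.
Proof. intros H Mf; apply (D_below Mtrans (below_fst' a b)), (rng_M H Mf). Qed.

Lemma rng_opair_r f a b : rng_opair f a b -> M f -> M b.
Proof. intros H Mf; apply (D_below Mtrans (below_snd' a b)), (rng_M H Mf). Qed.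

Ltac dm_hook ::=
  match goal with
  | H : opair_mem ?x _ _ |- _ ?x => apply (opair_mem_l H); solve [dm]
  | H : opair_mem _ ?x _ |- _ ?x => apply (opair_mem_r H); solve [dm]
  | H : rng _ ?x |- _ ?x => apply (rng_M H); solve [dm]
  | H : rng_opair _ ?x _ |- _ ?x => apply (rng_opair_l H); solve [dm]
  | H : rng_opair _ _ ?x |- _ ?x => apply (rng_opair_r H); solve [dm]
  end.

Lemma m_rng : D2 no_pred M tru2 (@rng V).
Proof.
change (D2 no_pred M tru2 (fun f v : V => exists j, opair_mem j v f)).
dgoal; dauto.
Qed.
Hint Resolve m_rng : dfn.

Lemma m_rng_opair : D3 no_pred M tru3 rng_opair.
Proof.
dgoal; apply dp_ext with (fun e => exists q, is_opair q (e 1) (e 2) /\ rng (e 0) q).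
- intros e _ _; unfold is_opair, rng_opair; split; [intros (q & -> & H); exact H | eauto].
- dauto.
Qed.
Hint Resolve m_rng_opair : dfn.

Lemma m_pfun : D1 no_pred M tru1 (@pfun V).
Proof.
change (D1 no_pred M tru1 (fun f : V => forall z y y', opair_mem z y f -> opair_mem z y' f -> y = y')).
dgoal; dauto.
Qed.
Hint Resolve m_pfun : dfn.

Lemma m_pair_in : D2 no_pred M tru2 (@pair_in V).
Proof.
change (D2 no_pred M tru2 (fun U v : V => exists a b, a ∈ U /\ b ∈ U /\ is_opair v a b)).
dgoal; dauto.
Qed.
Hint Resolve m_pair_in : dfn.

Lemma m_order_iso : D3 no_pred M tru3 (@order_iso V).
Proof.
change (D3 no_pred M tru3 (fun e n U : V =>
  (forall q, q ∈ e -> exists a b, is_opair q a b /\ a ∈ n /\ b ∈ U) /\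
  (forall a, a ∈ n -> exists b, opair_mem a b e) /\
  (forall b, b ∈ U -> exists a, opair_mem a b e) /\
  (forall a b a' b', opair_mem a b e -> opair_mem a' b' e -> (a ∈ a' <-> b ∈ b')))).
dgoal; dauto.
Qed.
Hint Resolve m_order_iso : dfn.

Lemma m_codes : D3 no_pred M tru3 (@codes V).
Proof.
change (D3 no_pred M tru3 (fun E f x : V => (exists b, opair_mem x b f) /\ forall y b, opair_mem y b f ->
  (forall y', y' ∈ y -> exists b', b' ∈ b /\ opair_mem y' b' f /\ opair_mem b' b E) /\
  (forall a, a ∈ b -> opair_mem a b E -> exists y', y' ∈ y /\ opair_mem y' a f))).
dgoal; dauto.
Qed.
Hint Resolve m_codes : dfn.

Definition copies_at (e t h a b : V) := rng_opair h a b <->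
  exists a' b', opair_mem a' b' t /\ opair_mem a' a e /\ opair_mem b' b e.

(** With [a] or [b] outside [M] both sides of the equivalence fail, by transitivity; this lets the
    quantifiers of [copies] be restricted to [M]. *)
Lemma copies_at_outside (e t h a b : V) : M e -> M h -> ~ (M a /\ M b) -> copies_at e t h a b.
Proof.
intros Me Mh N; split; [intros H | intros (a' & b' & _ & Ha & Hb)]; destruct N; split; dm.
Qed.

Lemma m_copies : D3 no_pred M tru3 (@copies V).
Proof.
assert (D5 no_pred M tru5 copies_at) as K by (dgoal; unfold copies_at; dauto).
change (D3 no_pred M tru3 (fun e t h : V => forall a b, copies_at e t h a b)).
dgoal; dstep; [| dstep; [| dauto]].
- intros e a He _ N; apply NNPP; intros C; apply N; intros b; apply copies_at_outside; [apply (He 0) | apply (He 2) | tauto].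
- intros e b He _ N; apply NNPP; intros C; apply N; apply copies_at_outside; [apply (He 1) | apply (He 3) | tauto].
Qed.
Hint Resolve m_copies : dfn.

Definition rng_iff (h' h : V) (P : V -> Prop) := forall v, rng h' v <-> rng h v /\ P v.

(** An element outside [M] is in neither range, so the equivalence holds trivially there, whatever
    [P] says. *)
Lemma m_rng_iff G (h' h : (nat -> V) -> V) (P : V -> (nat -> V) -> Prop) :
  Df no_pred M G h' -> Df no_pred M G h ->
  Dp (fun e => G (fun n => e (Datatypes.S n))) (fun e => P (e 0) (fun n => e (Datatypes.S n))) ->
  Dp G (fun e => rng_iff (h' e) (h e) (fun v => P v e)).
Proof.
intros Hh' Hh HP; unfold rng_iff; apply dp_all.
- intros e v He Ge N; apply NNPP; intros C; apply N.
  split; [intros H | intros [H _]]; destruct C; apply (rng_M H); [apply Hh' | apply Hh]; auto; exact (over_tl He).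
- pose proof (df_tl Hh'); pose proof (df_tl Hh); dstep.
  + dstep; [assumption | dstep].
  + apply dp_and; [dstep; [assumption | dstep] |]; apply dp_weaken with (fun e => G (fun n => e (Datatypes.S n))); [tauto | exact HP].
Qed.

Lemma m_rng_inter : D3 no_pred M tru3 (fun h' h k : V => rng_iff h' h (rng k)).
Proof.
apply (@m_rng_iff (fun _ => True) (fun e => e 0) (fun e => e 1) (fun v e => rng (e 2) v)); dauto.
Qed.

Lemma m_rng_mem : D3 no_pred M tru3 (fun h' h u : V => rng_iff h' h (fun v => v ∈ u)).
Proof.
apply (@m_rng_iff (fun _ => True) (fun e => e 0) (fun e => e 1) (fun v e => v ∈ e 2)); dauto.
Qed.

Lemma m_rng_pair_in : D3 no_pred M tru3 (fun h' h u : V => rng_iff h' h (pair_in u)).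
Proof.
apply (@m_rng_iff (fun _ => True) (fun e => e 0) (fun e => e 1) (fun v e => pair_in (e 2) v)); dauto.
Qed.

Definition functions_on (Z T K : V) := forall h, h ∈ K -> pfun h /\ forall j v, opair_mem j v h -> j ∈ Z /\ pair_in T v.

Lemma m_functions_on : D3 no_pred M tru3 functions_on.
Proof. dgoal; unfold functions_on; dauto. Qed.

Definition covering (Z T K : V) := forall g, M g -> pfun g -> (forall j v, opair_mem j v g -> j ∈ Z /\ v ∈ T) ->
    exists h, h ∈ K /\ forall a b, rng g a -> rng g b -> rng_opair h a b.

Lemma m_covering : D3 no_pred M tru3 covering.
Proof. dgoal; unfold covering; dauto. Qed.

Definition restricted (h h' U : V) := rng_iff h' h (pair_in U).
Definition intersected (h h' h'' : V) := rng_iff h'' h (rng h').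

Lemma m_restricted : D3 no_pred M tru3 restricted.
Proof. exact (dp_rename (fun n => match n with 0 => 1 | 1 => 0 | n => n end) m_rng_pair_in). Qed.

Lemma m_intersected : D3 no_pred M tru3 intersected.
Proof. exact (dp_rename (fun n => match n with 0 => 2 | 1 => 0 | 2 => 1 | n => n end) m_rng_inter). Qed.
Hint Resolve m_restricted m_intersected m_functions_on m_covering : dfn.

Definition closed_under (U K : V) := forall h, h ∈ K -> exists h', h' ∈ K /\ restricted h h' U.
Definition copies_from (U r f K : V) := forall h, h ∈ K -> (forall v, rng h v -> pair_in U v) -> exists t, t ∈ r /\ copies f t h.
Definition copies_to (n r f K : V) := forall t, t ∈ r -> (forall a b, opair_mem a b t -> a ∈ n /\ b ∈ n) ->
  exists h, h ∈ K /\ copies f t h.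

Lemma m_closed_under : D2 no_pred M tru2 closed_under.
Proof. dgoal; unfold closed_under; dauto. Qed.
Lemma m_copies_from : D4 no_pred M tru4 copies_from.
Proof. dgoal; unfold copies_from; dauto. Qed.
Lemma m_copies_to : D4 no_pred M tru4 copies_to.
Proof. dgoal; unfold copies_to; dauto. Qed.
Hint Resolve m_closed_under m_copies_from m_copies_to : dfn.

Lemma m_approximator : D5 no_pred M tru5 (approximator M).
Proof.
dgoal; apply dp_ext with (fun e => functions_on (e 0) (e 3) (e 4) /\ covering (e 0) (e 3) (e 4) /\
  (forall h h', h ∈ e 4 -> h' ∈ e 4 -> exists h'', h'' ∈ e 4 /\ intersected h h' h'') /\
  (forall U f n, M U -> M f -> n ∈ e 1 -> subset U (e 3) -> order_iso f n U -> closed_under U (e 4) ->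
    copies_from U (e 2) f (e 4) /\ copies_to n (e 2) f (e 4))).
- intros e He _; split; [intros (H1 & H2 & H3 & H4); split; assumption | intros [H1 H2 H3 H4]; splits; assumption].
- pose proof (@d_subset V Empty_set no_pred M Mtrans); dauto.
Qed.

Lemma m_ground : D4 no_pred M tru4 (fun x Z w r => ground M Z w r x).
Proof.
pose proof m_approximator; pose proof (@d_ord V Empty_set no_pred M Mtrans).
pose (cut := fun h h' u : V => rng_iff h' h (fun v => v ∈ u)).
assert (D3 no_pred M tru3 cut) as Kr.
{ exact (dp_rename (fun n => match n with 0 => 1 | 1 => 0 | n => n end) m_rng_mem). }
pose (relation_on := fun T E : V => forall p, p ∈ E -> pair_in T p).
assert (D2 no_pred M tru2 relation_on) as K2 by (dgoal; unfold relation_on; dauto).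
pose (approximated := fun K E : V => forall h, h ∈ K -> exists h', h' ∈ K /\ cut h h' E).
assert (D2 no_pred M tru2 approximated) as K3 by (dgoal; unfold approximated; dauto).
pose (values_in := fun f T : V => forall y b, opair_mem y b f -> b ∈ T).
assert (D2 no_pred M tru2 values_in) as K4 by (dgoal; unfold values_in; dauto).
change (D4 no_pred M tru4 (fun x Z w r => exists T K E f : V, M T /\ M K /\ M E /\ M f /\
  ord T /\ approximator M Z w r T K /\ relation_on T E /\ approximated K E /\ values_in f T /\ codes E f x)).
dgoal; dauto.
Qed.

End Formula.

Theorem corollary9p2 (V : universe) (W : V -> Prop) (S : V -> V) (c : V)
    (hWtrans : transitive_class W)
    (hZFC : models_ZFC W no_pred)
    (hGCH : GCH W)
    (hsquare : forall l : V, singular W l -> weak_square W l)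
    (hS : bristol_sequence W S)
    (hc : cohen_real W c) :
  definable_in (bristol_model W S c) W.
Proof.
destruct hS as [HZ HS].
pose proof (bristol_transitive (W := W) (S := S) (c := c)) as Mtrans.
pose proof (W_bristol hWtrans HZ c) as WM.
pose proof (bristol_cohen_named hWtrans HZ HS (c := c)) as MN.
pose proof (@f_AddSet V W S hWtrans HZ) as FA.
(* Cohen conditions are subsets in [W] of the product of [omega] and 2, so this stock contains all
   of them. *)
destruct (stock_exists hWtrans HZ (X0 := prod omega (suc (suc empty)))) as (Z & HSt & HA).
{ pose proof (f_omega hWtrans HZ); pose proof (f_empty hWtrans HZ); dm. }
assert (forall t, Add t -> t ∈ Z) as HA'.
{ intros t Ht; apply HA; [exact (Add_W hWtrans HZ Ht) |]; intros q Hq.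
  destruct Ht as (_ & Ht & _); destruct (Ht q Hq) as (n & i & Hn & Hi & ->); apply opair_in_prod; split; [exact Hn |].
  rewrite !in_suc; destruct Hi as [-> | ->]; [left; right | right]; reflexivity. }
pose (w := order_bound W Z); pose (r := small_relations W Z w).
assert (W w) as Ww by exact (order_bound_W hWtrans HZ HSt).
assert (W r) as Wr by exact (small_relations_W hWtrans HZ HSt).
destruct (m_ground Mtrans) as (f & Hf).
(* The parameters are [Z], [w] and [r]; variable 0 is left for the element to be tested, and [r]
   also fills the remaining positions. *)
exists f, (scons Z (scons w (fun _ => r))); split.
- intros [|[|n]]; apply WM; [apply HSt | exact Ww | exact Wr].
- intros x; rewrite (ground_iff hWtrans HZ hc WM MN HSt HA' x); split; intros [Mx H]; split; auto.
  + apply Hf; [repeat apply over_scons; auto; [apply WM, HSt | intros n; auto] | exact Logic.I | exact H].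
  + apply Hf in H; [exact H | repeat apply over_scons; auto; [apply WM, HSt | intros n; auto] | exact Logic.I].
Qed.
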